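(* Let $X$ be an $n$-dimensional compact complex manifold. There is a functorial $3$-space decomposition, orthogonal with respect to the intersection form, $$H_{dR}^n(X)=H_{\bar\partial}^{n,0}(X)\oplus H^{mid}(X)\oplus H_{\partial}^{0,n}(X),$$ where $$H^{mid}(X):=\frac{\ker d\cap(\mathcal{A}_X^{n-1,1}\oplus\dots\oplus\mathcal{A}_X^{1,n-1})}{\operatorname{im}d\cap(\mathcal{A}_X^{n-1,1}\oplus\dots\oplus\mathcal{A}_X^{1,n-1})}\subseteq H_{dR}^n(X).$$
   Context: $\mathcal{A}_X^{p,q}$ denotes smooth $\mathbb{C}$-valued $(p,q)$-forms on $X$, $d=\partial+\bar\partial$, $H_{dR}^n(X)$ is de Rham cohomology with $\mathbb{C}$-coefficients, $H_{\bar\partial}^{n,0}(X)=\ker(\bar\partial:\mathcal{A}_X^{n,0}\to\mathcal{A}_X^{n,1})$ and $H_\partial^{0,n}(X)=\ker(\partial:\mathcal{A}_X^{0,n}\to\mathcal{A}_X^{1,n})$; the elements of these two spaces are $d$-closed. The sum $\mathcal{A}_X^{n-1,1}\oplus\dots\oplus\mathcal{A}_X^{1,n-1}$ runs over all $(p,q)$ with $p+q=n$ and $p,q\ge1$. The maps from the three summands to $H_{dR}^n(X)$ are induced by the identity on forms, and functoriality refers to pullback by holomorphic maps. The intersection form on $H^n_{dR}(X)$ is the form given by integrating wedge products of representatives over $X$.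
   Formalization: Proved for n ≥ 1. For the intersection form ∫α∧β, H^mid is orthogonal to H^{n,0} and H^{0,n}, but these two pair nontrivially (dz∧dz̄ on an elliptic curve); orthogonality of all three spaces is proved for the sesquilinear form ∫α∧conj(β). *)

(* Defs.v *)
From HB Require Import structures.
From mathcomp Require Import all_boot all_order all_algebra.
From mathcomp Require Import all_classical all_reals all_analysis.
From mathcomp Require Import complex generic_quotient ring_quotient ring.

Set Implicit Arguments.
Unset Strict Implicit.
Unset Printing Implicit Defensive.

Import Order.TTheory GRing.Theory Num.Theory.
Import numFieldNormedType.Exports.
Local Open Scope classical_set_scope.
Local Open Scope ring_scope.
Local Open Scope quotient_scope.

Section Subquotient.
Variables (K : nzRingType) (V : lmodType K).

Record subspace (Z : submodClosed V) :=
  Subspace { subspace_val :> V; subspaceP : subspace_val \in Z }.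

HB.instance Definition _ Z := [isSub for @subspace_val Z].
HB.instance Definition _ Z := [Choice of subspace Z by <:].
HB.instance Definition _ Z := [SubChoice_isSubLmodule of subspace Z by <:].

Definition presub (Z B : submodClosed V) : {pred subspace Z} :=
  [pred w | val w \in B].

Fact presub_submod Z B : submod_closed (@presub Z B).
Proof.
split=> [|a u v]; rewrite !inE; first by rewrite rpred0.
by move=> uB vB; rewrite linearP rpredD // rpredZ.
Qed.
HB.instance Definition _ Z B :=
  GRing.isSubmodClosed.Build K (subspace Z) (@presub Z B) (presub_submod Z B).

(* Z / (Z :&: B) *)
Definition subquot (Z B : submodClosed V) : Type := Quotient.quot (@presub Z B).
HB.instance Definition _ Z B := GRing.Zmodule.on (subquot Z B).

Definition cls (Z B : submodClosed V) (w : subspace Z) : subquot Z B :=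
  \pi_(Quotient.quot (@presub Z B)) w.

Definition subquot_scale Z B (a : K) (c : subquot Z B) : subquot Z B :=
  cls B (a *: repr (c : Quotient.quot (@presub Z B))).

Fact clsP Z B (u v : subspace Z) :
  cls B u = cls B v <-> subspace_val u - subspace_val v \in B.
Proof.
have E : (u == v %[mod Quotient.quot (@presub Z B)]) =
    (subspace_val u - subspace_val v \in B).
  by rewrite -Quotient.idealrBE inE raddfB.
by split=> [/eqP|h]; [rewrite -E | apply/eqP; rewrite -E in h].
Qed.

Fact cls_repr Z B (c : subquot Z B) :
  cls B (repr (c : Quotient.quot (@presub Z B))) = c.
Proof. exact: reprK. Qed.

Fact clsD Z B : {morph @cls Z B : u v / u + v}.
Proof. by move=> u v; rewrite /cls raddfD. Qed.

Fact clsZ Z B a (u : subspace Z) : subquot_scale a (cls B u) = cls B (a *: u).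
Proof.
apply/clsP; have -> x : subspace_val (a *: x) = a *: subspace_val x by [].
rewrite -scalerBr rpredZ //.
by apply/clsP; rewrite cls_repr.
Qed.

Fact subquot_scaleA Z B a b (c : subquot Z B) :
  subquot_scale a (subquot_scale b c) = subquot_scale (a * b) c.
Proof. by rewrite -[c]cls_repr !clsZ scalerA. Qed.

Fact subquot_scale1 Z B : left_id 1 (@subquot_scale Z B).
Proof. by move=> c; rewrite -[c]cls_repr clsZ scale1r. Qed.

Fact subquot_scaleDr Z B : right_distributive (@subquot_scale Z B) +%R.
Proof.
by move=> a c c'; rewrite -[c]cls_repr -[c']cls_repr !(clsZ, =^~ clsD) scalerDr.
Qed.

Fact subquot_scaleDl Z B (c : subquot Z B) :
  {morph (@subquot_scale Z B)^~ c : a b / a + b}.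
Proof. by move=> a b; rewrite -[c]cls_repr !clsZ scalerDl clsD. Qed.

HB.instance Definition _ Z B := GRing.Zmodule_isLmodule.Build K (subquot Z B)
  (@subquot_scaleA Z B) (@subquot_scale1 Z B)
  (@subquot_scaleDr Z B) (@subquot_scaleDl Z B).

Fact cls_linear Z B : linear (@cls Z B).
Proof. by move=> a u v; rewrite clsD -clsZ. Qed.
HB.instance Definition _ Z B :=
  GRing.isLinear.Build K (subspace Z) (subquot Z B) _ (@cls Z B)
    (@cls_linear Z B).

Section InducedByIdentity.
Variables (Z1 B1 Z2 B2 : submodClosed V).
Hypothesis sZ : {subset Z1 <= Z2}.

Definition subspace_incl (w : subspace Z1) : subspace Z2 :=
  Subspace (sZ (subspaceP w)).

Definition incl_cls (w : subspace Z1) : subquot Z2 B2 :=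
  cls B2 (subspace_incl w).

Fact incl_cls_linear : linear incl_cls.
Proof.
move=> a u v; rewrite /incl_cls -linearP; congr cls; exact/val_inj.
Qed.
HB.instance Definition _ :=
  GRing.isLinear.Build K (subspace Z1) (subquot Z2 B2) _ incl_cls
    incl_cls_linear.

Definition subquot_incl of {subset B1 <= B2} :=
  fun c : subquot Z1 B1 => incl_cls (repr (c : Quotient.quot (@presub Z1 B1))).

Hypothesis sB : {subset B1 <= B2}.

Fact subquot_inclE (w : subspace Z1) :
  subquot_incl sB (cls B1 w) = incl_cls w.
Proof. by apply/clsP/sB => /=; apply/clsP; rewrite cls_repr. Qed.

Fact subquot_incl_linear : linear (subquot_incl sB).
Proof.
move=> a c c'; rewrite -[c]cls_repr -[c']cls_repr -linearP.
by rewrite !subquot_inclE linearP.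
Qed.
HB.instance Definition _ :=
  GRing.isLinear.Build K (subquot Z1 B1) (subquot Z2 B2) _ (subquot_incl sB)
    subquot_incl_linear.
End InducedByIdentity.

End Subquotient.

(* The norm topology of R[i], as the library does for the real fields. *)
#[export, non_forgetful_inheritance]
HB.instance Definition _ (R : realType) := NormedModule.copy R[i] (R[i])^o.

Lemma cvg_lin (K : numFieldType) (T : Type) (F : set_system T) (FF : Filter F)
    (c : K) (u w : T -> K) (a b : K) :
  u @ F --> a -> w @ F --> b -> (fun t => c * u t + w t) @ F --> c * a + b.
Proof. by move=> ua wb; apply: cvgD => //; apply: cvgMr. Qed.

Lemma wirtD (K : fieldType) (c i t x y x' y' : K) :
  (c * x + x' + i * (c * y + y')) / t = c * ((x + i * y) / t) + (x' + i * y') / t.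
Proof. by ring. Qed.

Lemma wirtB (K : fieldType) (c i t x y x' y' : K) :
  (c * x + x' - i * (c * y + y')) / t = c * ((x - i * y) / t) + (x' - i * y') / t.
Proof. by ring. Qed.

Section RealDerivatives.
Variables (R : realType) (n : nat).
Local Notation C := R[i].
Implicit Types (f g : 'rV[C]_n -> C) (v z : 'rV[C]_n) (V : set 'rV[C]_n).

Definition real_quotient f v z (h : R) : C :=
  (h^-1)%:C%C * (f (z + h%:C%C *: v) - f z).

(* Derivative at z in the direction v along real increments; f is C-valued on
   C^n seen as R^(2n). *)
Definition rderive f v z : C := lim (real_quotient f v z @ (0 : R)^').

(* f is of class C^k on the open set V: all iterated directional derivatives up
   to order k exist and are continuous on V. *)
Fixpoint Ck (k : nat) V f : Prop :=
  (forall z, V z -> f @ z --> f z) /\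
  if k is k'.+1 then
    forall v, exists2 g, Ck k' V g &
      forall z, V z -> real_quotient f v z @ (0 : R)^' --> g z
  else True.

Definition smooth V f := forall k, Ck k V f.

(* d/dz_a = (d/dx_a - i d/dy_a) / 2 and d/dzbar_a = (d/dx_a + i d/dy_a) / 2 *)
Definition dz a f z : C :=
  (rderive f (delta_mx 0 a) z - 'i%C * rderive f ('i%C *: delta_mx 0 a) z) / 2.

Definition dzbar a f z : C :=
  (rderive f (delta_mx 0 a) z + 'i%C * rderive f ('i%C *: delta_mx 0 a) z) / 2.

Lemma real_quotient_lin (c : C) f g v z :
  real_quotient (fun x => c * f x + g x) v z =
  (fun h => c * real_quotient f v z h + real_quotient g v z h).
Proof.
apply/funext => h; rewrite /real_quotient; set f' := f (z + _); set g' := g (z + _).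
by rewrite opprD addrACA mulrDr -mulrBr mulrCA.
Qed.

Lemma real_quotient_cvg (c : C) f g v z (a b : C) :
    real_quotient f v z @ (0 : R)^' --> a ->
    real_quotient g v z @ (0 : R)^' --> b ->
  real_quotient (fun x => c * f x + g x) v z @ (0 : R)^' --> c * a + b.
Proof.
move=> fa gb; rewrite real_quotient_lin.
exact: (@cvg_lin C _ _ (dnbhs_filter (0 : R)) c _ _ _ _ fa gb).
Qed.

Lemma Ck_lin k V (c : C) f g : Ck k V f -> Ck k V g -> Ck k V (fun x => c * f x + g x).
Proof.
have cvgfg f1 g1 z : f1 @ z --> f1 z -> g1 @ z --> g1 z ->
    (fun x => c * f1 x + g1 x) @ z --> c * f1 z + g1 z.
  by move=> cf cg; exact: (@cvg_lin C _ _ (nbhs_filter z) c _ _ _ _ cf cg).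
elim: k f g => [|k IHk] f g [cf df] [cg dg].
  by split=> [z Vz|]; [exact: cvgfg (cf z Vz) (cg z Vz)|exact: I].
split=> [z Vz|v]; first exact: cvgfg (cf z Vz) (cg z Vz).
have [f' f'k ff'] := df v; have [g' g'k gg'] := dg v.
exists (fun x => c * f' x + g' x) => [|z Vz]; first exact: IHk.
exact: real_quotient_cvg (ff' _ Vz) (gg' _ Vz).
Qed.

Lemma smooth_lin V (c : C) f g :
  smooth V f -> smooth V g -> smooth V (fun x => c * f x + g x).
Proof. by move=> sf sg k; exact: Ck_lin. Qed.

Lemma real_quotient0 v z : real_quotient (fun=> 0) v z = fun=> 0.
Proof. by apply/funext => h; rewrite /real_quotient subrr mulr0. Qed.

Lemma real_quotient0_cvg v z :
  real_quotient (fun=> 0) v z @ (0 : R)^' --> (0 : C).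
Proof. by rewrite real_quotient0; exact: cvg_cst. Qed.

Lemma rderiveE f v z (l : C) :
  real_quotient f v z @ (0 : R)^' --> l -> rderive f v z = l.
Proof. by move=> fl; exact: (cvg_lim (@norm_hausdorff C C) fl). Qed.

Lemma rderive0 v z : rderive (fun=> 0) v z = 0.
Proof. exact: rderiveE (real_quotient0_cvg v z). Qed.

Lemma smooth0 V : smooth V (fun=> 0).
Proof.
elim=> [|k IHk].
  by split=> [z _|]; [exact: (@cvg_cst C (0 : C) _ _ (nbhs_filter z))|exact: I].
split=> [z _|v]; first exact: (@cvg_cst C (0 : C) _ _ (nbhs_filter z)).
by exists (fun=> 0) => [|z _]; [exact: IHk|exact: real_quotient0_cvg].
Qed.

Lemma rderive_lin V (c : C) f g v z : V z -> smooth V f -> smooth V g ->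
  rderive (fun x => c * f x + g x) v z = c * rderive f v z + rderive g v z.
Proof.
move=> Vz /(_ 1)[_ /(_ v)[f' _ /(_ z Vz) ff']].
move=> /(_ 1)[_ /(_ v)[g' _ /(_ z Vz) gg']].
rewrite (rderiveE ff') (rderiveE gg').
exact/rderiveE/real_quotient_cvg.
Qed.

Lemma dz_lin V (c : C) f g a z : V z -> smooth V f -> smooth V g ->
  dz a (fun x => c * f x + g x) z = c * dz a f z + dz a g z.
Proof.
move=> Vz sf sg; have E v := rderive_lin c v Vz sf sg.
by rewrite /dz (E (delta_mx 0 a)) (E ('i%C *: delta_mx 0 a)) wirtB.
Qed.

Lemma dzbar_lin V (c : C) f g a z : V z -> smooth V f -> smooth V g ->
  dzbar a (fun x => c * f x + g x) z = c * dzbar a f z + dzbar a g z.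
Proof.
move=> Vz sf sg; have E v := rderive_lin c v Vz sf sg.
by rewrite /dzbar (E (delta_mx 0 a)) (E ('i%C *: delta_mx 0 a)) wirtD.
Qed.

Lemma dz0 a z : dz a (fun=> 0) z = 0.
Proof. by rewrite /dz !rderive0 mulr0 subr0 mul0r. Qed.

Lemma dzbar0 a z : dzbar a (fun=> 0) z = 0.
Proof. by rewrite /dzbar !rderive0 mulr0 addr0 mul0r. Qed.

End RealDerivatives.

Section Manifolds.
Variable R : realType.
Local Notation C := R[i].

(* Transition maps are differentiable over C, i.e. holomorphic. Second
   countability is automatic: finitely many charts cover a compact space. *)
Record ccManifold (n : nat) := CCManifold {
  point_of :> topologicalType;
  chart_index : Type;
  chart_dom : chart_index -> set point_of;
  chart_cod : chart_index -> set 'rV[C]_n;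
  chart : chart_index -> point_of -> 'rV[C]_n;
  chart_inv : chart_index -> 'rV[C]_n -> point_of;
  point_of_hausdorff : hausdorff_space point_of;
  point_of_compact : compact [set: point_of];
  chart_cover : forall x, exists i, chart_dom i x;
  chart_dom_open : forall i, open (chart_dom i);
  chart_cod_open : forall i, open (chart_cod i);
  chart_funS : forall i x, chart_dom i x -> chart_cod i (chart i x);
  chart_inv_funS : forall i z, chart_cod i z -> chart_dom i (chart_inv i z);
  chartK : forall i x, chart_dom i x -> chart_inv i (chart i x) = x;
  chart_invK : forall i z, chart_cod i z -> chart i (chart_inv i z) = z;
  chart_continuous :
    forall i x, chart_dom i x -> chart i @ x --> chart i x;
  chart_inv_continuous :
    forall i z, chart_cod i z -> chart_inv i @ z --> chart_inv i z;
  transition_holomorphic : forall i j z,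
    chart_cod i z -> chart_dom j (chart_inv i z) ->
    differentiable (chart j \o chart_inv i) z
}.

Definition local_rep n m (X : ccManifold n) (Y : ccManifold m) (f : X -> Y)
    (i : chart_index X) (j : chart_index Y) : 'rV[C]_n -> 'rV[C]_m :=
  chart j \o f \o chart_inv i.

Definition holomorphic n m (X : ccManifold n) (Y : ccManifold m) (f : X -> Y) :=
  continuous f /\
  forall i j z, chart_cod i z -> chart_dom j (f (chart_inv i z)) ->
    differentiable (local_rep f i j) z.

(* The (I, J) entry is the coefficient of dz_I /\ dzbar_J, where I and J are
   listed in increasing order. *)
Definition coefs n := {set 'I_n} * {set 'I_n} -> C.

Definition minor n m (M : 'M[C]_(n, m)) (I : {set 'I_n}) (K : {set 'I_m}) : C :=
  if eqVneq #|I| #|K| is EqNotNeq e then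
    \det (\matrix_(a < #|I|, b < #|I|)
            M (enum_val a) (enum_val (cast_ord e b)))
  else 0.

(* M is the Jacobian matrix, M a b = d g_b / d z_a, of a holomorphic map g:
   g^* dw_K = \sum_I minor M I K dz_I. *)
Definition pull n m (M : 'M[C]_(n, m)) (c : coefs m) : coefs n := fun P =>
  \sum_(Q : {set 'I_m} * {set 'I_m})
    c Q * (minor M P.1 Q.1 * (minor M P.2 Q.2)^*).

(* dz_I /\ dz_J = (-1) ^+ inversions I J dz_(I :|: J) for disjoint I and J *)
Definition inversions n (I J : {set 'I_n}) : nat :=
  #|[set p : 'I_n * 'I_n | [&& p.1 \in I, p.2 \in J & (p.2 < p.1)%N]]%SET|.

Section Forms.
Variables (n : nat) (X : ccManifold n).

(* Families of local expressions, one in each chart; the forms on X are those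
   satisfying [is_form] below. *)
Definition preform := chart_index X -> 'rV[C]_n -> coefs n.
HB.instance Definition _ := gen_eqMixin preform.
HB.instance Definition _ := gen_choiceMixin preform.

Definition pf_zero : preform := fun _ _ _ => 0.
Definition pf_opp (w : preform) : preform := fun i z P => - w i z P.
Definition pf_add (w e : preform) : preform := fun i z P => w i z P + e i z P.
Definition pf_scale (a : C) (w : preform) : preform := fun i z P => a * w i z P.

Lemma preformP (w e : preform) : (forall i z P, w i z P = e i z P) -> w = e.
Proof.
by move=> we; apply/funext => i; apply/funext => z; apply/funext => P.
Qed.

Fact pf_addA : associative pf_add.
Proof. by move=> u v w; apply: preformP => i z P; exact: addrA. Qed.
Fact pf_addC : commutative pf_add.
Proof. by move=> u v; apply: preformP => i z P; exact: addrC. Qed.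
Fact pf_add0 : left_id pf_zero pf_add.
Proof. by move=> u; apply: preformP => i z P; exact: add0r. Qed.
Fact pf_addN : left_inverse pf_zero pf_opp pf_add.
Proof. by move=> u; apply: preformP => i z P; exact: addNr. Qed.
HB.instance Definition _ :=
  GRing.isZmodule.Build preform pf_addA pf_addC pf_add0 pf_addN.

Fact pf_scaleA a b w : pf_scale a (pf_scale b w) = pf_scale (a * b) w.
Proof. by apply: preformP => i z P; exact: mulrA. Qed.
Fact pf_scale1 : left_id 1 pf_scale.
Proof. by move=> w; apply: preformP => i z P; exact: mul1r. Qed.
Fact pf_scaleDr : right_distributive pf_scale +%R.
Proof. by move=> a u v; apply: preformP => i z P; exact: mulrDr. Qed.
Fact pf_scaleDl w : {morph pf_scale^~ w : a b / a + b}.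
Proof. by move=> a b; apply: preformP => i z P; exact: mulrDl. Qed.
HB.instance Definition _ := GRing.Zmodule_isLmodule.Build C preform
  pf_scaleA pf_scale1 pf_scaleDr pf_scaleDl.

Lemma preform_linE (a : C) (w e : preform) i z P :
  (a *: w + e) i z P = a * w i z P + e i z P.
Proof. by []. Qed.

Implicit Types (w e : preform) (T : nat -> nat -> bool).

(* T selects the bidegrees (p, q) which may occur; local expressions are
   extended by 0 outside the chart, so that equal forms are equal families. *)
Definition is_form T w :=
  [/\ forall i z, ~ chart_cod i z -> w i z = fun=> 0,
      forall i P, smooth (chart_cod i) (fun z => w i z P),
      forall i j z, chart_cod i z -> chart_dom j (chart_inv i z) ->
        w i z = pull (jacobian (chart j \o chart_inv i) z)
                     (w j (chart j (chart_inv i z)))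
    & forall i z (P : {set 'I_n} * {set 'I_n}), ~~ T #|P.1| #|P.2| -> w i z P = 0].

(* deg k describes A^k, bideg p q describes A^(p,q), and mid k the sum of the
   A^(p,q) with p + q = k and p, q >= 1. *)
Definition bideg (p q : nat) : nat -> nat -> bool :=
  fun a b => (a == p) && (b == q).
Definition deg (k : nat) : nat -> nat -> bool := fun a b => (a + b == k)%N.
Definition pred_deg (k : nat) : nat -> nat -> bool :=
  fun a b => ((a + b).+1 == k)%N.
Definition mid (k : nat) : nat -> nat -> bool :=
  fun a b => [&& (a + b == k)%N, (1 <= a)%N & (1 <= b)%N].

(* del (f dz_I /\ dzbar_J) = \sum_a (d f / d z_a) dz_a /\ dz_I /\ dzbar_J, and
   similarly for delbar, where dzbar_b has to be moved past dz_I. *)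
Definition del w : preform := fun i z P =>
  if `[< chart_cod i z >] then
    \sum_(a in P.1) (-1) ^+ inversions [set a]%SET (P.1 :\ a)%SET *
      dz a (fun z' => w i z' ((P.1 :\ a)%SET, P.2)) z
  else 0.

Definition delbar w : preform := fun i z P =>
  if `[< chart_cod i z >] then
    \sum_(b in P.2) (-1) ^+ (#|P.1| + inversions [set b]%SET (P.2 :\ b)%SET) *
      dzbar b (fun z' => w i z' (P.1, (P.2 :\ b)%SET)) z
  else 0.

Definition dext w : preform := del w + delbar w.

Lemma pull_lin m (M : 'M[C]_(n, m)) (a : C) (c c' : coefs m) :
  pull M (fun P => a * c P + c' P) = fun P => a * pull M c P + pull M c' P.
Proof.
apply/funext => P; rewrite /pull mulr_sumr -big_split; apply: eq_bigr => Q _.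
by rewrite mulrDl -mulrA.
Qed.

Lemma pull0 m (M : 'M[C]_(n, m)) : pull M (fun=> 0) = fun=> 0.
Proof. by apply/funext => P; rewrite /pull big1 // => Q _; rewrite mul0r. Qed.

Lemma is_form_lin T (a : C) w e :
  is_form T w -> is_form T e -> is_form T (a *: w + e).
Proof.
move=> [w0 ws wc wT] [e0 es ec eT]; split=> [i z iz|i P|i j z iz jz|i z P nT].
- by apply/funext => P; rewrite preform_linE w0// e0// mulr0 addr0.
- exact: (smooth_lin a (ws i P) (es i P)).
- rewrite -[RHS]/(pull _ (fun P => a * w j _ P + e j _ P)) pull_lin.
  by apply/funext => P; rewrite preform_linE (wc _ _ _ iz jz) (ec _ _ _ iz jz).
- by rewrite preform_linE wT// eT// mulr0 addr0.
Qed.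

Lemma is_form0 T : is_form T 0.
Proof.
split=> [//|i P|i j z _ _|//]; first exact: smooth0.
by rewrite -[RHS]/(pull _ (fun=> 0)) pull0.
Qed.

Lemma is_form_sub T T' w :
  (forall a b, T a b -> T' a b) -> is_form T w -> is_form T' w.
Proof.
move=> TT' [w0 ws wc wT]; split=> // i z P nT; apply: wT.
by apply: contra nT; exact: TT'.
Qed.

Lemma del_lin T (a : C) w e : is_form T w -> is_form T e ->
  del (a *: w + e) = a *: del w + del e.
Proof.
move=> [_ ws _ _] [_ es _ _]; apply: preformP => i z P.
rewrite preform_linE /del.
case: asboolP => [iz|_]; last by rewrite mulr0 addr0.
rewrite mulr_sumr -big_split; apply: eq_bigr => b _ /=.
have -> := dz_lin a b iz (ws i ((P.1 :\ b)%SET, P.2)) (es i ((P.1 :\ b)%SET, P.2)).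
by rewrite mulrDr mulrCA.
Qed.

Lemma delbar_lin T (a : C) w e : is_form T w -> is_form T e ->
  delbar (a *: w + e) = a *: delbar w + delbar e.
Proof.
move=> [_ ws _ _] [_ es _ _]; apply: preformP => i z P.
rewrite preform_linE /delbar.
case: asboolP => [iz|_]; last by rewrite mulr0 addr0.
rewrite mulr_sumr -big_split; apply: eq_bigr => b _ /=.
have -> := dzbar_lin a b iz (ws i (P.1, (P.2 :\ b)%SET)) (es i (P.1, (P.2 :\ b)%SET)).
by rewrite mulrDr mulrCA.
Qed.

Lemma dext_lin T (a : C) w e : is_form T w -> is_form T e ->
  dext (a *: w + e) = a *: dext w + dext e.
Proof.
by move=> wT eT; rewrite /dext (del_lin _ wT eT) (delbar_lin _ wT eT) scalerDr addrACA.
Qed.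

Lemma del0 : del 0 = 0.
Proof.
apply: preformP => i z P; rewrite /del.
by case: ifP => // _; rewrite big1 // => a _; rewrite dz0 mulr0.
Qed.

Lemma delbar0 : delbar 0 = 0.
Proof.
apply: preformP => i z P; rewrite /delbar.
by case: ifP => // _; rewrite big1 // => a _; rewrite dzbar0 mulr0.
Qed.

Lemma dext0 : dext 0 = 0.
Proof. by rewrite /dext del0 delbar0 addr0. Qed.

(* Bundling keeps a single kernel construction for d, del and delbar. *)
Record form_operator := FormOperator {
  operator :> preform -> preform;
  operator0 : operator 0 = 0;
  operator_lin : forall T (a : C) w e, is_form T w -> is_form T e ->
    operator (a *: w + e) = a *: operator w + operator e
}.
Definition d_op := FormOperator dext0 dext_lin.
Definition del_op := FormOperator del0 del_lin.
Definition delbar_op := FormOperator delbar0 delbar_lin.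

Definition ker_forms (D : form_operator) T : {pred preform} :=
  [pred w | `[< is_form T w /\ D w = 0 >]].

Fact ker_forms_submod D T : submod_closed (ker_forms D T).
Proof.
split=> [|a w e]; rewrite !inE; first by split; [exact: is_form0|exact: operator0].
move=> [wT dw] [eT de]; split; first exact: is_form_lin wT eT.
by rewrite (operator_lin D _ wT eT) dw de scaler0 addr0.
Qed.
HB.instance Definition _ D T :=
  GRing.isSubmodClosed.Build C preform (ker_forms D T) (ker_forms_submod D T).

(* im d :&: A^T, for the image of d : A^(k - 1) -> A^k (0 if k = 0) *)
Definition im_d_forms (k : nat) T : {pred preform} :=
  [pred w | `[< is_form T w /\ exists2 e, is_form (pred_deg k) e & w = dext e >]].

Fact im_d_forms_submod k T : submod_closed (im_d_forms k T).
Proof.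
split=> [|a w e]; rewrite !inE.
  by split; [exact: is_form0|exists 0; [exact: is_form0|rewrite dext0]].
move=> [wT [w' w'k dw]] [eT [e' e'k de]]; split; first exact: is_form_lin wT eT.
exists (a *: w' + e'); first exact: is_form_lin w'k e'k.
by rewrite (dext_lin _ w'k e'k) dw de.
Qed.
HB.instance Definition _ k T :=
  GRing.isSubmodClosed.Build C preform (im_d_forms k T) (im_d_forms_submod k T).

Definition HdR (k : nat) := subquot (ker_forms d_op (deg k)) (im_d_forms k (deg k)).
Definition Hhol := subspace (ker_forms delbar_op (bideg n 0)).
Definition Hantihol := subspace (ker_forms del_op (bideg 0 n)).
Definition Hmid := subquot (ker_forms d_op (mid n)) (im_d_forms n (mid n)).

Definition dR_class (k : nat) : subspace (ker_forms d_op (deg k)) -> HdR k :=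
  @cls _ _ _ _.

Lemma form_eq0 T w i (P : {set 'I_n} * {set 'I_n}) :
  is_form T w -> ~~ T #|P.1| #|P.2| -> (fun z => w i z P) = fun=> 0.
Proof. by move=> [_ _ _ wT] nT; apply/funext => z; exact: wT. Qed.

Lemma Hhol_closed : {subset ker_forms delbar_op (bideg n 0) <= ker_forms d_op (deg n)}.
Proof.
move=> w; rewrite !inE => -[wT dw]; split.
  by apply: is_form_sub wT => a b /andP[/eqP-> /eqP->]; rewrite /deg addn0.
rewrite -[LHS]/(del w + delbar w) [delbar w]dw addr0.
apply: preformP => i z P; rewrite /del; case: ifP => // _.
rewrite big1 // => a aP; rewrite (form_eq0 i wT) ?dz0 ?mulr0 //=.
rewrite /bideg negb_and neq_ltn; apply/orP; left; apply/orP; left.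
by have := max_card P.1; rewrite (cardsD1 a) aP card_ord add1n.
Qed.

Lemma Hantihol_closed :
  {subset ker_forms del_op (bideg 0 n) <= ker_forms d_op (deg n)}.
Proof.
move=> w; rewrite !inE => -[wT dw]; split.
  by apply: is_form_sub wT => a b /andP[/eqP-> /eqP->]; rewrite /deg add0n.
rewrite -[LHS]/(del w + delbar w) [del w]dw add0r.
apply: preformP => i z P; rewrite /delbar; case: ifP => // _.
rewrite big1 // => b bP; rewrite (form_eq0 i wT) ?dzbar0 ?mulr0 //=.
rewrite /bideg negb_and neq_ltn [in X in _ || X]neq_ltn; apply/orP; right.
apply/orP; left.
by have := max_card P.2; rewrite (cardsD1 b) bP card_ord add1n.
Qed.

Lemma mid_deg a b : mid n a b -> deg n a b.
Proof. by case/and3P. Qed.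

Lemma Hmid_closed : {subset ker_forms d_op (mid n) <= ker_forms d_op (deg n)}.
Proof.
by move=> w; rewrite !inE => -[wT dw]; split=> //; exact: is_form_sub mid_deg wT.
Qed.

Lemma Hmid_exact : {subset im_d_forms n (mid n) <= im_d_forms n (deg n)}.
Proof.
by move=> w; rewrite !inE => -[wT dw]; split=> //; exact: is_form_sub mid_deg wT.
Qed.

(* The three maps induced by the identity on forms. *)
Definition hol_to_dR : {linear Hhol -> HdR n} :=
  incl_cls (im_d_forms n (deg n)) Hhol_closed.
Definition antihol_to_dR : {linear Hantihol -> HdR n} :=
  incl_cls (im_d_forms n (deg n)) Hantihol_closed.
Definition mid_to_dR : {linear Hmid -> HdR n} :=
  subquot_incl Hmid_closed Hmid_exact.

Definition sum_to_dR (t : Hhol * Hmid * Hantihol) : HdR n :=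
  hol_to_dR t.1.1 + mid_to_dR t.1.2 + antihol_to_dR t.2.

(* Each term splits dz_I /\ dzbar_J as the product of dz_K /\ dzbar_L and
   dz_(I :\: K) /\ dzbar_(J :\: L). *)
Definition wedge w e : preform := fun i z P =>
  \sum_(Q : {set 'I_n} * {set 'I_n} | (Q.1 \subset P.1) && (Q.2 \subset P.2))
    (-1) ^+ (inversions Q.1 (P.1 :\: Q.1) + inversions Q.2 (P.2 :\: Q.2)
             + #|Q.2| * #|P.1 :\: Q.1|)%N
    * (w i z Q * e i z ((P.1 :\: Q.1)%SET, (P.2 :\: Q.2)%SET)).

(* conj (f dz_J /\ dzbar_I) = (-1)^(|I| |J|) conj f dz_I /\ dzbar_J *)
Definition conj_form w : preform := fun i z P =>
  (-1) ^+ (#|P.1| * #|P.2|)%N * (w i z (P.2, P.1))^*.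

Record partition_of_unity := PartitionOfUnity {
  pou_size : nat;
  pou_chart : 'I_pou_size -> chart_index X;
  pou_fun : 'I_pou_size -> X -> R;
  pou_ge0 : forall k x, 0 <= pou_fun k x;
  pou_smooth : forall k i,
    smooth (chart_cod i) (fun z => (pou_fun k (chart_inv i z))%:C%C);
  pou_support : forall k,
    closure [set x | pou_fun k x != 0] `<=` chart_dom (pou_chart k);
  pou_sum : forall x, \sum_k pou_fun k x = 1
}.
End Forms.

(* Integral of g : C^n -> C with respect to the Lebesgue measure of R^(2n),
   as an iterated integral. *)
Definition integral_C (g : C -> C) : C :=
  let mu := (@lebesgue_measure R \x @lebesgue_measure R)%E in
  (\int[mu]_p complex.Re (g (p.1 +i* p.2)%C) +i*
   \int[mu]_p complex.Im (g (p.1 +i* p.2)%C))%C.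

Fixpoint integral_Cn (n : nat) : ('rV[C]_n -> C) -> C :=
  if n is m.+1 then
    fun g => integral_C (fun z => integral_Cn (fun v : 'rV[C]_m =>
               g (row_mx (z%:M : 'rV_1) v)))
  else fun g => g 0.

(* s is the integral of the 2n-form w, computed with some smooth partition of
   unity subordinate to the charts. X has its complex orientation, and
   dz_1 /\ ... /\ dz_n /\ dzbar_1 /\ ... /\ dzbar_n
     = (-1)^(n(n-1)/2) (-2i)^n dx_1 /\ dy_1 /\ ... /\ dx_n /\ dy_n. *)
Definition is_integral n (X : ccManifold n) (w : preform X) (s : C) :=
  exists u : partition_of_unity X,
    s = (-1) ^+ 'C(n, 2) * (- (2 * 'i%C)) ^+ n *
        \sum_(k < pou_size u) integral_Cn (fun z =>
          (pou_fun k (chart_inv (pou_chart k) z))%:C%C *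
          w (pou_chart k) z ([set: 'I_n], [set: 'I_n])%SET).

(* e = f^* w, expressed in every pair of charts *)
Definition is_pullback n m (X : ccManifold n) (Y : ccManifold m) (f : X -> Y)
    (w : preform Y) (e : preform X) :=
  forall i j z, chart_cod i z -> chart_dom j (f (chart_inv i z)) ->
    e i z = pull (jacobian (local_rep f i j) z)
                 (w j (local_rep f i j z)).

(* F is the map f^* induced on cohomology by the pullback of closed forms; it is
   determined by f since dR_class is onto. *)
Definition is_dR_pullback n m (X : ccManifold n) (Y : ccManifold m) (f : X -> Y)
    k (F : HdR Y k -> HdR X k) :=
  forall w, exists2 e, is_pullback f (subspace_val w) (subspace_val e) &
    F (dR_class w) = dR_class e.

(* Q is the form ([w], [e]) |-> \int_X w /\ e, and below h is its sesquilinear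
   version ([w], [e]) |-> \int_X w /\ conj e. *)
Definition is_intersection_form n (X : ccManifold n) (Q : HdR X n -> HdR X n -> C) :=
  forall w e, is_integral (wedge (subspace_val w) (subspace_val e))
                (Q (dR_class w) (dR_class e)).

Definition is_hermitian_intersection_form n (X : ccManifold n)
    (h : HdR X n -> HdR X n -> C) :=
  forall w e, is_integral (wedge (subspace_val w) (conj_form (subspace_val e)))
                (h (dR_class w) (dR_class e)).

Definition orthogonal_spaces (H : Type) (Q : H -> H -> C) (A B : set H) :=
  forall a b, A a -> B b -> Q a b = 0 /\ Q b a = 0.

End Manifolds.

(* Main.v *)
(** The heart of the matter is that every (n,0)-form is the sum of a
    holomorphic form and a del-exact one, which on a manifold without a metric
    replaces Hodge theory.  Convolution with a cut-off kernel that reproduces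
    holomorphic functions, transported to the charts by a partition of unity,
    gives a smoothing parametrix: v is congruent modulo del-exact forms to its
    smoothing.  Approximating the kernel by one of finite rank and inverting the
    remainder by a Neumann series, the forms "holomorphic + del-exact" have
    finite codimension.  If they were not everything, some nonzero functional
    would vanish on them; the parametrix makes it bounded and represents it by
    integration against a smooth (0,n)-form v.  Vanishing on del-exact forms
    makes v antiholomorphic, so its conjugate is holomorphic and the functional
    kills it: the integral of v /\ conj v is zero and v = 0.

    Given a closed n-form w, subtract d of the primitives found for its (n,0)-
    and, by conjugation, (0,n)-parts: both become holomorphic, respectively
    antiholomorphic, and the rest is closed of mixed type.  Uniqueness and
    orthogonality follow from Stokes: the integrals pair the extreme components
    only with each other, for reasons of type, and h /\ conj h is positive. *)
Require Import Defs.
From HB Require Import structures.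
From mathcomp Require Import all_boot all_order all_algebra.
From mathcomp Require Import all_classical all_reals all_analysis.
From mathcomp Require Import complex ring lra generic_quotient ring_quotient.
Set Implicit Arguments.
Unset Strict Implicit.
Unset Printing Implicit Defensive.
Import Order.TTheory GRing.Theory Num.Theory.
Import numFieldNormedType.Exports.
Local Open Scope classical_set_scope.
Local Open Scope ring_scope.
Local Notation icn := integral_Cn.

(** The kernel p is radial, so conj(u_j) p and u_j p are the dz_j and dzbar_j derivatives of one
    potential. Hence the t-derivative of the average of q(x - t u) involves q only through dz_j q,
    and q minus its average is a sum of terms dz_j B_j. For an (n, 0)-form such a sum is exactly a
    del-boundary, which is why the argument works in the extreme bidegree. Read with dzbar_j
    instead, the same identity says that averages reproduce holomorphic functions. The functional
    needs no transfinite extension: in finite codimension a hyperplane is reached in finitely many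
    steps, and its boundedness comes from the estimates of the Neumann series. Holomorphic maps are
    only assumed complex differentiable at each point, so the smoothness of transition maps is
    itself proved, by Goursat's argument and the reproducing kernel. Lebesgue integrals, segment
    integrals and the functional on forms are all handled as functionals bounded by suprema over
    compact sets, so one Fubini theorem and one rule for differentiating under the integral serve
    all of them. The condition n > 0 matters: for n = 0 the two outer summands coincide. *)

Lemma complex_ext (R : realType) (x y : R[i]) :
 complex.Re x = complex.Re y -> complex.Im x = complex.Im y -> x = y.
by case:x y => [a b] [c d] /= -> ->. Qed.
(* L1 norms with values in R *)
HB.lock Definition cn (R : realType) (z : R[i]) : R := `|complex.Re z| + `|complex.Im z|.
HB.lock Definition rn (R : realType) (n : nat) (v : 'rV[R[i]]_n) : R := \sum_a cn (v 0 a).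

(** * Real-valued norms and the topology of C and C^n *)

Section RealNorms.
Variable R : realType.
Local Notation C := R[i].
Implicit Types (x y z : C) (t e : R).
Lemma cnE z : cn z = `|complex.Re z| + `|complex.Im z|. by rewrite cn.unlock. Qed.
Lemma cn_ge0 z : 0 <= cn z. by rewrite cnE. Qed.
Lemma cn0 : cn (0 : C) = 0. by rewrite cnE normr0 addr0. Qed.
Lemma cn_eq0 z : cn z = 0 -> z = 0.
case:z => a b; rewrite cnE /= => h.
have [a0 b0] : a = 0 /\ b = 0.
 have ha := normr_ge0 a; have hb := normr_ge0 b.
 split; apply/eqP; rewrite -normr_eq0; lra.
by rewrite a0 b0.
Qed.
Lemma cn_small z : (forall e, 0 < e -> cn z <= e) -> z = 0.
by move=> h; apply:cn_eq0; apply/eqP; rewrite eq_le cn_ge0 andbT; apply/ler_addgt0Pr=> e; rewrite add0r; exact:h. Qed.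
Lemma cnN z : cn (- z) = cn z.
by case:z => a b; rewrite !cnE !normrN. Qed.
Lemma cnD x y : cn (x + y) <= cn x + cn y.
case:x y => [a b] [c d]; rewrite !cnE /=.
have := ler_normD a c; have := ler_normD b d; lra.
Qed.
Lemma cnB x y : cn (x - y) <= cn x + cn y.
by rewrite -(cnN y) cnD. Qed.
Lemma cnC x y : cn (x - y) = cn (y - x).
by rewrite -cnN opprB. Qed.
Lemma cnM x y : cn (x * y) <= cn x * cn y.
case:x y => [a b] [c d]; rewrite !cnE /=.
have h1 := ler_normB (a * c) (b * d); have h2 := ler_normD (a * d) (b * c).
move: h1 h2; rewrite !normrM; nra.
Qed.
Lemma cn_real t : cn t%:C%C = `|t|.
by rewrite cnE normr0 addr0. Qed.
Lemma cnZ t z : cn (t%:C%C * z) = `|t| * cn z.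
by case:z => a b; rewrite !cnE /= !mul0r subr0 addr0 !normrM mulrDr. Qed.
Lemma cn1 : cn (1 : C) = 1. by rewrite cnE normr0 normr1 addr0. Qed.
Lemma cni : cn ('i%C : C) = 1. by rewrite cnE normr0 normr1 add0r. Qed.
Lemma cn_conj z : cn z^* = cn z.
by case:z => a b; rewrite !cnE normrN. Qed.
Lemma cn_sum I (s : seq I) (P : pred I) (F : I -> C) :
 cn (\sum_(i <- s | P i) F i) <= \sum_(i <- s | P i) cn (F i).
elim/big_ind2: _ => [|a b c d h1 h2|//]; first by rewrite cn0.
exact:le_trans (cnD _ _) (lerD h1 h2).
Qed.
Lemma cn_distD x y z : cn (x - z) <= cn (x - y) + cn (y - z).
by rewrite -(subrKA y) cnD. Qed.
Lemma normC_cn z : `|z| <= (cn z)%:C%C.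
case:z => a b; rewrite normc_def cnE /= lecR.
have h0 : 0 <= `|a| + `|b| by [].
rewrite -(ger0_norm h0) -sqrtr_sqr ler_sqrt ?sqr_ge0// -(real_normK (num_real a)) -(real_normK (num_real b)).
have := normr_ge0 a; have := normr_ge0 b; nra.
Qed.
Lemma cn_normC z : (cn z)%:C%C <= 2 * `|z|.
case:z => a b; rewrite normc_def cnE /=.
have -> : (2 : C) = (2 : R)%:C%C by ring.
rewrite -rmorphM lecR; set s := Num.sqrt _.
have ha : `|a| <= s by rewrite -sqrtr_sqr ler_sqrt ?lerDl ?sqr_ge0 // addr_ge0 ?sqr_ge0.
have hb : `|b| <= s by rewrite -sqrtr_sqr ler_sqrt ?lerDr ?sqr_ge0 // addr_ge0 ?sqr_ge0.
lra.
Qed.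
Lemma posCE (e : C) : 0 < e -> exists2 e' : R, 0 < e' & e = e'%:C%C.
by case:e => a b; rewrite /= => /andP[/eqP-> a0]; exists a. Qed.
(** The norm on [R[i]] takes its values in [R[i]]. It is equivalent to [cn] up to a factor 2, so
    neighbourhoods can be described by real radii and all later estimates are inequalities between
    reals. *)
Lemma nbhsC_P z (A : set C) :
 nbhs z A <-> exists2 e, 0 < e & forall y, cn (y - z) < e -> A y.
split=> [/nbhs_normP[e /= /posCE[e' e0 ->] h]|[e e0 h]].
 exists e' => // y hy; apply:h => /=; rewrite distrC.
 by apply:le_lt_trans (normC_cn _) _; rewrite ltcR.
apply/nbhs_normP; exists (e / 2)%:C%C => /=; first by rewrite ltcR divr_gt0.
move=> y /= hy; apply:h; rewrite -ltcR; apply:le_lt_trans (cn_normC _) _.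
rewrite distrC mulrC -ltr_pdivlMr// (lt_le_trans hy)//.
by rewrite rmorphM fmorphV rmorph_nat.
Qed.
Lemma cvgC_P (T : Type) (F : set_system T) (FF : Filter F) (f : T -> C) l :
 f @ F --> l <-> forall e, 0 < e -> \forall x \near F, cn (f x - l) < e.
split=> [fl e e0|h A /nbhsC_P[e e0 hA]].
 by apply:(fl [set y | cn (y - l) < e]); apply/nbhsC_P; exists e.
apply:filterS (h e e0) => x; exact:hA.
Qed.
Variable n : nat.
Local Notation E := 'rV[C]_n.
Implicit Types (u v w : E).
Lemma rnE v : rn v = \sum_a cn (v 0 a). by rewrite rn.unlock. Qed.
Lemma rn_ge0 v : 0 <= rn v. rewrite rnE; apply:sumr_ge0 => a _; exact:cn_ge0. Qed.
Lemma rn0 : rn (0 : E) = 0. by rewrite rnE big1 // => a; rewrite mxE cn0. Qed.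
Lemma rnN v : rn (- v) = rn v.
by rewrite !rnE; apply:eq_bigr=> a; rewrite mxE cnN. Qed.
Lemma rnD u v : rn (u + v) <= rn u + rn v.
by rewrite !rnE -big_split; apply:ler_sum => a; rewrite mxE cnD. Qed.
Lemma rnB u v : rn (u - v) <= rn u + rn v. by rewrite -(rnN v) rnD. Qed.
Lemma rnC u v : rn (u - v) = rn (v - u). by rewrite -rnN opprB. Qed.
Lemma rnZ t v : rn (t%:C%C *: v) = `|t| * rn v.
by rewrite !rnE mulr_sumr; apply:eq_bigr=> a; rewrite mxE cnZ. Qed.
Lemma rnZc z v : rn (z *: v) <= cn z * rn v.
by rewrite !rnE mulr_sumr; apply:ler_sum => a; rewrite mxE cnM. Qed.
Lemma rn_coord v a : cn (v 0 a) <= rn v.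
rewrite rnE (bigD1 a) //= lerDl sumr_ge0 // => b _; exact:cn_ge0. Qed.
Lemma rn_distD u v w : rn (u - w) <= rn (u - v) + rn (v - w).
by rewrite -(subrKA v) rnD. Qed.
Lemma rn_delta a : rn (delta_mx 0 a : E) = 1.
rewrite rnE (bigD1 a) //= big1 ?addr0 => [|b ba]; rewrite mxE /=.
 by rewrite eqxx cn1.
by rewrite (negbTE ba) cn0.
Qed.
Lemma nbhsE_P v (A : set E) :
 nbhs v A <-> exists2 e, 0 < e & forall w, rn (w - v) < e -> A w.
split.
 move/nbhs_ballP=> [e /= /posCE[e' e0 ->] h].
 exists e' => // w hw; apply:h; split=> [|i j]; first by rewrite ltcR.
 rewrite /ball /= distrC.
 apply:le_lt_trans (normC_cn _) _; rewrite ltcR; apply:le_lt_trans hw.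
 by have := rn_coord (w - v) j; rewrite !mxE ord1.
move=> [e e0 h]; apply/nbhs_ballP.
exists (e / (2 * n.+1%:R))%:C%C => /=; first by rewrite ltcR mulr_gt0.
move=> w hw; apply:h.
have H a : cn ((w - v) 0 a) <= e / n.+1%:R.
 have := hw.2 0 a; rewrite /ball /= => h1; rewrite !mxE -lecR.
 apply:le_trans (cn_normC _) _; rewrite distrC mulrC -ler_pdivlMr//.
 apply:le_trans (ltW h1) _.
 have -> : e / (2 * n.+1%:R) = (e / n.+1%:R) / 2 by rewrite invfM mulrA mulrAC.
 by rewrite rmorphM fmorphV rmorph_nat.
rewrite rnE; apply:le_lt_trans (ler_sum _ (fun a _ => H a)) _.
rewrite sumr_const card_ord -[X in X < _]mulr_natr -mulrA gtr_pMr//.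
by rewrite mulrC ltr_pdivrMr ?ltr0n// mul1r ltr_nat.
Qed.
Lemma cvgE_P (T : Type) (F : set_system T) (FF : Filter F) (f : T -> E) (l : E) :
 f @ F --> l <-> forall e, 0 < e -> \forall x \near F, rn (f x - l) < e.
split=> [fl e e0|h A /nbhsE_P[e e0 hA]].
 by apply:(fl [set y | rn (y - l) < e]); apply/nbhsE_P; exists e.
apply:filterS (h e e0) => x; exact:hA.
Qed.
End RealNorms.

Section Topology.
Variable R : realType.
Local Notation C := R[i].
Lemma continuous_cplx : continuous (fun p : R * R => (p.1 +i* p.2)%C : C).
move=> [a b]; apply/cvgC_P=> e e0 /=.
have e20 : 0 < e / 2 by lra.
exists ([set x | `|a - x| < e / 2], [set x | `|b - x| < e / 2]) => /=.
 by split; exists (e / 2).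
move=> [x y] /= [h1 h2].
rewrite cnE distrC (distrC y); lra.
Qed.
Lemma cpt_cbox (r : R) :
 compact [set z : C | `|complex.Re z| <= r /\ `|complex.Im z| <= r].
have -> : [set z : C | `|complex.Re z| <= r /\ `|complex.Im z| <= r] =
 (fun p : R * R => (p.1 +i* p.2)%C) @` (`[-r, r] `*` `[-r, r]).
 apply/seteqP; split=> [[a b] /= [h1 h2]|z [[a b] /= [h1 h2] <-]] /=.
  by exists (a, b) => //=; rewrite !in_itv -!ler_norml.
 by move: h1 h2; rewrite !in_itv -!ler_norml.
apply:continuous_compact; last first.
 apply:compact_setX; exact:segment_compact.
apply:continuous_subspaceT; exact:continuous_cplx.
Qed.
Variable n : nat.
Local Notation E := 'rV[C]_n.
Lemma cpt_rball (v : E) (r : R) : compact [set w : E | rn (w - v) <= r].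
pose A := [set z : C | `|complex.Re z| <= rn v + r /\ `|complex.Im z| <= rn v + r].
have cA : compact [set w : E | forall i, A (w 0 i)].
 exact:(@rV_compact C n (fun=> A) (fun=> @cpt_cbox _)).
apply:(subclosed_compact _ cA).
 rewrite -[X in closed X]setCK; apply:open_closedC; rewrite openE => w /negP.
 rewrite -ltNge => hw; rewrite /interior nbhsE_P.
 exists (rn (w - v) - r); first by lra.
 move=> x hx /=; apply/negP; rewrite -ltNge.
 have := rn_distD w x v; rewrite (rnC w x); lra.
move=> w /= hw i; have := rn_coord w i; have := rnD (w - v) v; rewrite subrK cnE.
have := normr_ge0 (complex.Re (w 0 i)); have := normr_ge0 (complex.Im (w 0 i)).
split; lra.
Qed.
Lemma continuousE_P (f : E -> C) z :
 f @ z --> f z <->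
 forall e, 0 < e -> exists2 d : R, 0 < d & forall w, rn (w - z) < d -> cn (f w - f z) < e.
split=> [/cvgC_P h e /h/nbhsE_P//|h].
by apply/(@cvgC_P R _ (nbhs z) (nbhs_filter z)) => e /h H; apply/nbhsE_P.
Qed.
Lemma openE_P (V : set E) :
 open V <-> forall z, V z -> exists2 d : R, 0 < d & forall w, rn (w - z) < d -> V w.
rewrite openE; split=> h z Vz; first by apply/nbhsE_P; exact:h.
rewrite /interior nbhsE_P; exact:h.
Qed.
Lemma open_rball (v : E) r : open [set w : E | rn (w - v) < r].
apply/openE_P=> z /= hz; exists (r - rn (z - v)); first by lra.
move=> w hw; have := rn_distD w z v; lra.
Qed.
Lemma nr_op (V : set E) z : open V -> V z -> \forall w \near z, V w.
move=> oV Vz; exact:open_nbhs_nbhs. Qed.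
End Topology.

(** * Derivatives along real lines and C^k calculus *)

Section CurveDerivative.
Variable R : realType.
Local Notation C := R[i].
Implicit Types (f g : R -> C) (t h s e : R) (a b l c : C).
(** An o(h) estimate in place of a limit of quotients: it makes sense at h = 0 and combines with
    other estimates without division. [isD1P] links it to difference quotients. *)
Definition isD1 f t l := forall e, 0 < e -> exists2 d : R, 0 < d &
 forall h, `|h| < d -> cn (f (t + h) - f t - h%:C%C * l) <= e * `|h|.
Definition quot1 f t h : C := (h^-1)%:C%C * (f (t + h) - f t).
Lemma isD1P f t l : isD1 f t l <-> quot1 f t @ (0 : R)^' --> l.
have Q h : h != 0 -> f (t + h) - f t - h%:C%C * l = h%:C%C * (quot1 f t h - l).
 by move=> h0; rewrite mulrBr mulrA -rmorphM mulfV // mul1r.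
split=> [H|/(cvgC_P (dnbhs_filter (0 : R))) H e e0].
 apply/(cvgC_P (dnbhs_filter (0 : R))) => e e0; have e2 : 0 < e / 2 by lra.
 have [d d0 Hd] := H _ e2; exists d => //= h; rewrite /= sub0r normrN => hd h0.
 have nh : 0 < `|h| by rewrite normr_gt0.
 rewrite -(ltr_pM2l nh) -cnZ -Q //; apply:le_lt_trans (Hd h hd) _; rewrite mulrC ltr_pM2l; lra.
have /nbhs_ballP[d /= d0 Hd] := H e e0; exists d => // h hd; have [->|h0] := eqVneq h 0.
 by rewrite addr0 mul0r subrr subr0 cn0 normr0 mulr0.
rewrite Q // cnZ mulrC ler_wpM2r // ltW //.
by apply:Hd => //; rewrite /ball /= sub0r normrN.
Qed.
(** Rescaling e absorbs a constant K that does not depend on it. Later proofs may therefore collect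
    errors without tuning constants, and may assume e < 1. *)
Lemma isD1_weak f t l : (exists K : R, forall e : R, 0 < e -> e < 1 -> exists2 d : R, 0 < d &
 forall h, `|h| < d -> cn (f (t + h) - f t - h%:C%C * l) <= K * e * `|h|) -> isD1 f t l.
move=> [K H] e e0; have K0 : 0 < `|K| + 1 by [].
pose e' := Num.min (2^-1) (e / (`|K| + 1)).
have e'0 : 0 < e' by rewrite lt_min invr_gt0 ltr0n divr_gt0.
have e'1 : e' < 1 by rewrite gt_min; apply/orP; left; rewrite invf_lt1// ltr1n.
have [d d0 Hd] := H e' e'0 e'1; exists d => // h /Hd hh; apply:le_trans hh _.
rewrite ler_wpM2r //; have : e' <= e / (`|K| + 1) by rewrite ge_min lexx orbT.
rewrite ler_pdivlMr // => h2; have := ler_norm K; nra.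
Qed.
Lemma isD1_cst c t : isD1 (fun=> c) t 0.
by exists 1 => // h; rewrite subrr mulr0 subr0 cn0 mulr_ge0 // ltW.
Qed.
Lemma isD1_lin c f g t a b : isD1 f t a -> isD1 g t b ->
 isD1 (fun s => c * f s + g s) t (c * a + b).
move=> /isD1P fa /isD1P gb; apply/isD1P; rewrite (_ : quot1 _ t = fun h => c * quot1 f t h + quot1 g t h).
 exact:(@cvg_lin C _ _ (dnbhs_filter (0 : R)) c _ _ _ _ fa gb).
apply/funext=> h; rewrite /quot1; ring.
Qed.
Lemma isD1_eq f t a b : isD1 f t a -> a = b -> isD1 f t b.
by move=> ? <-. Qed.
Lemma isD1_near f g t a : (exists2 d : R, 0 < d & forall h, `|h| < d -> f (t + h) = g (t + h)) ->
 isD1 f t a -> isD1 g t a.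
move=> [d d0 fg] fa e e0; have [d1 d10 h1] := fa e e0.
exists (Num.min d d1); first by rewrite lt_min d0.
move=> h; rewrite lt_min => /andP[hd /h1]; rewrite fg//.
by have := fg 0; rewrite normr0 addr0 => ->.
Qed.
Lemma isD1_id t : isD1 (fun s => s%:C%C) t 1.
move=> e e0; exists 1 => // h _.
have -> : (t + h)%:C%C - t%:C%C - h%:C%C * 1 = (0 : C) by ring.
by rewrite cn0 mulr_ge0 // ltW.
Qed.
Lemma isD1_local_lip f t a : isD1 f t a ->
 exists2 d : R, 0 < d & forall h, `|h| < d -> cn (f (t + h) - f t) <= (cn a + 1) * `|h|.
move=> /(_ 1 ltr01)[d d0 H]; exists d => // h /H H1.
rewrite -[_ - f t](subrK (h%:C%C * a)); apply:le_trans (cnD _ _) _.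
rewrite cnZ; lra.
Qed.
Lemma isD1_cont f t a : isD1 f t a -> f @ t --> f t.
move=> /isD1_local_lip[d d0 H].
apply/(@cvgC_P R _ (nbhs t) (nbhs_filter t)) => e e0; apply/nbhs_ballP.
have k0 : 0 < cn a + 1 by have := cn_ge0 a; lra.
exists (Num.min d (e / (cn a + 1))) => /=; first by rewrite lt_min d0 divr_gt0.
move=> s; rewrite /ball /= distrC lt_min => /andP[hd he].
have := H (s - t) hd; rewrite [t + _]addrC subrK => h2; apply:le_lt_trans h2 _.
by rewrite mulrC -ltr_pdivlMr.
Qed.
Lemma isD1_cont0 f t a : isD1 f t a -> (fun h => f (t + h)) @ (0 : R)^' --> f t.
move=> /isD1_local_lip[d d0 H]; apply/(cvgC_P (dnbhs_filter (0 : R))) => e e0.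
have k0 : 0 < cn a + 1 by have := cn_ge0 a; lra.
apply/nbhs_ballP; exists (Num.min d (e / (cn a + 1))) => /=; first by rewrite lt_min d0 divr_gt0.
move=> s; rewrite /ball /= sub0r normrN lt_min => /andP[/H hd he] _; apply:le_lt_trans hd _.
by rewrite mulrC -ltr_pdivlMr.
Qed.
Lemma isD1_mul f g t a b : isD1 f t a -> isD1 g t b ->
 isD1 (fun s => f s * g s) t (a * g t + f t * b).
move=> fa gb; have gc := isD1_cont0 gb; move/isD1P: fa => fa; move/isD1P: gb => gb; apply/isD1P.
rewrite (_ : quot1 _ t = fun h => f t * quot1 g t h + quot1 f t h * g (t + h)); last first.
 apply/funext=> h; rewrite /quot1; ring.
rewrite addrC; apply:(@cvg_lin C _ _ (dnbhs_filter (0 : R)) _ _ _ _ _ gb).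
exact:(@cvgM C _ _ (dnbhs_filter (0 : R)) _ _ _ _ fa gc).
Qed.
Lemma isD1_inv f t a : f t != 0 -> isD1 f t a -> isD1 (fun s => (f s)^-1) t (- a / f t ^+ 2).
move=> ft0 fa; have fc := isD1_cont0 fa; move/isD1P: fa => fa; apply/isD1P.
have FF := dnbhs_filter (0 : R).
have H := @cvgM C _ _ FF _ _ _ _ (@cvgM C _ _ FF _ _ _ _ fa (@cvg_cst C (- (f t)^-1) _ _ FF)) (@cvgV C _ _ FF _ _ ft0 fc).
have -> : - a / f t ^+ 2 = a * - (f t)^-1 * (f t)^-1 by rewrite invfM; ring.
apply:(cvg_trans _ H); apply:@near_eq_cvg.
have pf : 0 < cn (f t) by rewrite lt_def cn_ge0 andbT; apply:contra_neq ft0; exact:cn_eq0.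
have /(cvgC_P FF) /(_ _ pf) := fc; apply:filterS => h hh; have fh : f (t + h) != 0 by apply:contraTneq hh => ->; rewrite sub0r cnN ltxx.
by rewrite -[LHS]/(quot1 f t h * - (f t)^-1 * (f (t + h))^-1) /quot1; move: (h^-1) => k; field; rewrite ft0.
Qed.
Lemma isD1_uniq f t a b : isD1 f t a -> isD1 f t b -> a = b.
move=> /isD1P fa /isD1P fb; by rewrite -(cvg_lim (@norm_hausdorff C C) fa); exact:cvg_lim.
Qed.
Lemma isD1_shift f t s0 a : isD1 f (t + s0) a -> isD1 (fun s => f (s + s0)) t a.
move=> fa e e0; have [d d0 H] := fa e e0; exists d => // h /H.
by rewrite [t + h + s0]addrAC.
Qed.
Lemma isD1_scale f t k a : isD1 f (k * t) a -> isD1 (fun s => f (k * s)) t (k%:C%C * a).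
move=> fa; apply:isD1_weak; exists `|k| => e e0 _.
have [d d0 H] := fa e e0.
exists (d / (`|k| + 1)); first by rewrite divr_gt0.
move=> h hh; have hk : `|k * h| < d.
 rewrite normrM; apply:le_lt_trans (_ : (`|k| + 1) * `|h| < _).
  by rewrite ler_wpM2r // lerDl.
 by rewrite mulrC -ltr_pdivlMr.
have := H _ hk; rewrite -mulrDr rmorphM mulrCA mulrA => h1; apply:le_trans h1 _.
by rewrite normrM mulrA [e * _]mulrC.
Qed.
Lemma isD1_Re f t a : isD1 f t a ->
 is_derive t 1 (fun s => complex.Re (f s)) (complex.Re a).
move=> fa.
suff H : (fun h => h^-1 *: (complex.Re (f (h *: 1 + t)) - complex.Re (f t)))
  @ (0 : R)^' --> complex.Re a.
 by apply:DeriveDef; [apply/cvg_ex; exists (complex.Re a) | exact:cvg_lim].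
apply/cvgrPdist_le=> e e0; have [d d0 h1] := fa e e0.
apply/nbhs_ballP; exists d => //= h; rewrite /ball /= sub0r normrN => /h1 hh hn0.
rewrite [h *: 1]mulr1 [h + t]addrC.
have nh : 0 < `|h| by rewrite normr_gt0.
rewrite -(ler_pM2l nh) -normrM mulrBr mulVKf //.
rewrite [leRHS]mulrC distrC; apply:le_trans hh.
rewrite cnE; case:(f _) (f _) (a) => [x y] [z w] [u v] /=.
by rewrite mul0r subr0 lerDl.
Qed.
Lemma isD1_Ni f t a : isD1 f t a -> isD1 (fun s => - 'i%C * f s) t (- 'i%C * a).
move=> fa; have H := @isD1_lin (- 'i%C) f (fun=> 0) t a 0 fa (isD1_cst 0 t).
apply:isD1_eq (_ : isD1 _ t (- 'i%C * a + 0)) _; last by ring.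
apply:isD1_near H; exists 1 => // h _; exact:addr0.
Qed.
Lemma Re_Ni a : complex.Re (- 'i%C * a) = complex.Im a.
case:a => x y /=; ring. Qed.
Lemma mvt_real (G G' : R -> R) (a b : R) : a <= b ->
 (forall s, a <= s <= b -> is_derive s 1 G (G' s)) ->
 exists2 c : R, a <= c <= b & G b - G a = G' c * (b - a).
move=> ab D; have D' x : x \in `[a, b] -> is_derive x 1 G (G' x) by exact:D.
have H1 x : x \in `]a, b[ -> is_derive x 1 G (G' x).
 by rewrite /= => /andP[ax xb]; apply:D; rewrite !ltW.
have H2 : {within `[a, b], continuous G}.
 by apply:derivable_within_continuous => x /D'[].
by have [c] := MVT_segment ab H1 H2; exists c.
Qed.
(** The mean value theorem fails for complex values. It is applied to the real parts of f and of -i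
    f, whose intermediate points differ; this costs the factor 2. *)
Lemma mvi f (f' : R -> C) (a b : R) l (M : R) : a <= b ->
 (forall s, a <= s <= b -> isD1 f s (f' s)) ->
 (forall s, a <= s <= b -> cn (f' s - l) <= M) ->
 cn (f b - f a - (b - a)%:C%C * l) <= 2 * M * (b - a).
move=> ab fD hM.
have mvtRe (g g' : R -> C) : (forall s, a <= s <= b -> isD1 g s (g' s)) ->
  exists2 c : R, a <= c <= b & complex.Re (g b) - complex.Re (g a) = complex.Re (g' c) * (b - a).
 move=> gD.
 have [|c cab E] := mvt_real ab (G := fun s => complex.Re (g s)) (G' := fun s => complex.Re (g' s)).
  move=> x hx; apply:isD1_Re; exact:gD.
 by exists c.
have [c1 /hM m1 e1] := mvtRe f f' fD.
have [c2 /hM m2] := mvtRe (fun s => - 'i%C * f s) (fun s => - 'i%C * f' s)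
 ltac:(by move=> s h; apply:isD1_Ni; exact:fD).
rewrite !Re_Ni => e2.
move: e1 e2 m1 m2; rewrite !cnE; case:(f b) (f a) (f' c1) (f' c2) l {hM fD} => [p q] [r s] [x y] [z w] [u v] /=.
rewrite !mul0r subr0 addr0 => -> -> m1 m2.
have -> : x * (b - a) - (b - a) * u = (b - a) * (x - u) by lra.
have -> : w * (b - a) - (b - a) * v = (b - a) * (w - v) by lra.
rewrite !normrM ger0_norm ?subr_ge0 //.
have := normr_ge0 (x - u); have := normr_ge0 (y - v); have := normr_ge0 (z - u); have := normr_ge0 (w - v).
nra.
Qed.
End CurveDerivative.

Section Reciprocal.
Variable R : realType.
Local Notation C := R[i].
End Reciprocal.
HB.lock Definition rD (R : realType) (n : nat) (f : 'rV[R[i]]_n -> R[i]) v z : R[i] :=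
 rderive f v z.

Section DirectionalDerivative.
Variables (R : realType) (n : nat).
Local Notation C := R[i].
Local Notation E := 'rV[C]_n.
Implicit Types (f g : E -> C) (u v w z : E) (V : set E) (t h : R).
Definition isD f v z l := isD1 (fun t => f (z + t%:C%C *: v)) 0 l.
Lemma isDP f v z l : isD f v z l <-> real_quotient f v z @ (0 : R)^' --> l.
rewrite /isD isD1P (_ : quot1 _ 0 = real_quotient f v z) //.
by apply/funext=> h; rewrite /quot1 add0r scale0r addr0.
Qed.
Lemma isD_line f v z t l :
 isD f v (z + t%:C%C *: v) l <-> isD1 (fun s => f (z + s%:C%C *: v)) t l.
have E h : z + t%:C%C *: v + (0 + h)%:C%C *: v = z + (t + h)%:C%C *: v.
 by rewrite add0r rmorphD scalerDl addrA.
have E0 : z + t%:C%C *: v + 0%:C%C *: v = z + t%:C%C *: v by rewrite scale0r addr0.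
split=> H e e0; have [d d0 Hd] := H e e0; exists d; [exact:d0| |exact:d0|] => h hd; have := Hd h hd.
 by rewrite E E0.
by rewrite E E0.
Qed.
Lemma isD_rD f v z l : isD f v z l -> rD f v z = l.
move/isDP; rewrite rD.unlock; exact:rderiveE. Qed.
Lemma isD_cst c v z : isD (fun=> c) v z 0.
exact:isD1_cst. Qed.
Lemma isD_lin c f g v z a b :
 isD f v z a -> isD g v z b -> isD (fun x => c * f x + g x) v z (c * a + b).
exact:isD1_lin. Qed.
Lemma isD_mul f g v z a b :
 isD f v z a -> isD g v z b -> isD (fun x => f x * g x) v z (a * g z + f z * b).
move=> fa gb; have := isD1_mul fa gb.
by rewrite scale0r addr0.
Qed.
Lemma isD_eq f v z l l' : isD f v z l -> l = l' -> isD f v z l'.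
by move=> ? <-. Qed.
Lemma isD_add f g v z a b :
 isD f v z a -> isD g v z b -> isD (fun x => f x + g x) v z (a + b).
move=> fa gb; have : isD (fun x => 1 * f x + g x) v z (1 * a + b) := isD_lin _ fa gb; rewrite mul1r.
by rewrite (_ : (fun x => 1 * f x + g x) = fun x => f x + g x) //; apply/funext=> x; rewrite mul1r.
Qed.
Lemma isD_scale c f v z a : isD f v z a -> isD (fun x => c * f x) v z (c * a).
move=> fa; have : isD (fun x => c * f x + 0) v z (c * a + 0) := isD_lin _ fa (isD_cst 0 v z); rewrite addr0.
by rewrite (_ : (fun x => c * f x + 0) = fun x => c * f x) //; apply/funext=> x; rewrite addr0.
Qed.
Lemma isD_sum I (s : seq I) (P : pred I) (F : I -> E -> C) (a : I -> C) v z :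
 (forall i, P i -> isD (F i) v z (a i)) ->
 isD (fun x => \sum_(i <- s | P i) F i x) v z (\sum_(i <- s | P i) a i).
move=> H; elim:s => [|i s IHs].
 rewrite big_nil (_ : (fun x => _) = fun=> 0); first exact:isD_cst.
 by apply/funext=> x; rewrite big_nil.
rewrite big_cons (_ : (fun x => _) = fun x => if P i then F i x + \sum_(j <- s | P j) F j x
 else \sum_(j <- s | P j) F j x); last by apply/funext=> x; rewrite big_cons.
case:ifP => Pi; [apply:isD_add; [exact:H|exact:IHs]|exact:IHs].
Qed.
Lemma isD_conj f v z a : isD f v z a -> isD (fun x => (f x)^*) v z a^*.
move=> fa e /fa[d d0 Hd]; exists d => // h /Hd.
rewrite -cn_conj !rmorphB rmorphM /=.
by have -> : (h%:C%C)^* = h%:C%C :> C by rewrite /Num.conj /= oppr0.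
Qed.
Lemma isD_near f g v z a : (\forall x \near z, f x = g x) -> isD f v z a -> isD g v z a.
move=> /nbhsE_P[d d0 H]; apply:isD1_near.
have k0 : 0 < rn v + 1 by have := rn_ge0 v; lra.
exists (d / (rn v + 1)); first by rewrite divr_gt0.
move=> h; rewrite ltr_pdivlMr // => hd; apply:H.
rewrite add0r [z + _]addrC addrK rnZ; have := normr_ge0 h; lra.
Qed.
Lemma isD_dirZ f v z t l : isD f v z l -> isD f (t%:C%C *: v) z (t%:C%C * l).
move=> fl; have := @isD1_scale R (fun s => f (z + s%:C%C *: v)) 0 t l.
rewrite mulr0 => /(_ fl) H; apply:isD1_near H; exists 1 => // h _.
by rewrite scalerA -rmorphM mulrC.
Qed.
Lemma isD_coord a v z : isD (fun x => x 0 a) v z (v 0 a).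
move=> e e0; exists 1 => // h _; rewrite !mxE add0r mul0r addr0.
by rewrite addrC addrK subrr cn0 mulr_ge0 // ltW.
Qed.
Lemma isD_inv f v z a : f z != 0 ->
 isD f v z a -> isD (fun x => (f x)^-1) v z (- a / (f z) ^+ 2).
by move=> fz0 fa; have := isD1_inv _ fa; rewrite scale0r addr0; apply.
Qed.
Definition cts f z := forall e : R, 0 < e ->
 exists2 d : R, 0 < d & forall w, rn (w - z) < d -> cn (f w - f z) < e.
Lemma ctsP f z : cts f z <-> f @ z --> f z.
by rewrite continuousE_P. Qed.
Lemma cts_cst c z : cts (fun=> c) z.
by exists 1 => //; rewrite subrr cn0. Qed.
Lemma cts_lin c f g z : cts f z -> cts g z -> cts (fun x => c * f x + g x) z.
move=> /ctsP fc /ctsP gc; apply/ctsP; exact:(@cvg_lin C _ _ (nbhs_filter z) c _ _ _ _ fc gc). Qed.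
Lemma cts_mul f g z : cts f z -> cts g z -> cts (fun x => f x * g x) z.
move=> /ctsP fc /ctsP gc; apply/ctsP; exact:(@cvgM C _ _ (nbhs_filter z) _ _ _ _ fc gc). Qed.
Lemma cts_inv f z : f z != 0 -> cts f z -> cts (fun x => (f x)^-1) z.
move=> fz0 /ctsP fc; apply/ctsP; exact:(@cvgV C _ _ (nbhs_filter z) _ _ fz0 fc). Qed.
Lemma cts_conj f z : cts f z -> cts (fun x => (f x)^*) z.
by move=> fc e /fc[d d0 Hd]; exists d => // w /Hd; rewrite -rmorphB cn_conj.
Qed.
Lemma cts_coord a z : cts (fun x => x 0 a) z.
move=> e e0; exists e => // w hw.
by apply:le_lt_trans hw; have := rn_coord (w - z) a; rewrite !mxE.
Qed.
Lemma cts_near f g z : (\forall x \near z, f x = g x) -> cts f z -> cts g z.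
move=> /nbhsE_P[d d0 H] fc e /fc[d' d'0 Hd].
exists (Num.min d d'); first by rewrite lt_min d0.
move=> w; rewrite lt_min => /andP[/H <- /Hd]; by rewrite (H z) // subrr rn0.
Qed.
End DirectionalDerivative.

Section CkCalculus.
Variables (R : realType) (n : nat).
Local Notation C := R[i].
Local Notation E := 'rV[C]_n.
Implicit Types (f g : E -> C) (u v w z : E) (V : set E) (t h : R) (k : nat).
Lemma Ck0E V f : Ck 0 V f <-> forall z, V z -> cts f z.
split=> [[H _] z Vz|H]; first by apply/ctsP; exact:H.
split; [move=> z Vz; apply/ctsP; exact:H|exact:I].
Qed.
Lemma CkSE k V f : Ck k.+1 V f <-> (forall z, V z -> cts f z) /\
 forall v, exists2 g, Ck k V g & forall z, V z -> isD f v z (g z).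
split=> -[fc fd]; split.
- move=> z Vz; apply/ctsP; exact:fc.
- move=> v; have [g gk gD] := fd v; exists g => [//|z Vz]; apply/isDP; exact:gD.
- move=> z Vz; apply/ctsP; exact:fc.
- move=> v; have [g gk gD] := fd v; exists g => [//|z Vz]; apply/isDP; exact:gD.
Qed.
Lemma Ck_cont k V f z : Ck k V f -> V z -> cts f z.
case:k => [/Ck0E H|k /CkSE[H _]]; exact:H.
Qed.
Lemma Ck_le k V f : Ck k.+1 V f -> Ck k V f.
elim:k f => [|k IHk] f /CkSE[fc fd]; first exact/Ck0E.
apply/CkSE; split=> [//|v]; have [g gk fg] := fd v; exists g => //; exact:IHk.
Qed.
Lemma Ck_sub k V V' f : V' `<=` V -> Ck k V f -> Ck k V' f.
move=> VV'; elim:k f => [f /Ck0E H|k IHk f /CkSE[fc fd]].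
 apply/Ck0E=> z /VV'; exact:H.
apply/CkSE; split=> [z /VV'/fc//|v].
have [g gk fg] := fd v; exists g => [|z /VV'/fg//]; exact:IHk.
Qed.
Lemma Ck_congr k V f g : open V -> (forall z, V z -> f z = g z) -> Ck k V f -> Ck k V g.
move=> oV fg; have nfg z : V z -> \forall x \near z, f x = g x.
 move=> Vz; apply:filterS (nr_op oV Vz) => x; exact:fg.
case:k => [/Ck0E fc|k /CkSE[fc fd]].
 apply/Ck0E=> z Vz; exact:cts_near (nfg _ Vz) (fc _ Vz).
apply/CkSE; split=> [z Vz|v]; first exact:cts_near (nfg _ Vz) (fc _ Vz).
have [f' f'k ff'] := fd v; exists f' => [//|z Vz].
exact:isD_near (nfg _ Vz) (ff' _ Vz).
Qed.
Lemma Ck_isD k V f v z : Ck k.+1 V f -> V z -> isD f v z (rD f v z).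
move=> /CkSE[_ /(_ v)[g _ H]] Vz; rewrite (isD_rD (H _ Vz)); exact:H. Qed.
Lemma Ck_rD k V f v : open V -> Ck k.+1 V f -> Ck k V (rD f v).
move=> oV /CkSE[_ /(_ v)[g gk H]]; apply:Ck_congr gk => // z Vz.
by rewrite (isD_rD (H _ Vz)).
Qed.
Lemma CkS k V f : (forall z, V z -> cts f z) ->
 (forall v, Ck k V (rD f v)) ->
 (forall v z, V z -> isD f v z (rD f v z)) -> Ck k.+1 V f.
move=> fc fk fd; apply/CkSE; split=> [//|v]; exists (rD f v); first exact:fk.
exact:fd.
Qed.
(** [Ck] asks for one derivative function on all of V. Since [rD] is a canonical choice, defined
    everywhere, the derivatives found on small open sets agree with it and need no gluing. *)
Lemma Ck_local k V f : (forall z, V z -> exists2 U, open U /\ U z & Ck k U f) -> Ck k V f.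
elim:k f => [|k IHk] f H.
 apply/Ck0E=> z /H[U [oU Uz] fU]; exact:Ck_cont fU Uz.
apply:CkS => [z|v|v z].
- move=> /H[U [oU Uz] fU]; exact:Ck_cont fU Uz.
- apply:IHk => z /H[U [oU Uz] fU]; exists U => //; exact:Ck_rD.
- move=> /H[U [oU Uz] fU]; exact:Ck_isD fU Uz.
Qed.
Lemma Ck_cst k V c : Ck k V (fun=> c).
elim:k c => [|k IHk] c; first by apply/Ck0E=> z _; exact:cts_cst.
apply/CkSE; split=> [z _|v]; first exact:cts_cst.
exists (fun=> 0) => [//|z _]; exact:isD_cst.
Qed.
Lemma Ck_add k V f g : Ck k V f -> Ck k V g -> Ck k V (fun x => f x + g x).
move=> fk gk; have := Ck_lin 1 fk gk.
by rewrite (_ : (fun x => 1 * f x + g x) = fun x => f x + g x) //; apply/funext=> x; rewrite mul1r.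
Qed.
Lemma Ck_mul k V f g : Ck k V f -> Ck k V g -> Ck k V (fun x => f x * g x).
elim:k f g => [|k IHk] f g fk gk.
 apply/Ck0E=> z Vz; exact:cts_mul (Ck_cont fk Vz) (Ck_cont gk Vz).
apply/CkSE; split=> [z Vz|v]; first exact:cts_mul (Ck_cont fk Vz) (Ck_cont gk Vz).
have /CkSE[_ /(_ v)[f' f'k ff']] := fk; have /CkSE[_ /(_ v)[g' g'k gg']] := gk.
exists (fun x => f' x * g x + f x * g' x) => [|z Vz].
 apply:Ck_add; apply:IHk => //; exact:Ck_le.
exact:isD_mul (ff' _ Vz) (gg' _ Vz).
Qed.
Lemma Ck_conj k V f : Ck k V f -> Ck k V (fun x => (f x)^*).
elim:k f => [|k IHk] f fk.
 apply/Ck0E=> z Vz; exact:cts_conj (Ck_cont fk Vz).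
apply/CkSE; split=> [z Vz|v]; first exact:cts_conj (Ck_cont fk Vz).
have /CkSE[_ /(_ v)[f' f'k ff']] := fk; exists (fun x => (f' x)^*) => [|z Vz]; first exact:IHk.
exact:isD_conj (ff' _ Vz).
Qed.
Lemma Ck_coord k V a : Ck k V (fun x => x 0 a).
case:k => [|k]; first by apply/Ck0E=> z _; exact:cts_coord.
apply/CkSE; split=> [z _|v]; first exact:cts_coord.
exists (fun=> v 0 a) => [|z _]; [exact:Ck_cst|exact:isD_coord].
Qed.
(** The derivative of 1/f is -f' times the square of 1/f, so the induction hypothesis on 1/f itself
    closes the step. *)
Lemma Ck_inv k V f : (forall z, V z -> f z != 0) -> Ck k V f -> Ck k V (fun x => (f x)^-1).
move=> f0; elim:k => [|k IHk] fk.
 apply/Ck0E=> z Vz; exact:cts_inv (f0 _ Vz) (Ck_cont fk Vz).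
apply/CkSE; split=> [z Vz|v]; first exact:cts_inv (f0 _ Vz) (Ck_cont fk Vz).
have /CkSE[_ /(_ v)[f' f'k ff']] := fk.
exists (fun x => (- 1 * f' x) * ((f x)^-1 * (f x)^-1)) => [|z Vz].
 have fV := IHk (Ck_le fk); apply:Ck_mul; last exact:Ck_mul.
 apply:Ck_mul => //; exact:Ck_cst.
apply:isD_eq (isD_inv (f0 _ Vz) (ff' _ Vz)) _.
by rewrite mulN1r invfM.
Qed.
Lemma Ck_sum k V I (s : seq I) (P : pred I) (F : I -> E -> C) :
 (forall i, P i -> Ck k V (F i)) -> Ck k V (fun x => \sum_(i <- s | P i) F i x).
move=> H; elim:s => [|i s IHs].
 rewrite (_ : (fun x => _) = fun=> 0); first exact:Ck_cst.
 by apply/funext=> x; rewrite big_nil.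
rewrite (_ : (fun x => _) = fun x => if P i then F i x + \sum_(j <- s | P j) F j x
 else \sum_(j <- s | P j) F j x); last by apply/funext=> x; rewrite big_cons.
case Pi: (P i); [apply:Ck_add; [exact:H|exact:IHs]|exact:IHs].
Qed.
Lemma sm_cont V f z : smooth V f -> V z -> cts f z.
move=> /(_ 0); exact:Ck_cont. Qed.
Lemma sm_isD V f v z : smooth V f -> V z -> isD f v z (rD f v z).
move=> /(_ 1); exact:Ck_isD. Qed.
Lemma sm_rD V f v : open V -> smooth V f -> smooth V (rD f v).
by move=> oV fs k; apply:Ck_rD. Qed.
Lemma sm_sub V V' f : V' `<=` V -> smooth V f -> smooth V' f.
move=> VV' fs k; exact:Ck_sub (fs k). Qed.
Lemma sm_congr V f g : open V -> (forall z, V z -> f z = g z) -> smooth V f -> smooth V g.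
move=> oV fg fs k; exact:Ck_congr (fs k). Qed.
Lemma sm_local V f :
 (forall z, V z -> exists2 U, open U /\ U z & smooth U f) -> smooth V f.
by move=> H k; apply:Ck_local => z /H[U oU fU]; exists U. Qed.
Lemma sm_cst V c : smooth V (fun=> c). move=> k; exact:Ck_cst. Qed.
Lemma sm_add V f g : smooth V f -> smooth V g -> smooth V (fun x => f x + g x).
move=> fs gs k; exact:Ck_add. Qed.
Lemma sm_mul V f g : smooth V f -> smooth V g -> smooth V (fun x => f x * g x).
move=> fs gs k; exact:Ck_mul. Qed.
Lemma sm_conj V f : smooth V f -> smooth V (fun x => (f x)^*).
move=> fs k; exact:Ck_conj. Qed.
Lemma sm_coord V a : smooth V (fun x => x 0 a).
move=> k; exact:Ck_coord. Qed.
Lemma sm_inv V f : (forall z, V z -> f z != 0) -> smooth V f -> smooth V (fun x => (f x)^-1).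
move=> f0 fs k; exact:Ck_inv. Qed.
Lemma sm_sum V I (s : seq I) (P : pred I) (F : I -> E -> C) :
 (forall i, P i -> smooth V (F i)) -> smooth V (fun x => \sum_(i <- s | P i) F i x).
move=> H k; apply:Ck_sum => i Pi; exact:H. Qed.
Lemma sm_prod V I (s : seq I) (P : pred I) (F : I -> E -> C) :
 (forall i, P i -> smooth V (F i)) -> smooth V (fun x => \prod_(i <- s | P i) F i x).
move=> H; elim:s => [|i s IHs].
 rewrite (_ : (fun x => _) = fun=> 1); first exact:sm_cst.
 by apply/funext=> x; rewrite big_nil.
rewrite (_ : (fun x => _) = fun x => if P i then F i x * \prod_(j <- s | P j) F j x
 else \prod_(j <- s | P j) F j x); last by apply/funext=> x; rewrite big_cons.
case Pi: (P i); [apply:sm_mul; [exact:H|exact:IHs]|exact:IHs].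
Qed.
End CkCalculus.

(** * Total derivatives, the chain rule and the symmetry of second derivatives *)

Section Frechet.
Variables (R : realType) (n : nat).
Local Notation C := R[i].
Local Notation E := 'rV[C]_n.
Implicit Types (f g : E -> C) (u v w z : E) (V : set E) (t h : R).
Definition ev (a : 'I_n) : E := delta_mx 0 a.
Definition iev (a : 'I_n) : E := 'i%C *: delta_mx 0 a.
Lemma rn_ev a : rn (ev a) = 1. exact:rn_delta. Qed.
Lemma rn_iev a : rn (iev a) = 1.
rewrite rnE (bigD1 a) //= big1 ?addr0 => [|b ba]; rewrite !mxE /=.
 by rewrite eqxx mulr1 cni.
by rewrite (negbTE ba) mulr0 cn0.
Qed.
(** The candidate for the total real differential at z, assembled from the 2n real partial
    derivatives; [dformE] is its form in dz and dzbar. *)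
Definition dform f z w : C :=
 \sum_a ((complex.Re (w 0 a))%:C%C * rD f (ev a) z +
     (complex.Im (w 0 a))%:C%C * rD f (iev a) z).
Lemma ReImE (x : C) : x = (complex.Re x)%:C%C + 'i%C * (complex.Im x)%:C%C.
by apply/eqP; rewrite eq_complex /= !mul0r !mul1r ?add0r oppr0 addr0 ?eqxx. Qed.
Lemma conjCE (x : C) : x^* = (complex.Re x)%:C%C - 'i%C * (complex.Im x)%:C%C.
case:x => a b; apply:complex_ext => /=; ring. Qed.
Lemma sqri : 'i%C * 'i%C = -1 :> C. by rewrite -expr2 sqr_i. Qed.
Lemma dzE f a z : dz a f z = (rD f (ev a) z - 'i%C * rD f (iev a) z) / 2.
by rewrite rD.unlock. Qed.
Lemma dzbarE f a z : dzbar a f z = (rD f (ev a) z + 'i%C * rD f (iev a) z) / 2.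
by rewrite rD.unlock. Qed.
Lemma dformE f z w :
 dform f z w = \sum_a (w 0 a * dz a f z + (w 0 a)^* * dzbar a f z).
apply:eq_bigr=> a _; rewrite dzE dzbarE conjCE [X in _ = X * _ + _]ReImE.
set x := (_)%:C%C; set y := (_)%:C%C; set A := rD _ _ _; set B := rD _ _ _.
have -> : x * A + y * B = x * A - y * ('i%C * 'i%C) * B by rewrite sqri; ring.
by field.
Qed.
Lemma dformD f z v w : dform f z (v + w) = dform f z v + dform f z w.
rewrite -big_split; apply:eq_bigr=> a _; rewrite mxE /=; ring.
Qed.
Lemma conj_real t : (t%:C%C)^* = t%:C%C :> C.
by rewrite conjCE mulr0 subr0. Qed.
Lemma dformZ f z t w : dform f z (t%:C%C *: w) = t%:C%C * dform f z w.
rewrite !dformE mulr_sumr; apply:eq_bigr=> a _; rewrite mxE rmorphM /= conj_real; ring.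
Qed.
Lemma dform_bound f z : exists2 K : R, 0 <= K & forall w, cn (dform f z w) <= K * rn w.
exists (\sum_a (cn (rD f (ev a) z) + cn (rD f (iev a) z))).
 by apply:sumr_ge0 => a; rewrite addr_ge0 ?cn_ge0.
move=> w; apply:le_trans (cn_sum _ _ _) _; rewrite mulr_suml; apply:ler_sum => a _.
apply:le_trans (cnD _ _) _; rewrite !cnZ mulrDl.
have h := rn_coord w a; move: h; rewrite cnE => h.
have h1 : `|complex.Re (w 0 a)| <= rn w by have := normr_ge0 (complex.Im (w 0 a)); lra.
have h2 : `|complex.Im (w 0 a)| <= rn w by have := normr_ge0 (complex.Re (w 0 a)); lra.
by apply:lerD; rewrite mulrC ler_wpM2l // cn_ge0.
Qed.
Lemma segment_est f v y l (t e : R) :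
 (forall s, `|s| <= `|t| -> isD f v (y + s%:C%C *: v) (rD f v (y + s%:C%C *: v))
  /\ cn (rD f v (y + s%:C%C *: v) - l) <= e) ->
 cn (f (y + t%:C%C *: v) - f y - t%:C%C * l) <= 2 * e * `|t|.
move=> H; pose phi s := f (y + s%:C%C *: v); pose phi' s := rD f v (y + s%:C%C *: v).
have phi0 : phi 0 = f y by rewrite /phi scale0r addr0.
have [t0|t0] := leP 0 t.
 have := @mvi R phi phi' 0 t l e t0; rewrite phi0 subr0 ger0_norm //; apply=> s /andP[s0 st].
  by apply/isD_line; apply:(H s _).1; rewrite !ger0_norm.
 by apply:(H s _).2; rewrite !ger0_norm.
have := @mvi R phi phi' t 0 l e (ltW t0); rewrite phi0 sub0r ltr0_norm // rmorphN.
rewrite (_ : f y - phi t - - t%:C%C * l = - (phi t - f y - t%:C%C * l)); last by ring.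
rewrite cnN; apply=> s /andP[st s0].
 by apply/isD_line; apply:(H s _).1; rewrite ler0_norm // ltr0_norm // lerN2.
by apply:(H s _).2; rewrite ler0_norm // ltr0_norm // lerN2.
Qed.
(** Along a broken line each piece is a one-variable mean value estimate, and the errors add up as
    long as the line stays in the ball of radius d. Only closeness of the directional derivatives to
    their values at z0 enters. *)
Lemma path_est f z0 (s : seq (R * E)) (e d : R) : 0 <= e ->
 (forall p, p \in s -> forall z, rn (z - z0) < d ->
  isD f p.2 z (rD f p.2 z) /\ cn (rD f p.2 z - rD f p.2 z0) <= e) ->
 forall y, rn (y - z0) + \sum_(p <- s) `|p.1| * rn p.2 < d ->
 cn (f (y + \sum_(p <- s) p.1%:C%C *: p.2) - f y - \sum_(p <- s) p.1%:C%C * rD f p.2 z0)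
  <= 2 * e * \sum_(p <- s) `|p.1|.
move=> e0; elim:s => [|[t v] s IHs] H y; rewrite ?big_nil ?big_cons /=.
 by rewrite !addr0 subrr subr0 cn0 mulr0.
move=> hy; have S0 : 0 <= \sum_(p <- s) `|p.1| * rn p.2.
 by apply:sumr_ge0 => p; rewrite mulr_ge0 ?rn_ge0.
have tv : rn (t%:C%C *: v) = `|t| * rn v by exact:rnZ.
have h1 : cn (f (y + t%:C%C *: v) - f y - t%:C%C * rD f v z0) <= 2 * e * `|t|.
 apply:segment_est => q qt; apply:(H (t, v)); first exact:mem_head.
 rewrite addrAC; apply:le_lt_trans (rnD _ _) _; rewrite rnZ.
 have : `|q| * rn v <= `|t| * rn v by rewrite ler_wpM2r // rn_ge0.
 lra.
have h2 : rn (y + t%:C%C *: v - z0) + \sum_(p <- s) `|p.1| * rn p.2 < d.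
 rewrite addrAC; have := rnD (y - z0) (t%:C%C *: v); lra.
have H' p : p \in s -> _ := fun ps => H p (mem_behead (s := (t, v) :: s) ps).
have {H'} := IHs H' _ h2.
rewrite addrA; set F := f _; set G := f _ in h1 *.
set A := _ * _ in h1 *; set B := \sum_(p <- s) p.1%:C%C * _ => h3.
have -> : F - f y - (A + B) = (F - G - B) + (G - f y - A) by ring.
apply:le_trans (cnD _ _) _; lra.
Qed.
Definition steps w : seq (R * E) :=
 [seq (complex.Re (w 0 a), ev a) | a <- index_enum 'I_n] ++
 [seq (complex.Im (w 0 a), iev a) | a <- index_enum 'I_n].
Lemma steps_sum w : \sum_(p <- steps w) p.1%:C%C *: p.2 = w.
rewrite big_cat /= !big_map -big_split /= [RHS]row_sum_delta; apply:eq_bigr=> a _.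
by rewrite scalerA -scalerDl [in RHS](ReImE (w 0 a)) mulrC.
Qed.
Lemma steps_dform f z w : \sum_(p <- steps w) p.1%:C%C * rD f p.2 z = dform f z w.
by rewrite big_cat /= !big_map -big_split. Qed.
Lemma steps_norm w : \sum_(p <- steps w) `|p.1| = rn w.
by rewrite rnE big_cat /= !big_map -big_split; apply:eq_bigr=> a; rewrite cnE. Qed.
Lemma steps_norm2 w : \sum_(p <- steps w) `|p.1| * rn p.2 = rn w.
rewrite rnE big_cat /= !big_map -big_split; apply:eq_bigr=> a _ /=.
by rewrite rn_ev rn_iev !mulr1 cnE.
Qed.
Variable V : set E.
Hypothesis oV : open V.
Lemma sm_near f z0 v (e : R) : smooth V f -> V z0 -> 0 < e ->
 \forall z \near z0, isD f v z (rD f v z) /\ cn (rD f v z - rD f v z0) <= e.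
move=> fs Vz e0; have := sm_cont (sm_rD v oV fs) Vz e0.
move/(nbhsE_P z0 (fun z => cn (rD f v z - rD f v z0) < e)).
apply:filterS2 (nr_op oV Vz) => z Vz' /ltW; split=> //; exact:sm_isD.
Qed.
(** A broken line parallel to the axes joins y to x, and continuity of the partial derivatives
    controls each step. Both points move: this strict form gives local Lipschitz bounds and the
    limit of kernels in the change of variables. *)
Lemma sm_strict f z0 (e : R) : smooth V f -> V z0 -> 0 < e ->
 exists2 d : R, 0 < d & forall x y, rn (x - z0) < d -> rn (y - z0) < d ->
  cn (f x - f y - dform f z0 (x - y)) <= e * rn (x - y).
move=> fs Vz e0; have e20 : 0 < e / 2 by lra.
have : \forall z \near z0, forall a,
  (isD f (ev a) z (rD f (ev a) z) /\ cn (rD f (ev a) z - rD f (ev a) z0) <= e / 2) /\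
  (isD f (iev a) z (rD f (iev a) z) /\ cn (rD f (iev a) z - rD f (iev a) z0) <= e / 2).
 apply:(@filter_forall _ _ _ _ (nbhs_filter z0)) => a.
 by apply:filterS2 (sm_near (ev a) fs Vz e20) (sm_near (iev a) fs Vz e20).
(* The start y lies within d / 3 of z0 and the broken line is shorter than 2 d / 3, so it never
   leaves the ball of radius d. *)
move/nbhsE_P=> [d d0 H]; exists (d / 3); first by lra.
move=> x y hx hy; have := @path_est f z0 (steps (x - y)) (e / 2) d (ltW e20) _ y.
have E1 : y + (x - y) = x by rewrite addrC subrK.
have E2 : 2 * (e / 2) = e by lra.
rewrite steps_sum steps_dform steps_norm steps_norm2 E1 E2; apply.
 move=> p; rewrite mem_cat => /orP[] /mapP[a _ ->] z /H/(_ a)[] //.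
have := rn_distD x z0 y; rewrite (rnC z0); lra.
Qed.
End Frechet.

Section Chain.
Variables (R : realType) (m : nat).
Local Notation C := R[i].
Lemma isD1_chain (V : set 'rV[C]_m) (f : 'rV[C]_m -> C) (g : R -> 'rV[C]_m) (t : R) (l : 'rV[C]_m) :
 open V -> smooth V f -> V (g t) ->
 (forall b, isD1 (fun s => g s 0 b) t (l 0 b)) ->
 isD1 (fun s => f (g s)) t (dform f (g t) l).
move=> oV fs Vg gD; apply:isD1_weak.
have [K K0 HK] := dform_bound f (g t).
(* Two errors: that of g, passed through the bounded linear form (K m), and that of linearising f
   over the increment of g (at most (rn l + m) |h|). *)
exists (K * m%:R + (rn l + m%:R)) => e e0 e1.
have [d d0 Hd] := sm_strict oV fs Vg e0.
have : \forall h \near (0 : R), forall b, cn (g (t + h) 0 b - g t 0 b - h%:C%C * l 0 b) <= e * `|h|.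
 apply:(@filter_forall _ _ _ _ (nbhs_filter (0:R))) => b; have [d1 d10 H1] := gD b e e0.
 by apply/nbhs_ballP; exists d1 => //= h; rewrite /ball /= sub0r normrN; exact:H1.
move/nbhs_ballP=> [d1 /= d10 H1].
have k0 : 0 < rn l + m%:R + 1 by have := rn_ge0 l; have : (0 : R) <= m%:R by []; lra.
exists (Num.min d1 (d / (rn l + m%:R + 1))); first by rewrite lt_min d10 divr_gt0.
move=> h; rewrite lt_min ltr_pdivlMr // => /andP[hd1 hd].
have {}H1 := H1 h; rewrite /ball /= sub0r normrN in H1; have {}H1 := H1 hd1.
have R1 : rn (g (t + h) - g t - h%:C%C *: l) <= m%:R * e * `|h|.
 rewrite rnE; apply:le_trans (_ : \sum_(b < m) e * `|h| <= _).
  by apply:ler_sum => b _; rewrite !mxE; exact:H1.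
 by rewrite sumr_const card_ord -[X in X <= _]mulr_natl mulrA.
have nh := normr_ge0 h; have m0 : (0 : R) <= m%:R by [].
have R2 : rn (g (t + h) - g t) <= (rn l + m%:R) * `|h|.
 rewrite -[g (t + h) - g t](subrK (h%:C%C *: l)); apply:le_trans (rnD _ _) _; rewrite rnZ.
 have : m%:R * e * `|h| <= m%:R * `|h| by rewrite ler_wpM2r // ler_piMr // ltW.
 lra.
have hx : rn (g (t + h) - g t) < d by apply:le_lt_trans R2 _; have := rn_ge0 l; lra.
have hy : rn (g t - g t) < d by rewrite subrr rn0.
have := Hd _ _ hx hy; set x := f _ - f _; set y := g _ - g _ in R1 R2 *.
move=> H3; have -> : x - h%:C%C * dform f (g t) l = (x - dform f (g t) y) + dform f (g t) (y - h%:C%C *: l).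
 have E1 : - (h%:C%C *: l) = (- h)%:C%C *: l by rewrite rmorphN scaleNr.
 by rewrite dformD E1 dformZ rmorphN; ring.
apply:le_trans (cnD _ _) _; apply:le_trans (lerD H3 (HK _)) _.
have := ler_wpM2l K0 R1; have := ler_wpM2l (ltW e0) R2; lra.
Qed.
Variable n : nat.
Implicit Types (f : 'rV[C]_m -> C) (G : 'rV[C]_n -> 'rV[C]_m).
Lemma isD_comp V f G z v (l : 'rV[C]_m) : open V -> smooth V f -> V (G z) ->
 (forall b, isD (fun x => G x 0 b) v z (l 0 b)) ->
 isD (fun x => f (G x)) v z (dform f (G z) l).
move=> oV fs VG GD; have Gz : G (z + 0%:C%C *: v) = G z by rewrite scale0r addr0.
have := @isD1_chain V f (fun t => G (z + t%:C%C *: v)) 0 l oV fs.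
by rewrite Gz => /(_ VG GD).
Qed.
Lemma vec_cts G z : (forall b, cts (fun z => G z 0 b) z) -> forall e : R, 0 < e ->
 exists2 d : R, 0 < d & forall w, rn (w - z) < d -> rn (G w - G z) < e.
move=> Gc d d0; have : \forall w \near z, forall b, cn (G w 0 b - G z 0 b) < d / m.+1%:R.
 apply:(@filter_forall _ _ _ _ (nbhs_filter z)) => b; apply/nbhsE_P.
 by apply:Gc; rewrite divr_gt0.
move/nbhsE_P=> [d1 d10 H1]; exists d1 => // w /H1 H; apply:le_lt_trans (_ : \sum_(b < m) d / m.+1%:R < d).
 rewrite rnE; apply:ler_sum => b _; rewrite !mxE; exact:ltW.
rewrite sumr_const card_ord -[X in X < _]mulr_natr -mulrA gtr_pMr//.
by rewrite mulrC ltr_pdivrMr ?ltr0n// mul1r ltr_nat.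
Qed.
Lemma cts_comp f G z : (forall b, cts (fun x => G x 0 b) z) -> cts f (G z) ->
 cts (fun x => f (G x)) z.
by move=> Gc fc e /fc[d /(vec_cts Gc)[d' d'0 H] Hd]; exists d' => // w /H /Hd. Qed.
Lemma sm_Re (U : set 'rV[C]_n) g : smooth U g -> smooth U (fun x => (complex.Re (g x))%:C%C).
move=> gs; rewrite (_ : (fun x => _) = fun x => 2^-1 * (g x + (g x)^*)).
 apply:sm_mul; [exact:sm_cst|apply:sm_add => //; exact:sm_conj].
apply/funext=> x; rewrite conjCE [X in _ = _ * (X + _)]ReImE; by field.
Qed.
Lemma sm_Im (U : set 'rV[C]_n) g : smooth U g -> smooth U (fun x => (complex.Im (g x))%:C%C).
move=> gs; rewrite (_ : (fun x => _) = fun x => (complex.Re (- 'i%C * g x))%:C%C).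
 apply:sm_Re; apply:sm_mul => //; exact:sm_cst.
by apply/funext=> x; rewrite Re_Ni.
Qed.
(** The derivative of the composite is a combination of derivatives of f composed with the same G.
    The induction on the order therefore lets f vary and keeps G fixed. *)
Lemma sm_comp (U : set 'rV[C]_n) V f G : open U -> open V -> (forall z, U z -> V (G z)) ->
 (forall b, smooth U (fun x => G x 0 b)) -> smooth V f -> smooth U (fun x => f (G x)).
move=> oU oV UV Gs fs k.
have fGc g : smooth V g -> forall z, U z -> cts (fun x => g (G x)) z.
 move=> gs z Uz; apply:cts_comp => [b|]; first exact:sm_cont.
 exact:sm_cont (UV _ Uz).
elim:k f fs => [|k IHk] f fs; first by apply/Ck0E; exact:fGc.
apply/CkSE; split=> [|v]; first exact:fGc.
exists (fun x => dform f (G x) (\row_b rD (fun x => G x 0 b) v x)) => [|z Uz].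
 apply:Ck_sum => a _; apply:Ck_add; apply:Ck_mul.
 - rewrite (_ : (fun x => _) = fun x => (complex.Re (rD (fun x => G x 0 a) v x))%:C%C).
   apply:sm_Re; exact:sm_rD.
  by apply/funext=> x; rewrite mxE.
 - apply:IHk; exact:sm_rD.
 - rewrite (_ : (fun x => _) = fun x => (complex.Im (rD (fun x => G x 0 a) v x))%:C%C).
   apply:sm_Im; exact:sm_rD.
  by apply/funext=> x; rewrite mxE.
 - apply:IHk; exact:sm_rD.
apply:isD_comp oV fs (UV _ Uz) _ => b; rewrite mxE.
exact:sm_isD.
Qed.
End Chain.

Section Schwarz.
Variables (R : realType) (n : nat).
Local Notation C := R[i].
Local Notation E := 'rV[C]_n.
Variable V : set E.
Hypothesis oV : open V.
Lemma sm_rderiveE f v z : smooth V f -> V z -> rD f v z = dform f z v.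
move=> fs Vz; apply:isD_rD.
have := @isD_comp R n n V f id z v v oV fs Vz (fun b => isD_coord b v z).
by [].
Qed.
(** The second difference over the parallelogram spanned by h u and h v is symmetric in u and v.
    Being h^2 times the mixed derivative up to o(h^2) in either order, it forces the two mixed
    derivatives to agree. *)
Lemma schwarz_est f u v z (e : R) : smooth V f -> V z -> 0 < e ->
 exists2 d : R, 0 < d & forall h : R, 0 < h -> h < d ->
  cn (f (z + h%:C%C *: u + h%:C%C *: v) - f (z + h%:C%C *: u) - f (z + h%:C%C *: v) + f z
    - (h * h)%:C%C * rD (rD f u) v z) <= 4 * e * (h * h).
move=> fs Vz e0; have fus := sm_rD u oV fs.
have [d d0 H] : exists2 d : R, 0 < d & forall w, rn (w - z) < d ->
  (isD (rD f u) v w (rD (rD f u) v w) /\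
  cn (rD (rD f u) v w - rD (rD f u) v z) <= e) /\ V w.
 apply/nbhsE_P.
 by apply:filterS2 (sm_near oV v fus Vz e0) (nr_op oV Vz).
set L := rD (rD f u) v z in H *.
have k0 : 0 < rn u + rn v + 1 by have := rn_ge0 u; have := rn_ge0 v; lra.
exists (d / (rn u + rn v + 1)); first by rewrite divr_gt0.
move=> h h0; rewrite ltr_pdivlMr // => hd.
have near1 s t : 0 <= s <= h -> `|t| <= h -> rn (z + s%:C%C *: u + t%:C%C *: v - z) < d.
 move=> /andP[s0 sh] th; rewrite (_ : _ - z = s%:C%C *: u + t%:C%C *: v); last by rewrite -[z + _ + _]addrA addrC addrK.
 apply:le_lt_trans (rnD _ _) _.
 rewrite !rnZ ger0_norm //; have := ler_wpM2r (rn_ge0 u) sh; have := ler_wpM2r (rn_ge0 v) th.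
 nra.
have near2 s : 0 <= s <= h -> V (z + s%:C%C *: u + h%:C%C *: v) /\ V (z + s%:C%C *: u).
 move=> sh; split; first by apply:(H _ (near1 s h sh _)).2; rewrite gtr0_norm.
 have := near1 s 0 sh; rewrite normr0 scale0r addr0 => h1; apply:(H _ _).2.
 lra.
(* The difference in direction u is the increment of [psi]; the difference in direction v is a
   second mean value estimate, applied to the derivative of [psi]. *)
pose psi s := f (z + s%:C%C *: u + h%:C%C *: v) - f (z + s%:C%C *: u).
pose psi' s := rD f u (z + s%:C%C *: u + h%:C%C *: v) - rD f u (z + s%:C%C *: u).
have psiD s : 0 <= s <= h -> isD1 psi s (psi' s).
 move=> sh; have [V1 V2] := near2 s sh.
 have D1 : isD1 (fun q => f (z + q%:C%C *: u + h%:C%C *: v)) s (rD f u (z + s%:C%C *: u + h%:C%C *: v)).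
  have := sm_isD u fs V1; rewrite addrAC => /isD_line.
  by apply:isD1_near; exists 1 => // q _; rewrite addrAC.
 have D2 : isD1 (fun q => f (z + q%:C%C *: u)) s (rD f u (z + s%:C%C *: u)).
  apply/isD_line; exact:sm_isD.
 have := isD1_lin (-1) D2 D1; rewrite mulN1r addrC; apply:isD1_near.
 by exists 1 => // q; rewrite mulN1r addrC.
have := @mvi R psi psi' 0 h (h%:C%C * L) (2 * e * h) (ltW h0) psiD.
rewrite /psi scale0r addr0 subr0 => Hm.
have -> : (h * h)%:C%C * L = h%:C%C * (h%:C%C * L) by ring.
have -> : 4 * e * (h * h) = 2 * (2 * e * h) * h by lra.
have -> : forall a b c d : C, a - b - c + d = a - b - (c - d) by move=> *; ring.
apply:Hm => s sh; rewrite /psi'.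
have := @segment_est R n (rD f u) v (z + s%:C%C *: u) L h; rewrite (gtr0_norm h0); apply=> q qh.
by have [] := H _ (near1 s q sh qh).
Qed.
Lemma schwarz f u v z : smooth V f -> V z ->
 rD (rD f u) v z = rD (rD f v) u z.
move=> fs Vz; apply:subr0_eq; apply:cn_small => e e0.
(* Each of the two second-difference estimates costs 4 times its tolerance. *)
have e80 : 0 < e / 8 by lra.
have [d1 d10 H1] := schwarz_est u v fs Vz e80.
have [d2 d20 H2] := schwarz_est v u fs Vz e80.
pose h := Num.min d1 d2 / 2.
have hm : 0 < Num.min d1 d2 by rewrite lt_min d10.
have h0 : 0 < h by rewrite divr_gt0.
have hh : h < Num.min d1 d2 by rewrite /h; lra.
move: (hh); rewrite lt_min => /andP[/(H1 h h0) {}H1 /(H2 h h0) {}H2].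
have hp : 0 < h * h by nra.
rewrite -(ler_pM2l hp) -{1}(gtr0_norm hp) -cnZ.
rewrite [X in f X - _ - _ + _ - _]addrAC in H2; set A := rD _ _ _ in H1 *; set B := rD _ _ _ in H2 *.
set a := f _ in H1 H2; set b := f _ in H1 H2; set c := f _ in H1 H2.
have -> : (h * h)%:C%C * (A - B) = (a - c - b + f z - (h * h)%:C%C * B) - (a - b - c + f z - (h * h)%:C%C * A).
 ring.
apply:le_trans (cnB _ _) _; lra.
Qed.
End Schwarz.

(** * Abstract bounded functionals, partitions of unity in C^n and Fubini's theorem *)

Section BoundedFunctional.
Variable R : realType.
Local Notation C := R[i].
Lemma nr_right0 (d : R) : 0 < d -> \forall x \near (0 : R)^'+, 0 < x < d.
move=> d0; near=> x; apply/andP; split; near: x; first exact:nbhs_right_gt.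
exact:nbhs_right_lt.
Unshelve. all: by end_near. Qed.
(* A linear functional on the functions satisfying D, bounded by the supremum over the compact set A *)
Record bfun (S : topologicalType) (A : set S) (D : (S -> C) -> Prop) (J : (S -> C) -> C) : Prop := Bfun {
 bf_compact : compact A;
 bf_D0 : D (fun=> 0);
 bf_Dlin : forall c f g, D f -> D g -> D (fun s => c * f s + g s);
 bf_lin : forall c f g, D f -> D g -> J (fun s => c * f s + g s) = c * J f + J g;
 bf_bound : exists2 K : R, 0 <= K &
  forall f (M : R), D f -> (forall s, A s -> cn (f s) <= M) -> cn (J f) <= K * M }.

Section One.
Variables (S : topologicalType) (A : set S) (D : (S -> C) -> Prop) (J : (S -> C) -> C).
Hypothesis bJ : bfun A D J.
Lemma bf_0 : J (fun=> 0) = 0.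
have := bf_lin bJ (-1) (bf_D0 bJ) (bf_D0 bJ).
rewrite (_ : (fun s : S => -1 * 0 + 0) = fun=> 0); first by move=> ->; ring.
by rewrite mulr0 addr0.
Qed.
Lemma bf_DZ c f : D f -> D (fun s => c * f s).
move=> Df; have := bf_Dlin bJ c Df (bf_D0 bJ).
by rewrite (_ : (fun s => c * f s + 0) = fun s => c * f s) //; apply/funext=> s; rewrite addr0.
Qed.
Lemma bf_Z c f : D f -> J (fun s => c * f s) = c * J f.
move=> Df; have := bf_lin bJ c Df (bf_D0 bJ); rewrite bf_0 addr0.
by rewrite (_ : (fun s => c * f s + 0) = fun s => c * f s) //; apply/funext=> s; rewrite addr0.
Qed.
Lemma bf_DD f g : D f -> D g -> D (fun s => f s + g s).
move=> Df Dg; have := bf_Dlin bJ 1 Df Dg.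
by rewrite (_ : (fun s => 1 * f s + g s) = fun s => f s + g s) //; apply/funext=> s; rewrite mul1r.
Qed.
Lemma bf_D f g : D f -> D g -> J (fun s => f s + g s) = J f + J g.
move=> Df Dg; have := bf_lin bJ 1 Df Dg; rewrite mul1r.
by rewrite (_ : (fun s => 1 * f s + g s) = fun s => f s + g s) //; apply/funext=> s; rewrite mul1r.
Qed.
Lemma bf_DB f g : D f -> D g -> D (fun s => f s - g s).
move=> Df Dg; have := bf_Dlin bJ (-1) Dg Df.
by rewrite (_ : (fun s => -1 * g s + f s) = fun s => f s - g s) //; apply/funext=> s; rewrite mulN1r addrC.
Qed.
Lemma bf_B f g : D f -> D g -> J (fun s => f s - g s) = J f - J g.
move=> Df Dg; have := bf_lin bJ (-1) Dg Df; rewrite mulN1r addrC.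
by rewrite (_ : (fun s => -1 * g s + f s) = fun s => f s - g s) //; apply/funext=> s; rewrite mulN1r addrC.
Qed.
Lemma bf_Dsum I (r : seq I) (P : pred I) (F : I -> S -> C) : (forall i, P i -> D (F i)) ->
 D (fun s => \sum_(i <- r | P i) F i s).
move=> H; elim:r => [|i r IHr].
 rewrite (_ : (fun x => _) = fun=> 0); first exact:bf_D0 bJ.
 by apply/funext=> x; rewrite big_nil.
rewrite (_ : (fun x => _) = fun x => if P i then F i x + \sum_(j <- r | P j) F j x
 else \sum_(j <- r | P j) F j x); last by apply/funext=> x; rewrite big_cons.
case Pi: (P i); [apply:bf_DD; [exact:H|exact:IHr]|exact:IHr].
Qed.
Lemma bf_sum I (r : seq I) (P : pred I) (F : I -> S -> C) : (forall i, P i -> D (F i)) ->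
 J (fun s => \sum_(i <- r | P i) F i s) = \sum_(i <- r | P i) J (F i).
move=> H; elim:r => [|i r IHr].
 rewrite big_nil (_ : (fun x => _) = fun=> 0); first exact:bf_0.
 by apply/funext=> x; rewrite big_nil.
rewrite big_cons (_ : (fun x => _) = fun x => if P i then F i x + \sum_(j <- r | P j) F j x
 else \sum_(j <- r | P j) F j x); last by apply/funext=> x; rewrite big_cons.
case Pi: (P i); last exact:IHr.
rewrite bf_D ?IHr //; [exact:H|exact:bf_Dsum].
Qed.
(** Convergence that is locally uniform near each point of the compact set is uniform on it, and the
    supremum bound passes it to J. This takes the place of dominated convergence. *)
Lemma bf_cvg T (Fl : set_system T) (FF : Filter Fl) (F : T -> S -> C) (g : S -> C) :
 D g -> (\forall t \near Fl, D (F t)) ->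
 (forall s, A s -> forall e : R, 0 < e -> \forall s' \near s & t \near Fl, cn (F t s' - g s') < e) ->
 forall e : R, 0 < e -> \forall t \near Fl, cn (J (F t) - J g) < e.
move=> Dg DF Fg e e0; have [K K0 HK] := bf_bound bJ.
have K1 : 0 < K + 1 by lra.
have e'0 : 0 < e / (K + 1) by rewrite divr_gt0.
have /compact_near_coveringP cA := bf_compact bJ.
have H := cA T Fl (fun t s => cn (F t s - g s) < e / (K + 1)) FF (fun s As => Fg s As _ e'0).
apply:filterS2 DF H => t DFt Ht.
rewrite -bf_B //; apply:le_lt_trans (HK _ (e / (K + 1)) _ _) _; first exact:bf_DB.
 by move=> s /Ht /ltW.
rewrite mulrCA gtr_pMr // ltr_pdivrMr; lra.
Qed.
Lemma bf_cts (T : topologicalType) (F : T -> S -> C) t0 : (\forall t \near t0, D (F t)) ->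
 (forall s, A s -> (fun p : T * S => F p.1 p.2) @ (t0, s) --> F t0 s) ->
 (fun t => J (F t)) @ t0 --> J (F t0).
move=> DF cF; apply/(@cvgC_P R _ (nbhs t0) (nbhs_filter t0)).
apply:bf_cvg => //; first exact:nbhs_singleton DF.
move=> s As e e0; have e20 : 0 < e / 2 by lra.
have /cvgC_P /(_ _ e20) := cF s As.
move=> [[U V] /= [Ut Vs] UV]; exists (V, U) => //= -[s' t] /= [Vs' Ut'].
have h1 := UV (t, s') (conj Ut' Vs').
have h2 := UV (t0, s') (conj (nbhs_singleton Ut) Vs').
rewrite cnC in h2; apply:le_lt_trans (cn_distD _ (F t0 s) _) _; lra.
Qed.
(** Joint continuity and compactness make the oscillation of F' near t0 small uniformly in s. The
    mean value inequality turns this into a uniform error for the increment, to which the bound of J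
    applies. *)
Lemma bf_deriv (F F' : R -> S -> C) (t0 : R) : (\forall t \near t0, D (F t)) -> D (F' t0) ->
 (forall t s, A s -> isD1 (F^~ s) t (F' t s)) ->
 (forall s, A s -> (fun p : R * S => F' p.1 p.2) @ (t0, s) --> F' t0 s) ->
 isD1 (fun t => J (F t)) t0 (J (F' t0)).
move=> DF DF' FD cF'; have [K K0 HK] := bf_bound bJ.
apply:isD1_weak; exists (2 * K) => e e0 e1.
have /compact_near_coveringP cA := bf_compact bJ.
have /nbhs_ballP[d1 /= d10 Hd1] := DF.
have H : \forall d \near (0 : R)^'+, A `<=` (fun s => forall t, `|t - t0| < d -> cn (F' t s - F' t0 s) < e).
 apply:cA => s As; have e20 : 0 < e / 2 by lra.
 have /cvgC_P /(_ _ e20) := cF' s As.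
 move=> [[U V] /= [/nbhs_ballP[d /= d0 Hd] Vs] UV].
 exists (V, [set x | 0 < x < d]) => //=.
  split=> //; exact:nr_right0.
 move=> [s' t'] /= [Vs' /andP[t'0 t'd]] t tt.
 have tU : U t by apply:Hd; rewrite /ball /= distrC; exact:lt_trans t'd.
 have h1 := UV (t, s') (conj tU Vs').
 have t0U : U t0 by apply:Hd; exact:ballxx.
 have h2 := UV (t0, s') (conj t0U Vs').
 rewrite cnC in h2; apply:le_lt_trans (cn_distD _ (F' t0 s) _) _; lra.
have [d Hd d0] : exists2 d, (A `<=` (fun s => forall t, `|t - t0| < d -> cn (F' t s - F' t0 s) < e)) & 0 < d.
 have /filter_ex[d [h1 h2]] : \forall d \near (0 : R)^'+,
   (A `<=` (fun s => forall t, `|t - t0| < d -> cn (F' t s - F' t0 s) < e)) /\ 0 < d.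
  by apply:filterS2 H (nbhs_right_gt (0 : R)).
 by exists d.
exists (Num.min d d1); first by rewrite lt_min d0.
move=> h; rewrite lt_min => /andP[hd hd1].
have DFh : D (F (t0 + h)).
 by apply:Hd1; rewrite /ball /= opprD addrA subrr sub0r normrN.
have DFt := nbhs_singleton DF.
rewrite -bf_B // -bf_Z // -bf_B; [|exact:bf_DB|exact:bf_DZ].
rewrite (_ : 2 * K * e * `|h| = K * (2 * e * `|h|)); last by lra.
apply:HK.
- apply:bf_DB; [exact:bf_DB|exact:bf_DZ].
- move=> s As; have [h0|h0] := leP 0 h.
  have := @mvi R (F^~ s) (F'^~ s) t0 (t0 + h) (F' t0 s) e.
  have E0 : t0 + h - t0 = h by lra.
  rewrite E0 (ger0_norm h0); apply; first by lra.
   move=> t _; exact:FD.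
  move=> t /andP[t1 t2]; apply/ltW/Hd => //; rewrite ger0_norm ?subr_ge0 //.
  rewrite ger0_norm in hd; lra.
 have := @mvi R (F^~ s) (F'^~ s) (t0 + h) t0 (F' t0 s) e.
 have E0 : t0 - (t0 + h) = - h by lra.
 rewrite E0 (ltr0_norm h0) -cnN => H1.
 have -> : F (t0 + h) s - F t0 s - h%:C%C * F' t0 s = - (F t0 s - F (t0 + h) s - (- h)%:C%C * F' t0 s).
  ring.
 rewrite -cnN in H1 *; apply:H1; first by lra.
  move=> t _; exact:FD.
 move=> t /andP[t1 t2]; apply/ltW/Hd => //; rewrite ler0_norm ?subr_le0 //.
 rewrite ltr0_norm in hd; lra.
Qed.
End One.
End BoundedFunctional.

Section Partition.
Variables (R : realType) (n : nat).
Local Notation C := R[i].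
Local Notation E := 'rV[C]_n.
Implicit Types (y z : E) (r d : R).
Definition tent d y z : R := Num.min 1 (Num.max 0 (2 - 2 * rn (z - y) / d)).
Lemma tent_ge0 d y z : 0 <= tent d y z.
by rewrite le_min ler01 le_max lexx. Qed.
Lemma tent_le1 d y z : tent d y z <= 1.
by rewrite ge_min lexx. Qed.
Lemma tent1 d y z : 0 < d -> rn (z - y) <= d / 2 -> tent d y z = 1.
move=> d0 h; apply/min_idPl; rewrite le_max; apply/orP; right.
have : 2 * rn (z - y) / d <= 1 by rewrite ler_pdivrMr; lra.
lra.
Qed.
Lemma tent0 d y z : 0 < d -> d <= rn (z - y) -> tent d y z = 0.
move=> d0 h; rewrite /tent (_ : Num.max _ _ = 0); first by apply/min_idPr.
apply/max_idPl; rewrite subr_le0 ler_pdivlMr; lra.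
Qed.
Lemma minmax_lip (a b : R) : `|Num.min 1 (Num.max 0 a) - Num.min 1 (Num.max 0 b)| <= `|a - b|.
have H (x y : R) : y <= x -> 0 <= Num.min 1 (Num.max 0 x) - Num.min 1 (Num.max 0 y) <= x - y.
 move=> yx; rewrite minEle maxEle minEle maxEle.
 do 4?case:ifP; lra.
have [ab|/ltW ab] := leP b a.
 by have /andP[h1 h2] := H _ _ ab; rewrite !ger0_norm // subr_ge0.
by have /andP[h1 h2] := H _ _ ab; rewrite distrC [leRHS]distrC !ger0_norm // subr_ge0.
Qed.
Lemma tent_cts d y z : 0 < d -> cts (fun x => (tent d y x)%:C%C) z.
move=> d0 e e0; exists (e * d / 2) => [|w hw]; first by nra.
rewrite -rmorphB cn_real; apply:le_lt_trans (minmax_lip _ _) _.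
rewrite (_ : _ - _ = 2 / d * (rn (z - y) - rn (w - y))); last by lra.
rewrite normrM gtr0_norm ?divr_gt0 // -ltr_pdivlMl ?divr_gt0 // (_ : _ * e = e * d / 2); last by lra.
apply:le_lt_trans hw; rewrite ler_norml.
have := rn_distD z w y; have := rn_distD w z y; rewrite (rnC z w) => h2; lra.
Qed.
(** Each centre takes from the remainder the share given by its tent. What is left at the end is
    [rem] times the product of the factors 1 - tent, which vanishes wherever one tent equals 1; no
    normalising division occurs. *)
Fixpoint part d (ys : seq E) (rem : E -> R) : seq (E * (E -> R)) :=
 if ys is y :: ys' then
  (y, fun z => rem z * tent d y z) :: part d ys' (fun z => rem z * (1 - tent d y z))
 else [::].
Lemma part_sum d ys rem z : \sum_(p <- part d ys rem) p.2 z = rem z * (1 - \prod_(y <- ys) (1 - tent d y z)).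
elim:ys rem => [|y ys IHys] rem /=; first by rewrite !big_nil subrr mulr0.
rewrite !big_cons IHys /=; ring.
Qed.
Lemma part_prop d ys rem : 0 < d -> (forall z, cts (fun x => (rem x)%:C%C) z) -> (forall z, 0 <= rem z) ->
 forall i, (i < size ys)%N -> let p := nth (0, fun=> 0) (part d ys rem) i in
 [/\ forall z, cts (fun x => (p.2 x)%:C%C) z, forall z, 0 <= p.2 z, forall z, d <= rn (z - p.1) -> p.2 z = 0
  & p.1 = nth 0 ys i].
move=> d0; elim:ys rem => [|y ys IHys] rem rc r0 //= [|i] /= hi.
 split=> // [z|z|z hz]; last by rewrite tent0 // mulr0.
  rewrite (_ : (fun x => _) = fun x => (rem x)%:C%C * (tent d y x)%:C%C).
   apply:cts_mul; [exact:rc|exact:tent_cts].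
  by apply/funext=> x; rewrite rmorphM.
 by rewrite mulr_ge0 // tent_ge0.
apply:IHys => // z; last by rewrite mulr_ge0 // subr_ge0 tent_le1.
rewrite (_ : (fun x => _) = fun x => (rem x)%:C%C * (-1 * (tent d y x)%:C%C + 1)).
 apply:cts_mul; first exact:rc.
 apply:cts_lin; [exact:tent_cts|exact:cts_cst].
apply/funext=> x; ring.
Qed.
Lemma size_part d ys rem : size (part d ys rem) = size ys.
by elim:ys rem => //= y ys IHys rem; rewrite IHys. Qed.
Definition Ball r : set E := [set z | rn z <= r].
Lemma cpt_Ball r : compact (Ball r).
have := @cpt_rball R n 0 r; rewrite (_ : [set w | _] = Ball r) //.
by apply/seteqP; split=> z /=; rewrite subr0.
Qed.
Lemma cpt_net (K : set E) d : compact K -> 0 < d ->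
 exists ys : seq E, (forall y, y \in ys -> K y) /\
  forall z, K z -> exists2 y, y \in ys & rn (z - y) < d.
move=> cK d0; rewrite compact_cover in cK.
have [||D' D'K cov] := @cK E K (fun y => [set w | rn (w - y) < d]).
- move=> i _; exact:open_rball.
- by move=> z; exists z => //=; rewrite subrr rn0.
exists (finmap.enum_fset D'); split=> [y yD|z /cov[y /= yD h]]; last by exists y.
by have := D'K y yD; rewrite inE.
Qed.
(* A partition of unity on the compact K with supports of radius d *)
Lemma part_fine (K : set E) d : compact K -> 0 < d ->
 exists s : seq (E * (E -> R)), [/\
  forall i, (i < size s)%N -> K (nth (0, fun=> 0) s i).1,
  forall i, (i < size s)%N -> let p := nth (0, fun=> 0) s i in
   [/\ forall z, cts (fun x => (p.2 x)%:C%C) z, forall z, 0 <= p.2 z &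
     forall z, d <= rn (z - p.1) -> p.2 z = 0],
  forall z, \sum_(i < size s) (nth (0, fun=> 0) s i).2 z <= 1 &
  forall z, K z -> \sum_(i < size s) (nth (0, fun=> 0) s i).2 z = 1].
move=> cK d0; have d20 : 0 < d / 2 by lra.
have [ys [ysK cov]] := cpt_net cK d20.
have P := @part_prop d ys (fun=> 1) d0 (fun z => cts_cst 1 z) (fun=> ler01).
have S z : \sum_(i < size (part d ys (fun=> 1))) (nth (0, fun=> 0) (part d ys (fun=> 1)) i).2 z =
  1 - \prod_(y <- ys) (1 - tent d y z).
 rewrite -[RHS]mul1r -(part_sum d ys (fun=> 1)).
 by rewrite (big_nth (0, fun=> 0)) big_mkord.
exists (part d ys (fun=> 1)); split=> [i|i|z|z Kz]; rewrite ?S ?size_part.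
- move=> hi; have [_ _ _ ->] := P i hi; apply:ysK; exact:mem_nth.
- by move=> hi; have [h1 h2 h3 _] := P i hi.
- by rewrite gerBl prodr_ge0 // => y; rewrite subr_ge0 tent_le1.
have [y yy hy] := cov z Kz.
rewrite (big_rem y) //= tent1 ?subrr ?mul0r ?subr0 //; exact:ltW.
Qed.
End Partition.

Section Swap.
Variables (R : realType) (n : nat).
Local Notation C := R[i].
Local Notation E := 'rV[C]_n.
Definition Cc (r : R) (f : E -> C) := (forall z, cts f z) /\ (forall z, r <= rn z -> f z = 0).
Lemma Cc_le r r' f : r <= r' -> Cc r f -> Cc r' f.
move=> rr' [fc f0]; split=> // z hz; apply:f0; exact:le_trans hz. Qed.
(* integral functionals: bounded on all Cc r *)
Definition ccfun (J : (E -> C) -> C) := forall r, 0 <= r -> bfun (Ball r) (Cc r) J.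
(** Compactness of the product of A with the ball gives one d for all parameters. Points outside the
    ball are covered because F vanishes there, either by exchanging the two points or trivially. *)
Lemma unif_cts (S : topologicalType) (A : set S) (F : S -> E -> C) r : compact A -> 0 <= r ->
 (forall s y, A s -> (fun p : S * E => F p.1 p.2) @ (s, y) --> F s y) ->
 (forall s y, r <= rn y -> F s y = 0) ->
 forall e : R, 0 < e -> exists2 d : R, 0 < d &
  forall s y y', A s -> rn (y - y') < d -> cn (F s y - F s y') <= e.
move=> cA r0 cF F0 e e0.
have /compact_near_coveringP cAB := compact_setX cA (@cpt_Ball R n r).
have H : \forall d \near (0 : R)^'+, (A `*` @Ball R n r) `<=`
  (fun p => forall y', rn (p.2 - y') < d -> cn (F p.1 p.2 - F p.1 y') <= e).
 apply:cAB => -[s y] [/= As By]; have e20 : 0 < e / 2 by lra.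
 have /cvgC_P /(_ _ e20) := cF s y As.
 move=> [[U V] /= [Us /nbhsE_P[d d0 Hd]] UV].
 have d20 : 0 < d / 2 by lra.
 exists (U `*` [set y' | rn (y' - y) < d / 2], [set x | 0 < x < d / 2]) => /=.
  split; last exact:nr_right0.
  exists (U, [set y' | rn (y' - y) < d / 2]) => //; split=> //=.
  by apply/nbhsE_P; exists (d / 2).
 move=> [[s' y'] t] /= [[Us' hy'] /andP[t0 td]] y'' hy''.
 have V1 : V y' by apply:Hd; lra.
 have V2 : V y''.
  apply:Hd; have := rn_distD y'' y' y; rewrite (rnC y'' y'); lra.
 have h1 := UV (s', y') (conj Us' V1); have h2 := UV (s', y'') (conj Us' V2).
 rewrite /= in h1 h2; rewrite cnC in h2.
 have := cn_distD (F s' y') (F s y) (F s' y''); lra.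
have [d [hd d0]] : exists d : R, ((A `*` @Ball R n r) `<=`
  (fun p => forall y', rn (p.2 - y') < d -> cn (F p.1 p.2 - F p.1 y') <= e)) /\ 0 < d.
 have /filter_ex[d [h1 h2]] : \forall d \near (0 : R)^'+, ((A `*` @Ball R n r) `<=`
  (fun p => forall y', rn (p.2 - y') < d -> cn (F p.1 p.2 - F p.1 y') <= e)) /\ 0 < d.
  by apply:filterS2 H (nbhs_right_gt (0 : R)).
 by exists d.
exists d => // s y y' As hyy.
have [By|/ltW nBy] := leP (rn y) r; first by have := hd (s, y) (conj As By) y' hyy.
have [By'|/ltW nBy'] := leP (rn y') r.
 by have := hd (s, y') (conj As By') y; rewrite rnC cnC; apply.
by rewrite !F0 // subrr cn0 ltW.
Qed.
Lemma part_Cc r d (p : E * (E -> R)) : rn p.1 <= r -> (forall z, cts (fun x => (p.2 x)%:C%C) z) ->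
 (forall z, d <= rn (z - p.1) -> p.2 z = 0) -> Cc (r + d) (fun z => (p.2 z)%:C%C).
move=> hr pc p0; split=> // z hz; rewrite p0 //.
have := rn_distD z p.1 0; rewrite !subr0; lra.
Qed.
Lemma part_approx (F : E -> C) (r d e : R) (s : seq (E * (E -> R))) : 0 <= e ->
 (forall i, (i < size s)%N -> let p := nth (0, fun=> 0) s i in
   (forall z, 0 <= p.2 z) /\ (forall z, d <= rn (z - p.1) -> p.2 z = 0)) ->
 (forall z, \sum_(i < size s) (nth (0, fun=> 0) s i).2 z <= 1) ->
 (forall z, Ball r z -> \sum_(i < size s) (nth (0, fun=> 0) s i).2 z = 1) ->
 (forall z, r <= rn z -> F z = 0) ->
 (forall y y', rn (y - y') < d -> cn (F y - F y') <= e) ->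
 forall z, cn (F z - \sum_(i < size s) F (nth (0, fun=> 0) s i).1 * ((nth (0, fun=> 0) s i).2 z)%:C%C) <= e.
move=> e0 H S1 S2 F0 uF z; set nt := nth (0, fun=> 0) s.
have -> : F z - \sum_(i < size s) F (nt i).1 * ((nt i).2 z)%:C%C =
 \sum_(i < size s) ((nt i).2 z)%:C%C * (F z - F (nt i).1).
 have E : F z = \sum_(i < size s) ((nt i).2 z)%:C%C * F z.
  rewrite -mulr_suml -rmorph_sum /=; have [hz|/ltW hz] := leP (rn z) r.
   by rewrite S2 // mul1r.
  by rewrite F0 // mulr0.
 rewrite [X in X - _]E -sumrB; apply:eq_bigr=> i _; ring.
apply:le_trans (cn_sum _ _ _) _.
apply:le_trans (_ : \sum_(i < size s) (nt i).2 z * e <= _).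
 apply:ler_sum => i _; have [h1 h2] := H i (ltn_ord i); rewrite cnZ ger0_norm //.
 have [hz|hz] := ltP (rn (z - (nt i).1)) d; last by rewrite h2 // !mul0r.
 by rewrite ler_wpM2l // uF.
by rewrite -mulr_suml ler_piMl.
Qed.
(** F is uniformly close to the finite sum of the products F(s, y_i) psi_i(y) over a fine partition,
    and on such sums the exchange is mere linearity. It applies equally to iterated integrals and to
    the functional on forms. *)
Lemma bf_swap (S : topologicalType) (A : set S) D (J : (S -> C) -> C) (J' : (E -> C) -> C)
  (F : S -> E -> C) r : bfun A D J -> ccfun J' -> 0 <= r ->
 (forall y, D (F^~ y)) -> (forall s, Cc r (F s)) ->
 D (fun s => J' (F s)) -> Cc r (fun y => J (F^~ y)) ->
 (forall s y, A s -> (fun p : S * E => F p.1 p.2) @ (s, y) --> F s y) ->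
 J (fun s => J' (F s)) = J' (fun y => J (F^~ y)).
move=> bJ cJ' r0 DF CF DJ' CJ cF.
have [K K0 HK] := bf_bound bJ.
(* Room for the partition functions, which reach at most a distance 1 beyond the ball of radius
   r. *)
have r1 : 0 <= r + 1 by lra.
have bJ' := cJ' _ r1; have [K' K'0 HK'] := bf_bound bJ'.
apply:subr0_eq; apply:cn_small => e0' e0'0.
have Kp : 0 < 2 * K * K' + 1 by nra.
pose e := e0' / (2 * K * K' + 1); have e0 : 0 < e by rewrite divr_gt0.
suff : cn (J (fun s : S => J' (F s)) - J' (fun y : E => J (F^~ y))) <= 2 * K * K' * e.
 move=> h; apply:le_trans h _; rewrite mulrA mulrC -[X in _ <= X]mul1r mulrA ler_wpM2r //; first exact:ltW.
 by rewrite -mulrC ler_pdivrMr // mul1r lerDl.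
have [d d0 Hd] := unif_cts (bf_compact bJ) r0 cF (fun s => (CF s).2) e0.
pose d' := Num.min d 1; have d'0 : 0 < d' by rewrite lt_min d0 ltr01.
have d'1 : d' <= 1 by rewrite ge_min lexx orbT.
have [s [sK sP sS1 sS]] := part_fine (@cpt_Ball R n r) d'0.
set nt := nth (0, fun=> 0) s in sK sP sS1 sS.
pose psi i := fun z => ((nt i).2 z)%:C%C : C.
have psiC i : (i < size s)%N -> Cc (r + 1) (psi i).
 move=> hi; have [h1 h2 h3] := sP i hi; apply:Cc_le (part_Cc (sK i hi) h1 h3).
 lra.
have uF s0 : A s0 -> forall y y', rn (y - y') < d' -> cn (F s0 y - F s0 y') <= e.
 by move=> As y y' hy; apply:Hd => //; apply:lt_le_trans hy _; rewrite ge_min lexx.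
have App s0 : A s0 -> forall z, cn (F s0 z - \sum_(i < size s) F s0 (nt i).1 * psi i z) <= e.
 move=> As; apply:(part_approx (ltW e0) _ sS1 sS (CF s0).2 (uF s0 As)).
 by move=> i hi; have [h1 h2 h3] := sP i hi.
have CF1 s0 : Cc (r + 1) (F s0) by apply:Cc_le (CF s0); rewrite lerDl.
have CJ1 : Cc (r + 1) (fun y => J (F^~ y)) by apply:Cc_le CJ; rewrite lerDl.
have CS s0 : Cc (r + 1) (fun y => \sum_(i < size s) F s0 (nt i).1 * psi i y).
 apply:(bf_Dsum bJ') => i _; apply:(bf_DZ bJ'); exact:psiC.
(* The common value of both iterated functionals on the finite sum; each side of the claim is within
   K K' e of it. *)
pose T := \sum_(i < size s) J' (psi i) * J (F^~ (nt i).1).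
have JS s0 : J' (fun y => \sum_(i < size s) F s0 (nt i).1 * psi i y) =
  \sum_(i < size s) J' (psi i) * F s0 (nt i).1.
 rewrite (bf_sum bJ') => [|i _]; last by apply:(bf_DZ bJ'); exact:psiC.
 by apply:eq_bigr=> i; rewrite (bf_Z bJ' _ (psiC i (ltn_ord i))) mulrC.
have DT : D (fun s0 => \sum_(i < size s) J' (psi i) * F s0 (nt i).1).
 by apply:(bf_Dsum bJ) => i _; apply:(bf_DZ bJ).
have JT : J (fun s0 => \sum_(i < size s) J' (psi i) * F s0 (nt i).1) = T.
 rewrite (bf_sum bJ) => [|i _]; last by apply:(bf_DZ bJ).
 by apply:eq_bigr=> i; rewrite (bf_Z bJ _ (DF _)).
have h1 : cn (J (fun s0 => J' (F s0)) - T) <= K * (K' * e).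
 rewrite -JT -(bf_B bJ) //; apply:HK; first exact:(bf_DB bJ).
 move=> s0 As; rewrite -JS -(bf_B bJ') //; apply:HK'; first exact:(bf_DB bJ').
 move=> z _; exact:App.
have CT : Cc (r + 1) (fun y => \sum_(i < size s) J (F^~ (nt i).1) * psi i y).
 apply:(bf_Dsum bJ') => i _; apply:(bf_DZ bJ'); exact:psiC.
have JT' : J' (fun y => \sum_(i < size s) J (F^~ (nt i).1) * psi i y) = T.
 rewrite (bf_sum bJ') => [|i _]; last by apply:(bf_DZ bJ'); exact:psiC.
 by apply:eq_bigr=> i; rewrite (bf_Z bJ' _ (psiC i (ltn_ord i))) mulrC.
have h2 : cn (J' (fun y => J (F^~ y)) - T) <= K' * (K * e).
 rewrite -JT' -(bf_B bJ') //; apply:HK'; first exact:(bf_DB bJ').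
 move=> y _.
 have Dy : D (fun s0 => \sum_(i < size s) psi i y * F s0 (nt i).1).
  by apply:(bf_Dsum bJ) => i _; apply:(bf_DZ bJ).
 have -> : \sum_(i < size s) J (F^~ (nt i).1) * psi i y = J (fun s0 => \sum_(i < size s) psi i y * F s0 (nt i).1).
  rewrite (bf_sum bJ) => [|i _]; last by apply:(bf_DZ bJ).
  by apply:eq_bigr=> i; rewrite (bf_Z bJ _ (DF _)) mulrC.
 rewrite -(bf_B bJ) //; apply:HK; first exact:(bf_DB bJ).
 move=> s0 As; have := App s0 As y.
 by under eq_bigr do rewrite mulrC.
have := cn_distD (J (fun s0 => J' (F s0))) T (J' (fun y => J (F^~ y))).
rewrite [cn (T - _)]cnC; lra.
Qed.
End Swap.

(** * Integrals of complex functions over segments, the line, the plane and C^n *)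

Section SegmentIntegral.
Variable R : realType.
Local Notation C := R[i].
Local Notation mu := (@lebesgue_measure R).
Implicit Types (f g h : R -> C) (a b t : R).
Definition Lam a b f : C :=
 (\int[mu]_(t in `[a, b]) complex.Re (f t) +i* \int[mu]_(t in `[a, b]) complex.Im (f t))%C.
Lemma Re_cts (T : topologicalType) (F : T -> C) (t : T) : F @ t --> F t -> (fun x => complex.Re (F x)) @ t --> complex.Re (F t).
move=> /cvgC_P H; apply/cvgrPdist_lt=> e e0.
apply:filterS (H e e0) => x; rewrite cnE distrC.
case:(F x) (F t) => [p q] [r s]; have := normr_ge0 (q - s); lra.
Qed.
Lemma Im_cts (T : topologicalType) (F : T -> C) (t : T) : F @ t --> F t -> (fun x => complex.Im (F x)) @ t --> complex.Im (F t).
move=> /cvgC_P H; apply/cvgrPdist_lt=> e e0.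
apply:filterS (H e e0) => x; rewrite cnE distrC.
case:(F x) (F t) => [p q] [r s]; have := normr_ge0 (p - r); lra.
Qed.
Lemma itg_Re f a b : continuous f -> mu.-integrable `[a, b] (EFin \o (fun t => complex.Re (f t))).
move=> fc; apply:continuous_compact_integrable; first exact:segment_compact.
apply:continuous_subspaceT => t; exact:(Re_cts (fc t)).
Qed.
Lemma itg_Im f a b : continuous f -> mu.-integrable `[a, b] (EFin \o (fun t => complex.Im (f t))).
move=> fc; apply:continuous_compact_integrable; first exact:segment_compact.
apply:continuous_subspaceT => t; exact:(Im_cts (fc t)).
Qed.
(** The real theorem is applied to the real parts of f and of -i f. Substitution rules, additivity
    over intervals and definiteness of the segment integral are then all deduced by comparing
    antiderivatives. *)
Lemma Lam_FTC (F : R -> C) f a b : a <= b -> continuous f ->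
 (forall t, a <= t <= b -> isD1 F t (f t)) -> Lam a b f = F b - F a.
move=> ab fc FD.
have [ab'|ba] := ltP a b; last first.
 have -> : b = a by lra.
 by rewrite /Lam set_itv1 !Rintegral_set1 subrr.
have ReF (G g : R -> C) : continuous g -> (forall t, a <= t <= b -> isD1 G t (g t)) ->
  \int[mu]_(t in `[a, b]) complex.Re (g t) = complex.Re (G b) - complex.Re (G a).
 move=> gc GD; have D t : a <= t <= b -> is_derive t 1 (fun s => complex.Re (G s)) (complex.Re (g t)).
  move=> h; apply:isD1_Re; exact:GD.
 have cts t : a <= t <= b -> (fun s => complex.Re (G s)) @ t --> complex.Re (G t).
  move=> /GD/isD1_cont; exact:Re_cts.
 rewrite /Rintegral (@continuous_FTC2 R (fun t => complex.Re (g t)) (fun s => complex.Re (G s))) //.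
 - apply:continuous_subspaceT => x; exact:(Re_cts (gc x)).
 - split.
  + by move=> t; rewrite /= => /andP[t1 t2]; apply:(@ex_derive _ _ _ _ _ _ _ (D t _)); rewrite !ltW.
  + by apply:cvg_at_right_filter; apply:cts; rewrite lexx.
  + by apply:cvg_at_left_filter; apply:cts; rewrite lexx ltW.
 - move=> t; rewrite in_itv /= => /andP[t1 t2]; rewrite derive1E.
  by apply:(@derive_val _ _ _ _ _ _ _ (D t _)); rewrite !ltW.
have Ni g : continuous g -> continuous (fun t => - 'i%C * g t).
 move=> gc t; apply/(@cvgC_P R _ (nbhs t) (nbhs_filter t)) => e e0.
 have /(cvgC_P (nbhs_filter t)) /(_ _ e0) := gc t; apply:filterS => x h.
 by rewrite -mulrBr; apply:le_lt_trans (cnM _ _) _; rewrite cnN cni mul1r.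
have := ReF (fun t => - 'i%C * F t) (fun t => - 'i%C * f t) (Ni _ fc).
rewrite !Re_Ni => H2.
rewrite /Lam (ReF F f) //; under eq_Rintegral do rewrite -Re_Ni.
rewrite H2 => [|t ht]; last by apply:isD1_Ni; exact:FD.
by case:(F b) (F a) => [p q] [r s].
Qed.
Lemma Rint_bound (g : R -> R) a b (M : R) : a <= b -> mu.-integrable `[a, b] (EFin \o g) ->
 (forall t, a <= t <= b -> `|g t| <= M) -> `|\int[mu]_(t in `[a, b]) g t| <= M * (b - a).
move=> ab ig gM.
have ic (c : R) : mu.-integrable `[a, b] (EFin \o (fun=> c)).
 apply:continuous_compact_integrable; first exact:segment_compact.
 apply:continuous_subspaceT => t; exact:cvg_cst.
have Ic (c : R) : \int[mu]_(t in `[a, b]) c = c * (b - a).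
 rewrite Rintegral_cst //; congr (_ * _).
 rewrite /= lebesgue_measure_itv lte_fin; case:ltP => h //=.
 lra.
rewrite ler_norml; apply/andP; split.
 rewrite -mulNr -Ic; apply:le_Rintegral => // t; rewrite /= => /gM.
 by rewrite ler_norml => /andP[].
rewrite -Ic; apply:le_Rintegral => // t; rewrite /= => /gM.
by rewrite ler_norml => /andP[].
Qed.
Lemma Lam_bound f a b (M : R) : a <= b -> continuous f -> (forall t, a <= t <= b -> cn (f t) <= M) ->
 cn (Lam a b f) <= 2 * M * (b - a).
move=> ab fc fM; rewrite cnE /=.
have h1 := @Rint_bound _ a b M ab (itg_Re _ _ fc); have h2 := @Rint_bound _ a b M ab (itg_Im _ _ fc).
rewrite -mulrA mulr_natl; apply:lerD; [apply:h1|apply:h2] => t /fM; rewrite cnE;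
 have := normr_ge0 (complex.Re (f t)); have := normr_ge0 (complex.Im (f t)); lra.
Qed.
Lemma Lam_lin c f g a b : continuous f -> continuous g ->
 Lam a b (fun t => c * f t + g t) = c * Lam a b f + Lam a b g.
move=> fc gc; have mab : measurable (`[a, b] : set (measurableTypeR R)) by [].
have i1 := itg_Re a b fc; have i2 := itg_Im a b fc.
have i3 := itg_Re a b gc; have i4 := itg_Im a b gc.
have iZ (k : R) u : mu.-integrable `[a, b] (EFin \o u) -> mu.-integrable `[a, b] (EFin \o (fun t => k * u t)).
 by move=> iu; have := integrableZl mab k iu.
have iD u v : mu.-integrable `[a, b] (EFin \o u) -> mu.-integrable `[a, b] (EFin \o v) ->
  mu.-integrable `[a, b] (EFin \o (fun t => u t + v t)).
 by move=> iu iv; have := integrableD mab iu iv.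
have LC (k l : R) : \int[mu]_(t in `[a, b]) (k * complex.Re (f t) + l * complex.Im (f t)) =
  k * \int[mu]_(t in `[a, b]) complex.Re (f t) + l * \int[mu]_(t in `[a, b]) complex.Im (f t).
 by rewrite RintegralD //; [rewrite !RintegralZl|exact:iZ|exact:iZ].
case:c => k l; rewrite /Lam.
have -> : (fun t => complex.Re ((k +i* l)%C * f t + g t)) =
  (fun t => (k * complex.Re (f t) + (- l) * complex.Im (f t)) + complex.Re (g t)).
 apply/funext=> t; case:(f t) (g t) => [p q] [r s] /=; ring.
have -> : (fun t => complex.Im ((k +i* l)%C * f t + g t)) =
  (fun t => (l * complex.Re (f t) + k * complex.Im (f t)) + complex.Im (g t)).
 apply/funext=> t; case:(f t) (g t) => [p q] [r s] /=; ring.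
rewrite RintegralD //; last by apply:iD; exact:iZ.
rewrite [X in (_ +i* X)%C]RintegralD //; last by apply:iD; exact:iZ.
rewrite !LC; apply:complex_ext => /=; ring.
Qed.
(* Antiderivatives exist to the right of any point *)
Lemma Lam_prim f a : continuous f -> exists F : R -> C, forall t, a < t -> isD1 F t (f t).
move=> fc; exists (fun t => Lam a t f) => t at_.
have tu : t < t + 1 by lra.
have [d1 D1] := continuous_FTC1_closed tu (itg_Re _ _ fc) at_ (Re_cts (fc t)).
have [d2 D2] := continuous_FTC1_closed tu (itg_Im _ _ fc) at_ (Im_cts (fc t)).
have H (G : R -> R) (l : R) : derivable G t 1 -> G^`()%classic t = l -> forall e : R, 0 < e ->
  exists2 d : R, 0 < d & forall h : R, `|h| < d -> `|G (t + h) - G t - h * l| <= e * `|h|.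
 move=> dG <- e e0; rewrite derive1E.
 have /cvgrPdist_le /(_ _ e0) : (fun h : R => h^-1 *: (G (h *: 1 + t) - G t)) @ (0 : R)^' --> 'D_1 G t by [].
 move=> /nbhs_ballP[d /= d0 Hd]; exists d => // h hd.
 have [->|h0] := eqVneq h 0; first by rewrite addr0 mul0r subrr subr0 normr0 mulr0.
 have := Hd h; rewrite /ball /= sub0r normrN => /(_ hd h0).
 rewrite [h *: 1]mulr1 [h + t]addrC -[_ *: _]/(h^-1 * _) distrC => h1.
 have -> : G (t + h) - G t - h * 'D_1 G t = h * (h^-1 * (G (t + h) - G t) - 'D_1 G t).
  by rewrite mulrBr mulVKf.
 by rewrite normrM mulrC ler_wpM2r.
apply:isD1_weak; exists 2 => e e0 e1.
have [e1' e1'0 H1] := H _ _ d1 D1 e e0; have [e2' e2'0 H2] := H _ _ d2 D2 e e0.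
exists (Num.min e1' e2'); first by rewrite lt_min e1'0.
move=> h; rewrite lt_min => /andP[/H1 {}H1 /H2 {}H2]; rewrite cnE.
move: H1 H2; case:(f t) => p q /=.
rewrite !mul0r subr0 addr0; lra.
Qed.
Lemma cts_R_comp f (g : R -> R) : continuous f -> continuous g -> continuous (fun t => f (g t)).
move=> fc gc t; apply:continuous_comp; [exact:gc|exact:fc]. Qed.
Lemma Lam_shift f a b s : a <= b -> continuous f -> Lam a b (fun t => f (t + s)) = Lam (a + s) (b + s) f.
move=> ab fc; have [F FD] := Lam_prim (a + s - 1) fc.
have cf : continuous (fun t => f (t + s)).
 apply:cts_R_comp => // t; apply:cvgD => //; exact:cvg_cst.
have ab' : a + s <= b + s by lra.
have D1 t : a + s <= t <= b + s -> isD1 F t (f t) by move=> /andP[h _]; apply:FD; lra.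
have D2 t : a <= t <= b -> isD1 (fun t => F (t + s)) t (f (t + s)).
 move=> /andP[h _]; apply:isD1_shift; apply:FD; lra.
by rewrite (Lam_FTC ab' fc D1) (Lam_FTC ab cf D2).
Qed.
Lemma Lam_scale f a b k : 0 < k -> a <= b -> continuous f ->
 k%:C%C * Lam a b (fun t => f (k * t)) = Lam (k * a) (k * b) f.
move=> k0 ab fc; have [F FD] := Lam_prim (k * a - 1) fc.
have cf : continuous (fun t => f (k * t)).
 apply:cts_R_comp => // t; apply:cvgM => //; exact:cvg_cst.
have ab' : k * a <= k * b by nra.
have D1 t : k * a <= t <= k * b -> isD1 F t (f t) by move=> /andP[h _]; apply:FD; lra.
have kC : k%:C%C != 0 :> C by rewrite fmorph_eq0 gt_eqF.
have D2 t : a <= t <= b -> isD1 (fun t => k%:C%C^-1 * F (k * t) + 0) t (f (k * t)).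
 move=> /andP[h _]; have FDt : isD1 F (k * t) (f (k * t)) by apply:FD; have := ler_wpM2l (ltW k0) h; lra.
 apply:isD1_eq (isD1_lin _ (isD1_scale FDt) (isD1_cst 0 t)) _.
 by rewrite addr0 mulrA mulVf // mul1r.
rewrite (Lam_FTC ab' fc D1) (Lam_FTC ab cf D2).
by rewrite !addr0 -mulrBr mulrA mulfV // mul1r.
Qed.
Lemma Lam_opp f a b : a <= b -> continuous f -> Lam a b (fun t => f (- t)) = Lam (- b) (- a) f.
move=> ab fc; have [F FD] := Lam_prim (- b - 1) fc.
have cf : continuous (fun t => f (- t)) by apply:cts_R_comp => // t; exact:cvgN.
have ab' : - b <= - a by lra.
have D1 t : - b <= t <= - a -> isD1 F t (f t) by move=> /andP[h _]; apply:FD; lra.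
have D2 t : a <= t <= b -> isD1 (fun t => -1 * F (-1 * t) + 0) t (f (- t)).
 move=> /andP[_ h]; have FDt : isD1 F (-1 * t) (f (- t)) by rewrite mulN1r; apply:FD; lra.
 apply:isD1_eq (isD1_lin _ (isD1_scale FDt) (isD1_cst 0 t)) _.
 ring.
by rewrite (Lam_FTC ab' fc D1) (Lam_FTC ab cf D2) !mulN1r !addr0 opprK addrC.
Qed.
Lemma Lam_split f a b c : a <= b -> b <= c -> continuous f -> Lam a c f = Lam a b f + Lam b c f.
move=> ab bc fc; have [F FD] := Lam_prim (a - 1) fc.
have D t : a <= t -> isD1 F t (f t) by move=> h; apply:FD; lra.
have D1 t : a <= t <= b -> isD1 F t (f t) by move=> /andP[h _]; exact:D.
have D2 t : b <= t <= c -> isD1 F t (f t) by move=> /andP[h _]; apply:D; lra.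
have D3 t : a <= t <= c -> isD1 F t (f t) by move=> /andP[h _]; exact:D.
rewrite (Lam_FTC ab fc D1) (Lam_FTC bc fc D2) (Lam_FTC (le_trans ab bc) fc D3); ring.
Qed.
Lemma Lam_eq f g a b : (forall t, a <= t <= b -> f t = g t) -> Lam a b f = Lam a b g.
move=> fg; congr (_ +i* _)%C; apply:eq_Rintegral => t; rewrite inE => h; rewrite fg //.
Qed.
Lemma Lam0 a b : Lam a b (fun=> 0) = 0.
have c0 : continuous (fun _ : R => 0 : C) by move=> t; exact:cvg_cst.
have := Lam_lin (-1) a b c0 c0; rewrite (_ : (fun _ => _) = fun=> 0); first by move=> ->; ring.
apply/funext=> t; ring.
Qed.
Lemma Lam_supp f a b r : a <= - r -> 0 <= r -> r <= b -> continuous f -> (forall t, r <= `|t| -> f t = 0) ->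
 Lam a b f = Lam (- r) r f.
move=> ar r0 rb fc f0.
have z1 : Lam a (- r) f = 0.
 rewrite -(Lam0 a (- r)); apply:Lam_eq => t /andP[_ h]; apply:f0.
 rewrite ler0_norm; lra.
have z2 : Lam r b f = 0.
 rewrite -(Lam0 r b); apply:Lam_eq => t /andP[h _]; apply:f0.
 rewrite ger0_norm; lra.
have h1 : - r <= b by lra.
have h2 : - r <= r by lra.
by rewrite (Lam_split ar h1 fc) (Lam_split h2 rb fc) z1 z2 add0r addr0.
Qed.
Lemma Lam_ge0 f a b : (forall t, a <= t <= b -> 0 <= f t) -> 0 <= Lam a b f.
move=> f0; have H t : a <= t <= b -> complex.Im (f t) = 0 /\ 0 <= complex.Re (f t).
 by move=> /f0; rewrite lecE => /andP[/eqP-> ->].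
rewrite /=; apply/andP; split; last first.
 by apply:Rintegral_ge0 => t; rewrite /= => /H[].
have /eqP := Lam0 a b; rewrite /Lam /= => /andP[/eqP I0 _].
rewrite -I0; apply/eqP; apply:eq_Rintegral => t; rewrite inE => /H[] //.
Qed.
(** An antiderivative has a nondecreasing real part with equal values at both ends, so this part is
    constant and its derivative vanishes inside. In [R[i]] the inequality 0 <= f t already makes f t
    real. *)
Lemma Lam_eq0 f a b : continuous f -> (forall t, 0 <= f t) -> Lam a b f = 0 ->
 forall t, a < t < b -> f t = 0.
move=> fc f0 I0 t /andP[at_ tb]; have [F FD] := Lam_prim (a - 1) fc.
have D s : a <= s -> isD1 F s (f s) by move=> h; apply:FD; lra.
have fR s : 0 <= complex.Re (f s) by have := f0 s; rewrite lecE => /andP[].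
have mon u v : a <= u -> u <= v -> complex.Re (F u) <= complex.Re (F v).
 move=> au uv; have [s hs|s _ E] := @mvt_real R (fun s => complex.Re (F s)) (fun s => complex.Re (f s)) u v uv.
  apply:isD1_Re; apply:D; lra.
 by rewrite -subr_ge0 E mulr_ge0 // subr_ge0.
have Fab : complex.Re (F b) = complex.Re (F a).
 have ab : a <= b by lra.
 have D1 s : a <= s <= b -> isD1 F s (f s) by move=> /andP[h _]; exact:D.
 have : F b - F a = 0 by rewrite -I0 (Lam_FTC ab fc D1).
 by move/eqP; rewrite subr_eq0 => /eqP ->.
have cst s : a <= s <= b -> complex.Re (F s) = complex.Re (F a).
 move=> /andP[h1 h2]; apply/eqP; rewrite eq_le; apply/andP; split; last exact:mon.
 by rewrite -Fab; apply:mon.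
have Re0 : complex.Re (f t) = 0.
 apply/eqP; rewrite eq_le fR andbT; apply/ler_addgt0Pr=> e e0; rewrite add0r.
 have [d d0 Hd] := D t (ltW at_) e e0.
 pose h := Num.min (d / 2) ((b - t) / 2).
 have h0 : 0 < h by rewrite lt_min !divr_gt0 // subr_gt0.
 have hd : `|h| < d by rewrite gtr0_norm // gt_min; lra.
 have hb : h <= (b - t) / 2 by rewrite ge_min lexx orbT.
 have := Hd h hd; rewrite cnE (gtr0_norm h0).
 have := cst t; have := cst (t + h); case:(F _) (F _) (F _) (f t) => [p q] [r s] [u v] [x y] /=.
 move=> h1 h2; rewrite mul0r subr0 h1; last by lra.
 rewrite h2; last by lra.
 rewrite subrr sub0r normrN normrM (gtr0_norm h0) => h3.
 have h4 : h * `|x| <= e * h by apply:le_trans h3; rewrite lerDl.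
 rewrite mulrC ler_pM2r // in h4; exact:le_trans (ler_norm _) h4.
have := f0 t; case:(f t) Re0 => p q /= ->; rewrite /= => /andP[/eqP-> _].
by [].
Qed.
End SegmentIntegral.

Section PairContinuity.
Variables S T : topologicalType.
Lemma pair_ctsl (x : S) : continuous (fun y : T => (x, y)).
move=> y A [[U V] /= [Ux Vy] UV]; apply:filterS Vy => v Vv; apply:UV.
split=> //=; exact:nbhs_singleton.
Qed.
Lemma pair_ctsr (y : T) : continuous (fun x : S => (x, y)).
move=> x A [[U V] /= [Ux Vy] UV]; apply:filterS Ux => v Vv; apply:UV.
split=> //=; exact:nbhs_singleton.
Qed.
Lemma pair_swap_cts : continuous (fun p : S * T => (p.2, p.1)).
move=> [x y] A [[U V] /= [Uy Vx] UV]; exists (V, U) => //= -[a b] [/= Va Ub].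
by apply:UV.
Qed.
End PairContinuity.

Section LineIntegral.
Variable R : realType.
Local Notation C := R[i].
Local Notation mu := (@lebesgue_measure R).
Implicit Types (f g h : R -> C) (a b t r : R).
Definition intR f : C := (\int[mu]_t complex.Re (f t) +i* \int[mu]_t complex.Im (f t))%C.
Definition CcR r f := continuous f /\ forall t, r <= `|t| -> f t = 0.
Lemma Rint_supp (u : R -> R) r : (forall t, r <= `|t| -> u t = 0) ->
 (\int[mu]_t (u t)%:E)%E = (\int[mu]_(t in `[(- r)%R, r]) (u t)%:E)%E.
move=> u0; rewrite [RHS]integral_mkcond; apply:eq_integral => t _; rewrite patchE.
case:ifPn => // nt; rewrite u0 // leNgt; apply:contra nt => h.
rewrite inE /= in_itv /=; move: h; rewrite ltr_norml => /andP[h1 h2].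
lra.
Qed.
Lemma intR_Lam f r : (forall t, r <= `|t| -> f t = 0) -> intR f = Lam (- r) r f.
move=> f0; congr (fine _ +i* fine _)%C;
 by apply:Rint_supp => t /f0 ->.
Qed.
Lemma cts_lin_top (T : topologicalType) (F G : T -> C) (c : C) : continuous F -> continuous G ->
 continuous (fun t : T => c * F t + G t).
move=> fc gc t; exact:(@cvg_lin C T (nbhs t) _ c F G _ _ (fc t) (gc t)). Qed.
Lemma bfun_R r : 0 <= r -> bfun (`[(- r)%R, r]%classic : set R) (CcR r) intR.
move=> r0; split.
- exact:segment_compact.
- split=> // t; exact:cvg_cst.
- move=> c f g [fc f0] [gc g0]; split; first exact:(@cts_lin_top _ f g c fc gc).
 by move=> t h; rewrite f0 // g0 // mulr0 addr0.
- move=> c f g [fc f0] [gc g0]; rewrite (@intR_Lam _ r) => [|t h]; last by rewrite f0 // g0 // mulr0 addr0.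
 by rewrite Lam_lin // -!intR_Lam.
exists (2 * (r + r)); first by lra.
move=> f M [fc f0] H; rewrite (intR_Lam f0).
have rr : - r <= r by lra.
have := @Lam_bound R f (- r) r M rr fc; rewrite opprK => H2.
rewrite (_ : 2 * (r + r) * M = 2 * M * (r + r)); last by lra.
by apply:H2.
Qed.
Lemma intR_shift f r s : CcR r f -> intR (fun t => f (t + s)) = intR f.
move=> [fc f0]; pose r' := `|r| + `|s|; have nr := normr_ge0 r; have ns := normr_ge0 s.
have h1 := ler_norm r; have h2 := ler_norm s; have h3 : - `|s| <= s by rewrite lerNl -normrN ler_norm.
have f0' t : `|r| <= `|t| -> f t = 0 by move=> h; apply:f0; lra.
rewrite (@intR_Lam _ r') => [|t ht]; last first.
 apply:f0'; have := ler_normB (t + s) s; rewrite addrK; rewrite /r' in ht; lra.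
rewrite Lam_shift //; last by rewrite /r'; lra.
rewrite (@Lam_supp R f _ _ `|r|) -?intR_Lam // /r'; lra.
Qed.
Lemma intR_opp f r : CcR r f -> intR (fun t => f (- t)) = intR f.
move=> [fc f0]; have nr := normr_ge0 r; have h1 := ler_norm r.
have f0' t : `|r| <= `|t| -> f t = 0 by move=> h; apply:f0; lra.
rewrite (@intR_Lam _ `|r|) => [|t ht]; last by rewrite f0' // normrN.
rewrite Lam_opp //; last by lra.
by rewrite opprK -intR_Lam.
Qed.
Lemma intR_scale f r k : k != 0 -> CcR r f -> `|k|%:C%C * intR (fun t => f (k * t)) = intR f.
wlog k0 : k f / 0 < k => [H|] kn0 Cf.
 have [k0|k0|k0] := ltgtP k 0; last by rewrite k0 eqxx in kn0.
  have := H (- k) (fun t => f (- t)); rewrite oppr_gt0 normrN => /(_ k0).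
  rewrite oppr_eq0 => /(_ kn0); rewrite (intR_opp Cf) => <-; last first.
   case:Cf => fc f0; split=> [|t ht]; last by apply:f0; rewrite normrN.
   apply:cts_R_comp => // t; exact:cvgN.
  by congr (_ * intR _); apply/funext=> t; rewrite mulNr opprK.
 exact:H.
case:Cf => fc f0; rewrite gtr0_norm //.
have nr := normr_ge0 r; have h1 := ler_norm r.
have f0' t : `|r| <= `|t| -> f t = 0 by move=> h; apply:f0; lra.
have nrk0 : 0 <= `|r| / k by rewrite divr_ge0 // ltW.
have nrk : - (`|r| / k) <= `|r| / k by lra.
rewrite (@intR_Lam _ (`|r| / k)) => [|t ht]; last first.
 by apply:f0'; rewrite normrM gtr0_norm // mulrC -ler_pdivrMr.
rewrite (Lam_scale k0 nrk fc) mulrN mulrCA divff // mulr1.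
by rewrite -intR_Lam.
Qed.
Lemma intR_ge0 f r : CcR r f -> (forall t, 0 <= f t) -> 0 <= intR f.
by move=> [fc f0] fp; rewrite (intR_Lam f0); apply:Lam_ge0. Qed.
Lemma intR_eq0 f r : CcR r f -> (forall t, 0 <= f t) -> intR f = 0 -> forall t, f t = 0.
move=> [fc f0] fp; rewrite (intR_Lam f0) => I0 t.
have [h|h] := leP r `|t|; first exact:f0.
by apply:(Lam_eq0 fc fp I0); rewrite -ltr_norml.
Qed.
End LineIntegral.

Section PlaneIntegral.
Variable R : realType.
Local Notation C := R[i].
Local Notation mu := (@lebesgue_measure R).
(** The product sigma-algebra is generated by rectangles, so an open set is written as the countable
    union of the squares with rational centres and radii 1 / (k + 1) that it contains. *)
Lemma open_measurable2 (G : set (R * R)) : open G ->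
 measurable (G : set (measurableTypeR R * measurableTypeR R)).
move=> oG; pose box (q r : rat) (k : nat) : set (R * R) :=
 (ball (ratr q : R) k.+1%:R^-1) `*` (ball (ratr r : R) k.+1%:R^-1).
pose F q r k := if `[< box q r k `<=` G >] then box q r k else set0.
have -> : G = \bigcup_q \bigcup_r \bigcup_k F q r k.
 apply/seteqP; split=> [[x y] Gxy|p [q _ [r _ [k _]]]]; last first.
  by rewrite /F; case:asboolP=> // h /h.
 have [[A B] /= [/nbhs_ballP[d1 /= d10 h1] /nbhs_ballP[d2 /= d20 h2]] AB] := open_nbhs_nbhs (conj oG Gxy).
 pose d := Num.min d1 d2; have d0 : 0 < d by rewrite lt_min d10.
 have [k kd] : exists k : nat, k.+1%:R^-1 < d / 2.
  exists (Num.trunc (d / 2)^-1); rewrite invf_plt ?posrE ?divr_gt0 //.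
  apply:truncnS_gt.
 have ratnear (u e : R) : 0 < e -> exists q : rat, `|u - ratr q| < e.
  move=> e0; have [|q] := @rat_in_itvoo R (u - e) (u + e); first lra.
  rewrite in_itv /= => /andP[h3 h4]; exists q; rewrite ltr_norml; lra.
 have k0 : 0 < (k.+1%:R^-1 : R) by [].
 have [q qx] := ratnear x _ k0; have [r ry] := ratnear y _ k0.
 exists q => //; exists r => //; exists k => //; rewrite /F; case:asboolP=> [_|[]].
  by split; rewrite /ball /= distrC.
 move=> [u v] [/= hu hv]; rewrite /ball /= in hu hv; apply:AB; split=> /=; [apply:h1|apply:h2]; rewrite /ball /=.
  have : `|x - u| < d.
   apply:le_lt_trans (ler_distD (ratr q) _ _) _; rewrite [ltRHS]splitr.
   exact:ltrD (lt_trans qx kd) (lt_trans hu kd).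
  by rewrite lt_min => /andP[].
 have : `|y - v| < d.
  apply:le_lt_trans (ler_distD (ratr r) _ _) _; rewrite [ltRHS]splitr.
  exact:ltrD (lt_trans ry kd) (lt_trans hv kd).
 by rewrite lt_min => /andP[].
apply:bigcupT_measurable_rat => q; apply:bigcupT_measurable_rat => r.
apply:bigcupT_measurable => k; rewrite /F; case:asboolP=> _ //.
apply:measurableX; apply:measurable_realfun.open_measurable; apply:ball_open.
Qed.
Lemma cts_measurable2 (G : R * R -> R) : continuous G ->
 measurable_fun [set: measurableTypeR R * measurableTypeR R] (G : measurableTypeR R * measurableTypeR R -> measurableTypeR R).
move=> Gc; apply:(measurability _ (measurable_realfun.RGenOpens.measurableE R)).
move=> _ [_ [a [b ->] <-]]; rewrite setTI; apply:open_measurable2.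
by have /continuousP := Gc; apply.
Qed.
Lemma integrable2 (G : R * R -> R) r : 0 <= r -> continuous G ->
 (forall p, r <= `|p.1| -> G p = 0) -> (forall p, r <= `|p.2| -> G p = 0) ->
 (mu \x mu)%E.-integrable [set: measurableTypeR R * measurableTypeR R] (EFin \o G).
move=> r0 Gc G1 G2.
pose B : set (measurableTypeR R * measurableTypeR R) := `[(- r)%R, r] `*` `[(- r)%R, r].
have mB : measurable B by apply:measurableX.
have GB : (EFin \o G) = ((EFin \o G) \_ B).
 apply/funext=> -[x y]; rewrite patchE; case:ifPn => /negP nB; congr EFin.
 have [hx|hx] := leP r `|x|; first exact:G1.
 have [hy|hy] := leP r `|y|; first exact:G2.
 case:nB; rewrite inE; split; rewrite /= in_itv; rewrite -ler_norml; exact:ltW.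
rewrite GB; apply/(integrable_mkcond _ mB); apply:measurable_bounded_integrable => //.
-  rewrite [X in (X < _)%E](_ : _ = (mu `[(- r)%R, r] * mu `[(- r)%R, r])%E); last exact:product_measure1E.
 rewrite lebesgue_measure_itv /=; case:ifP => _; last by rewrite ltry.
 by rewrite ltry.
- apply:measurable_funTS; exact:cts_measurable2.
have cB : compact (`[(- r)%R, r] `*` `[(- r)%R, r] : set (R * R)) by apply:compact_setX; exact:segment_compact.
have cGB : compact (G @` (`[(- r)%R, r] `*` `[(- r)%R, r])).
 apply:continuous_compact => //; exact:continuous_subspaceT.
have [M [Mr HM]] := compact_bounded cGB.
exists M; split=> // x Mx p Bp; apply:HM; by [].
Qed.
(** Continuity and support in a square give integrability on the plane. From here on only iterated
    integrals of such functions are handled. *)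
Lemma fub_supp (G : R * R -> R) r : 0 <= r -> continuous G ->
 (forall p, r <= `|p.1| -> G p = 0) -> (forall p, r <= `|p.2| -> G p = 0) ->
 \int[(mu \x mu)%E]_p G p = \int[mu]_x \int[mu]_y G (x, y) /\
 \int[(mu \x mu)%E]_p G p = \int[mu]_y \int[mu]_x G (x, y).
move=> r0 Gc G1 G2; have iG := integrable2 r0 Gc G1 G2.
have slice1 x : continuous (fun y => G (x, y)).
 move=> y; apply:(@continuous_comp _ _ _ (fun y => (x, y)) G); last exact:Gc.
 exact:pair_ctsl.
have slice2 y : continuous (fun x => G (x, y)).
 move=> x; apply:@continuous_comp; last exact:Gc.
 exact:pair_ctsr.
have fin (u : R -> R) : continuous u -> (forall t, r <= `|t| -> u t = 0) ->
  (\int[mu]_t (u t)%:E)%E = (\int[mu]_t u t)%:E.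
 move=> uc u0; rewrite fineK // (Rint_supp u0); apply:integrable_fin_num => //.
 apply:continuous_compact_integrable; first exact:segment_compact.
 exact:continuous_subspaceT.
split.
 rewrite {1}/Rintegral -(integral12_prod_meas1 iG) /fubini_F; congr fine.
 apply:eq_integral => x; rewrite fin //=; move=> t ht; exact:G2.
rewrite {1}/Rintegral -(integral12_prod_meas1 iG) (Fubini iG); congr fine.
apply:eq_integral => y; rewrite fin //=; move=> t ht; exact:G1.
Qed.
Definition CcC (r : R) (g : C -> C) := continuous g /\ forall z, r <= cn z -> g z = 0.
Lemma cts_cplx2 (g : C -> C) : continuous g -> continuous (fun p : R * R => g (p.1 +i* p.2)%C).
move=> gc p; apply:(@continuous_comp _ _ _ (fun p : R * R => (p.1 +i* p.2)%C : C) g); last exact:gc.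
exact:continuous_cplx.
Qed.
Lemma CcC_slice (r : R) g : CcC r g -> (forall x, CcR r (fun y => g (x +i* y)%C)) /\ (forall y, CcR r (fun x => g (x +i* y)%C)).
move=> [gc g0]; have H := cts_cplx2 gc; split=> x; split=> t.
- apply:(@continuous_comp _ _ _ (fun y => (x, y)) (fun p : R * R => g (p.1 +i* p.2)%C)); last exact:H.
 exact:pair_ctsl.
- move=> h; apply:g0; rewrite cnE; have := normr_ge0 x; lra.
- apply:(@continuous_comp _ _ _ (fun y => (y, x)) (fun p : R * R => g (p.1 +i* p.2)%C)); last exact:H.
 exact:pair_ctsr.
- move=> h; apply:g0; rewrite cnE; have := normr_ge0 x; lra.
Qed.
Lemma CcC_int (r : R) g : 0 <= r -> CcC r g ->
 CcR r (fun x => intR (fun y => g (x +i* y)%C)) /\ CcR r (fun y => intR (fun x => g (x +i* y)%C)).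
move=> r0 Cg; have [S1 S2] := CcC_slice Cg; case:Cg => gc g0; have H := cts_cplx2 gc.
have bR := bfun_R r0; have I0 : intR (fun _ : R => 0) = 0 := bf_0 bR.
split; split=> t.
- apply:(bf_cts bR (F := fun x y => g (x +i* y)%C)); first by apply:@filterE.
 move=> s _; exact:(H (t, s)).
- move=> ht; rewrite (_ : (fun y => _) = fun=> 0) //; apply/funext=> y; apply:g0.
 rewrite cnE; have := normr_ge0 y; lra.
- apply:(bf_cts bR (F := fun y x => g (x +i* y)%C)); first by apply:@filterE.
 move=> s _; apply:(@continuous_comp _ _ _ (fun p : R * R => (p.2, p.1)) (fun p : R * R => g (p.1 +i* p.2)%C) (t, s)); last exact:H.
 exact:pair_swap_cts.
- move=> ht; rewrite (_ : (fun y => _) = fun=> 0) //; apply/funext=> y; apply:g0.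
 rewrite cnE; have := normr_ge0 y; lra.
Qed.
Lemma intC_intR (r : R) g : 0 <= r -> CcC r g ->
 integral_C g = intR (fun x => intR (fun y => g (x +i* y)%C)) /\
 integral_C g = intR (fun y => intR (fun x => g (x +i* y)%C)).
move=> r0 [gc g0]; have H := cts_cplx2 gc.
have z1 p : r <= `|p.1| -> g (p.1 +i* p.2)%C = 0.
 move=> h; apply:g0; rewrite cnE; have := normr_ge0 p.2; lra.
have z2 p : r <= `|p.2| -> g (p.1 +i* p.2)%C = 0.
 move=> h; apply:g0; rewrite cnE; have := normr_ge0 p.1; lra.
have [e1 e2] := @fub_supp (fun p => complex.Re (g (p.1 +i* p.2)%C)) r r0 (fun p => Re_cts (H p))
 ltac:(by move=> p /z1 ->) ltac:(by move=> p /z2 ->).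
have [e3 e4] := @fub_supp (fun p => complex.Im (g (p.1 +i* p.2)%C)) r r0 (fun p => Im_cts (H p))
 ltac:(by move=> p /z1 ->) ltac:(by move=> p /z2 ->).
by rewrite /integral_C; split; [rewrite e1 e3|rewrite e2 e4].
Qed.
End PlaneIntegral.

Section PlaneFunctional.
Variable R : realType.
Local Notation C := R[i].
Implicit Types (f g : C -> C) (r : R).
Lemma bfun_C r : 0 <= r ->
 bfun [set z : C | `|complex.Re z| <= r /\ `|complex.Im z| <= r] (CcC r) (@integral_C R).
move=> r0; have bR := bfun_R r0.
have Dl c f g : CcC r f -> CcC r g -> CcC r (fun z => c * f z + g z).
 move=> [fc f0] [gc g0]; split; first exact:(@cts_lin_top R C f g c fc gc).
 by move=> z h; rewrite f0 // g0 // mulr0 addr0.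
split.
- exact:cpt_cbox.
- split=> [z|//]; exact:(@cvg_cst C 0 C (nbhs z) (nbhs_filter z)).
- exact:Dl.
- move=> c f g Cf Cg; have [fx fy] := CcC_slice Cf; have [gx gy] := CcC_slice Cg.
 have [If _] := CcC_int r0 Cf; have [Ig _] := CcC_int r0 Cg.
 rewrite (intC_intR r0 (Dl c f g Cf Cg)).1 (intC_intR r0 Cf).1 (intC_intR r0 Cg).1.
 rewrite -(bf_lin bR c If Ig); congr intR; apply/funext=> x.
 by rewrite -(bf_lin bR c (fx x) (gx x)).
have [K K0 HK] := bf_bound bR; exists (K * K); first exact:mulr_ge0.
move=> f M Cf fM; have [fx fy] := CcC_slice Cf; have [If _] := CcC_int r0 Cf.
rewrite (intC_intR r0 Cf).1 -mulrA; apply:(HK) => // x; rewrite /= in_itv -ler_norml => hx.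
apply:HK => // y; rewrite /= in_itv -ler_norml => hy.
exact:fM.
Qed.
Lemma continuous_shiftC g (a : C) : continuous g -> continuous (fun z => g (z + a)).
move=> gc z; apply:@continuous_comp; last exact:gc.
apply/(@cvgC_P R C (nbhs z) (nbhs_filter z)) => e e0.
apply/nbhsC_P; exists e => // y hy; rewrite (_ : y + a - (z + a) = y - z) //; ring.
Qed.
Lemma intC_shift g r a : 0 <= r -> CcC r g -> integral_C (fun z => g (z + a)) = integral_C g.
move=> r0 Cg; pose r' := r + cn a; have r'0 : 0 <= r' by rewrite addr_ge0 // cn_ge0.
have Cga : CcC r' (fun z => g (z + a)).
 case:Cg => gc g0; split; first exact:continuous_shiftC.
 move=> z; rewrite /r' => h; apply:g0; have := cnB (z + a) a; rewrite addrK; lra.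
have [gx gy] := CcC_slice Cg; have [Ig _] := CcC_int r0 Cg.
rewrite (intC_intR r'0 Cga).1 (intC_intR r0 Cg).1.
case:a r' r'0 Cga => a b r' r'0 Cga.
rewrite -(intR_shift a Ig); congr intR; apply/funext=> x.
by rewrite -(intR_shift b (gx _)).
Qed.
Lemma intC_ge0 g r : 0 <= r -> CcC r g -> (forall z, 0 <= g z) -> 0 <= integral_C g.
move=> r0 Cg gp; have [gx gy] := CcC_slice Cg; have [Ig _] := CcC_int r0 Cg.
rewrite (intC_intR r0 Cg).1; apply:intR_ge0 Ig _ => x.
exact:intR_ge0.
Qed.
Lemma intC_eq0 g r : 0 <= r -> CcC r g -> (forall z, 0 <= g z) -> integral_C g = 0 -> forall z, g z = 0.
move=> r0 Cg gp; have [gx gy] := CcC_slice Cg; have [Ig _] := CcC_int r0 Cg.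
rewrite (intC_intR r0 Cg).1 => I0 [x y].
have H := intR_eq0 Ig (fun x => intR_ge0 (gx x) (fun y => gp _)) I0 x.
exact:(intR_eq0 (gx x) (fun y => gp _) H y).
Qed.
End PlaneFunctional.

Section Cons.
Variables (R : realType) (m : nat).
Local Notation C := R[i].
Implicit Types (z : C) (v : 'rV[C]_m).
Definition ccons z v : 'rV[C]_m.+1 := row_mx (z%:M : 'rV_1) v.
Lemma rn_ccons z v : rn (ccons z v) = cn z + rn v.
rewrite !rnE (@big_split_ord _ _ _ 1 m) big_ord1.
rewrite [ccons z v 0 _](_ : _ = z); last by rewrite (@row_mxEl _ 1 1 m) mxE.
by congr (_ + _); apply:eq_bigr=> i; rewrite (@row_mxEr _ 1 1 m).
Qed.
Lemma ccons_add z v z' v' : ccons z v + ccons z' v' = ccons (z + z') (v + v').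
by rewrite /ccons (@add_row_mx _ 1 1 m) raddfD. Qed.
Lemma ccons_sub z v z' v' : ccons z v - ccons z' v' = ccons (z - z') (v - v').
by rewrite /ccons (@opp_row_mx _ 1 1 m) (@add_row_mx _ 1 1 m) raddfB. Qed.
Lemma ccons_split (w : 'rV[C]_m.+1) : exists z v, w = ccons z v.
exists ((lsubmx (w : 'rV_(1 + m))) 0 0), (rsubmx (w : 'rV_(1 + m))).
by rewrite /ccons -mx11_scalar (@hsubmxK _ 1 1 m).
Qed.
Lemma cts_ccons (f : 'rV[C]_m.+1 -> C) z v : cts f (ccons z v) ->
 (fun p : C * 'rV[C]_m => f (ccons p.1 p.2)) @ (z, v) --> f (ccons z v).
move=> fc; apply/(cvgC_P (nbhs_filter (z, v))) => e e0; have [d d0 Hd] := fc e e0.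
have d20 : 0 < d / 2 by lra.
exists ([set x | cn (x - z) < d / 2], [set x | rn (x - v) < d / 2]) => /=.
 by split; [apply/nbhsC_P; exists (d / 2)|apply/nbhsE_P; exists (d / 2)].
move=> [x y] /= [h1 h2]; apply:Hd; rewrite ccons_sub rn_ccons; lra.
Qed.
Lemma Cc_slice (f : 'rV[C]_m.+1 -> C) r z : Cc r f -> Cc r (fun v => f (ccons z v)).
move=> [fc f0]; split=> [v e /(fc (ccons z v))[d d0 Hd]|v h].
 by exists d => // w hw; apply:Hd; rewrite ccons_sub rn_ccons subrr cn0 add0r.
apply:f0; rewrite rn_ccons; have := cn_ge0 z; lra.
Qed.
End Cons.

Section SpaceIntegral.
Variable R : realType.
Local Notation C := R[i].
Lemma Cc_lin n r (c : C) (f g : 'rV[C]_n -> C) : Cc r f -> Cc r g -> Cc r (fun z => c * f z + g z).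
move=> [fc f0] [gc g0]; split=> z; first exact:cts_lin.
by move=> h; rewrite f0 // g0 // mulr0 addr0.
Qed.
Lemma Cc0 n r : Cc r (fun _ : 'rV[C]_n => 0 : C).
split=> // z; exact:cts_cst. Qed.
Lemma int_slice m r (f : 'rV[C]_m.+1 -> C) : 0 <= r -> ccfun (@icn R m) -> Cc r f ->
 CcC r (fun z => icn (fun v => f (ccons z v))).
move=> r0 IH Cf; have bm := IH r r0; split=> [z|z hz].
 apply:(bf_cts bm (F := fun z v => f (ccons z v))); last first.
  move=> v _; apply:cts_ccons; exact:Cf.1.
 apply:(@filterE _ (nbhs z) (nbhs_filter z)) => x; exact:Cc_slice.
rewrite (_ : (fun v => _) = fun=> 0); first exact:bf_0 bm.
apply/funext=> v; apply:Cf.2; rewrite rn_ccons; have := rn_ge0 v; lra.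
Qed.
Lemma int_CnS m (f : 'rV[C]_m.+1 -> C) :
 icn f = integral_C (fun z => icn (fun v => f (ccons z v))).
by []. Qed.
(** Induction on the dimension: since [rn] is additive over [ccons], the inner integral is again
    continuous with support in the same radius, and the bounds multiply. *)
Lemma int_ccfun n : ccfun (@icn R n).
elim:n => [|m IH] r r0.
 split; [exact:cpt_Ball|exact:Cc0|exact:Cc_lin|by []|].
 exists 1 => // f M Cf fM; rewrite mul1r; apply:fM; by rewrite /Ball /= rn0.
have bm := IH r r0; have bC := bfun_C r0.
split; [exact:cpt_Ball|exact:Cc0|exact:Cc_lin| |].
 move=> c f g Cf Cg; rewrite !int_CnS.
 rewrite -(bf_lin bC c (int_slice r0 IH Cf) (int_slice r0 IH Cg)); congr integral_C.
 by apply/funext=> z; rewrite -(bf_lin bm c (Cc_slice z Cf) (Cc_slice z Cg)).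
have [K K0 HK] := bf_bound bm; have [K' K'0 HK'] := bf_bound bC.
exists (K' * K); first exact:mulr_ge0.
move=> f M Cf fM.
have fM' z : cn (f z) <= `|M|.
 have [h|h] := leP (rn z) r; first exact:le_trans (fM z h) (ler_norm M).
 by rewrite Cf.2 ?cn0 // ltW.
have M0 : 0 <= M.
 by apply:le_trans (cn_ge0 (f 0)) (fM 0 _); rewrite /Ball /= rn0.
rewrite int_CnS -mulrA; apply:HK'; first exact:int_slice.
move=> z _; apply:HK; first exact:Cc_slice.
by rewrite -(ger0_norm M0).
Qed.
Lemma Cc_shift n r (f : 'rV[C]_n -> C) a : Cc r f -> Cc (r + rn a) (fun z => f (z + a)).
move=> [fc f0]; split=> [z e /(fc (z + a))[d d0 Hd]|z h].
 by exists d => // w hw; apply:Hd; rewrite opprD addrACA subrr addr0.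
apply:f0; have := rnB (z + a) a; rewrite addrK; lra.
Qed.
Lemma int_shift n r (f : 'rV[C]_n -> C) a : 0 <= r -> Cc r f ->
 icn (fun z => f (z + a)) = icn f.
move=> r0; elim:n f a => [|m IH] f a Cf.
 by rewrite /= (_ : 0 + a = 0) //; apply/rowP=> -[].
have [a0 [a' ->]] := ccons_split a; rewrite !int_CnS.
rewrite -(intC_shift a0 r0 (int_slice r0 (@int_ccfun m) Cf)).
congr integral_C; apply/funext=> z; rewrite -(IH _ a' (Cc_slice (z + a0) Cf)).
by congr icn; apply/funext=> v; rewrite ccons_add.
Qed.
Lemma int_ge0 n r (f : 'rV[C]_n -> C) : 0 <= r -> Cc r f -> (forall z, 0 <= f z) -> 0 <= icn f.
move=> r0; elim:n f => [|m IH] f Cf fp; first exact:fp.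
rewrite int_CnS; apply:intC_ge0 r0 (int_slice r0 (@int_ccfun m) Cf) _ => z.
by apply:IH; [exact:Cc_slice|].
Qed.
Lemma int_eq0 n r (f : 'rV[C]_n -> C) : 0 <= r -> Cc r f -> (forall z, 0 <= f z) ->
 icn f = 0 -> forall z, f z = 0.
move=> r0; elim:n f => [|m IH] f Cf fp; first by move=> f0 z; rewrite -f0; congr f; apply/rowP=> -[].
rewrite int_CnS => I0 w; have [z [v ->]] := ccons_split w.
have ge x : 0 <= icn (fun v => f (ccons x v)).
 by apply:int_ge0 (Cc_slice x Cf) _.
have H := intC_eq0 r0 (int_slice r0 (@int_ccfun m) Cf) ge I0 z.
exact:(IH (fun v => f (ccons z v)) (Cc_slice z Cf) (fun v => fp _) H v).
Qed.
Variable n : nat.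
Local Notation E := 'rV[C]_n.
Lemma cts_line (g : E -> C) v w t : cts g (w + t%:C%C *: v) ->
 (fun p : R * E => g (p.2 + p.1%:C%C *: v)) @ (t, w) --> g (w + t%:C%C *: v).
move=> gc; apply/(cvgC_P (nbhs_filter (t, w))) => e e0; have [d d0 Hd] := gc e e0.
have d20 : 0 < d / 2 by lra.
have k0 : 0 < rn v + 1 by have := rn_ge0 v; lra.
exists ([set x | `|t - x| < d / 2 / (rn v + 1)], [set x | rn (x - w) < d / 2]) => /=.
 split; last by apply/nbhsE_P; exists (d / 2).
 by exists (d / 2 / (rn v + 1)) => //=; rewrite divr_gt0.
move=> [x y] /= [h1 h2]; apply:Hd.
have -> : y + x%:C%C *: v - (w + t%:C%C *: v) = (y - w) + (x - t)%:C%C *: v.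
 by rewrite rmorphB scalerBl opprD addrACA.
apply:le_lt_trans (rnD _ _) _; rewrite rnZ distrC.
move: h1; rewrite ltr_pdivlMr // => h1; have := normr_ge0 (t - x); lra.
Qed.
(** By translation invariance the integral of f(w + t v) is constant in t, while its derivative at t
    = 0 is the integral of g. This is the only integration by parts principle used. *)
Lemma int_isD (f g : E -> C) v r : 0 <= r -> Cc r f -> Cc r g ->
 (forall z, isD f v z (g z)) -> icn g = 0.
move=> r0 Cf Cg fD; pose r' := r + rn v; have r'0 : 0 <= r' by rewrite addr_ge0 // rn_ge0.
have bI := @int_ccfun n r' r'0.
have sh (h : E -> C) t : Cc r h -> `|t| <= 1 -> Cc r' (fun w => h (w + t%:C%C *: v)).
 move=> Ch ht; apply:Cc_le (Cc_shift _ Ch); rewrite lerD2l rnZ.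
 by rewrite ler_piMl // rn_ge0.
have H := @bf_deriv R E (Ball r') (Cc r') (@icn R n) bI (fun t w => f (w + t%:C%C *: v))
 (fun t w => g (w + t%:C%C *: v)) 0.
have N : \forall t \near (0 : R), Cc r' (fun w => f (w + t%:C%C *: v)).
 apply/nbhs_ballP; exists 1 => //= t; rewrite /ball /= sub0r normrN => ht.
 apply:sh => //; exact:ltW.
have D0 : Cc r' (fun w => g (w + 0%:C%C *: v)) by apply:sh => //; rewrite normr0.
have {H} H := H N D0 (fun t w _ => (isD_line f v w t _).1 (fD _)) (fun w _ => cts_line (Cg.1 _)).
have c0 : isD1 (fun t => icn (fun w => f (w + t%:C%C *: v))) 0 0.
 apply:isD1_near (isD1_cst (icn f) 0); exists 1 => // h _.
 by rewrite (int_shift _ r0).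
have := isD1_uniq H c0; rewrite (_ : (fun w => g (w + 0%:C%C *: v)) = g) //.
by apply/funext=> w; rewrite scale0r addr0.
Qed.
End SpaceIntegral.

(** * Conjugation, flat functions and a radial smooth bump *)

Section Conjugation.
Variable R : realType.
Local Notation C := R[i].
Implicit Types x y : C.
Lemma cjD x y : (x + y)^* = x^* + y^*. exact:rmorphD. Qed.
Lemma cjB x y : (x - y)^* = x^* - y^*. exact:rmorphB. Qed.
Lemma cjM x y : (x * y)^* = x^* * y^*. exact:rmorphM. Qed.
Lemma cjN x : (- x)^* = - x^*. exact:rmorphN. Qed.
Lemma cjK x : x^*^* = x. by case:x => a b; apply/eqP; rewrite eq_complex /= opprK !eqxx. Qed.
Lemma cj_i : ('i%C : C)^* = - 'i%C. by apply/eqP; rewrite eq_complex /= oppr0 !eqxx. Qed.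
Lemma cjV x : (x^-1)^* = (x^*)^-1. exact:fmorphV. Qed.
Lemma cj_nat k : (k%:R : C)^* = k%:R. exact:rmorph_nat. Qed.
Lemma cj0 : (0 : C)^* = 0. exact:rmorph0. Qed.
Lemma cj1 : (1 : C)^* = 1. exact:rmorph1. Qed.
Lemma cj_sum I (r : seq I) (P : pred I) (F : I -> C) :
 (\sum_(i <- r | P i) F i)^* = \sum_(i <- r | P i) (F i)^*. exact:rmorph_sum. Qed.
End Conjugation.

Section Flat.
Variable R : realType.
Local Notation C := R[i].
Implicit Types (x t h : R) (k : nat).
Lemma isD1_comp (f : R -> C) (g : R -> R) t (m : R) l :
 isD1 (fun s => (g s)%:C%C) t m%:C%C -> isD1 f (g t) l -> isD1 (fun s => f (g s)) t (m%:C%C * l).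
move=> gD fD; apply:isD1_weak; exists (cn l + (`|m| + 1)) => e e0 e1.
have [d1 d10 H1] := gD e e0; have [d2 d20 H2] := fD e e0.
have [d3 d30 H3] := isD1_local_lip gD; rewrite cn_real in H3.
exists (Num.min d1 (Num.min d3 (d2 / (`|m| + 1)))); first by rewrite !lt_min d10 d30 divr_gt0.
move=> h; rewrite !lt_min => /andP[/H1 {}H1 /andP[/H3 {}H3 h2]].
rewrite -rmorphB cn_real in H3; set u := g (t + h) - g t in H3.
have hu : `|u| < d2 by apply:le_lt_trans H3 _; rewrite mulrC -ltr_pdivlMr.
have := H2 u hu; rewrite (_ : g t + u = g (t + h)); last by rewrite /u; ring.
move=> {}H2; rewrite -rmorphB -/u -rmorphM -rmorphB cn_real in H1.
clearbody u; have Em : (u - h * m)%:C%C = u%:C%C - h%:C%C * m%:C%C :> C by ring.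
have -> : f (g (t + h)) - f (g t) - h%:C%C * (m%:C%C * l) =
  (f (g (t + h)) - f (g t) - u%:C%C * l) + (u - h * m)%:C%C * l by ring.
apply:le_trans (cnD _ _) _; rewrite cnZ.
have h3 : e * `|u| <= e * ((`|m| + 1) * `|h|) by nra.
have h4 : `|u - h * m| * cn l <= e * `|h| * cn l by rewrite ler_wpM2r // cn_ge0.
rewrite (_ : (cn l + (`|m| + 1)) * e * `|h| = e * ((`|m| + 1) * `|h|) + e * `|h| * cn l); last by lra.
lra.
Qed.
(** The powers of x in the denominator close the family under differentiation: the derivative of
    [beta k] is -k [beta k.+1] + [beta k.+2], at x = 0 included. One induction then makes every
    member smooth. *)
Definition beta k x : R := if 0 < x then expR (- x^-1) / x ^+ k else 0.
Lemma beta_ge0 k x : 0 <= beta k x.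
by rewrite /beta; case:ifP => // x0; rewrite divr_ge0 // exprn_ge0 // ltW. Qed.
Lemma beta_gt0 k x : 0 < x -> 0 < beta k x.
by move=> x0; rewrite /beta x0 divr_gt0 ?expR_gt0 // exprn_gt0. Qed.
Lemma beta_eq0 k x : x <= 0 -> beta k x = 0.
by move=> x0; rewrite /beta ltNge x0. Qed.
Lemma betaS k x : 0 < x -> beta k.+1 x = beta k x * x^-1.
move=> x0; rewrite /beta x0 exprS invfM; ring. Qed.
(** From exp(y) >= (y / m)^m with y = 1 / x and m = k + 2, which is the m-th power of exp(s) > s.
    The quadratic bound gives the zero derivative at the origin. *)
Lemma beta_flat k x : beta k x <= k.+2%:R ^+ k.+2 * x ^+ 2.
have m0 : 0 < (k.+2%:R : R) by [].
set m : R := k.+2%:R in m0 *.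
rewrite /beta; case:ifP => [x0|_]; last by apply:mulr_ge0; [apply:exprn_ge0|exact:sqr_ge0].
have y0 : 0 < x^-1 / m by rewrite divr_gt0 ?invr_gt0.
have h1 : (x^-1 / m) ^+ k.+2 <= expR x^-1.
 have -> : expR x^-1 = expR (x^-1 / m) ^+ k.+2.
  rewrite -expRM_natl mulrCA divff ?mulr1 //.
 apply:lerXn2r; rewrite ?nnegrE ?expR_ge0 1?ltW //.
 have Hy (y : R) : 0 < y -> y < expR y by move=> y1; have := expR_gt1Dx (lt0r_neq0 y1); lra.
 exact:Hy.
have xk : 0 < x ^+ k by rewrite exprn_gt0.
rewrite expRN ler_pdivrMr // -mulrA -exprD addnC -addn2 -exprMn.
rewrite -lef_pV2 ?posrE ?invr_gt0 ?expR_gt0 ?exprn_gt0 ?mulr_gt0 // in h1 *.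
rewrite -exprVn invfM addn2 invrK mulrC //.
Qed.
Lemma beta_isD1_pos k x : 0 < x ->
 isD1 (fun s => (beta k s)%:C%C) x (- k%:R * beta k.+1 x + beta k.+2 x)%:C%C.
move=> x0; have nx : x%:C%C != 0 :> C by rewrite fmorph_eq0 gt_eqF.
have IV : isD1 (fun s => (s^-1)%:C%C) x (- (x^-1) ^+ 2)%:C%C.
 apply:isD1_eq (isD1_near _ (isD1_inv nx (isD1_id x))) _.
  by exists 1 => // h; rewrite fmorphV.
 by rewrite rmorphN rmorphXn fmorphV mulN1r exprVn.
elim:k => [|k IH].
 have ID : isD1 (fun s => (- s^-1)%:C%C) x ((x^-1) ^+ 2)%:C%C.
  apply:isD1_eq (isD1_near _ (isD1_lin (-1) IV (isD1_cst 0 x))) _.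
   by exists 1 => // h; rewrite rmorphN mulN1r addr0.
  ring.
 have EX (y : R) : isD1 (fun s => (expR s)%:C%C) y (expR y)%:C%C.
  move=> e e0; have D := @is_derive_expR R y.
  have /cvgrPdist_le /(_ _ e0) : (fun h : R => h^-1 *: (expR (h *: 1 + y) - expR y)) @ (0 : R)^' --> 'D_1 (@expR R) y.
   exact:@ex_derive.
  rewrite (@derive_val _ _ _ _ _ _ _ D) => /nbhs_ballP[d /= d0 Hd]; exists d => // h hd.
  have [->|h0] := eqVneq h 0; first by rewrite addr0 mul0r subrr subr0 cn0 normr0 mulr0.
  have := Hd h; rewrite /ball /= sub0r normrN => /(_ hd h0).
  rewrite [h *: 1]mulr1 [h + y]addrC -[_ *: _]/(h^-1 * _) distrC => h1.
  rewrite -rmorphM -!rmorphB cn_real.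
  have -> : expR (y + h) - expR y - h * expR y = h * (h^-1 * (expR (y + h) - expR y) - expR y).
   by rewrite mulrBr mulVKf.
  by rewrite normrM mulrC ler_wpM2r.
 apply:isD1_eq (isD1_near _ (isD1_comp ID (EX (- x^-1)))) _.
  exists x => // h hx; rewrite /beta divr1; case:ltP => // h1.
  exfalso; move: hx; rewrite ltr_norml => /andP[h2 _]; lra.
 rewrite -rmorphM; rewrite /beta x0 exprVn; ring.
apply:isD1_eq (isD1_near _ (isD1_mul IH IV)) _.
 exists x => // h hx; rewrite -rmorphM betaS // .
 move: hx; rewrite ltr_norml => /andP[h2 _]; lra.
rewrite -!rmorphM -rmorphD; congr (_%:C%C).
rewrite [beta k.+3 x]betaS // [beta k.+2 x]betaS // betaS //; ring.
Qed.
Lemma beta_isD1 k x :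
 isD1 (fun s => (beta k s)%:C%C) x (- k%:R * beta k.+1 x + beta k.+2 x)%:C%C.
have [x0|x0|<-] := ltgtP 0 x; first exact:beta_isD1_pos.
 rewrite !(@beta_eq0 _ x) ?ltW // mulr0 addr0; apply:isD1_near (isD1_cst 0 x).
 exists (- x); first by lra.
 move=> h; rewrite ltr_norml => /andP[_ h2]; rewrite beta_eq0 //; lra.
rewrite !beta_eq0 // mulr0 addr0; apply:isD1_weak; exists (k.+2%:R ^+ k.+2) => e e0 e1.
exists e => // h he; rewrite mulr0 subr0 add0r (@beta_eq0 _ 0) // subr0 cn_real ger0_norm ?beta_ge0 //.
apply:le_trans (beta_flat k h) _; rewrite -mulrA ler_wpM2l //.
by rewrite -real_normK ?num_real // ler_wpM2r // ltW.
Qed.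
End Flat.

Section Bump.
Variables (R : realType) (n : nat).
Local Notation C := R[i].
Local Notation E := 'rV[C]_n.
Implicit Types (v z : E) (k : nat).
Definition nsq z : R := \sum_a ((complex.Re (z 0 a)) ^+ 2 + (complex.Im (z 0 a)) ^+ 2).
Definition bump k z : C := (beta k (1 - nsq z))%:C%C.
Definition bdot v z : R := \sum_a (complex.Re (z 0 a) * complex.Re (v 0 a) + complex.Im (z 0 a) * complex.Im (v 0 a)).
Lemma nsq_ge0 z : 0 <= nsq z.
by apply:sumr_ge0 => a; rewrite addr_ge0 // sqr_ge0. Qed.
Lemma nsq_line z v t : nsq (z + t%:C%C *: v) = nsq z + t * (2 * bdot v z) + t ^+ 2 * nsq v.
rewrite /nsq !mulr_sumr -!big_split /=; apply:eq_bigr=> a _; rewrite !mxE.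
case:(z 0) (v 0) => [p q] [r s] /=; ring.
Qed.
Lemma bdotC v z : (2 * bdot v z)%:C%C = \sum_a (v 0 a * (z 0 a)^* + (v 0 a)^* * z 0 a) :> C.
rewrite mulr_sumr rmorph_sum; apply:eq_bigr=> a _.
case:(z 0) (v 0) => [p q] [r s]; apply/eqP; rewrite eq_complex /=.
apply/andP; split; apply/eqP; ring.
Qed.
Lemma bump_isD k v z : isD (bump k) v z
 ((- (2 * bdot v z))%:C%C * (- k%:R * bump k.+1 z + bump k.+2 z)).
rewrite /isD; set b := 2 * bdot v z.
have G : isD1 (fun t => (1 - nsq (z + t%:C%C *: v))%:C%C) 0 (- b)%:C%C.
 have I := @isD1_id R 0; have I2 := isD1_mul I I.
 have L := isD1_lin (- b)%:C%C I (isD1_lin (- nsq v)%:C%C I2 (isD1_cst (1 - nsq z)%:C%C 0)).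
 apply:isD1_eq (isD1_near _ L) _.
  exists 1 => // h _; rewrite add0r nsq_line -/b; apply/eqP; rewrite eq_complex /=.
  apply/andP; split; apply/eqP; ring.
 ring.
have H := beta_isD1 k (1 - nsq (z + 0%:C%C *: v)).
have := isD1_comp G H; rewrite scale0r addr0 /bump.
by rewrite rmorphD rmorphM !rmorphN rmorph_nat.
Qed.
Lemma bump_cts k z : cts (bump k) z.
have /isD1_cont/(@cvgC_P R _ (nbhs (1 - nsq z)) (nbhs_filter _)) H := beta_isD1 k (1 - nsq z).
move=> e e0; have /nbhs_ballP[d /= d0 Hd] := H e e0.
have cN : cts (fun x => (nsq x)%:C%C) z.
 have : smooth setT (fun x : E => \sum_a (x 0 a * (x 0 a)^*)).
  apply:sm_sum => a _; apply:sm_mul; [|apply:sm_conj]; exact:sm_coord.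
 move=> /(@sm_cont _ _ _ _ z) /(_ I); apply:cts_near.
 apply:(@filterE _ (nbhs z) (nbhs_filter z)) => x; rewrite rmorph_sum; apply:eq_bigr=> a _.
 case:(x 0) => p q; apply:complex_ext => /=; ring.
have [d' d'0 Hd'] := cN d d0; exists d' => // w /Hd'; rewrite -rmorphB cn_real => hw; apply:Hd.
rewrite /ball /= (_ : _ - _ = nsq w - nsq z) //; ring.
Qed.
Lemma bump_sm k V : smooth V (bump k).
move=> K; elim:K k => [|K IH] k; first by apply/Ck0E=> z _; exact:bump_cts.
apply/CkSE; split=> [z _|v]; first exact:bump_cts.
exists (fun z => (- (2 * bdot v z))%:C%C * (- k%:R * bump k.+1 z + bump k.+2 z)); last first.
 move=> z _; exact:bump_isD.
apply:Ck_mul; last by apply:Ck_add => //; apply:Ck_mul => //; exact:Ck_cst.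
have H : Ck K V (fun z => -1 * \sum_a (v 0 a * (z 0 a)^* + (v 0 a)^* * z 0 a)).
 apply:Ck_mul; first exact:Ck_cst.
 apply:Ck_sum => a _; apply:Ck_add; apply:Ck_mul; first [exact:Ck_cst|exact:Ck_coord|apply:Ck_conj; exact:Ck_coord].
rewrite (_ : (fun z => _) = (fun z => -1 * \sum_a (v 0 a * (z 0 a)^* + (v 0 a)^* * z 0 a))) //.
by apply/funext=> z; rewrite -bdotC mulN1r -rmorphN.
Qed.
Lemma bump_out k z : 1 <= nsq z -> bump k z = 0.
by move=> h; rewrite /bump beta_eq0 // subr_le0. Qed.
Lemma bump_ge0 k z : 0 <= bump k z.
by rewrite lecR beta_ge0. Qed.
Lemma bump0_gt0 k : 0 < bump k (0 : E).
rewrite ltcR beta_gt0 // /nsq big1 // => a _; rewrite mxE; ring.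
Qed.
Lemma bump_conj k z : (bump k z)^* = bump k z. exact:conj_real. Qed.
(** In the Euclidean unit ball every coordinate has [cn] at most 2. The extra 1 makes the bound
    strict and the radius positive. *)
Definition rad : R := 2 * n%:R + 1.
Lemma rad_gt0 : 0 < rad. rewrite ltr_wpDl //. Qed.
Lemma rad_nsq z : nsq z < 1 -> rn z < rad.
move=> h; have H a : cn (z 0 a) <= 2.
 have : (complex.Re (z 0 a)) ^+ 2 + (complex.Im (z 0 a)) ^+ 2 < 1.
  apply:le_lt_trans h; rewrite /nsq (bigD1 a) //= lerDl; apply:sumr_ge0 => b _.
  nra.
 rewrite cnE; case:(z 0) => p q /= h1; have := sqr_ge0 p; have := sqr_ge0 q => hp hq.
 have : `|p| <= 1 by rewrite -(@ler_pXn2r _ 2) ?nnegrE // real_normK ?num_real; lra.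
 have : `|q| <= 1 by rewrite -(@ler_pXn2r _ 2) ?nnegrE // real_normK ?num_real; lra.
 lra.
rewrite rnE; apply:le_lt_trans (_ : \sum_(a < n) 2 < _); first exact:ler_sum.
rewrite sumr_const card_ord /rad; lra.
Qed.
Lemma bump_rad k z : rad <= rn z -> bump k z = 0.
by move=> h; apply:bump_out; rewrite leNgt; apply/negP=> /rad_nsq; rewrite ltNge h. Qed.
Lemma bump_Cc k : Cc rad (bump k).
split; [exact:bump_cts|exact:bump_rad]. Qed.
(** The bump depends on the squared Euclidean norm only, so its dz_a and dzbar_a derivatives are the
    conjugate coordinate and the coordinate times the same function [bump 2]. This coincidence is
    what [radial_swap] lives on. *)
Lemma bump_dz a z : dz a (bump 0) z = - ((z 0 a)^* * bump 2 z).
rewrite dzE (isD_rD (bump_isD 0 (ev R a) z)) (isD_rD (bump_isD 0 (iev R a) z)).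
have BN v : (- (2 * bdot v z))%:C%C = - \sum_b (v 0 b * (z 0 b)^* + (v 0 b)^* * z 0 b) :> C.
 by rewrite -bdotC -rmorphN.
rewrite !BN.
have S1 : \sum_b (ev R a 0 b * (z 0 b)^* + (ev R a 0 b)^* * z 0 b) = (z 0 a)^* + z 0 a :> C.
 rewrite (bigD1 a) //= big1 => [|b ba]; rewrite mxE ?eqxx ?(negbTE ba) /=; ring.
have S2 : \sum_b (iev R a 0 b * (z 0 b)^* + (iev R a 0 b)^* * z 0 b) = 'i%C * (z 0 a)^* - 'i%C * z 0 a :> C.
 rewrite (bigD1 a) //= big1 => [|b ba]; rewrite !mxE ?eqxx ?(negbTE ba) /= ?mulr1; last by ring.
 rewrite cj_i; ring.
rewrite S1 S2; have := @sqri R; move: ('i%C : C) => j jj.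
have -> : (- ((z 0 a)^* + z 0 a) * (- 0%:R * bump 1 z + bump 2 z) - j * (- (j * (z 0 a)^* - j * z 0 a) * (- 0%:R * bump 1 z + bump 2 z))) =
 (- ((z 0 a)^* + z 0 a) + (j * j) * ((z 0 a)^* - z 0 a)) * bump 2 z by ring.
by rewrite jj; field.
Qed.
Lemma bump_dzb a z : dzbar a (bump 0) z = - (z 0 a * bump 2 z).
have E v : (rD (bump 0) v z)^* = rD (bump 0) v z.
 rewrite -(isD_rD (isD_conj (sm_isD v (@bump_sm 0 setT) (I : setT z)))).
 congr rD; apply/funext=> x; exact:bump_conj.
have := congr1 (fun x : C => x^*) (bump_dz a z); rewrite dzE dzbarE.
rewrite cjM cjB cjM cjV cj_nat !E cj_i cjN cjM cjK bump_conj => <-.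
ring.
Qed.
End Bump.

(** * Joint continuity and integrals depending on a parameter *)

Section JointContinuity.
Variables (R : realType) (n : nat).
Local Notation C := R[i].
Local Notation E := 'rV[C]_n.
Variables (T : Type) (F : set_system T) (FF : Filter F).
Lemma cvg_real (f : T -> R) (a : R) : f @ F --> a -> (fun x => (f x)%:C%C : C) @ F --> (a%:C%C : C).
move=> fa; apply/cvgC_P=> e e0; have /cvgrPdist_lt /(_ e e0) := fa.
by apply:filterS => h; rewrite -rmorphB cn_real distrC.
Qed.
Lemma cvg_cts (q : E -> C) (f : T -> E) (a : E) : cts q a -> f @ F --> a -> (fun t => q (f t)) @ F --> q a.
move=> /ctsP qa fa; exact:cvg_comp qa. Qed.
Lemma cvg_affine (f g : T -> E) (c : T -> C) (a b : E) (k : C) : f @ F --> a -> c @ F --> k -> g @ F --> b ->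
 (fun t => f t + c t *: g t) @ F --> a + k *: b.
move=> fa ck gb; apply:cvgD; [exact:fa|exact:cvgZ]. Qed.
Lemma cvg_mulC (f g : T -> C) (a b : C) : f @ F --> a -> g @ F --> b -> (fun x => f x * g x) @ F --> a * b.
move=> fa gb; exact:(@cvgM C T F FF f g a b fa gb). Qed.
Lemma cvg_addC (f g : T -> C) (a b : C) : f @ F --> a -> g @ F --> b -> (fun x => f x + g x) @ F --> a + b.
move=> fa gb; exact:(@cvgD C _ T F FF f g a b fa gb). Qed.
End JointContinuity.

Section JointFubini.
Variables (R : realType) (S T : topologicalType).
Local Notation C := R[i].
Lemma joint_r (F : S -> T -> C) s t : (fun p : S * T => F p.1 p.2) @ (s, t) --> F s t -> F s @ t --> F s t.
move=> H; apply:(@cvg_comp _ _ _ (fun y => (s, y)) (fun p : S * T => F p.1 p.2) _ _ _ _ H); exact:(@cvg_pair _ _ _ (nbhs t) (nbhs s) (nbhs t) _ _ _ (fun=> s) id (cvg_cst s) cvg_id). Qed.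
Lemma joint_l (F : S -> T -> C) s t : (fun p : S * T => F p.1 p.2) @ (s, t) --> F s t -> F^~ t @ s --> F s t.
move=> H; apply:(@cvg_comp _ _ _ (fun y => (y, t)) (fun p : S * T => F p.1 p.2) _ _ _ _ H); exact:(@cvg_pair _ _ _ (nbhs s) (nbhs s) (nbhs t) _ _ _ id (fun=> t) cvg_id (cvg_cst t)). Qed.
Lemma joint_flip (F : S -> T -> C) s t : (fun p : S * T => F p.1 p.2) @ (s, t) --> F s t ->
 (fun p : T * S => F p.2 p.1) @ (t, s) --> F s t.
move=> H; apply:(@cvg_comp _ _ _ (fun p : T * S => (p.2, p.1)) (fun p : S * T => F p.1 p.2) _ _ _ _ H); exact:(@cvg_pair _ _ _ (nbhs (t, s)) (nbhs s) (nbhs t) _ _ _ snd fst cvg_snd cvg_fst). Qed.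
End JointFubini.
(** The premise on D isolates what is required of s -> [icn (F s)]: continuity, and vanishing at
    every s where F s vanishes. It covers both supported functions and plain continuity, so
    [bf_swap] becomes applicable with few side conditions. *)
Lemma fub_joint (R : realType) n (S : topologicalType) (A : set S) D (J : (S -> R[i]) -> R[i]) (F : S -> 'rV[R[i]]_n -> R[i]) r :
 bfun A D J -> 0 <= r -> (forall s u, (fun p : S * 'rV[R[i]]_n => F p.1 p.2) @ (s, u) --> F s u) ->
 (forall s u, r <= rn u -> F s u = 0) ->
 (forall f : S -> R[i], (forall s, f @ s --> f s) -> (forall s, F s = (fun=> 0) -> f s = 0) -> D f) ->
 [/\ J (fun s => icn (F s)) = icn (fun u => J (F^~ u)), Cc r (fun u => J (F^~ u)),
   D (fun s => icn (F s)) & forall s, (fun s => icn (F s)) @ s --> icn (F s)].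
move=> bJ r0 Fc F0 DD; have cI := @int_ccfun R n; have bI := cI r r0.
have Fs s : Cc r (F s) by split=> [u|u]; [apply/ctsP; exact:joint_r|exact:F0].
have Fu u : D (F^~ u) by apply:DD => [s|s ->//]; exact:joint_l.
have Ic s : (fun s => icn (F s)) @ s --> icn (F s).
 exact:(@bf_cts R _ _ _ _ bI S F s (@filterE _ (nbhs s) (nbhs_filter s) _ Fs) (fun u _ => Fc s u)).
have DI : D (fun s => icn (F s)) by apply:DD => // s ->; exact:bf_0 bI.
have CL : Cc r (fun u => J (F^~ u)).
 split=> [u|u hu].
  apply/ctsP; apply:(@bf_cts R S _ _ _ bJ _ (fun u s => F s u) u (@filterE _ (nbhs u) (nbhs_filter u) _ Fu)) => s _.
  exact:joint_flip.
 rewrite (_ : F^~ u = fun=> 0) ?(bf_0 bJ) //; apply/funext=> s; exact:F0.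
split=> //; exact:(@bf_swap R n S A D J (@icn R n) F r bJ cI r0 Fu Fs DI CL (fun s u _ => Fc s u)).
Qed.
Lemma affine_cts (R : realType) n (q : 'rV[R[i]]_n -> R[i]) x (T : R) z : (forall y, cts q y) -> cts (fun u => q (x - T%:C%C *: u)) z.
move=> qc; apply/ctsP; apply:(@cvg_cts R n _ _ q (fun u => x - T%:C%C *: u) _ (qc _)).
have FF := nbhs_filter z; by apply:cvgB; [exact:cvg_cst|apply:cvgZ; [exact:cvg_cst|exact:cvg_id]].
Qed.
Lemma plane_line_cts (R : realType) n (q : 'rV[R[i]]_n -> R[i]) y v : (forall y, cts q y) -> continuous (fun w : R[i] => q (y + w *: v)).
move=> qc w; apply:(@cvg_cts R n _ _ q (fun w => y + w *: v) _ (qc _)).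
apply:(@cvg_affine R n _ _ (nbhs_filter w) (fun=> y) (fun=> v)); [exact:cvg_cst|exact:cvg_id|exact:cvg_cst].
Qed.

Section ParamIntegrals.
Variables (R : realType) (n : nat).
Local Notation C := R[i].
Local Notation E := 'rV[C]_n.
Implicit Types (f q : E -> C) (u v x z : E) (V : set E).
Variables (S : topologicalType) (A : set S) (D : (S -> C) -> Prop) (J : (S -> C) -> C).
Hypothesis bJ : bfun A D J.
Lemma joint_line (T : topologicalType) (F : E -> T -> C) x v (t : R) s :
 (fun p : E * T => F p.1 p.2) @ (x + t%:C%C *: v, s) --> F (x + t%:C%C *: v) s ->
 (fun p : R * T => F (x + p.1%:C%C *: v) p.2) @ (t, s) --> F (x + t%:C%C *: v) s.
move=> H; have FF := nbhs_filter (t, s).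
apply:(@cvg_comp _ _ _ (fun p : R * T => (x + p.1%:C%C *: v, p.2)) (fun p : E * T => F p.1 p.2) _ _ _ _ H).
have h1 : (fun p : R * T => p.1%:C%C) @ (t, s) --> (t%:C%C : C) by apply:cvg_real; exact:cvg_fst.
have h2 : (fun p : R * T => x + p.1%:C%C *: v) @ (t, s) --> x + t%:C%C *: v.
 apply:@cvg_affine; [exact:cvg_cst|exact:h1|exact:cvg_cst].
exact:(@cvg_pair _ _ _ _ _ _ FF _ _ _ _ h2 cvg_snd).
Qed.
Lemma param_isD (F F' : E -> S -> C) v x (U : set E) : open U -> U x ->
 (forall x', U x' -> D (F x')) -> D (F' x) ->
 (forall x' s, A s -> isD (F^~ s) v x' (F' x' s)) ->
 (forall s, A s -> (fun p : E * S => F' p.1 p.2) @ (x, s) --> F' x s) ->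
 isD (fun y => J (F y)) v x (J (F' x)).
move=> oU Ux DF DF' FD cF'; have [d d0 Hd] := (openE_P U).1 oU x Ux.
have k0 : 0 < rn v + 1 by have := rn_ge0 v; lra.
have := @bf_deriv R S A D J bJ (fun t => F (x + t%:C%C *: v)) (fun t => F' (x + t%:C%C *: v)) 0.
have E0 : x + 0%:C%C *: v = x by rewrite scale0r addr0.
rewrite E0; apply=> //.
- apply/nbhs_ballP; exists (d / (rn v + 1)); first by rewrite /= divr_gt0.
 move=> t; rewrite /ball /= sub0r normrN => ht; apply:DF; apply:Hd.
 rewrite [x + _]addrC addrK rnZ; move: ht; rewrite ltr_pdivlMr // mulrDr mulr1 => h1.
 have := normr_ge0 t; lra.
- move=> t s As; exact:(isD_line (F^~ s) v x t _).1 (FD _ _ As).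
- move=> s As; rewrite -[in X in _ --> X]E0; apply:@joint_line.
 rewrite E0; exact:cF'.
Qed.
Lemma param_cts (F : E -> S -> C) x (U : set E) : open U -> U x ->
 (forall x', U x' -> D (F x')) ->
 (forall s, A s -> (fun p : E * S => F p.1 p.2) @ (x, s) --> F x s) ->
 cts (fun y => J (F y)) x.
move=> oU Ux DF cF; apply/ctsP; apply:(bf_cts bJ) => //.
apply:filterS (nr_op oU Ux) => y; exact:DF.
Qed.
Variables (Q : (E -> C) -> Prop) (w : S -> C) (al : S -> E) (V : set E).
Hypothesis oV : open V.
Hypothesis wc : forall s, A s -> w @ s --> w s.
Hypothesis alc : forall s, A s -> al @ s --> al s.
Hypothesis Qs : forall q, Q q -> smooth setT q.
Hypothesis QD : forall q v, Q q -> Q (rD q v).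
Hypothesis QV : forall q x, Q q -> V x -> D (fun s => w s * q (x + al s)).
(** A generalised convolution: translates of q by [al s], weighted by w and collected by J.
    Mollified functions, the primitives of the parametrix and the density of the functional all have
    this shape, so their smoothness is proved once. *)
Definition gop q x := J (fun s => w s * q (x + al s)).
Lemma gop_joint q x s : Q q -> A s ->
 (fun p : E * S => w p.2 * q (p.1 + al p.2)) @ (x, s) --> w s * q (x + al s).
move=> Qq As; have FF := nbhs_filter (x, s).
have sn : (fun p : E * S => p.2) @ (x, s) --> s by exact:cvg_snd.
apply:(cvg_mulC FF); first exact:cvg_comp (wc As).
apply:(@cvg_cts R n _ _ q (fun p => p.1 + al p.2)); first exact:sm_cont (Qs Qq) I.
apply:cvgD; [exact:cvg_fst|exact:cvg_comp (alc As)].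
Qed.
Lemma gop_isD q v x : Q q -> V x -> isD (gop q) v x (gop (rD q v) x).
move=> Qq Vx; apply:(@param_isD (fun x s => w s * q (x + al s)) (fun x s => w s * rD q v (x + al s)) v x V oV Vx).
- move=> y Vy; exact:QV.
- apply:QV => //; exact:QD.
- move=> y s As; apply:isD_scale.
 have H := sm_isD v (Qs Qq) (I : setT (y + al s)).
 by move: H; congr isD1; apply/funext=> t; rewrite addrAC.
- move=> s As; apply:(@gop_joint (rD q v)) => //; exact:QD.
Qed.
Lemma gop_sm q : Q q -> smooth V (gop q).
move=> Qq k; elim:k q Qq => [|k IH] q Qq.
 apply/Ck0E=> x Vx; apply:(@param_cts (fun x s => w s * q (x + al s)) x V oV Vx).
  move=> y Vy; exact:QV.
 move=> s As; exact:gop_joint.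
apply/CkSE; split=> [x Vx|v].
 apply:Ck_cont Vx; exact:IH.
exists (gop (rD q v)); first by apply:IH; exact:QD.
move=> x Vx; exact:gop_isD.
Qed.
Lemma gop_rD q v x : Q q -> V x -> rD (gop q) v x = gop (rD q v) x.
move=> Qq Vx; apply:isD_rD; exact:gop_isD. Qed.
Lemma gop_dz a q x : Q q -> V x -> dz a (gop q) x = gop (dz a q) x.
move=> Qq Vx; rewrite dzE !gop_rD // /gop.
have D1 := QV (QD (ev R a) Qq) Vx; have D2 := QV (QD (iev R a) Qq) Vx.
rewrite [in RHS](_ : (fun s => _) = fun s => 2^-1 * (w s * rD q (ev R a) (x + al s)) + (- 'i%C / 2) * (w s * rD q (iev R a) (x + al s))).
 rewrite (bf_lin bJ _ D1 (bf_DZ bJ _ D2)) (bf_Z bJ _ D2); ring.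
apply/funext=> s; rewrite dzE; ring.
Qed.
End ParamIntegrals.
Lemma cvg_sumC (R : realType) (T : Type) (F : set_system T) (FF : Filter F) (I : Type) (r : seq I)
  (f : I -> T -> R[i]) (l : I -> R[i]) : (forall i, f i @ F --> l i) ->
 (fun x => \sum_(i <- r) f i x) @ F --> \sum_(i <- r) l i.
move=> H; elim:r => [|i r IH].
 rewrite big_nil (_ : (fun x => _) = fun=> 0); last by apply/funext=> x; rewrite big_nil.
 exact:@cvg_cst.
rewrite big_cons (_ : (fun x => _) = fun x => 1 * f i x + \sum_(j <- r) f j x).
 rewrite -[l i]mul1r; exact:(@cvg_lin R[i] T F FF 1 _ _ _ _ (H i) IH).
by apply/funext=> x; rewrite big_cons mul1r.
Qed.
Lemma cvg_snd_cts (R : realType) (n : nat) (T : topologicalType) (g : 'rV[R[i]]_n -> R[i]) (t : T) u :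
 cts g u -> (fun p : T * 'rV[R[i]]_n => g p.2) @ (t, u) --> g u.
move=> gc; exact:(@cvg_cts R n _ _ g snd u gc cvg_snd). Qed.

(** * Averages against the radial kernel: the homotopy formula and the reproducing property *)

Section Homotopy.
Variables (R : realType) (n : nat).
Local Notation C := R[i].
Local Notation E := 'rV[C]_n.
Implicit Types (f q : E -> C) (u v x z : E).
Lemma rD_sm f v : smooth setT f -> smooth setT (rD f v).
apply:sm_rD; exact:openT. Qed.
Lemma sm_linT c f g : smooth setT f -> smooth setT g -> smooth (setT : set E) (fun y => c * f y + g y).
move=> sf sg; apply:sm_add => //; apply:sm_mul => //; exact:sm_cst. Qed.
Lemma dz_form a f : dz a f = fun y => 2^-1 * rD f (ev R a) y + (- 'i%C / 2) * rD f (iev R a) y.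
apply/funext=> y; rewrite dzE; ring. Qed.
Lemma dzbar_form a f : dzbar a f = fun y => 2^-1 * rD f (ev R a) y + ('i%C / 2) * rD f (iev R a) y.
apply/funext=> y; rewrite dzbarE; ring. Qed.
Lemma sm_dz V a f : open V -> smooth V f -> smooth V (dz a f).
move=> oV sf; rewrite dz_form; apply:sm_add; apply:sm_mul; try exact:sm_cst;
 exact:sm_rD.
Qed.
Lemma sm_dzb V a f : open V -> smooth V f -> smooth V (dzbar a f).
move=> oV sf; rewrite dzbar_form; apply:sm_add; apply:sm_mul; try exact:sm_cst;
 exact:sm_rD.
Qed.
Lemma rD_lin2 (V : set E) (c d : C) f g v z : open V -> smooth V f -> smooth V g -> V z ->
 rD (fun y => c * f y + d * g y) v z = c * rD f v z + d * rD g v z.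
move=> oV sf sg Vz; apply:isD_rD; apply:isD_lin; [|apply:isD_scale]; exact:sm_isD. Qed.

Section Commute.
Variables (V : set E) (f : E -> C) (z : E).
Hypotheses (oV : open V) (sf : smooth V f) (Vz : V z).
Let W c d v u1 u2 : rD (fun y => c * rD f u1 y + d * rD f u2 y) v z =
 c * rD (rD f u1) v z + d * rD (rD f u2) v z.
exact:(rD_lin2 c d v oV (sm_rD u1 oV sf) (sm_rD u2 oV sf) Vz). Qed.
Lemma dz_dzbarC a b : dz a (dzbar b f) z = dzbar b (dz a f) z.
rewrite dzE dzbarE dzbar_form dz_form !W.
rewrite !(schwarz oV _ (ev R a) sf Vz) !(schwarz oV _ (iev R a) sf Vz).
ring.
Qed.
Lemma dz_dzC a b : dz a (dz b f) z = dz b (dz a f) z.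
rewrite !dzE !dz_form !W.
rewrite !(schwarz oV _ (ev R a) sf Vz) !(schwarz oV _ (iev R a) sf Vz).
ring.
Qed.
End Commute.
Definition mass : C := icn (@bump R n 2).
Lemma mass_neq0 : mass != 0.
apply/eqP=> m0; have := int_eq0 (ltW (rad_gt0 R n)) (bump_Cc R n 2) (@bump_ge0 R n 2) m0 0.
by apply/eqP; rewrite gt_eqF // bump0_gt0.
Qed.
Definition pker u : C := mass^-1 * bump 2 u.
(** A common potential: both conj(u_a) p and u_a p are derivatives of this function, by [Psi_dz] and
    [Psi_dzb]. *)
Definition Psi u : C := - mass^-1 * bump 0 u.
Local Notation rd := (rad R n).
Lemma pker_sm V : smooth V pker.
apply:sm_mul; [exact:sm_cst|exact:bump_sm]. Qed.
Lemma Psi_sm V : smooth V Psi.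
apply:sm_mul; [exact:sm_cst|exact:bump_sm]. Qed.
Lemma pker_rad u : rd <= rn u -> pker u = 0.
by move=> h; rewrite /pker bump_rad // mulr0. Qed.
Lemma pker_Cc : Cc rd pker.
split; [move=> z; exact:sm_cont (pker_sm setT) I|exact:pker_rad]. Qed.
Lemma Psi_rad u : rd <= rn u -> Psi u = 0.
by move=> h; rewrite /Psi bump_rad // mulr0. Qed.
Lemma pker_int : icn pker = 1.
have := bf_Z (@int_ccfun R n _ (ltW (rad_gt0 R n))) mass^-1 (bump_Cc R n 2).
by rewrite mulVf // mass_neq0.
Qed.
Lemma Psi_dz a u : dz a Psi u = (u 0 a)^* * pker u.
have := bump_dz a u; rewrite /Psi !dzE.
have E v : rD (fun x => - mass^-1 * bump 0 x) v u = - mass^-1 * rD (bump 0) v u.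
 apply:isD_rD; apply:isD_scale; apply:sm_isD; exact:bump_sm.
rewrite !E /pker => H.
transitivity (- mass^-1 * ((rD (bump 0) (ev R a) u - 'i%C * rD (bump 0) (iev R a) u) / 2)); first by ring.
rewrite H; ring.
Qed.
Lemma Psi_dzb a u : dzbar a Psi u = u 0 a * pker u.
have := bump_dzb a u; rewrite /Psi !dzbarE.
have E v : rD (fun x => - mass^-1 * bump 0 x) v u = - mass^-1 * rD (bump 0) v u.
 apply:isD_rD; apply:isD_scale; apply:sm_isD; exact:bump_sm.
rewrite !E /pker => H.
transitivity (- mass^-1 * ((rD (bump 0) (ev R a) u + 'i%C * rD (bump 0) (iev R a) u) / 2)); first by ring.
rewrite H; ring.
Qed.
Let rd0 := ltW (rad_gt0 R n).
Lemma Cc_mull r f g : Cc r f -> (forall z, cts g z) -> Cc r (fun z => f z * g z).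
by move=> [fc f0]; split=> [z|z h]; [exact:cts_mul|rewrite f0 // mul0r]. Qed.
Lemma isD_affine q v x (t : R) u l : isD q v (x - t%:C%C *: u) l ->
 isD (fun u => q (x - t%:C%C *: u)) v u (- t%:C%C * l).
move=> H; have := isD_dirZ (- t) H; rewrite rmorphN.
rewrite /isD; congr isD1; apply/funext=> s; congr q.
by rewrite scalerDr opprD addrA scalerA mulrC -scalerA scaleNr.
Qed.
Lemma sm_affine q x (t : R) : smooth setT q -> smooth setT (fun u => q (x - t%:C%C *: u)).
move=> sq; apply:(@sm_comp R n n setT setT q (fun u => x - t%:C%C *: u)) => //; try exact:openT.
move=> b; rewrite (_ : (fun u => _) = (fun u : E => x 0 b + (- t%:C%C) * u 0 b)); last first.
 by apply/funext=> u; rewrite !mxE mulNr.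
apply:sm_add; first exact:sm_cst.
apply:sm_mul; [exact:sm_cst|exact:sm_coord].
Qed.
(** The derivative is seen to vanish at a point only when Psi vanishes in a neighbourhood of it,
    hence the enlarged radius. *)
Lemma Psi_Cc v : Cc (rd + 1) Psi /\ Cc (rd + 1) (rD Psi v).
have sP := @Psi_sm setT; split; split=> [z|z h]; [exact:sm_cont|apply:Psi_rad; lra| |].
 exact:sm_cont (rD_sm v sP) I.
apply:isD_rD; apply:isD_near (isD_cst 0 v z).
have : \forall y \near z, rn (y - z) < 1 by apply/nbhsE_P; exists 1.
apply:filterS => y hy; apply/esym/Psi_rad.
have := rnB y (y - z); rewrite opprB addrC subrK; lra.
Qed.
Lemma ibp q v x (t : R) : smooth setT q ->
 icn (fun u => rD Psi v u * q (x - t%:C%C *: u)) =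
 t%:C%C * icn (fun u => Psi u * rD q v (x - t%:C%C *: u)).
move=> sq; have sP := @Psi_sm setT.
have qc z : cts (fun u => q (x - t%:C%C *: u)) z by exact:sm_cont (sm_affine x t sq) I.
have dqc z : cts (fun u => rD q v (x - t%:C%C *: u)) z.
 exact:sm_cont (sm_affine x t (rD_sm v sq)) I.
have rd10 : 0 <= rd + 1 by have := rd0; lra.
have [CP' CdP] := Psi_Cc v.
have I0 := @int_isD R n (fun u => Psi u * q (x - t%:C%C *: u))
 (fun u => rD Psi v u * q (x - t%:C%C *: u) + Psi u * (- t%:C%C * rD q v (x - t%:C%C *: u))) v (rd + 1) rd10.
have C1 : Cc (rd + 1) (fun u => rD Psi v u * q (x - t%:C%C *: u)) by exact:Cc_mull.
have C2 : Cc (rd + 1) (fun u => Psi u * rD q v (x - t%:C%C *: u)) by exact:Cc_mull.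
have bI := @int_ccfun R n _ rd10.
have E1 : (fun u => rD Psi v u * q (x - t%:C%C *: u) + Psi u * (- t%:C%C * rD q v (x - t%:C%C *: u))) =
 (fun u => (- t%:C%C) * (Psi u * rD q v (x - t%:C%C *: u)) + rD Psi v u * q (x - t%:C%C *: u)).
 apply/funext=> u; ring.
rewrite E1 in I0.
have := I0 (Cc_mull CP' qc) (bf_Dlin bI (- t%:C%C) C2 C1); rewrite (bf_lin bI _ C2 C1) => H.
have {}H := H (fun z => isD_mul (sm_isD v sP (I : setT z)) (isD_affine (sm_isD v sq (I : setT _)))).
by move/eqP: H; rewrite mulNr addrC subr_eq0 => /eqP.
Qed.
(* Moving the derivative from the primitive Psi of both [ubar_j p] and [u_j p] turns each side into [t \int Psi dz_j dzbar_j q] *)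
Lemma radial_swap q j x (t : R) : smooth setT q ->
 icn (fun u => pker u * (u 0 j)^* * dzbar j q (x - t%:C%C *: u)) =
 icn (fun u => pker u * u 0 j * dz j q (x - t%:C%C *: u)).
move=> sq; have oT : open (setT : set E) := openT.
have rd10 : 0 <= rd + 1 by have := rd0; lra.
have bI1 := @int_ccfun R n _ rd10.
have cA g z : smooth setT g -> cts (fun u => g (x - t%:C%C *: u)) z.
 move=> sg; exact:sm_cont (sm_affine x t sg) I.
have CP := (Psi_Cc 0).1; have CdP v := (Psi_Cc v).2.
have L (P1 P2 g1 g2 : E -> C) c1 c2 : Cc (rd + 1) P1 -> Cc (rd + 1) P2 -> smooth setT g1 -> smooth setT g2 ->
 icn (fun u => c1 * (P1 u * g1 (x - t%:C%C *: u)) + c2 * (P2 u * g2 (x - t%:C%C *: u))) =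
 c1 * icn (fun u => P1 u * g1 (x - t%:C%C *: u)) + c2 * icn (fun u => P2 u * g2 (x - t%:C%C *: u)).
 move=> CP1 CP2 s1 s2.
 have D1 : Cc (rd + 1) (fun u => P1 u * g1 (x - t%:C%C *: u)) by apply:Cc_mull => // z; exact:cA.
 have D2 : Cc (rd + 1) (fun u => P2 u * g2 (x - t%:C%C *: u)) by apply:Cc_mull => // z; exact:cA.
 by rewrite (bf_lin bI1 c1 D1 (bf_DZ bI1 c2 D2)) (bf_Z bI1).
have s1 := sm_dzb j oT sq; have s2 := sm_dz j oT sq.
have sr g v : smooth setT g -> smooth (setT : set E) (rD g v) by exact:rD_sm.
transitivity (t%:C%C * icn (fun u => Psi u * dz j (dzbar j q) (x - t%:C%C *: u))).
 rewrite (_ : (fun u => _) = (fun u => 2^-1 * (rD Psi (ev R j) u * dzbar j q (x - t%:C%C *: u)) +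
   (- 'i%C / 2) * (rD Psi (iev R j) u * dzbar j q (x - t%:C%C *: u)))); last first.
  apply/funext=> u; rewrite [pker u * _]mulrC -Psi_dz dz_form; ring.
 rewrite L // (ibp _ _ _ s1) (ibp _ _ _ s1) dz_form.
 rewrite [in RHS](_ : (fun u => _) = (fun u => 2^-1 * (Psi u * rD (dzbar j q) (ev R j) (x - t%:C%C *: u)) +
   (- 'i%C / 2) * (Psi u * rD (dzbar j q) (iev R j) (x - t%:C%C *: u)))); last by apply/funext=> u; ring.
 rewrite L //; try exact:sr; ring.
rewrite (_ : (fun u => Psi u * _) = (fun u => 2^-1 * (Psi u * rD (dz j q) (ev R j) (x - t%:C%C *: u)) +
   ('i%C / 2) * (Psi u * rD (dz j q) (iev R j) (x - t%:C%C *: u)))); last first.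
 apply/funext=> u; rewrite (dz_dzbarC oT sq I) dzbar_form; ring.
rewrite L //; try exact:sr.
rewrite [RHS](_ : _ = icn (fun u => 2^-1 * (rD Psi (ev R j) u * dz j q (x - t%:C%C *: u)) +
   ('i%C / 2) * (rD Psi (iev R j) u * dz j q (x - t%:C%C *: u)))); last first.
 congr icn; apply/funext=> u; rewrite [pker u * _]mulrC -Psi_dzb dzbar_form; ring.
rewrite L // (ibp _ _ _ s2) (ibp _ _ _ s2); ring.
Qed.
Definition avg q x (t : R) := icn (fun u => pker u * q (x - t%:C%C *: u)).
Lemma joint_affine g x (t : R) u : smooth setT g ->
 (fun p : R * E => g (x - p.1%:C%C *: p.2)) @ (t, u) --> g (x - t%:C%C *: u).
move=> sg; have FF := nbhs_filter (t, u); apply:(@cvg_cts R n _ _ g (fun p => x - p.1%:C%C *: p.2)); first exact:sm_cont.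
apply:cvgB; first exact:cvg_cst.
apply:cvgZ; [apply:cvg_real; exact:cvg_fst|exact:cvg_snd].
Qed.
(** Under the integral the chain rule gives -u_j dz_j q - conj(u_j) dzbar_j q. By [radial_swap] both
    halves have the same integral, so only dz_j q remains, twice. *)
Lemma avg_isD q x (t : R) : smooth setT q ->
 isD1 (avg q x) t (\sum_j (-2) * icn (fun u => pker u * u 0 j * dz j q (x - t%:C%C *: u))).
move=> sq; have oT : open (setT : set E) := openT.
have bI := @int_ccfun R n _ rd0.
have cA g z s : smooth setT g -> cts (fun u => g (x - s%:C%C *: u)) z.
 move=> sg; exact:sm_cont (sm_affine x s sg) I.
have cp z : cts pker z by exact:sm_cont (@pker_sm setT) I.
have D0 s : Cc rd (fun u => pker u * q (x - s%:C%C *: u)) by apply:Cc_mull pker_Cc _ => z; exact:cA.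
have Dj s j : Cc rd (fun u => pker u * u 0 j * dz j q (x - s%:C%C *: u)).
 apply:Cc_mull; first by apply:Cc_mull pker_Cc _ => z; exact:cts_coord.
 move=> z; apply:cA; exact:sm_dz.
have Dbj s j : Cc rd (fun u => pker u * (u 0 j)^* * dzbar j q (x - s%:C%C *: u)).
 apply:Cc_mull; first by apply:Cc_mull pker_Cc _ => z; apply:cts_conj; exact:cts_coord.
 move=> z; apply:cA; exact:sm_dzb.
pose F' s u := \sum_j (-1) * (pker u * u 0 j * dz j q (x - s%:C%C *: u) + pker u * (u 0 j)^* * dzbar j q (x - s%:C%C *: u)).
have DF' s : Cc rd (F' s).
 by apply:(bf_Dsum bI) => j _; apply:(bf_DZ bI); apply:(bf_DD bI).
have HF : icn (F' t) = \sum_j (-2) * icn (fun u => pker u * u 0 j * dz j q (x - t%:C%C *: u)).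
 rewrite (bf_sum bI) => [|j _]; last by apply:(bf_DZ bI); apply:(bf_DD bI).
 apply:eq_bigr=> j _; rewrite (bf_Z bI); last exact:(bf_DD bI).
 rewrite (bf_D bI) // radial_swap //; ring.
rewrite -HF; apply:(@bf_deriv R E (Ball rd) (Cc rd) (@icn R n) bI (fun s u => pker u * q (x - s%:C%C *: u)) F' t).
- by apply:@filterE.
- exact:DF'.
- move=> s u _.
 have : isD1 (fun s => q (x - s%:C%C *: u)) s (dform q (x - s%:C%C *: u) (- u)).
  have := (isD_line q (- u) x s _).1 (sm_isD _ sq (I : setT (x + s%:C%C *: - u))).
  rewrite (sm_rderiveE oT) // scalerN.
  by congr isD1; apply/funext=> r; rewrite scalerN.
 move=> H; have := isD1_lin (pker u) H (isD1_cst 0 s).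
 rewrite (_ : (fun s => _) = (fun s : R => pker u * q (x - s%:C%C *: u))); last by apply/funext=> r; rewrite addr0.
 move=> {}H; apply:isD1_eq H _; rewrite addr0 dformE mulr_sumr; apply:eq_bigr=> j _.
 rewrite mxE; ring.
- move=> u _; apply/(cvgC_P (nbhs_filter (t, u))).
 suff H : (fun p : R * E => F' p.1 p.2) @ (t, u) --> F' t u by apply/cvgC_P.
 rewrite /F'; apply:cvg_sumC => j.
 apply:cvg_mulC; first exact:@cvg_cst.
 have H1 : (fun p : R * E => pker p.2 * p.2 0 j * dz j q (x - p.1%:C%C *: p.2)) @ (t, u) -->
   pker u * u 0 j * dz j q (x - t%:C%C *: u).
  apply:cvg_mulC; last by apply:joint_affine; exact:sm_dz.
  apply:(@cvg_snd_cts R n R (fun u => pker u * u 0 j)); apply:cts_mul; [exact:cp|exact:cts_coord].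
 have H2 : (fun p : R * E => pker p.2 * (p.2 0 j)^* * dzbar j q (x - p.1%:C%C *: p.2)) @ (t, u) -->
   pker u * (u 0 j)^* * dzbar j q (x - t%:C%C *: u).
  apply:cvg_mulC; last by apply:joint_affine; exact:sm_dzb.
  apply:(@cvg_snd_cts R n R (fun u => pker u * (u 0 j)^*)); apply:cts_mul; first exact:cp.
  apply:cts_conj; exact:cts_coord.
 exact:cvg_addC H2.
Qed.
Lemma Lam_int_cts g j x (T : R) : smooth setT g ->
 continuous (fun t : R => icn (fun u => pker u * u 0 j * g (x - t%:C%C *: u))).
move=> sg t; have bI := @int_ccfun R n _ rd0.
have H1 : \forall s \near t, Cc rd (fun u => pker u * u 0 j * g (x - s%:C%C *: u)).
 apply:(@filterE _ (nbhs t) (nbhs_filter t)) => s; apply:Cc_mull.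
  apply:Cc_mull pker_Cc _ => z; exact:cts_coord.
 move=> z; exact:sm_cont (sm_affine x s sg) I.
have H2 u : Ball rd u -> (fun p : R * E => pker p.2 * p.2 0 j * g (x - p.1%:C%C *: p.2)) @ (t, u) -->
   pker u * u 0 j * g (x - t%:C%C *: u).
 move=> _; apply:cvg_mulC; last exact:joint_affine.
 apply:(@cvg_snd_cts R n R (fun u => pker u * u 0 j)).
 apply:cts_mul; [exact:sm_cont (@pker_sm setT) I|exact:cts_coord].
exact:(@bf_cts R E _ _ _ bI R (fun t u => pker u * u 0 j * g (x - t%:C%C *: u)) t H1 H2).
Qed.
(** This is [avg_isD] integrated from 0 to T; at t = 0 the average is q x because p has integral 1.
    The right side involves q through its dz_j derivatives alone. *)
Lemma homotopy q x (T : R) : 0 <= T -> smooth setT q ->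
 q x - avg q x T = \sum_j 2 * Lam 0 T (fun t => icn (fun u => pker u * u 0 j * dz j q (x - t%:C%C *: u))).
move=> T0 sq; have oT : open (setT : set E) := openT.
have cI j : continuous (fun t : R => icn (fun u => pker u * u 0 j * dz j q (x - t%:C%C *: u))).
 apply:Lam_int_cts => //; exact:sm_dz.
have a0 : avg q x 0 = q x.
 have bI := @int_ccfun R n _ rd0.
 have := bf_Z bI (q x) pker_Cc; rewrite pker_int mulr1 => <-; congr icn.
 by apply/funext=> u; rewrite scale0r subr0 mulrC.
have cL (I : Type) (r : seq I) (G : I -> R -> C) : (forall i, continuous (G i)) -> continuous (fun t => \sum_(i <- r) (-2) * G i t)
  /\ Lam 0 T (fun t => \sum_(i <- r) (-2) * G i t) = \sum_(i <- r) (-2) * Lam 0 T (G i).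
 move=> Gc; elim:r => [|i r [IH1 IH2]].
  rewrite (_ : (fun t => _) = fun=> 0); last by apply/funext=> t; rewrite big_nil.
  rewrite Lam0 big_nil; split=> // t; exact:cvg_cst.
 rewrite (_ : (fun t => _) = fun t => -2 * G i t + \sum_(i <- r) (-2) * G i t); last by apply/funext=> t; rewrite big_cons.
 split; first exact:(@cts_lin_top R R (G i) _ (-2) (Gc i) IH1).
 by rewrite (@Lam_lin R (-2) _ _ 0 T (Gc i) IH1) big_cons IH2.
have [c1 c2] := cL 'I_n (index_enum 'I_n) _ cI.
rewrite -a0 -[LHS]opprK opprB -(Lam_FTC T0 c1) => [|t _]; last exact:avg_isD.
by rewrite c2 -sumrN; apply:eq_bigr=> j; rewrite mulNr opprK.
Qed.
(* Complex conjugate of the previous identity *)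
Lemma homotopy_hol q x (T : R) : 0 <= T -> smooth setT q ->
 (forall t u j, 0 <= t <= T -> rn u <= rd -> dzbar j q (x - t%:C%C *: u) = 0) -> q x = avg q x T.
move=> T0 sq q0; apply/eqP; rewrite -subr_eq0; rewrite homotopy // big1 // => j _.
rewrite (_ : Lam _ _ _ = 0) ?mulr0 // -(Lam0 0 T); apply:Lam_eq => t ht.
rewrite -radial_swap // (_ : (fun u => _) = fun=> 0); first exact:bf_0 (@int_ccfun R n _ rd0).
apply/funext=> u; have [h|h] := leP rd (rn u); first by rewrite pker_rad // !mul0r.
by rewrite q0 ?mulr0 // ltW.
Qed.
End Homotopy.

(** * Goursat's theorem for squares *)

Section Goursat.
Variable R : realType.
Local Notation C := R[i].
Implicit Types (g : C -> C) (p w c : C) (s t : R).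
Lemma line_ctsC g p c : continuous g -> continuous (fun t : R => g (p + c * t%:C%C)).
move=> gc t; apply/(@cvgC_P R _ (nbhs t) (nbhs_filter t)) => e e0.
have /cvgC_P /(_ e e0)/nbhsC_P[d d0 Hd] := gc (p + c * t%:C%C).
have k0 : 0 < cn c + 1 by have := cn_ge0 c; lra.
apply/nbhs_ballP; exists (d / (cn c + 1)) => /=; first by rewrite divr_gt0.
move=> r; rewrite /ball /= ltr_pdivlMr // distrC => hr; apply:Hd.
have -> : p + c * r%:C%C - (p + c * t%:C%C) = (r - t)%:C%C * c.
 ring.
rewrite cnZ; have := normr_ge0 (r - t); lra.
Qed.
Lemma Lam_cst s c : 0 <= s -> Lam 0 s (fun=> c) = s%:C%C * c.
move=> s0; have cc : continuous (fun _ : R => c) by move=> t; exact:@cvg_cst.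
rewrite (Lam_FTC (F := fun t => c * t%:C%C + 0) s0 cc) => [|t _].
 ring.
apply:isD1_eq (isD1_lin c (isD1_id t) (isD1_cst 0 t)) _; ring.
Qed.
Lemma Lam_dist (f : R -> C) s c (M : R) : 0 <= s -> continuous f ->
 (forall t, 0 <= t <= s -> cn (f t - c) <= M) -> cn (Lam 0 s f - s%:C%C * c) <= 2 * M * s.
move=> s0 fc H; have cc : continuous (fun _ : R => c) by move=> t; exact:@cvg_cst.
have cd := @cts_lin_top R R _ _ (-1) cc fc.
have -> : Lam 0 s f - s%:C%C * c = Lam 0 s (fun t => -1 * c + f t).
 rewrite (@Lam_lin R (-1) _ _ 0 s cc fc) Lam_cst //; ring.
have LB := @Lam_bound R _ 0 s M s0 cd; rewrite subr0 in LB; apply:LB => t /H.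
by rewrite mulN1r addrC.
Qed.
Definition hseg g p s := Lam 0 s (fun t => g (p + t%:C%C)).
Definition vseg g p s := Lam 0 s (fun t => g (p + 'i%C * t%:C%C)).
(* The counterclockwise integral over the boundary of the square with lower left corner p and side s *)
Definition square_int g p s : C :=
 hseg g p s - hseg g (p + 'i%C * s%:C%C) s + 'i%C * (vseg g (p + s%:C%C) s - vseg g p s).
Lemma hcts g p : continuous g -> continuous (fun t : R => g (p + t%:C%C)).
move=> gc; have := @line_ctsC g p 1 gc.
by rewrite (_ : (fun t : R => g (p + 1 * t%:C%C)) = fun t : R => g (p + t%:C%C)) //; apply/funext=> t; rewrite mul1r.
Qed.
Lemma Lam_sub (f h : R -> C) s : continuous f -> continuous h ->
 Lam 0 s f - Lam 0 s h = Lam 0 s (fun t => -1 * h t + f t).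
move=> fc hc; rewrite (@Lam_lin R (-1) h f 0 s hc fc); ring. Qed.
Definition in_square p s w := (complex.Re p <= complex.Re w <= complex.Re p + s) /\
 (complex.Im p <= complex.Im w <= complex.Im p + s).
(** For an affine integrand only the coefficient of conj(w) survives, with weight 2 i times the
    area. With ga = 0 this is the estimate for Goursat's theorem; with ga a dzbar derivative it
    recovers that derivative from vanishing integrals. *)
Lemma square_est g p s al be ga (M : R) : 0 <= s -> continuous g ->
 (forall w, in_square 0 s w -> cn (g (p + w) - (al + be * w + ga * w^*)) <= M) ->
 cn (square_int g p s - 2 * 'i%C * (s ^+ 2)%:C%C * ga) <= 8 * M * s.
move=> s0 gc H.
have c1 := @hcts g p gc; have c2 := @hcts g (p + 'i%C * s%:C%C) gc.
have c3 := @line_ctsC g (p + s%:C%C) 'i%C gc; have c4 := @line_ctsC g p 'i%C gc.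
have E1 := Lam_sub s c1 c2; have E2 := Lam_sub s c3 c4.
have cA := @cts_lin_top R R _ _ (-1) c2 c1; have cB := @cts_lin_top R R _ _ (-1) c4 c3.
(* The affine function differs by a constant between opposite sides: k1 between bottom and top, k2
   between right and left. The sum s k1 + i s k2 is 2 i s^2 ga. *)
pose k1 := - be * 'i%C * s%:C%C + ga * 'i%C * s%:C%C.
pose k2 := be * s%:C%C + ga * s%:C%C.
have cjr (x : R) : (x%:C%C)^* = x%:C%C :> C := conj_real x.
have B1 t : 0 <= t <= s -> cn (-1 * g (p + 'i%C * s%:C%C + t%:C%C) + g (p + t%:C%C) - k1) <= M + M.
 move=> /andP[t0 ts].
 have h1 : cn (g (p + t%:C%C) - (al + be * t%:C%C + ga * (t%:C%C)^*)) <= M.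
  apply:H; split=> /=; lra.
 have h2 : cn (g (p + ('i%C * s%:C%C + t%:C%C)) - (al + be * ('i%C * s%:C%C + t%:C%C) + ga * ('i%C * s%:C%C + t%:C%C)^*)) <= M.
  apply:H; split=> /=; lra.
 apply:le_trans (_ : _ <= cn (g (p + t%:C%C) - (al + be * t%:C%C + ga * (t%:C%C)^*) -
  (g (p + ('i%C * s%:C%C + t%:C%C)) - (al + be * ('i%C * s%:C%C + t%:C%C) + ga * ('i%C * s%:C%C + t%:C%C)^*)))) _.
  rewrite le_eqVlt; apply/orP; left; apply/eqP; congr cn.
  rewrite cjD cjM cj_i !cjr addrA /k1; ring.
 apply:le_trans (cnB _ _) _; exact:lerD.
have B2 t : 0 <= t <= s -> cn (-1 * g (p + 'i%C * t%:C%C) + g (p + s%:C%C + 'i%C * t%:C%C) - k2) <= M + M.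
 move=> /andP[t0 ts].
 have h1 : cn (g (p + 'i%C * t%:C%C) - (al + be * ('i%C * t%:C%C) + ga * ('i%C * t%:C%C)^*)) <= M.
  apply:H; split=> /=; lra.
 have h2 : cn (g (p + (s%:C%C + 'i%C * t%:C%C)) - (al + be * (s%:C%C + 'i%C * t%:C%C) + ga * (s%:C%C + 'i%C * t%:C%C)^*)) <= M.
  apply:H; split=> /=; lra.
 apply:le_trans (_ : _ <= cn (g (p + (s%:C%C + 'i%C * t%:C%C)) - (al + be * (s%:C%C + 'i%C * t%:C%C) + ga * (s%:C%C + 'i%C * t%:C%C)^*)
  - (g (p + 'i%C * t%:C%C) - (al + be * ('i%C * t%:C%C) + ga * ('i%C * t%:C%C)^*)))) _.
  rewrite le_eqVlt; apply/orP; left; apply/eqP; congr cn.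
  rewrite cjD cjr addrA /k2; ring.
 apply:le_trans (cnB _ _) _; exact:lerD.
have D1 := Lam_dist s0 cA B1; have D2 := Lam_dist s0 cB B2.
rewrite /square_int E1 E2.
set X := Lam _ _ _ in D1 *; set Y := Lam _ _ _ in D2 *.
have -> : X + 'i%C * Y - 2 * 'i%C * (s ^+ 2)%:C%C * ga = (X - s%:C%C * k1) + 'i%C * (Y - s%:C%C * k2).
 rewrite /k1 /k2; ring.
have h3 := cnD (X - s%:C%C * k1) ('i%C * (Y - s%:C%C * k2)).
have h4 := cnM 'i%C (Y - s%:C%C * k2); rewrite cni mul1r in h4.
by lra.
Qed.
Lemma seg_double (f : R -> C) (h : R) : 0 <= h -> continuous f ->
 Lam 0 (h + h) f = Lam 0 h f + Lam 0 h (fun t => f (t + h)).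
move=> h0 fc; have hh : h <= h + h by lra.
by rewrite (Lam_split h0 hh fc) (Lam_shift h h0 fc) add0r.
Qed.
Lemma square_split g p (h : R) : 0 <= h -> continuous g -> square_int g p (h + h) =
 square_int g p h + square_int g (p + h%:C%C) h + square_int g (p + 'i%C * h%:C%C) h +
 square_int g (p + h%:C%C + 'i%C * h%:C%C) h.
move=> h0 gc.
have H q : hseg g q (h + h) = hseg g q h + hseg g (q + h%:C%C) h.
 rewrite /hseg (seg_double h0 (@hcts g q gc)); congr (_ + Lam _ _ _); apply/funext=> t; congr g.
 ring.
have V q : vseg g q (h + h) = vseg g q h + vseg g (q + 'i%C * h%:C%C) h.
 rewrite /vseg (seg_double h0 (@line_ctsC g q 'i%C gc)); congr (_ + Lam _ _ _); apply/funext=> t; congr g.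
 ring.
rewrite /square_int !H !V rmorphD.
rewrite !mulrDr !addrA.
have A1 : p + h%:C%C + 'i%C * h%:C%C = p + 'i%C * h%:C%C + h%:C%C by ring.
have A2 : p + 'i%C * h%:C%C + 'i%C * h%:C%C + h%:C%C = p + 'i%C * h%:C%C + h%:C%C + 'i%C * h%:C%C by ring.
have A3 : p + h%:C%C + h%:C%C + 'i%C * h%:C%C = p + 'i%C * h%:C%C + h%:C%C + h%:C%C by ring.
rewrite A1 A2 A3; ring.
Qed.
(** Repeated quartering: at each stage some quarter carries at least a fourth of the integral. The
    nested squares shrink to a point where g is differentiable, and there the integral is o(side^2),
    too small against the factor 4^k. *)
Lemma goursat g p0 (s0 : R) : 0 < s0 -> continuous g ->
 (forall w, in_square p0 s0 w -> exists l, forall e : R, 0 < e -> exists2 d : R, 0 < d &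
   forall v, cn v < d -> cn (g (w + v) - g w - v * l) <= e * cn v) ->
 square_int g p0 s0 = 0.
move=> s00 gc gD.
(* A square is coded by its lower left corner and its side; b is a square of half the side inside a
   that carries at least a quarter of the integral. *)
pose inv (a b : C * R) := [/\ b.2 = a.2 / 2, cn (square_int g a.1 a.2) <= 4 * cn (square_int g b.1 b.2)
 , complex.Re a.1 <= complex.Re b.1, complex.Re b.1 + b.2 <= complex.Re a.1 + a.2
 & complex.Im a.1 <= complex.Im b.1 /\ complex.Im b.1 + b.2 <= complex.Im a.1 + a.2].
have step (a : C * R) : exists b, 0 < a.2 -> inv a b.
 have [a0|a0] := ltP 0 a.2; last by exists a.
 pose h := a.2 / 2; have h0 : 0 <= h by rewrite /h; lra.
 have hE : h + h = a.2 by rewrite /h -splitr.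
 have mk (q : C) (u v : R) : complex.Re q = complex.Re a.1 + u -> complex.Im q = complex.Im a.1 + v ->
   (u = 0 \/ u = h) -> (v = 0 \/ v = h) -> cn (square_int g a.1 a.2) <= 4 * cn (square_int g q h) ->
   exists b, true -> inv a b.
  move=> q1 q2 uu vv hq; exists (q, h) => _; rewrite /inv /= q1 q2; move: (complex.Re a.1) (complex.Im a.1) => a1 a2.
  by clear - hq h0 hE uu vv; split=> //; [case:uu => ->; lra|case:uu => ->; lra|split; case:vv => ->; lra].
 have E := square_split a.1 h0 gc; rewrite -splitr in E.
 set S1 := square_int g a.1 h in E; set S2 := square_int g (a.1 + h%:C%C) h in E.
 set S3 := square_int g (a.1 + 'i%C * h%:C%C) h in E; set S4 := square_int g (_ + _ + _) h in E.
 have B : cn (square_int g a.1 a.2) <= cn S1 + cn S2 + cn S3 + cn S4.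
  rewrite E; have := cnD (S1 + S2 + S3) S4; have := cnD (S1 + S2) S3; have := cnD S1 S2; lra.
 case:(leP (cn (square_int g a.1 a.2)) (4 * cn S1)) => [K1|K1].
  by apply:(mk a.1 0 0) => //; rewrite ?addr0 //; left.
 case:(leP (cn (square_int g a.1 a.2)) (4 * cn S2)) => [K2|K2].
  by apply:(mk (a.1 + h%:C%C) h 0) => //; rewrite ?raddfD ?addr0 //; [right|left].
 case:(leP (cn (square_int g a.1 a.2)) (4 * cn S3)) => [K3|K3].
  apply:(mk (a.1 + 'i%C * h%:C%C) 0 h) => //; try (by [left|right]); rewrite raddfD /=; ring.
 have K4 : cn (square_int g a.1 a.2) <= 4 * cn S4.
  move: (cn S1) (cn S2) (cn S3) (cn S4) (cn _) K1 K2 K3 B => b1 b2 b3 b4 b K1 K2 K3 B.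
  by clear - K1 K2 K3 B; lra.
 apply:(mk (a.1 + h%:C%C + 'i%C * h%:C%C) h h) => //; try (by right); rewrite !raddfD /=; ring.
have [nx nxP] := choice step.
pose P k := iter k nx (p0, s0).
have P2 k : (P k).2 = s0 / 2 ^+ k /\ 0 < (P k).2.
 elim:k => [|k [IH1 IH2]]; first by rewrite /= expr0 divr1.
 have [h1 _ _ _ _] := nxP (P k) IH2; rewrite -/(P k.+1) in h1; rewrite h1 IH1 exprS invfM.
 have h2 : 0 < (2 ^+ k : R) by rewrite exprn_gt0.
 by split; [rewrite mulrCA mulrC|rewrite !divr_gt0].
have PS k : inv (P k) (P k.+1) by apply:nxP; exact:(P2 k).2.
have mono j k : (j <= k)%N -> [/\ complex.Re (P j).1 <= complex.Re (P k).1,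
  complex.Re (P k).1 + (P k).2 <= complex.Re (P j).1 + (P j).2,
  complex.Im (P j).1 <= complex.Im (P k).1 & complex.Im (P k).1 + (P k).2 <= complex.Im (P j).1 + (P j).2].
 move=> /subnK <-; elim:(k - j)%N => [|m [h1 h2 h3 h4]]; first by rewrite add0n.
 by have [_ _ h5 h6 [h7 h8]] := PS (m + j)%N; rewrite addSn; split; lra.
have nest (F : C -> R) : (forall j k, (j <= k)%N -> F (P j).1 <= F (P k).1 /\ F (P k).1 + (P k).2 <= F (P j).1 + (P j).2) ->
  exists x, forall k, F (P k).1 <= x <= F (P k).1 + (P k).2.
 move=> mF; have ub k : ubound (range (fun j => F (P j).1)) (F (P k).1 + (P k).2).
  move=> _ [j _ <-]; have [jk|kj] := leqP j k.
   by have [h1 _] := mF _ _ jk; have := (P2 k).2; lra.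
  by have [_ h1] := mF _ _ (ltnW kj); have := (P2 j).2; lra.
 exists (sup (range (fun j => F (P j).1))) => k; apply/andP; split.
  by apply:ub_le_sup; [exists (F (P 0%N).1 + (P 0%N).2); exact:ub|exists k].
 by apply:ge_sup; [exists (F (P 0%N).1), 0%N|exact:ub].
have [x hx] : exists x, forall k, complex.Re (P k).1 <= x <= complex.Re (P k).1 + (P k).2.
 by apply:nest => j k /mono[].
have [y hy] : exists y, forall k, complex.Im (P k).1 <= y <= complex.Im (P k).1 + (P k).2.
 by apply:nest => j k /mono[].
have [l lD] := gD (x +i* y)%C (conj (hx 0%N) (hy 0%N)).
have grow k : cn (square_int g p0 s0) <= 4 ^+ k * cn (square_int g (P k).1 (P k).2).
 elim:k => [|k IH]; first by rewrite expr0 mul1r.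
 apply:le_trans IH _; have [_ h _ _ _] := PS k.
 by rewrite exprSr -mulrA ler_wpM2l // exprn_ge0.
apply:cn_small => e e0.
(* At stage k the bound is 4^k times 8 (2 e' s) s with s = s0 / 2^k, that is 16 e' s0^2. *)
pose e' := e / (16 * s0 ^+ 2).
have s02 : 0 < 16 * s0 ^+ 2 by rewrite mulr_gt0 // exprn_gt0.
have e'0 : 0 < e' by rewrite divr_gt0.
have [d d0 Hd] := lD e' e'0.
have [k kd] : exists k, (P k).2 * 2 < d.
 have [m mP] : exists m : nat, s0 * 2 / d < m%:R.
  by exists (Num.trunc (s0 * 2 / d)).+1; exact:truncnS_gt.
 exists m; rewrite (P2 m).1 mulrAC ltr_pdivrMr ?exprn_gt0 //.
 rewrite ltr_pdivrMr // in mP; apply:lt_le_trans mP _; rewrite mulrC ler_wpM2l ?(ltW d0) //.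
 by rewrite -natrX ler_nat ltnW // ltn_expl.
have [h1 h2] := (hx k, hy k); move: (P2 k) (grow k) kd h1 h2.
case:(P k) => [p s] /= [sE sp] gk kd h1 h2.
pose v0 := p - (x +i* y)%C.
(* The first-order expansion at the limit point, rewritten with the corner p as origin; v0 is the
   displacement between the two. *)
have EST := @square_est g p s (g (x +i* y)%C + v0 * l) l 0 (e' * (2 * s)) (ltW sp) gc.
rewrite mulr0 subr0 in EST.
have {}EST : cn (square_int g p s) <= 8 * (e' * (2 * s)) * s.
 apply:EST => w [w1 w2].
 have hw : cn (v0 + w) <= 2 * s.
  rewrite cnE /v0; move: h1 h2 w1 w2; case:(p) (w) => [p1 p2] [w1 w2] /=.
  move=> /andP[a1 a2] /andP[a3 a4] /andP[a5 a6] /andP[a7 a8].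
  have : `|p1 - x + w1| <= s by rewrite ler_norml; apply/andP; split; lra.
  have : `|p2 - y + w2| <= s by rewrite ler_norml; apply/andP; split; lra.
  lra.
 have hd : cn (v0 + w) < d by apply:le_lt_trans hw _; rewrite mulrC.
 have := Hd _ hd; have -> : (x +i* y)%C + (v0 + w) = p + w by rewrite /v0; ring.
 move=> h3; apply:le_trans (_ : _ <= e' * cn (v0 + w)) _; last by rewrite ler_wpM2l // ltW.
 apply:le_trans h3; rewrite le_eqVlt; apply/orP; left; apply/eqP; congr cn; ring.
apply:le_trans gk _; apply:le_trans (_ : 4 ^+ k * (8 * (e' * (2 * s)) * s) <= _).
 by rewrite ler_wpM2l // exprn_ge0.
rewrite le_eqVlt; apply/orP; left; apply/eqP; rewrite /e' sE.
have -> : 4 ^+ k = 2 ^+ k * 2 ^+ k :> R by rewrite -exprMn -natrM.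
have k2 : (2 ^+ k : R) != 0 by rewrite gt_eqF // exprn_gt0.
by field; rewrite k2 gt_eqF.
Qed.
Lemma bfun_seg s : 0 <= s -> bfun (`[0, s]%classic : set R) (fun f : R -> C => continuous f) (Lam 0 s).
move=> s0; split.
- exact:segment_compact.
- move=> t; exact:@cvg_cst.
- move=> c f g fc gc; exact:(@cts_lin_top R R f g c fc gc).
- move=> c f g fc gc; exact:@Lam_lin.
exists (2 * s); first by lra.
move=> f M fc fM; rewrite (_ : 2 * s * M = 2 * M * (s - 0)); last by lra.
by apply:@Lam_bound.
Qed.
End Goursat.

(** * Linear changes of variables *)

Section PlaneScaling.
Variable R : realType.
Local Notation C := R[i].
Implicit Types (g : C -> C) (a b w : C) (r k m p q : R).
Lemma CcC_comp g (T : C -> C) r (K : R) : 0 < K -> continuous T -> (forall w, cn w <= K * cn (T w)) ->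
 CcC r g -> CcC (K * r) (fun w => g (T w)).
move=> K0 Tc TK [gc g0]; split=> [w|w h].
 apply:@continuous_comp; [exact:Tc|exact:gc].
by apply:g0; have := le_trans h (TK w); rewrite ler_pM2l.
Qed.
Lemma intR_affine (f : R -> C) r k s : k != 0 -> CcR r f -> `|k|%:C%C * intR (fun t => f (k * t + s)) = intR f.
move=> k0 Cf; rewrite -(intR_shift s Cf).
have Cs : CcR (r + `|s|) (fun t => f (t + s)).
 case:Cf => fc f0; split.
  apply:(@cts_R_comp R f (fun t => t + s) fc) => t; apply:cvgD; [exact:cvg_id|exact:cvg_cst].
 move=> t h; apply:f0; have := ler_normB (t + s) s; rewrite addrK; lra.
exact:intR_scale Cs.
Qed.
Lemma lin_ctsC (T : C -> C) (K : R) : (forall w w', cn (T w - T w') <= K * cn (w - w')) -> continuous T.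
move=> H w; apply/(@cvgC_P R _ (nbhs w) (nbhs_filter w)) => e e0.
apply/nbhsC_P; exists (e / (`|K| + 1)) => [|w' hw]; first by rewrite divr_gt0.
apply:le_lt_trans (H w' w) _; rewrite ltr_pdivlMr // in hw; apply:le_lt_trans hw.
rewrite mulrC ler_wpM2l ?cn_ge0; have := ler_norm K; lra.
Qed.
Definition plane (a b c d : R) (w : C) : C :=
 ((a * complex.Re w + b * complex.Im w) +i* (c * complex.Re w + d * complex.Im w))%C.
Lemma plane_bound (a b c d : R) : exists2 K, 0 < K & forall w, cn (plane a b c d w) <= K * cn w.
exists (1 + (`|a| + `|b| + `|c| + `|d|)); first by [].
move=> [x y]; rewrite !cnE /= mulrDl mul1r !mulrDl !mulrDr.
have := ler_normD (a * x) (b * y); have := ler_normD (c * x) (d * y); rewrite !normrM.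
have H (p q : R) := mulr_ge0 (normr_ge0 p) (normr_ge0 q).
have := H a y; have := H b x; have := H c y; have := H d x; have := normr_ge0 x; have := normr_ge0 y; lra.
Qed.
Lemma CcC_plane g r (a b c d : R) : a * d - b * c != 0 -> 0 <= r -> CcC r g ->
 exists2 r', 0 <= r' & CcC r' (fun w => g (plane a b c d w)).
set D := a * d - b * c => D0 r0 Cg; have [K K0 HK] := plane_bound a b c d.
have [K' K'0 HK'] := plane_bound (d / D) (- b / D) (- c / D) (a / D).
exists (K' * r); first by nra.
apply:CcC_comp Cg => //.
 apply:(@lin_ctsC _ K) => w w'; apply:le_trans (HK _); rewrite le_eqVlt; apply/orP; left; apply/eqP.
 rewrite !cnE /=; congr (_ + _); congr `|_|; ring.
move=> w; have {1}-> : w = plane (d / D) (- b / D) (- c / D) (a / D) (plane a b c d w); last exact:HK'.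
case:w => x y; apply/eqP; rewrite eq_complex /=; apply/andP.
by split; apply/eqP; rewrite /D; field.
Qed.
(** A real linear map of the plane is a product of maps fixing the first coordinate ([sh], a
    one-variable substitution on each slice) and of coordinate swaps ([sw], Fubini). When a = 0 one
    further swap moves the nonzero entry b to the corner. *)
Lemma int_plane g r (a b c d : R) : a * d - b * c != 0 -> 0 <= r -> CcC r g ->
 `|a * d - b * c|%:C%C * integral_C (fun w => g (plane a b c d w)) = integral_C g.
have sh f s k m : m != 0 -> 0 <= s -> CcC s f -> `|m|%:C%C * integral_C (fun w => f (plane 1 0 k m w)) = integral_C f.
 move=> m0 s0 Cf; have [s' s'0 CT] : exists2 s', 0 <= s' & CcC s' (fun w => f (plane 1 0 k m w)).
  by apply:CcC_plane Cf; rewrite // mul1r mul0r subr0.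
 rewrite (intC_intR s'0 CT).1 (intC_intR s0 Cf).1.
 have [I1 _] := CcC_int s'0 CT; have [S1 _] := CcC_slice Cf.
 rewrite -(bf_Z (bfun_R s'0) _ I1); congr intR; apply/funext=> x.
 rewrite -(intR_affine (k * x) m0 (S1 x)); congr (_ * intR _); apply/funext=> y.
 by rewrite /plane mul1r mul0r addr0 addrC.
have n1 : (0 * 0 - 1 * 1 : R) != 0 by [].
have sw f s : 0 <= s -> CcC s f -> integral_C (fun w => f (plane 0 1 1 0 w)) = integral_C f.
 move=> s0 Cf; have [s' s'0 CT] := CcC_plane n1 s0 Cf.
 rewrite (intC_intR s'0 CT).1 (intC_intR s0 Cf).2; congr intR; apply/funext=> y.
 by congr intR; apply/funext=> x; rewrite /plane !mul0r !mul1r addr0 add0r.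
have main f s k l m o : k != 0 -> k * o - l * m != 0 -> 0 <= s -> CcC s f ->
  `|k * o - l * m|%:C%C * integral_C (fun w => f (plane k l m o w)) = integral_C f.
 move=> k0 D0 s0 Cf; have d0 : (k * o - l * m) / k != 0 by rewrite mulf_neq0 ?invr_eq0.
 rewrite -(sh f s (m / k) _ d0 s0 Cf); set d' := (k * o - l * m) / k in d0 *.
 have [s1 s10 C1] : exists2 s1, 0 <= s1 & CcC s1 (fun w => f (plane 1 0 (m / k) d' w)).
  by apply:CcC_plane Cf; rewrite // mul1r mul0r subr0.
 have [s2 s20 C2] := CcC_plane n1 s10 C1; rewrite -(sw _ _ s10 C1) -(sh _ _ l _ k0 s20 C2).
 have [s3 s30 C3] : exists2 s3, 0 <= s3 & CcC s3 (fun w => f (plane 1 0 (m / k) d' (plane 0 1 1 0 (plane 1 0 l k w)))).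
  by apply:(CcC_plane _ s20 C2); rewrite mul1r mul0r subr0.
 rewrite -(sw _ _ s30 C3) mulrA -rmorphM -normrM /d' divfK //; congr (_ * integral_C _); apply/funext=> -[x y].
 by congr f; apply:complex_ext => /=; field.
move=> D0 r0 Cg; have [a0|a0] := eqVneq a 0; last exact:(main g r).
have b0 : b != 0 by nra.
have D1 : b * c - 0 * d != 0 by nra.
have [s s0 Cs] := CcC_plane D1 r0 Cg.
rewrite -(main _ _ b 0 d c b0 D1 r0 Cg) -(sw _ _ s0 Cs).
rewrite a0 mul0r sub0r subr0 normrN; congr (_ * integral_C _); apply/funext=> -[x y].
congr g; apply:complex_ext => /=; ring.
Qed.
(** Multiplication by a = p + i q is a real linear map of the plane with determinant p^2 + q^2. *)
Lemma intC_scale g r a : 0 <= r -> a != 0 -> CcC r g ->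
 a * a^* * integral_C (fun z => g (a * z)) = integral_C g.
case:a => p q r0 a0 Cg; have D : 0 < p * p - - q * q.
 by rewrite mulNr opprK lt_def addr_ge0 ?sqr_ge0 // andbT paddr_eq0 ?sqr_ge0 // !sqrf_eq0; move: a0; rewrite eq_complex.
rewrite -(int_plane (lt0r_neq0 D) r0 Cg) gtr0_norm //; congr (_ * integral_C _).
 apply:complex_ext => /=; ring.
apply/funext=> -[x y]; congr g; apply:complex_ext => /=; ring.
Qed.
End PlaneScaling.

Section LinearChange.
Variable R : realType.
Local Notation C := R[i].
Lemma rn_mulmx n m (M : 'M[C]_(n, m)) : exists2 K : R, 0 < K & forall v, rn (v *m M) <= K * rn v.
exists (1 + \sum_a \sum_b cn (M a b)).
 rewrite ltr_wpDr // sumr_ge0 // => a; rewrite sumr_ge0 // => b _; exact:cn_ge0.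
move=> v; rewrite mulrDl mul1r; apply:le_trans (_ : (\sum_a \sum_b cn (M a b)) * rn v <= _); last first.
 by rewrite lerDr rn_ge0.
rewrite rnE exchange_big mulr_suml; apply:ler_sum => b _; rewrite mxE.
apply:le_trans (cn_sum _ _ _) _; rewrite mulr_suml; apply:ler_sum => a _.
by apply:le_trans (cnM _ _) _; rewrite mulrC ler_wpM2l ?cn_ge0 // rn_coord.
Qed.
Lemma Cc_mulmx n (M : 'M[C]_n) r f : M \in unitmx -> 0 <= r -> Cc r f ->
 exists2 r', 0 <= r' & Cc r' (fun v : 'rV[C]_n => f (v *m M)).
move=> Mu r0 [fc f0]; have [K K0 HK] := rn_mulmx M; have [K' K'0 HK'] := rn_mulmx (invmx M).
exists (K' * r); first by nra.
split=> [v e e0|v h].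
 have [d d0 Hd] := fc (v *m M) e e0; exists (d / K); first by rewrite divr_gt0.
 move=> w; rewrite ltr_pdivlMr // => hw; apply:Hd; rewrite -mulmxBl.
 by apply:le_lt_trans (HK _) _; rewrite mulrC.
apply:f0; have := HK' (v *m M); rewrite mulmxK // => h1.
nra.
Qed.
(** The substitution rule for a complex linear map: as a real map, M has determinant |det M|^2. *)
Definition covp n (M : 'M[C]_n) := forall (r : R) f, 0 <= r -> Cc r f ->
 \det M * (\det M)^* * icn (fun v => f (v *m M)) = icn f.
Lemma covp_mul n (M N : 'M[C]_n) : N \in unitmx -> covp M -> covp N -> covp (M *m N).
move=> Nu cM cN r f r0 Cf; have [r' r'0 C'] := Cc_mulmx Nu r0 Cf.
rewrite -(cN r f r0 Cf) -(cM r' _ r'0 C') det_mulmx cjM.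
rewrite (_ : icn (fun v => f (v *m (M *m N))) = icn (fun v => f (v *m M *m N))); first by ring.
by congr icn; apply/funext=> v; rewrite mulmxA.
Qed.
Variable m : nat.
Implicit Types (a : C) (b : 'rV[C]_m) (c : 'cV[C]_m) (D : 'M[C]_m).
Definition blk a b c D : 'M[C]_m.+1 := block_mx (a%:M : 'M[C]_1) b c D.
Lemma blk_mul a b c D z v : ccons z v *m blk a b c D = ccons (z * a + (v *m c) 0 0) (z *: b + v *m D).
have E1 : (z%:M : 'M[C]_1) *m a%:M + v *m c = (z * a + (v *m c) 0 0)%:M.
 by rewrite -scalar_mxM raddfD /= -mx11_scalar.
have E2 : (z%:M : 'M[C]_1) *m b + v *m D = z *: b + v *m D by rewrite mul_scalar_mx.
rewrite /ccons -E1 -E2; exact:(@mul_row_block C 1 1 m 1 m z%:M v a%:M b c D).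
Qed.
Lemma blk_mulb a b c D a' b' c' D' : blk a b c D *m blk a' b' c' D' =
 blk (a * a' + (b *m c') 0 0) (a *: b' + b *m D') (a' *: c + D *m c') (c *m b' + D *m D').
have E1 : (a%:M : 'M[C]_1) *m a'%:M + b *m c' = (a * a' + (b *m c') 0 0)%:M.
 by rewrite -scalar_mxM raddfD /= -mx11_scalar.
have E2 : (a%:M : 'M[C]_1) *m b' + b *m D' = a *: b' + b *m D' by rewrite mul_scalar_mx.
have E3 : c *m (a'%:M : 'M[C]_1) + D *m c' = a' *: c + D *m c' by rewrite mul_mx_scalar.
rewrite /blk -E1 -E2 -E3; exact:(@mulmx_block C 1 m 1 m 1 m a%:M b c D a'%:M b' c' D').
Qed.
Lemma blk_det0 a b D : \det (blk a b 0 D) = a * \det D.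
by rewrite (@det_ublock _ 1 m) det_scalar1. Qed.
Lemma blk_det1 a c D : \det (blk a 0 c D) = a * \det D.
by rewrite (@det_lblock _ 1 m) det_scalar1. Qed.
(** The shear moves the first coordinate by an amount depending on the others, while the iterated
    integral has the first coordinate outermost. Fubini brings it innermost, where translation
    invariance applies. *)
Lemma covp_lower c : covp (blk 1 0 c 1%:M).
move=> r f r0 Cf; have Mu : blk 1 0 c 1%:M \in unitmx by rewrite unitmxE blk_det1 det1 mulr1 unitr1.
rewrite blk_det1 det1 mulr1 cj1 !mul1r.
have [r1' r1'0 C1'] := Cc_mulmx Mu r0 Cf; pose r1 := r1' + r.
have C1 := Cc_le (ler_wpDr r0 (lexx r1')) C1'; have r10 : 0 <= r1 by rewrite addr_ge0.
have Cf1 : Cc r1 f by apply:Cc_le Cf; rewrite lerDr.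
have bC := bfun_C r10; have bI := @int_ccfun R m.
have sw (h : 'rV[C]_m.+1 -> C) : Cc r1 h -> icn h = icn (fun v : 'rV[C]_m => integral_C (fun z => h (ccons z v)))
  /\ forall v : 'rV[C]_m, CcC r1 (fun z => h (ccons z v)).
 move=> Ch; have Sl v : CcC r1 (fun z => h (ccons z v)).
  split=> [z|z hz]; last by apply:Ch.2; rewrite rn_ccons; have := rn_ge0 v; lra.
  exact:(@joint_l R C _ (fun z v => h (ccons z v)) z v (cts_ccons (Ch.1 _))).
 split=> //; rewrite int_CnS.
 have jc z v : (fun p : C * 'rV[C]_m => h (ccons p.1 p.2)) @ (z, v) --> h (ccons z v) by apply:cts_ccons; exact:Ch.1.
 have h0 z v : r1 <= rn v -> h (ccons z v) = 0.
  move=> hv; apply:Ch.2; rewrite rn_ccons; have := cn_ge0 z; lra.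
 have [] // := fub_joint bC r10 jc.
 move=> f' fc f0; split=> // z hz; apply:f0; apply/funext=> v.
 apply:Ch.2; rewrite rn_ccons; have := rn_ge0 v; lra.
rewrite (sw _ C1).1 (sw _ Cf1).1; congr icn; apply/funext=> v.
rewrite -(intC_shift ((v *m c) 0 0) r10 ((sw _ Cf1).2 v)); congr integral_C; apply/funext=> z.
by rewrite blk_mul mulr1 scaler0 add0r mulmx1.
Qed.
Lemma covp_scale a : a != 0 -> covp (blk a 0 0 1%:M).
move=> a0 r f r0 Cf; rewrite blk_det1 det1 mulr1 !int_CnS.
rewrite -(intC_scale r0 a0 (int_slice r0 (@int_ccfun R m) Cf)).
congr (_ * integral_C _); apply/funext=> z; congr icn; apply/funext=> v.
by rewrite blk_mul mulmx0 mxE addr0 scaler0 add0r mulmx1 mulrC.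
Qed.
Lemma covp_upper b D : D \in unitmx -> covp D -> covp (blk 1 b 0 D).
move=> Du cD r f r0 Cf; rewrite blk_det0 mul1r.
have Mu : blk 1 b 0 D \in unitmx by rewrite unitmxE blk_det0 mul1r.
have [r1 r10 C1] := Cc_mulmx Mu r0 Cf.
rewrite !int_CnS -(bf_Z (bfun_C r10) _ (int_slice r10 (@int_ccfun R m) C1)).
congr integral_C; apply/funext=> z.
have Cz := Cc_slice z Cf; have rb : 0 <= r + rn (z *: b) by rewrite addr_ge0 // rn_ge0.
rewrite -(int_shift (z *: b) r0 Cz) -(cD _ _ rb (Cc_shift (z *: b) Cz)).
congr (_ * icn _); apply/funext=> v.
by rewrite blk_mul mulmx0 mxE addr0 mulr1 addrC.
Qed.
End LinearChange.
(** Block elimination by induction on the dimension, with the Schur complement as smaller matrix. If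
    the corner entry vanishes, invertibility provides a nonzero entry in the first row, and the
    shear [S] adds its column to the first one. *)
Lemma linear_change (R : realType) n (M : 'M[R[i]]_n) : M \in unitmx -> covp M.
elim:n M => [|m IH] M Mu.
 move=> r f r0 Cf; by rewrite det_mx00 cj1 !mul1r; congr f; apply/rowP=> -[].
have nzcase (a : R[i]) b c D : a != 0 -> blk a b c D \in unitmx -> covp (@blk R m a b c D).
 move=> a0; set D' := D - a^-1 *: (c *m b).
 have E : blk a b c D = blk 1 0 (a^-1 *: c) 1%:M *m (blk a 0 0 1%:M *m blk 1 (a^-1 *: b) 0 D').
  rewrite !blk_mulb !mul0mx !mul1mx scaler0 mxE !addr0 add0r mul1r mulr1 scale1r.
 by rewrite !scalerA divff // !scale1r -scalemxAl addrC subrK.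
 rewrite E; rewrite !unitmx_mul => /andP[_ /andP[u1 u2]].
 apply:covp_mul; [by rewrite unitmx_mul u1|exact:covp_lower|].
 apply:covp_mul => //; first exact:covp_scale.
 have uD : D' \in unitmx by move: u2; rewrite unitmxE blk_det0 mul1r.
 apply:covp_upper => //; exact:IH.
have ME : M = blk (M 0 0) (ursubmx (M : 'M[R[i]]_(1 + m))) (dlsubmx (M : 'M[R[i]]_(1 + m))) (drsubmx (M : 'M[R[i]]_(1 + m))).
 rewrite /blk; have <- : @ulsubmx _ 1 m 1 m M = (M 0 0)%:M; last by rewrite (@submxK _ 1 m 1 m M).
 apply/matrixP=> i j; rewrite !ord1 !mxE; congr (M _ _); exact/val_inj.
have [a0|a0] := eqVneq (M 0 0) 0; last by rewrite ME; apply:nzcase=> //; rewrite -ME.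
set b := ursubmx _ in ME; set c := dlsubmx _ in ME; set D := drsubmx _ in ME.
have [j bj] : exists j, b 0 j != 0.
 apply/existsP; apply:contraLR Mu; rewrite negb_exists => /forallP b0.
 have -> : M = blk 0 0 c D.
  have b00 : b = 0 by apply/rowP=> j; rewrite [RHS]mxE; apply/eqP; have := b0 j; rewrite negbK.
  by etransitivity; [exact:ME|rewrite a0 b00].
 by rewrite unitmxE blk_det1 mul0r unitr0.
pose S : 'M[R[i]]_m.+1 := blk 1 0 (delta_mx j 0) 1%:M; pose S' : 'M[R[i]]_m.+1 := blk 1 0 (- delta_mx j 0) 1%:M.
have SS : S *m S' = 1%:M.
 rewrite blk_mulb !mul0mx mulmx0 !mul1mx scaler0 mxE !addr0 mulr1 scale1r subrr add0r.
 by rewrite /blk -(@scalar_mx_block _ 1 m 1).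
have Su : S \in unitmx by rewrite unitmxE blk_det1 det1 mulr1 unitr1.
have S'u : S' \in unitmx by rewrite unitmxE blk_det1 det1 mulr1 unitr1.
have -> : M = (M *m S) *m S' by rewrite -mulmxA SS mulmx1.
apply:covp_mul => //; last exact:covp_lower.
have MS : M *m S = blk (b 0 j) b (c + D *m delta_mx j 0) D.
 rewrite {1}ME a0 blk_mulb mulmx0 scaler0 !mulmx1 mul0r !add0r scale1r; congr blk.
 rewrite mxE (bigD1 j) //= big1 => [|k kj]; first by rewrite !mxE eqxx mulr1 addr0.
 by rewrite !mxE (negbTE kj) mulr0.
have MSu : M *m S \in unitmx by rewrite unitmx_mul Mu.
rewrite MS in MSu *; exact:nzcase.
Qed.
Lemma int_scale (R : realType) n (k : R) (r : R) (f : 'rV[R[i]]_n -> R[i]) : k != 0 -> 0 <= r -> Cc r f ->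
 (k ^+ (2 * n))%:C%C * icn (fun v => f (k%:C%C *: v)) = icn f.
move=> k0 r0 Cf; have kC : k%:C%C != 0 :> R[i] by rewrite fmorph_eq0.
have u : ((k%:C%C)%:M : 'M[R[i]]_n) \in unitmx by rewrite unitmxE det_scalar unitfE expf_neq0.
have := linear_change u r0 Cf; rewrite det_scalar => <-; congr (_ * _).
 by rewrite -rmorphXn conj_real -rmorphM -exprD addnn mul2n.
by congr icn; apply/funext=> v; rewrite mul_mx_scalar.
Qed.

(** * Mollification, and smoothness of complex differentiable functions *)

Section Mollify.
Variables (R : realType) (n : nat).
Local Notation C := R[i].
Local Notation E := 'rV[C]_n.
Implicit Types (f q : E -> C) (u v x y z : E) (s t T r e : R).
Local Notation rd := (rad R n).
Let rd0 : 0 <= rd := ltW (rad_gt0 R n).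
Let bI := @int_ccfun R n _ rd0.
Definition pkerT T y := pker (T^-1%:C%C *: y).
Lemma pkerT_sm T : smooth setT (pkerT T).
have := sm_affine 0 (- T^-1) (@pker_sm R n setT).
rewrite (_ : (fun u => _) = pkerT T) //; apply/funext=> u; congr pker.
by rewrite rmorphN scaleNr opprK add0r.
Qed.
Lemma pkerT_Cc T : 0 < T -> Cc (rd * T) (pkerT T).
move=> T0; split=> [z|z h]; first exact:sm_cont (pkerT_sm T) I.
by apply:pker_rad; rewrite rnZ gtr0_norm ?invr_gt0 // mulrC ler_pdivlMr.
Qed.
Lemma sm_reflect q x : smooth setT q -> smooth setT (fun u : E => q (x - u)).
move=> sq; have E1 : (fun u => q (x - u)) = (fun u => q (x - 1%:C%C *: u)).
 by apply/funext=> u; rewrite scale1r.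
rewrite E1; exact:sm_affine.
Qed.
Lemma cn_trans3 (a b c d : C) (k1 k2 : R) : a = b -> cn (a - c) <= k1 -> cn (b - d) <= k2 -> cn (c - d) <= k2 + k1.
move=> <- h1 h2; have -> : c - d = (a - d) - (a - c) by ring.
apply:le_trans (cnB _ _) _; exact:lerD.
Qed.
(** The substitution w = x - T u moves x from f into the kernel. Averages of merely continuous
    functions are therefore smooth. *)
Lemma avg_mollify f x T r : 0 <= r -> 0 < T -> Cc r f ->
 avg f x T = (T ^- (2 * n))%:C%C * icn (fun w => f w * pkerT T (x + - w)).
move=> r0 T0 Cf; pose h w := f w * pkerT T (x - w).
have Ch : Cc r h.
 apply:Cc_mull => // z; exact:sm_cont (sm_reflect x (pkerT_sm T)) I.
have nT : - T != 0 by lra.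
have Chx : Cc (r + rn x) (fun w => h (w + x)) by exact:Cc_shift.
have rx : 0 <= r + rn x by rewrite addr_ge0 // rn_ge0.
rewrite -(int_shift x r0 Ch) -(int_scale nT rx Chx) mulrA -rmorphM.
have ET : (- T) ^+ (2 * n) = T ^+ (2 * n) by rewrite !exprM sqrrN.
rewrite ET mulVf ?expf_neq0 ?gt_eqF // mul1r; congr icn; apply/funext=> u.
rewrite /h rmorphN scaleNr [- _ + x]addrC opprB addrCA subrr addr0 /pkerT scalerA -rmorphM mulVf ?gt_eqF //.
by rewrite scale1r mulrC.
Qed.
Lemma avg_sm f T r V : open V -> 0 <= r -> 0 < T -> Cc r f -> smooth V (fun x => avg f x T).
move=> oV r0 T0 Cf; rewrite (_ : (fun x => _) = fun x => (T ^- (2 * n))%:C%C * icn (fun w => f w * pkerT T (x + - w))).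
 2: by apply/funext=> x; exact:(avg_mollify x r0).
apply:sm_mul; first exact:sm_cst.
apply:(@gop_sm R n E (Ball r) (Cc r) (@icn R n) (@int_ccfun R n r r0) (fun q => smooth setT q) f (fun w => - w) V oV).
- move=> w _; apply/ctsP; exact:Cf.1.
- move=> w _; have FF := nbhs_filter w; apply:cvgN; exact:cvg_id.
- by [].
- exact:rD_sm.
- move=> q y sq _; apply:Cc_mull => // z; exact:sm_cont (sm_reflect y sq) I.
- exact:pkerT_sm.
Qed.
Lemma avg_bound : exists2 K : R, 0 <= K & forall q1 q2 x T e, (forall y, cts q1 y) -> (forall y, cts q2 y) ->
 (forall u, rn u <= rd -> cn (q1 (x - T%:C%C *: u) - q2 (x - T%:C%C *: u)) <= e) ->
 cn (avg q1 x T - avg q2 x T) <= K * e.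
have [K K0 HK] := bf_bound bI.
(* A bound for the kernel; 4 ^ 4 is the constant of [beta_flat] for k = 2. *)
pose P := cn (mass R n)^-1 * 4%:R ^+ 4.
have pP (u : E) : cn (pker u) <= P.
 apply:le_trans (cnM _ _) _; rewrite ler_wpM2l ?cn_ge0 // cn_real ger0_norm ?beta_ge0 //.
 have [h|h] := leP (1 - nsq u) 0; first by rewrite beta_eq0.
 apply:le_trans (beta_flat _ _) _; rewrite -[leRHS]mulr1 ler_wpM2l //.
 by apply:exprn_ile1; [exact:ltW|rewrite lerBlDr lerDl nsq_ge0].
have P0 := le_trans (cn_ge0 _) (pP 0).
exists (K * P); first exact:mulr_ge0.
move=> q1 q2 x T e c1 c2 H.
have D1 : Cc rd (fun u => pker u * q1 (x - T%:C%C *: u)) by apply:Cc_mull; [exact:pker_Cc|move=> z; exact:affine_cts].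
have D2 : Cc rd (fun u => pker u * q2 (x - T%:C%C *: u)) by apply:Cc_mull; [exact:pker_Cc|move=> z; exact:affine_cts].
rewrite -(bf_B bI D1 D2) -mulrA; apply:HK; first exact:(bf_DB bI).
move=> u hu; rewrite -mulrBr; apply:le_trans (cnM _ _) _; apply:ler_pM; rewrite ?cn_ge0 //.
exact:H.
Qed.
Lemma avg_cst (c : C) x T : avg (fun=> c) x T = c.
transitivity (icn (fun u : E => c * pker u)); last by rewrite (bf_Z bI c (@pker_Cc R n)) pker_int mulr1.
by congr icn; apply/funext=> u; rewrite mulrC.
Qed.
Lemma avg_unif f r : 0 <= r -> Cc r f -> forall e, 0 < e -> exists2 d : R, 0 < d &
 forall s x, 0 < s -> s < d -> cn (avg f x s - f x) <= e.
move=> r0 Cf e e0; have [K K0 HK] := avg_bound.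
have K1 : 0 < K + 1 by lra.
have e1 : 0 < e / (K + 1) by rewrite divr_gt0.
have cA : compact (Ball (0 : R) : set E) by exact:cpt_Ball.
have Fc : forall (s : E) y, Ball (0 : R) s -> (fun p : E * E => f p.2) @ (s, y) --> f y.
 move=> s y _; apply:cvg_snd_cts; exact:Cf.1.
have [d d0 Hd] := @unif_cts R n E (Ball 0) (fun _ => f) r cA r0 Fc (fun _ => Cf.2) _ e1.
have rd1 := rad_gt0 R n.
exists (d / rd); first by rewrite divr_gt0.
move=> s x s0 sd; have /= H := HK f (fun=> f x) x s (e / (K + 1)) Cf.1 (fun y => @cts_cst R n (f x) y).
rewrite avg_cst in H; apply:le_trans (H _) _ => [u hu|]; last first.
 rewrite mulrA ler_pdivrMr; lra.
apply:(Hd 0); first by rewrite /Ball /= rn0.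
have -> : x - s%:C%C *: u - x = - (s%:C%C *: u) by rewrite addrAC subrr add0r.
rewrite rnN rnZ gtr0_norm //; apply:le_lt_trans (_ : s * rd < _); first by nra.
by rewrite -ltr_pdivlMr.
Qed.
(** Complex differentiability at the single point z, with complex partial derivatives L. Nothing is
    said about their dependence on z. *)
Definition cdiff f z (L : 'I_n -> C) := forall e : R, 0 < e -> exists2 d : R, 0 < d &
 forall w, rn w < d -> cn (f (z + w) - f z - \sum_a w 0 a * L a) <= e * rn w.
Lemma cdiff_isD f z L v : cdiff f z L -> isD f v z (\sum_a v 0 a * L a).
move=> H; apply:isD1_weak; exists (rn v) => e e0 _; have [d d0 Hd] := H e e0.
have k0 : 0 < rn v + 1 by have := rn_ge0 v; lra.
exists (d / (rn v + 1)) => [|h]; first by rewrite divr_gt0.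
rewrite ltr_pdivlMr // => hh; rewrite add0r scale0r addr0.
have := Hd (h%:C%C *: v); rewrite rnZ => /(_ _).
have -> : \sum_a (h%:C%C *: v) 0 a * L a = h%:C%C * \sum_a v 0 a * L a.
 by rewrite mulr_sumr; apply:eq_bigr=> a; rewrite mxE mulrA.
move=> H2; apply:le_trans (H2 _) _; last by lra.
have := normr_ge0 h; lra.
Qed.
Lemma cdiff_cts f z L : cdiff f z L -> cts f z.
move=> H e e0; have [d d0 Hd] := H 1 ltr01.
pose K := 1 + \sum_a cn (L a).
have K0 : 0 < K by rewrite ltr_wpDr // sumr_ge0 // => a _; exact:cn_ge0.
exists (Num.min d (e / K)) => [|w]; first by rewrite lt_min d0 divr_gt0.
rewrite lt_min => /andP[/Hd]; rewrite (_ : z + (w - z) = w); last by rewrite addrC subrK.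
rewrite ltr_pdivlMr // mul1r => h1 h2.
set S := \sum_a _ in h1.
have hS : cn S <= rn (w - z) * \sum_a cn (L a).
 apply:le_trans (cn_sum _ _ _) _; rewrite mulr_sumr; apply:ler_sum => a _.
 by apply:le_trans (cnM _ _) _; rewrite ler_wpM2r ?cn_ge0 // rn_coord.
have -> : f w - f z = (f w - f z - S) + S by ring.
apply:le_lt_trans (cnD _ _) _; apply:le_lt_trans h2; rewrite mulrDr mulr1; exact:lerD.
Qed.
Lemma cdiff_rD f z L v : cdiff f z L -> rD f v z = \sum_a v 0 a * L a.
move=> /(@cdiff_isD f z L v); exact:isD_rD. Qed.
Lemma cdiff_dz f z L a : cdiff f z L -> dz a f z = L a /\ dzbar a f z = 0.
move=> H; rewrite dzE dzbarE !(cdiff_rD _ H).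
have E1 : \sum_b ev R a 0 b * L b = L a.
 rewrite (bigD1 a) //= big1 => [|b ba]; first by rewrite mxE !eqxx mul1r addr0.
 by rewrite mxE (negbTE ba) mul0r.
have E2 : \sum_b iev R a 0 b * L b = 'i%C * L a.
 rewrite (bigD1 a) //= big1 => [|b ba]; first by rewrite !mxE !eqxx mulr1 addr0.
 by rewrite !mxE (negbTE ba) mulr0 mul0r.
rewrite E1 E2 mulrA sqri; split; [by field|by ring].
Qed.
Lemma square_of_segs (g : C -> C) (W : C -> C -> C) (h : R) :
 (forall b c, Lam 0 h (fun t => g (b + c * t%:C%C)) = W b c) ->
 square_int g 0 h = W 0 1 - W (0 + 'i%C * h%:C%C) 1 + 'i%C * (W (0 + h%:C%C) 'i%C - W 0 'i%C).
move=> H; have HS b : hseg g b h = W b 1.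
 by rewrite -H; congr Lam; apply/funext=> t; rewrite mul1r.
by rewrite /square_int !HS /vseg !H.
Qed.
Lemma int_comb0 (A1 A2 A3 A4 : E -> C) (c : C) : Cc rd (fun u => pker u * A1 u) -> Cc rd (fun u => pker u * A2 u) ->
 Cc rd (fun u => pker u * A3 u) -> Cc rd (fun u => pker u * A4 u) ->
 (forall u, rn u <= rd -> A1 u - A2 u + c * (A3 u - A4 u) = 0) ->
 icn (fun u => pker u * A1 u) - icn (fun u => pker u * A2 u)
 + c * (icn (fun u => pker u * A3 u) - icn (fun u => pker u * A4 u)) = 0.
move=> h1 h2 h3 h4 H; have D1 := bf_DB bI h1 h2; have D2 := bf_DB bI h3 h4.
rewrite -(bf_B bI h1 h2) -(bf_B bI h3 h4) addrC -(bf_lin bI c D2 D1) (_ : (fun u => _) = fun=> 0); first exact:bf_0 bI.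
apply/funext=> u; have [hu|hu] := leP rd (rn u); first by rewrite pker_rad // !mul0r subrr mulr0 addr0.
by rewrite -!mulrBr mulrCA -mulrDr addrC H ?mulr0 // ltW.
Qed.
(* Fubini reduces the square integrals of the mollification to those of f, which vanish by Goursat *)
Lemma avg_square f x s a r (h : R) : 0 <= r -> Cc r f -> 0 < h -> 
 (forall u, rn u <= rd -> square_int (fun w => f (x - s%:C%C *: u + w *: ev R a)) 0 h = 0) ->
 square_int (fun w => avg f (x + w *: ev R a) s) 0 h = 0.
move=> r0 Cf h0 H; have h0' := ltW h0.
pose F (b c : C) t u := pker u * f (x - s%:C%C *: u + (b + c * t%:C%C) *: ev R a).
have fc b c t u : (fun p : R * E => f (x - s%:C%C *: p.2 + (b + c * p.1%:C%C) *: ev R a)) @ (t, u) -->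
  f (x - s%:C%C *: u + (b + c * t%:C%C) *: ev R a).
 have FF := nbhs_filter (t, u).
 apply:(@cvg_cts R n _ _ f (fun p : R * E => x - s%:C%C *: p.2 + (b + c * p.1%:C%C) *: ev R a) _ (Cf.1 _)).
 apply:(@cvg_affine R n _ _ FF (fun p : R * E => x - s%:C%C *: p.2) (fun=> ev R a)); last exact:cvg_cst.
  apply:cvgB; [exact:cvg_cst|apply:cvgZ; [exact:cvg_cst|exact:cvg_snd]].
 apply:cvg_addC; first exact:cvg_cst.
 apply:cvg_mulC; [exact:cvg_cst|apply:cvg_real; exact:cvg_fst].
have Fc b c t u : (fun p : R * E => F b c p.1 p.2) @ (t, u) --> F b c t u.
 apply:cvg_mulC (fc b c t u); apply:cvg_snd_cts; exact:sm_cont (@pker_sm R n setT) I.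
have F0 b c t u : rd <= rn u -> F b c t u = 0 by move=> hu; rewrite /F pker_rad // mul0r.
have SW b c := fub_joint (@bfun_seg R h h0') rd0 (Fc b c) (F0 b c) (fun (g : R -> C) gc _ => gc).
have LE b c u : Lam 0 h (F b c ^~ u) = pker u * Lam 0 h (fun t => f (x - s%:C%C *: u + (b + c * t%:C%C) *: ev R a)).
 exact:(bf_Z (@bfun_seg R h h0') (pker u) (fun t => @joint_l R R E (fun t u => f (x - s%:C%C *: u + (b + c * t%:C%C) *: ev R a)) t u (fc b c t u))).
have SEG b c : Lam 0 h (fun t => avg f (x + (b + c * t%:C%C) *: ev R a) s) =
  icn (fun u => pker u * Lam 0 h (fun t => f (x - s%:C%C *: u + (b + c * t%:C%C) *: ev R a))).
 transitivity (Lam 0 h (fun t => icn (F b c t))).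
  congr Lam; apply/funext=> t; congr icn; apply/funext=> u; congr (_ * f _).
  by rewrite addrAC.
 by have [-> _ _ _] := SW b c; congr icn; apply/funext=> u.
have CcS b c : Cc rd (fun u => pker u * Lam 0 h (fun t => f (x - s%:C%C *: u + (b + c * t%:C%C) *: ev R a))).
 by have [_ C1 _ _] := SW b c; move: C1; congr Cc; apply/funext=> u.
rewrite (square_of_segs SEG).
apply:(int_comb0 (CcS 0 1) (CcS (0 + 'i%C * h%:C%C) 1) (CcS (0 + h%:C%C) 'i%C) (CcS 0 'i%C)) => u hu.
have := H u hu.
by rewrite (@square_of_segs _ (fun b c => Lam 0 h (fun t => f (x - s%:C%C *: u + (b + c * t%:C%C) *: ev R a))) h).
Qed.
Lemma in_square_cn (h : R) w : in_square 0 h w -> cn w <= 2 * h.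
case:w => p q [/= w1 w2]; rewrite cnE; move: w1 w2; rewrite /= add0r => /andP[p1 p2] /andP[q1 q2].
rewrite !ger0_norm; lra.
Qed.
Lemma avg_dzbar0 f x s a r : 0 <= r -> Cc r f -> 0 < s ->
 (exists2 h1 : R, 0 < h1 & forall h u, 0 < h -> h < h1 -> rn u <= rd ->
   square_int (fun w => f (x - s%:C%C *: u + w *: ev R a)) 0 h = 0) ->
 dzbar a (fun y => avg f y s) x = 0.
move=> r0 Cf s0 [h1 h10 H]; have oT : open (setT : set E) := openT.
have sA := avg_sm oT r0 s0 Cf.
apply:cn_small => e e0.
have e8 : 0 < e / 8 by lra.
have [d d0 Hd] := sm_strict oT sA (I : setT x) e8.
pose h := Num.min (h1 / 2) (d / 3).
have hp : 0 < h by rewrite lt_min !divr_gt0.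
have hh1 : h < h1 by have : h <= h1 / 2 by [rewrite ge_min lexx]; lra.
have hd : 2 * h < d by have : h <= d / 3 by [rewrite ge_min lexx orbT]; lra.
have cG := @plane_line_cts R n _ x (ev R a) (fun y => sm_cont sA (I : setT y)).
have SQ := @avg_square f x s a r h r0 Cf hp (fun u => H h u hp hh1).
have := @square_est R _ 0 h (avg f x s) (dz a (fun y => avg f y s) x) (dzbar a (fun y => avg f y s) x) (e / 8 * (2 * h)) (ltW hp) cG.
rewrite SQ sub0r cnN => EST.
have {}EST : cn (2 * 'i%C * (h ^+ 2)%:C%C * dzbar a (fun y => avg f y s) x) <= 8 * (e / 8 * (2 * h)) * h.
 apply:EST => w [/= w1 w2]; rewrite add0r.
 have cw : cn w <= 2 * h by apply:in_square_cn.
 have hx : rn (x - x) < d by rewrite subrr rn0.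
 have E1 : x + w *: ev R a - x = w *: ev R a by rewrite addrAC subrr add0r.
 have rw : rn (w *: ev R a) <= 2 * h.
  by apply:le_trans (rnZc _ _) _; rewrite rn_ev mulr1.
 have := Hd (x + w *: ev R a) x; rewrite E1 => /(_ (le_lt_trans rw hd) hx).
 rewrite dformE (bigD1 a) //= big1 => [|b ba]; last first.
  by rewrite !mxE (negbTE ba) mulr0 mul0r cj0 mul0r addr0.
 rewrite !mxE !eqxx mulr1 addr0 => h2.
 have -> : avg f (x + w *: ev R a) s - (avg f x s + dz a (fun y => avg f y s) x * w + dzbar a (fun y => avg f y s) x * w^*) =
  avg f (x + w *: ev R a) s - avg f x s - (w * dz a (fun y => avg f y s) x + w^* * dzbar a (fun y => avg f y s) x) by ring.
 nra.
set G := dzbar _ _ _ in EST *.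
have h3 : cn (2 * 'i%C * (h ^+ 2)%:C%C * G) = 2 * h ^+ 2 * cn ('i%C * G).
 have -> : 2 * 'i%C * (h ^+ 2)%:C%C * G = (2 * h ^+ 2)%:C%C * ('i%C * G).
  ring.
 by rewrite cnZ ger0_norm // mulr_ge0 // sqr_ge0.
have h4 : cn G <= cn ('i%C * G).
 have := cnM (- 'i%C) ('i%C * G); rewrite cnN cni mul1r (_ : - 'i%C * ('i%C * G) = G) //.
 by rewrite mulrA mulNr sqri opprK mul1r.
have hh : 0 < 2 * h ^+ 2 by nra.
rewrite h3 (_ : 8 * (e / 8 * (2 * h)) * h = 2 * h ^+ 2 * e) in EST; last by lra.
nra.
Qed.
(** The average at a small scale s is smooth and satisfies the Cauchy-Riemann equations near z0,
    hence is reproduced by averaging at the fixed scale T. Letting s tend to 0, f itself equals its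
    average at scale T, which is smooth. *)
Theorem cdiff_sm f (U : set E) : open U -> (forall z, U z -> exists L, cdiff f z L) -> smooth U f.
move=> oU fD; apply:sm_local => z0 Uz0; have oT : open (setT : set E) := openT.
have [r r0 Hr] := (openE_P U).1 oU z0 Uz0.
have r20 : 0 < r / 2 by rewrite divr_gt0.
(* A continuous cutoff is enough, since averages of continuous functions are smooth. *)
pose g z := (tent (r / 2) z0 z)%:C%C * f z.
have gf z : rn (z - z0) < r / 4 -> g z = f z.
 by move=> h; rewrite /g tent1 ?rmorph1 ?mul1r //; lra.
have Cg : Cc (rn z0 + r / 2) g.
 split=> [z|z h]; last first.
  rewrite /g tent0 ?rmorph0 ?mul0r //; have := rnB z (z - z0).
  by rewrite opprB addrC subrK => h2; have := rnD (z - z0) z0; rewrite subrK; lra.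
 have [h|h] := ltP (rn (z - z0)) r.
  apply:cts_mul; first exact:tent_cts.
  by have [L /cdiff_cts] := fD z (Hr z h).
 apply:cts_near (cts_cst 0 z); have : \forall y \near z, rn (y - z) < r / 2 by apply/nbhsE_P; exists (r / 2).
 apply:filterS => y hy; rewrite /g tent0 ?rmorph0 ?mul0r //.
 by have := rn_distD z y z0; rewrite (rnC z y); lra.
have R0 : 0 <= rn z0 + r / 2 by have := rn_ge0 z0; lra.
have rd1 := rad_gt0 R n; have rdp : 0 < rd + 1 by lra.
(* All points visited must stay within r / 4 of z0, where g = f: r / 12 for x, less than r / 12 for
   each of the two averages, and the small squares fit into the remaining slack. *)
pose T := r / 12 / (rd + 1); have T0 : 0 < T by rewrite !divr_gt0.
have Trd t u : 0 <= t <= T -> rn u <= rd -> rn (t%:C%C *: u) < r / 12.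
 move=> /andP[t0 tT] hu; rewrite rnZ ger0_norm //.
 have : t * rn u <= T * rn u by rewrite ler_wpM2r // rn_ge0.
 have : T * rn u <= T * rd by rewrite ler_wpM2l // ltW.
 have : T * (rd + 1) = r / 12 by rewrite /T divfK // gt_eqF.
 rewrite mulrDr mulr1; lra.
have key x : rn (x - z0) < r / 12 -> g x = avg g x T.
 move=> hx; apply/eqP; rewrite -subr_eq0; apply/eqP; apply:cn_eq0; apply/eqP; rewrite eq_le cn_ge0 andbT.
 have [K K0 HK] := avg_bound.
 have K1 : 0 < K + 1 by lra.
 apply/ler_addgt0Pr=> e e0; rewrite add0r.
 have e10 : 0 < e / (K + 1) by rewrite divr_gt0.
 have [d d0 Hd] := avg_unif R0 Cg e10.
 pose s := Num.min (d / 2) T; have s0 : 0 < s by rewrite lt_min divr_gt0 // T0.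
 have sd : s < d by have : s <= d / 2 by [rewrite ge_min lexx]; lra.
 have sT : 0 <= s <= T by rewrite ltW // ge_min lexx orbT.
 have sA := avg_sm oT R0 s0 Cg.
 have db j y : rn (y - z0) < r / 6 -> dzbar j (fun y => avg g y s) y = 0.
  move=> hy; have [h1 h10 Hh1] : exists2 h1 : R, 0 < h1 & rn (y - z0) + r / 12 + 2 * h1 < r / 4.
   exists ((r / 6 - rn (y - z0)) / 3); first by rewrite divr_gt0 // subr_gt0.
   lra.
  apply:(avg_dzbar0 R0 Cg s0); exists h1 => // h u hp hh hu.
  have inb w : in_square 0 h w -> rn (y - s%:C%C *: u + w *: ev R j - z0) < r / 4.
   move=> /in_square_cn cw.
   have := rnZc w (ev R j); rewrite rn_ev mulr1 => h3.
   have := Trd s u sT hu => h4.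
   rewrite (_ : _ - z0 = (y - z0) - s%:C%C *: u + w *: ev R j); last by rewrite addrAC [y - _ - z0]addrAC.
   have := rnD ((y - z0) - s%:C%C *: u) (w *: ev R j); have := rnB (y - z0) (s%:C%C *: u); lra.
  apply:goursat => //.
   by apply:plane_line_cts; exact:Cg.1.
  move=> w /inb; set y' := y - s%:C%C *: u + w *: ev R j => hy'.
  have [L HL] := fD y' (Hr y' ltac:(lra)); exists (L j) => e' e'0; have [d' d'0 Hd'] := HL e' e'0.
  exists (Num.min d' (r / 4 - rn (y' - z0))); first by rewrite lt_min d'0 subr_gt0.
  move=> v; rewrite lt_min => /andP[v1 v2].
  have rv : rn (v *: ev R j) <= cn v by have := rnZc v (ev R j); rewrite rn_ev mulr1.
  have -> : y - s%:C%C *: u + (w + v) *: ev R j = y' + v *: ev R j by rewrite /y' scalerDl addrA.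
  rewrite !gf //; last first.
   by rewrite addrAC; apply:le_lt_trans (rnD _ _) _; lra.
  have := Hd' (v *: ev R j) (le_lt_trans rv v1).
  rewrite (bigD1 j) //= big1 => [|b bj]; last by rewrite !mxE (negbTE bj) mulr0 mul0r.
  rewrite !mxE !eqxx mulr1 addr0 => h3; apply:le_trans h3 _.
  by rewrite ler_wpM2l // ltW.
 have hol := @homotopy_hol R n (fun y => avg g y s) x T (ltW T0) sA.
 have E1 : avg g x s = avg (fun y => avg g y s) x T.
  apply:hol => t u j ht hu; apply:db.
  have := Trd t u ht hu; have := rnB (x - z0) (t%:C%C *: u).
  rewrite (_ : x - z0 - t%:C%C *: u = x - t%:C%C *: u - z0); last by rewrite addrAC.
  lra.
 have h1 := Hd s x s0 sd.
 have h2 := HK (fun y => avg g y s) g x T (e / (K + 1)) (fun y => sm_cont sA (I : setT y)) Cg.1 (fun u _ => Hd s _ s0 sd).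
 apply:le_trans (cn_trans3 E1 h1 h2) _.
 by rewrite -[X in _ + X]mul1r -mulrDl mulrCA divff ?mulr1 // gt_eqF.
exists [set z | rn (z - z0) < r / 12].
 by split; [exact:open_rball|rewrite /= subrr rn0 divr_gt0].
have := avg_sm (@open_rball R n z0 (r / 12)) R0 T0 Cg.
apply:sm_congr; first exact:open_rball.
by move=> z hz; rewrite -key // gf //; rewrite /= in hz; lra.
Qed.
End Mollify.

(** * Exterior algebra of coefficient vectors: multiplication by one-forms, wedge, minors and
    pullback *)

Section Inversions.
Import mathcomp.boot.finset.
Local Close Scope classical_set_scope.
Variable n : nat.
Implicit Types (a b : 'I_n) (I J K T : {set 'I_n}).
Definition inv1 a I := #|[set b in I | (b < a)%N]|.
Lemma inversions1 a I : inversions [set a] I = inv1 a I.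
rewrite /inversions /inv1 -(card_imset _ (f := fun b : 'I_n => (a, b))) => [|b b' []//].
apply:eq_card => -[x y]; rewrite !inE /=; apply/and3P/imsetP => [[/eqP-> yI ya]|[b]].
 by exists y => //; rewrite inE yI.
by rewrite inE => /andP[bI ba] [-> ->].
Qed.
Lemma inversions0 I : inversions set0 I = 0%N.
by apply:eq_card0 => -[x y]; rewrite !inE.
Qed.
Lemma inv1_setD a b I : b \in I -> inv1 a I = ((b < a)%N + inv1 a (I :\ b))%N.
move=> bI; rewrite /inv1 (cardsD1 b) inE bI; congr (_ + _)%N; apply:eq_card => x.
by rewrite !inE andbA.
Qed.
Lemma inv1_U a I T : [disjoint I & T] -> inv1 a (I :|: T) = (inv1 a I + inv1 a T)%N.
move=> dIT; rewrite /inv1 -cardsUI; have -> : [set b in I | (b < a)%N] :&: [set b in T | (b < a)%N] = set0.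
 apply/setP=> x; rewrite !inE; apply/negP=> /andP[/andP[xI _] /andP[xT _]].
 by have := disjointFr dIT xI; rewrite xT.
rewrite cards0 addn0; apply:eq_card => x; rewrite !inE; by case:(x \in I); case:(x \in T); case:(x < a)%N.
Qed.
Lemma inversions_U1 a I T : a \notin I -> inversions (a |: I) T = (inv1 a T + inversions I T)%N.
move=> aI; rewrite -inversions1 /inversions -cardsUI.
rewrite (_ : [set p : 'I_n * 'I_n | [&& p.1 \in [set a], p.2 \in T & (p.2 < p.1)%N]] :&:
 [set p : 'I_n * 'I_n | [&& p.1 \in I, p.2 \in T & (p.2 < p.1)%N]] = set0); last first.
 apply/setP=> -[x y]; rewrite !inE /=; apply/negbTE/negP => /andP[/and3P[/eqP xa _ _] /and3P[xI _ _]].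
 by rewrite xa (negbTE aI) in xI.
rewrite cards0 addn0; apply:eq_card => -[x y]; rewrite !inE /=.
by case:(x == a); case:(x \in I); case:(y \in T); case:(y < x)%N.
Qed.
End Inversions.

Section Creation.
Import mathcomp.boot.finset.
Local Close Scope classical_set_scope.
Variables (R : realType) (n : nat).
Local Notation C := R[i].
Local Notation cf := (coefs R n).
Implicit Types (a b : 'I_n) (c d x y : cf) (P Q : {set 'I_n} * {set 'I_n}).
(* Left multiplication by dz_a and by dzbar_b *)
Definition crz a c : cf := fun P =>
 if a \in P.1 then (-1) ^+ inv1 a (P.1 :\ a) * c ((P.1 :\ a)%SET, P.2) else 0.
Definition crb b c : cf := fun P =>
 if b \in P.2 then (-1) ^+ (#|P.1| + inv1 b (P.2 :\ b))%N * c (P.1, (P.2 :\ b)%SET) else 0.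
Definition cone : cf := fun P => ((P.1 == set0) && (P.2 == set0))%:R.
Definition clin (k : C) c d : cf := fun P => k * c P + d P.
(** The parity operator of the exterior algebra: the sign picked up when a one-form moves past a
    form. *)
Definition csgn c : cf := fun P => (-1) ^+ (#|P.1| + #|P.2|)%N * c P.
Definition cconj c : cf := fun P => (-1) ^+ (#|P.1| * #|P.2|)%N * (c (P.2, P.1))^*.
Definition czero : cf := fun=> 0.
Lemma crz_lin a k c d : crz a (clin k c d) = clin k (crz a c) (crz a d).
apply/funext=> P; rewrite /crz /clin; case:ifP => _; ring. Qed.
Lemma crb_lin a k c d : crb a (clin k c d) = clin k (crb a c) (crb a d).
apply/funext=> P; rewrite /crb /clin; case:ifP => _; ring. Qed.
Lemma signC k : ((-1) ^+ k : C) * (-1) ^+ k = 1.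
by rewrite -exprMn mulrNN mulr1 expr1n. Qed.
Lemma sign_swap a b (I : {set 'I_n}) : a != b -> a \in I -> b \in I ->
 ((-1) ^+ (inv1 a (I :\ a) + inv1 b (I :\ a :\ b))%N : C) = - (-1) ^+ (inv1 b (I :\ b) + inv1 a (I :\ b :\ a))%N.
move=> ab aI bI.
have h1 : b \in I :\ a by rewrite !inE eq_sym ab.
have h2 : a \in I :\ b by rewrite !inE ab.
rewrite (inv1_setD a h1) (inv1_setD b h2) setDDl setDDl [[set b] :|: _]setUC.
have : (b < a)%N = ~~ (a < b)%N by have := ab; rewrite -val_eqE; case:ltngtP.
move=> ->; rewrite !exprD; case:(a < b)%N => /=; ring.
Qed.
Lemma crzC a b c : crz a (crz b c) = clin (-1) (crz b (crz a c)) czero.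
apply/funext=> P; rewrite /clin /crz addr0 /= !inE.
have [->|ab] := eqVneq a.
 by case:(b \in P.1); rewrite ?mulr0.
case aP: (a \in P.1); case bP: (b \in P.1); rewrite /= ?mulr0 //.
rewrite !mulrA -mulrA -mulrA.
have := sign_swap ab aP bP; rewrite !exprD => E.
have ES : P.1 :\ a :\ b = P.1 :\ b :\ a by rewrite !setDDl setUC.
rewrite mulrA E ES; ring.
Qed.
Lemma crzbC a b c : crz a (crb b c) = clin (-1) (crb b (crz a c)) czero.
apply/funext=> P; rewrite /clin /crb /crz addr0 /=.
case aP: (a \in P.1); case bP: (b \in P.2); rewrite ?mulr0 //.
rewrite (cardsD1 a P.1) aP exprS; ring.
Qed.
Lemma cconjK c : cconj (cconj c) = c.
apply/funext=> -[I J]; rewrite /cconj /= cjM cjK rmorphXn rmorphN rmorph1 [(#|J| * _)%N]mulnC.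
by rewrite mulrA signC mul1r.
Qed.
Lemma cconj_crz a c : cconj (crz a c) = crb a (cconj c).
apply/funext=> -[I J]; rewrite /cconj /crz /crb /=; case:ifP => aJ; last by ring.
rewrite cjM rmorphXn rmorphN rmorph1 (cardsD1 a J) aJ mulnDr muln1 !exprD; ring.
Qed.
Lemma cconj_crb a c : cconj (crb a c) = crz a (cconj c).
by rewrite -{1}[c]cconjK -cconj_crz cconjK. Qed.
Lemma cconj_lin k c d : cconj (clin k c d) = clin k^* (cconj c) (cconj d).
apply/funext=> P; rewrite /cconj /clin; ring. Qed.
Lemma cconj_cone : cconj cone = cone.
apply/funext=> -[I J]; rewrite /cconj /cone /= andbC cj_nat; case:eqP => [->|_] /=; last by ring.
by rewrite cards0 mul1r.
Qed.
Lemma csgn_conj c : csgn (cconj c) = cconj (csgn c).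
apply/funext=> -[I J]; rewrite /csgn /cconj cjM rmorphXn rmorphN rmorph1 addnC; ring.
Qed.
Lemma csgn_lin k c d : csgn (clin k c d) = clin k (csgn c) (csgn d).
apply/funext=> P; rewrite /csgn /clin; ring. Qed.
Lemma csgn_cone : csgn cone = cone.
apply/funext=> -[I J]; rewrite /csgn /cone; case:eqP => [->|_] /=; last by ring.
by case:eqP => [->|_]; rewrite cards0 ?mul1r // mulr0.
Qed.
Lemma csgn_crz a c : csgn (crz a c) = clin (-1) (crz a (csgn c)) czero.
apply/funext=> P; rewrite /csgn /clin addr0 /crz /=; case:ifP => aP; last by ring.
rewrite (cardsD1 a) aP exprS; ring.
Qed.
Lemma csgn_crb a c : csgn (crb a c) = clin (-1) (crb a (csgn c)) czero.
apply/funext=> P; rewrite /csgn /clin addr0 /crb /=; case:ifP => aP; last by ring.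
rewrite (cardsD1 a P.2) aP !exprD; ring.
Qed.
(** Monomials arise from the unit by multiplying with the dz_a and conjugating, so an identity
    compatible with these operations need only be checked on the unit. The rules for wedge and
    pullback are proved this way. *)
Lemma coefs_indC (Pr : cf -> Prop) :
 (forall k c d, Pr c -> Pr d -> Pr (clin k c d)) -> Pr cone ->
 (forall a c, Pr c -> Pr (crz a c)) -> (forall c, Pr c -> Pr (cconj c)) -> forall c, Pr c.
move=> Plin P1 Pz Pc.
have P0 : Pr czero.
 rewrite (_ : czero = clin (-1) cone cone); first exact:Plin.
 apply/funext=> P; rewrite /clin; ring.
pose delta Q : cf := fun P => (P == Q)%:R.
have Pdz a (I J : {set 'I_n}) : a \in I -> Pr (delta (I :\ a, J)) -> Pr (delta (I, J)).
 move=> aI /(Pz a) h; rewrite (_ : delta _ = clin ((-1) ^+ inv1 a (I :\ a)) (crz a (delta (I :\ a, J))) czero).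
  exact:Plin.
 apply/funext=> -[K L]; rewrite /clin addr0 /delta /crz /= !xpair_eqE.
 case aK: (a \in K); last first.
  by rewrite mulr0; case:eqP => //= KI; rewrite KI aI in aK.
 have -> : (K :\ a == I :\ a) = (K == I).
  by apply/eqP/eqP => [h'|-> //]; rewrite -(setD1K aK) h' setD1K.
 case:eqP => [->|_] /=; last by ring.
 by rewrite mulrA signC mul1r.
have Pdelta Q : Pr (delta Q).
 have [k] := ubnP (#|Q.1| + #|Q.2|)%N; elim:k Q => // k IH [I J] /= hk.
 have [I0|[a aI]] := set_0Vmem I; last first.
  by apply:(Pdz a) => //; apply:IH; move: hk; rewrite (cardsD1 a I) aI.
 have [J0|[b bJ]] := set_0Vmem J.
  by rewrite I0 J0.
 rewrite (_ : delta _ = cconj (delta (J, I))).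
  apply:Pc; apply:(Pdz b) => //; apply:IH; move: hk.
  by rewrite addnC (cardsD1 b J) bJ.
 apply/funext=> -[K L]; rewrite /cconj /delta cj_nat !xpair_eqE I0 andbC.
 by case:(K =P set0) => [->|_]; rewrite ?andbF ?mulr0 // cards0 mul1r.
move=> c; have -> : c = fun P => \sum_Q c Q * delta Q P.
 apply/funext=> P; rewrite (bigD1 P) //= big1 => [|Q QP]; first by rewrite /delta eqxx mulr1 addr0.
 by rewrite /delta eq_sym (negbTE QP) mulr0.
elim:index_enum => [|Q s IH].
 by rewrite (_ : (fun P => _) = czero) //; apply/funext=> P; rewrite big_nil.
rewrite (_ : (fun P => _) = clin (c Q) (delta Q) (fun P => \sum_(j <- s) c j * delta j P)); first exact:Plin.
by apply/funext=> P; rewrite big_cons.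
Qed.
(** The property is carried along for c and its conjugate together, because conjugation exchanges
    [crz] and [crb]. *)
Lemma coefs_ind (Pr : cf -> Prop) :
 (forall k c d, Pr c -> Pr d -> Pr (clin k c d)) -> Pr cone ->
 (forall a c, Pr c -> Pr (crz a c)) -> (forall b c, Pr c -> Pr (crb b c)) -> forall c, Pr c.
move=> Pl P1 Pz Pb c; suff [] : Pr c /\ Pr (cconj c) by [].
elim/coefs_indC: c => [k c d [c1 c2] [d1 d2]||a c [c1 c2]|c [c1 c2]].
- rewrite cconj_lin; split; exact:Pl.
- by rewrite cconj_cone.
- rewrite cconj_crz; split; [exact:Pz|exact:Pb].
- by rewrite cconjK.
Qed.
Definition csum (I : finType) (F : I -> cf) : cf := fun P => \sum_i F i P.
Lemma clinN c : clin (-1) c c = czero.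
by apply/funext=> P; rewrite /clin mulN1r addNr. Qed.
End Creation.
Arguments cone {R n}.
Arguments czero {R n}.

Section LinearOperators.
Variables (R : realType) (n m : nat) (T : coefs R n -> coefs R m).
Hypothesis TL : forall k c d, T (clin k c d) = clin k (T c) (T d).
Lemma clin0 : T czero = czero.
by have := TL (-1) czero czero; rewrite !clinN. Qed.
Lemma clinZ k c : T (clin k c czero) = clin k (T c) czero.
by rewrite TL clin0. Qed.
Lemma clin_csum (I : finType) (F : I -> coefs R n) : T (csum F) = csum (fun i => T (F i)).
rewrite /csum; elim:index_enum => [|i s IH].
 rewrite (_ : (fun P => _) = czero) ?clin0; last by apply/funext=> P; rewrite big_nil.
 by apply/funext=> P; rewrite big_nil.
rewrite (_ : (fun P => _) = clin 1 (F i) (fun P => \sum_(j <- s) F j P)); last first.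
 by apply/funext=> P; rewrite big_cons /clin mul1r.
by rewrite TL IH; apply/funext=> P; rewrite big_cons /clin mul1r.
Qed.
End LinearOperators.

Section Wedge.
Import mathcomp.boot.finset.
Local Close Scope classical_set_scope.
Variables (R : realType) (n : nat).
Local Notation C := R[i].
Local Notation cf := (coefs R n).
Implicit Types (a b : 'I_n) (c d x y : cf) (P Q : {set 'I_n} * {set 'I_n}).
Definition cwedge x y : cf := fun P =>
 \sum_(Q : {set 'I_n} * {set 'I_n} | (Q.1 \subset P.1) && (Q.2 \subset P.2))
  (-1) ^+ (inversions Q.1 (P.1 :\: Q.1) + inversions Q.2 (P.2 :\: Q.2)
       + #|Q.2| * #|P.1 :\: Q.1|)%N
  * (x Q * y ((P.1 :\: Q.1)%SET, (P.2 :\: Q.2)%SET)).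
Lemma cw_linl k x x' y : cwedge (clin k x x') y = clin k (cwedge x y) (cwedge x' y).
apply/funext=> P; rewrite /cwedge /clin mulr_sumr -big_split; apply:eq_bigr=> Q _ /=; ring.
Qed.
Lemma cw_linr k x y y' : cwedge x (clin k y y') = clin k (cwedge x y) (cwedge x y').
apply/funext=> P; rewrite /cwedge /clin mulr_sumr -big_split; apply:eq_bigr=> Q _ /=; ring.
Qed.
Lemma cw_one y : cwedge cone y = y.
apply/funext=> -[I J]; rewrite /cwedge (bigD1 (set0, set0)) /=; last by rewrite !sub0set.
rewrite big1 => [|[K L] /andP[_]]; last first.
 by rewrite xpair_eqE /cone => /negbTE ->; rewrite mul0r mulr0.
by rewrite !inversions0 cards0 /cone eqxx !mul1r !setD0 addr0.
Qed.
Lemma cw_crz a x y : cwedge (crz a x) y = crz a (cwedge x y).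
apply/funext=> -[I J]; rewrite /crz /cwedge /=.
case aI: (a \in I); last first.
 apply:big1 => -[K L] /= /andP[KI _]; case:ifP => aK; last by ring.
 by rewrite (fintype.subsetP KI _ aK) in aI.
rewrite (bigID (fun Q : {set 'I_n} * {set 'I_n} => a \in Q.1)) /= [X in _ + X]big1 => [|[K L]]; last first.
 by move=> /andP[_ /negbTE ->]; rewrite mul0r mulr0.
rewrite addr0 mulr_sumr.
(* Only subsets containing a contribute; removing a from them gives the summands of the right side,
   and the sign of a splits off by counting inversions over a disjoint union. *)
rewrite (reindex_onto (fun Q : {set 'I_n} * {set 'I_n} => (a |: Q.1, Q.2)) (fun Q => (Q.1 :\ a, Q.2))) /=; last first.
 by move=> [K L] /andP[_ aK]; rewrite setD1K.
apply:eq_big => [[K L]|[K L]] /=.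
 rewrite setU11 andbT subUset sub1set aI /= xpair_eqE eqxx andbT.
 have -> : (((a |: K) :\ a)%SET == K) = (a \notin K).
  apply/eqP/idP => [<-|]; first by rewrite !inE eqxx.
  exact:setU1K.
 by rewrite subsetD1; case:(K \subset I); case:(L \subset J); case:(a \in K).
move=> /andP[/andP[/andP[h1 h2] _] /eqP[E]].
have aK : a \notin K by rewrite -E !inE eqxx.
rewrite setU11 E.
have -> : I :\: (a |: K) = I :\ a :\: K by rewrite setDDl.
set T := I :\ a :\: K.
have IE : (I :\ a)%SET = K :|: T.
 apply/setP=> u; rewrite !inE; case uL: (u \in K) => //=.
 have uJ : u \in I by apply:(fintype.subsetP h1); rewrite inE uL orbT.
 by rewrite uJ andbT; apply/eqP=> ua; rewrite -ua uL in aK.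
rewrite inversions_U1 // IE inv1_U; last by rewrite disjoint_sym disjoints_subset; apply/fintype.subsetP => u; rewrite !inE => /andP[].
rewrite !exprD; ring.
Qed.
(** Conjugation swaps I and J up to the sign of moving one block past the other, and these signs
    multiply consistently. Every rule for dzbar then follows from the rule for dz. *)
Lemma cconj_wedge x y : cconj (cwedge x y) = cwedge (cconj x) (cconj y).
apply/funext=> -[I J]; rewrite /cconj /cwedge cj_sum mulr_sumr.
rewrite [RHS](reindex_inj (h := fun Q : {set 'I_n} * {set 'I_n} => (Q.2, Q.1))) /=; last by move=> [? ?] [? ?] [-> ->].
apply:eq_big => [[K L]|[K L] /= /andP[KJ LI]] /=; first exact:andbC.
rewrite -(cardsID L I) -(cardsID K J) (setIidPr KJ) (setIidPr LI) !cjM rmorphXn rmorphN rmorph1.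
have E k (t : C) : t = (-1) ^+ k * (-1) ^+ k * t by rewrite signC mul1r.
by rewrite [RHS](E (#|L| * #|J :\: K|)%N) mulnDl !mulnDr !exprD [(#|K| * #|I :\: L|)%N]mulnC; ring.
Qed.
Lemma cw_crb a x y : cwedge (crb a x) y = crb a (cwedge x y).
by apply:(can_inj (@cconjK _ _)); rewrite !(cconj_wedge, cconj_crb) cw_crz. Qed.
(** By induction on x: each generator anticommutes with dz_a and also changes the parity, and the
    two signs cancel. *)
Lemma cw_sgn_crz a x y : cwedge (csgn x) (crz a y) = crz a (cwedge x y).
elim/(@coefs_ind R n): x => [k c d IHc IHd||b c IH|b c IH].
- by rewrite csgn_lin !cw_linl IHc IHd crz_lin.
- by rewrite csgn_cone !cw_one.
- rewrite csgn_crz (clinZ (fun k c d => cw_linl k c d _)) cw_crz IH cw_crz crzC.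
 apply/funext=> P; rewrite /clin; ring.
- rewrite csgn_crb (clinZ (fun k c d => cw_linl k c d _)) !cw_crb IH crzbC.
 by [].
Qed.
Lemma cw_sgn_crb a x y : cwedge (csgn x) (crb a y) = crb a (cwedge x y).
by apply:(can_inj (@cconjK _ _)); rewrite !(cconj_wedge, cconj_crb) -csgn_conj cw_sgn_crz.
Qed.
End Wedge.

Section Minors.
Import mathcomp.boot.finset.
Local Close Scope classical_set_scope.
Variable R : realType.
Local Notation C := R[i].
(** Increasing enumerations indexed by an ordinal of freely named size, so that minors can be
    manipulated without the cast between equal cardinals. *)
Definition incr_onto n k (r : 'I_k -> 'I_n) (I : {set 'I_n}) :=
 (forall i j : 'I_k, (i < j)%N -> (r i < r j)%N) /\ I = [set r i | i : 'I_k].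
Lemma incr_inj n k (r : 'I_k -> 'I_n) I : incr_onto r I -> injective r.
move=> [m _] i j e; apply/eqP; rewrite -val_eqE /=; apply/eqP.
by case:(ltngtP i j) => // /m; rewrite e ltnn.
Qed.
Lemma incr_card n k (r : 'I_k -> 'I_n) I : incr_onto r I -> #|I| = k.
move=> h; rewrite h.2 card_imset ?card_ord //; exact:incr_inj h. Qed.
Lemma incr_enum n k (r : 'I_k -> 'I_n) I : incr_onto r I -> enum I = [seq r i | i <- enum 'I_k].
move=> h; apply:(inj_map val_inj).
apply:(@irr_sorted_eq _ ltn); [exact:ltn_trans|exact:ltnn| | |].
- rewrite sorted_map; have : sorted (relpre val ltn) (enum 'I_n).
  by rewrite -sorted_map val_enum_ord iota_ltn_sorted.
 apply:subseq_sorted; [exact:ltn_trans|rewrite enumT; exact:filter_subseq].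
- rewrite -map_comp sorted_map; have : sorted (relpre val ltn) (enum 'I_k).
  by rewrite -sorted_map val_enum_ord iota_ltn_sorted.
 apply:sub_sorted; exact:h.1.
move=> x; apply/mapP/mapP => -[y yI ->]; exists y => //.
 move: yI; rewrite mem_enum h.2 => /imsetP[i _ ->]; exact:map_f (mem_enum _ i).
by move/mapP: yI => [i _ ->]; rewrite mem_enum h.2 imset_f.
Qed.
Lemma incr_exists n (I : {set 'I_n}) k : #|I| = k -> exists r : 'I_k -> 'I_n, incr_onto r I.
move=> <-; exists (fun i => enum_val i); split; last first.
 apply/setP=> x; apply/idP/imsetP => [xI|[i _ ->]]; last exact:enum_valP.
 by exists (enum_rank_in xI x) => //; rewrite enum_rankK_in.
move=> i j ij; have s : sorted (relpre val ltn) (enum I).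
 have : sorted (relpre val ltn) (enum 'I_n).
  by rewrite -sorted_map val_enum_ord iota_ltn_sorted.
 apply:subseq_sorted; [exact:ltn_trans|rewrite enumT; exact:filter_subseq].
have x0 := enum_val i; rewrite !(enum_val_nth x0).
by apply:(sorted_ltn_nth _ x0 s) => //; [exact:ltn_trans|rewrite inE -cardE|rewrite inE -cardE].
Qed.
Lemma minorE n m k (M : 'M[C]_(n, m)) (I : {set 'I_n}) (K : {set 'I_m}) (r : 'I_k -> 'I_n) (c : 'I_k -> 'I_m) :
 incr_onto r I -> incr_onto c K -> minor M I K = \det (\matrix_(i, j) M (r i) (c j)).
move=> hr hc; have rI := incr_card hr; have cK := incr_card hc.
rewrite /minor; case:eqVneq => [e|/eqP[]]; last by rewrite cK.
have Er i : enum_val (cast_ord (esym rI) i) = r i.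
 have x0 := r i; rewrite (enum_val_nth x0) (incr_enum hr) (nth_map i) ?nth_ord_enum //=.
 by rewrite size_enum_ord.
have Ec (i : 'I_k) : enum_val (cast_ord (esym cK) i) = c i.
 have x0 := c i; rewrite (enum_val_nth x0) (incr_enum hc) (nth_map i) ?nth_ord_enum //=.
 by rewrite size_enum_ord.
subst k.
congr (\det _); apply/matrixP=> i j; rewrite !mxE -Er -Ec; congr (M _ _).
 congr enum_val; exact/val_inj.
congr enum_val; exact/val_inj.
Qed.
Lemma minor_card n m (M : 'M[C]_(n, m)) (I : {set 'I_n}) (K : {set 'I_m}) : #|I| != #|K| -> minor M I K = 0.
by rewrite /minor; case:eqVneq. Qed.
Lemma minor0 n m (M : 'M[C]_(n, m)) : minor M set0 set0 = 1.
have [r hr] := incr_exists (@cards0 'I_n); have [c hc] := incr_exists (@cards0 'I_m).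
by rewrite (minorE M hr hc) det_mx00.
Qed.
Lemma minorT n (M : 'M[C]_n) : minor M setT setT = \det M.
have h : incr_onto (fun i : 'I_n => i) setT.
 by split=> //; apply/setP=> x; rewrite inE; apply/esym/imsetP; exists x.
by rewrite (minorE M h h); congr (\det _); apply/matrixP=> i j; rewrite mxE.
Qed.
Lemma incr_lift n k (r : 'I_k.+1 -> 'I_n) I i : incr_onto r I -> incr_onto (fun j => r (lift i j)) (I :\ r i).
move=> h; split=> [j l jl|].
 apply:h.1; rewrite /= /fintype.bump; move: jl; case:(leqP i) => a; case:(leqP i) => b jl; rewrite ?add0n ?add1n ?ltnS //.
  by have := leq_ltn_trans a (ltn_trans jl b); rewrite ltnn.
 exact:ltnW.
apply/setP=> x; rewrite !inE h.2; apply/andP/imsetP => [[xi /imsetP[j _ xj]]|[j _ ->]].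
 have ji : i != j by apply:contraNneq xi => ->; rewrite xj.
 by have [l jl _] := unlift_some ji; exists l => //; rewrite xj jl.
split; last exact:imset_f.
by rewrite (inj_eq (incr_inj h)) eq_sym neq_lift.
Qed.
(** The elements smaller than r i are the values at smaller indices. This identifies the signs of
    wedge products with the signs of cofactors. *)
Lemma incr_inv1 n k (r : 'I_k.+1 -> 'I_n) I i : incr_onto r I -> inv1 (r i) (I :\ r i) = i.
move=> h; rewrite /inv1 (_ : [set b in I :\ r i | (b < r i)%N] = [set r j | j in [set j : 'I_k.+1 | (j < i)%N]]).
 rewrite card_imset; last exact:incr_inj h.
 rewrite (_ : [set j : 'I_k.+1 | (j < i)%N] = [set widen_ord (ltnW (ltn_ord i)) x | x : 'I_i]).
  by rewrite card_imset ?card_ord // => x y /(congr1 val) /= /val_inj.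
 apply/setP=> j; rewrite inE; apply/idP/imsetP => [ji|[x _ ->]]; last exact:(ltn_ord x).
 exists (Ordinal ji) => //; exact/val_inj.
apply/setP=> x; rewrite !inE; apply/idP/imsetP => [/andP[/andP[xi]]|[j]].
 rewrite h.2 => /imsetP[j _ ->] ji; exists j => //; rewrite inE.
 by case:(ltngtP j) ji => // [/h.1|/val_inj ->]; rewrite ?ltnn // => /ltnW; rewrite leqNgt => /negbTE ->.
rewrite inE => ji ->; have := h.1 _ _ ji => rr; rewrite rr andbT h.2 imset_f // andbT.
by apply:contraTneq rr => ->; rewrite ltnn.
Qed.
(* Laplace expansion along the column of b, inserted in front of the columns K *)
Lemma minor_expand n m (M : 'M[C]_(n, m)) (I : {set 'I_n}) (K : {set 'I_m}) b :
 \sum_(a in I) M a b * ((-1) ^+ inv1 a (I :\ a) * minor M (I :\ a) K) =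
 if b \in K then 0 else (-1) ^+ inv1 b K * minor M I (b |: K).
have [e|ne] := eqVneq #|I| #|K|.+1; last first.
 rewrite big1 => [|a aI].
  case:ifP => // bK; rewrite minor_card ?mulr0 // cardsU1 bK //.
 rewrite minor_card ?mulr0 //; apply:contra ne => /eqP h.
 by rewrite (cardsD1 a) aI h.
have [k cK] : exists k, #|K| = k by exists #|K|.
rewrite cK in e.
have [r hr] := incr_exists e; have [c hc] := incr_exists cK.
have S : \sum_(a in I) M a b * ((-1) ^+ inv1 a (I :\ a) * minor M (I :\ a) K) =
  \sum_i M (r i) b * ((-1) ^+ i * \det (\matrix_(i', j) M (r (lift i i')) (c j))).
 rewrite {1}hr.2 big_imset /=; last by move=> i j _ _ /(incr_inj hr).
 apply:eq_bigr=> i _; rewrite (incr_inv1 i hr); congr (_ * (_ * _)).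
 by rewrite (minorE M (incr_lift i hr) hc).
rewrite S; case:ifP => bK.
 have [j0 bj] : exists j0, b = c j0.
  by have := bK; rewrite hc.2 => /imsetP[j0 _ ->]; exists j0.
 (* Column b is placed in front of the columns K; as b already lies in K, the matrix has a repeated
    column and the expansion sums to zero. *)
 pose cc (j : 'I_k.+1) := oapp c b (unlift ord0 j).
 pose A := \matrix_(i, j) M (r i) (cc j).
 have : \det A = 0.
  rewrite -det_tr; apply:(@determinant_alternate _ _ _ ord0 (lift ord0 j0)); first by [].
  by move=> i; rewrite !mxE /cc unlift_none liftK bj.
 rewrite (expand_det_col A ord0) => D; rewrite -[RHS]D; apply:eq_bigr=> i _.
 rewrite mxE /cc unlift_none /cofactor addn0; congr (_ * (_ * \det _)).
 by apply/matrixP=> i' j; rewrite !mxE /cc liftK.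
have e' : #|b |: K| = k.+1 by rewrite cardsU1 bK cK.
have [d hd] := incr_exists e'.
have [j0 bj] : exists j0, d j0 = b.
 have : b \in b |: K by rewrite !inE eqxx.
 by rewrite hd.2 => /imsetP[j0 _ ->]; exists j0.
have KE : (b |: K) :\ b = K by rewrite setU1K // bK.
have j0E : inv1 b K = j0 by have := incr_inv1 j0 hd; rewrite bj KE.
have hK : incr_onto (fun j => d (lift j0 j)) K by have := incr_lift j0 hd; rewrite bj KE.
rewrite (minorE M hr hd) (expand_det_col _ j0) mulr_sumr; apply:eq_bigr=> i _.
rewrite mxE bj /cofactor j0E exprD.
have -> : \det (row' i (col' j0 (\matrix_(i0, j) M (r i0) (d j)))) = \det (\matrix_(i', j) M (r (lift i i')) (c j)).
 rewrite -(minorE M (incr_lift i hr) hc) (minorE M (incr_lift i hr) hK).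
 by congr (\det _); apply/matrixP=> i' j; rewrite !mxE.
have := signC R j0; set s := (-1) ^+ j0 => ss.
rewrite [RHS](_ : _ = (s * s) * (M (r i) b * ((-1) ^+ i * \det (\matrix_(i', j) M (r (lift i i')) (c j))))); last by ring.
by rewrite ss mul1r.
Qed.
End Minors.

Section Pull.
Import mathcomp.boot.finset.
Local Close Scope classical_set_scope.
Variable R : realType.
Local Notation C := R[i].
Lemma pull_clin n m (M : 'M[C]_(n, m)) k (c d : coefs R m) : pull M (clin k c d) = clin k (pull M c) (pull M d).
exact:pull_lin. Qed.
(** Laplace expansion along the column of b. Together with linearity, the unit and conjugation this
    rule determines pullback, so minors need not be met again in the algebraic identities. *)
Lemma pull_crz n m (M : 'M[C]_(n, m)) b (c : coefs R m) :
 pull M (crz b c) = csum (fun a => clin (M a b) (crz a (pull M c)) czero).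
apply/funext=> -[I J]; rewrite /csum /clin /czero /pull /crz /=.
transitivity (\sum_(Q : {set 'I_m} * {set 'I_m}) c Q * (minor M J Q.2)^* *
  \sum_(a in I) M a b * ((-1) ^+ inv1 a (I :\ a) * minor M (I :\ a) Q.1)); last first.
 rewrite (bigID (fun a => a \in I)) /= [X in _ + X]big1 => [|a /negbTE ->]; last by ring.
 rewrite addr0; under eq_bigr do rewrite mulr_sumr; rewrite exchange_big /=; apply:eq_bigr=> a aI.
 rewrite aI addr0 mulr_sumr mulr_sumr; apply:eq_bigr=> Q _; ring.
under [RHS]eq_bigr do rewrite minor_expand.
rewrite (bigID (fun Q : {set 'I_m} * {set 'I_m} => b \in Q.1)) /= [X in _ + X]big1 => [|Q /negbTE ->]; last by ring.
rewrite [RHS](bigID (fun Q : {set 'I_m} * {set 'I_m} => b \in Q.1)) /= [X in _ = X + _]big1 => [|Q ->]; last by ring.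
rewrite addr0 add0r.
rewrite (reindex_onto (fun Q : {set 'I_m} * {set 'I_m} => (b |: Q.1, Q.2)) (fun Q => (Q.1 :\ b, Q.2))) /=; last first.
 by move=> [K L] bK; rewrite setD1K.
apply:eq_big => [[K L]|[K L]] /=.
 rewrite setU11 xpair_eqE eqxx andbT /=.
 apply/eqP/idP => [<-|]; first by rewrite !inE eqxx.
 exact:setU1K.
move=> /andP[_ /eqP[E]]; have bK : b \notin K by rewrite -E !inE eqxx.
rewrite setU11 E (negbTE bK); ring.
Qed.
Lemma pull_conj n m (M : 'M[C]_(n, m)) (c : coefs R m) : cconj (pull M c) = pull M (cconj c).
apply/funext=> -[I J]; rewrite /cconj /pull /= cj_sum mulr_sumr.
rewrite (reindex_inj (h := fun Q : {set 'I_m} * {set 'I_m} => (Q.2, Q.1))) /=; last by move=> [? ?] [? ?] [-> ->].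
apply:eq_bigr=> -[K L] _ /=; rewrite !cjM cjK.
have [e1|/minor_card ->] := eqVneq #|I| #|K|; last by ring.
have [e2|/minor_card ->] := eqVneq #|J| #|L|; last by ring.
rewrite e1 e2; ring.
Qed.
Lemma pull_crb n m (M : 'M[C]_(n, m)) b (c : coefs R m) :
 pull M (crb b c) = csum (fun a => clin (M a b)^* (crb a (pull M c)) czero).
rewrite -[LHS]cconjK pull_conj cconj_crb pull_crz.
apply/funext=> P; rewrite /cconj cj_sum mulr_sumr; apply:eq_bigr=> a _.
have := congr1 (fun c => c P) (cconj_lin (M a b) (crz a (pull M (cconj c))) czero).
rewrite {1}/cconj => ->; rewrite cconj_crz pull_conj cconjK.
by congr clin; apply/funext=> Q; rewrite /cconj cj0 mulr0.
Qed.
Lemma pull_cone n m (M : 'M[C]_(n, m)) : pull M cone = cone.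
apply/funext=> -[I J]; rewrite /pull (bigD1 (set0, set0)) //= big1 => [|[K L]]; last first.
 by rewrite xpair_eqE /cone => /negbTE ->; rewrite mul0r.
rewrite /cone /= eqxx mul1r addr0.
have [->|I0] := eqVneq; last by rewrite minor_card ?mul0r // cards0 cards_eq0.
have [->|J0] := eqVneq; last by rewrite [minor M J _]minor_card ?cj0 ?mulr0 // cards0 cards_eq0.
by rewrite minor0 cj1 mulr1.
Qed.
(** This contains the Cauchy-Binet formula. On generators it reduces to the definition of the matrix
    product, so no products of minors are expanded. *)
Lemma pull_comp n m l (M : 'M[C]_(n, m)) (N : 'M[C]_(m, l)) c : pull (M *m N) c = pull M (pull N c).
elim/(@coefs_indC R l): c => [k c d IHc IHd||b c IH|c IH].
- by rewrite !pull_clin IHc IHd.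
- by rewrite !pull_cone.
- rewrite !pull_crz (clin_csum (@pull_clin n m M)) IH; apply/funext=> P; rewrite /csum.
 under [RHS]eq_bigr do rewrite (clinZ (@pull_clin n m M)) pull_crz /clin /czero addr0 mulr_sumr.
 rewrite exchange_big /=; apply:eq_bigr=> a _; rewrite /clin addr0 mxE mulr_suml.
 apply:eq_bigr=> j _; ring.
- by rewrite -!pull_conj IH.
Qed.
Lemma pull1 n (c : coefs R n) : pull 1%:M c = c.
elim/(@coefs_indC R n): c => [k c d IHc IHd||b c IH|c IH].
- by rewrite pull_clin IHc IHd.
- by rewrite pull_cone.
- rewrite pull_crz IH; apply/funext=> P; rewrite /csum (bigD1 b) //= big1 => [|a ab]; rewrite /clin /czero mxE.
  by rewrite eqxx mul1r !addr0.
 by rewrite (negbTE ab) mul0r addr0.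
- by rewrite -pull_conj IH.
Qed.
Lemma cw_sum n (I : finType) (F : I -> coefs R n) y : cwedge (csum F) y = csum (fun i => cwedge (F i) y).
exact:(clin_csum (fun k c d => cw_linl k c d y)). Qed.
Lemma pull_wedge n m (M : 'M[C]_(n, m)) (x y : coefs R m) : pull M (cwedge x y) = cwedge (pull M x) (pull M y).
elim/(@coefs_indC R m): x y => [k c d IHc IHd||b c IH|c IH] y.
- by rewrite cw_linl !pull_clin cw_linl IHc IHd.
- by rewrite cw_one pull_cone cw_one.
- rewrite cw_crz !pull_crz cw_sum IH; congr csum; apply/funext=> a.
 by rewrite (clinZ (T := fun x => cwedge x _) (fun k c d => cw_linl k c d _)) cw_crz.
- by rewrite -[y]cconjK -cconj_wedge -pull_conj IH cconj_wedge -!pull_conj.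
Qed.
(** Only the full minors are nonzero. The factor |det M|^2 is that of the change of variables, which
    makes integrals of top forms independent of charts. *)
Lemma pull_top n (M : 'M[C]_n) (c : coefs R n) : pull M c (setT, setT) = \det M * (\det M)^* * c (setT, setT).
rewrite /pull (bigD1 (setT, setT)) //= big1 => [|[K L]]; first by rewrite minorT addr0 mulrC.
have H (K' : {set 'I_n}) : K' != setT -> minor M setT K' = 0.
 move=> h; apply:minor_card; apply:contra h => /eqP h; rewrite eqEcard subsetT /=.
 by rewrite -h.
rewrite negb_and => /orP[/H ->|/H ->]; first by ring.
ring.
Qed.
Lemma pull_deg n m (M : 'M[C]_(n, m)) (c : coefs R m) (I J : {set 'I_n}) :
 (forall K L : {set 'I_m}, #|K| = #|I| -> #|L| = #|J| -> c (K, L) = 0) -> pull M c (I, J) = 0.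
move=> H; rewrite /pull big1 // => -[K L] _ /=.
have [e1|/minor_card ->] := eqVneq #|I| #|K|; last by ring.
have [e2|/minor_card ->] := eqVneq #|J| #|L|; last by ring.
by rewrite H ?mul0r.
Qed.
End Pull.

(** * Differential calculus of form-valued functions and naturality under holomorphic maps *)

Definition smc (R : realType) (n k : nat) (V : set 'rV[R[i]]_n) (x : 'rV[R[i]]_n -> coefs R k) :=
 forall P, smooth V (fun z => x z P).
Lemma smc_cst (R : realType) (n k : nat) (V : set 'rV[R[i]]_n) (c : coefs R k) : smc V (fun=> c).
move=> P; exact:sm_cst. Qed.
Definition cdz (R : realType) (n k : nat) a (x : 'rV[R[i]]_n -> coefs R k) z : coefs R k := fun P => dz a (fun w => x w P) z.
Definition cdzb (R : realType) (n k : nat) a (x : 'rV[R[i]]_n -> coefs R k) z : coefs R k := fun P => dzbar a (fun w => x w P) z.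

Section Wirtinger.
Variables (R : realType) (n : nat).
Local Notation C := R[i].
Local Notation E := 'rV[C]_n.
Local Notation cf := (coefs R n).
Variable V : set E.
Hypothesis oV : open V.
Implicit Types (f g : E -> C) (z : E) (a b : 'I_n) (x y : E -> cf).
Lemma rD_mulV f g v z : smooth V f -> smooth V g -> V z -> rD (fun w => f w * g w) v z = rD f v z * g z + f z * rD g v z.
move=> sf sg Vz; apply:isD_rD; apply:isD_mul; exact:sm_isD. Qed.
Lemma rD_sumV I (s : seq I) (Pr : pred I) (F : I -> E -> C) v z : (forall i, smooth V (F i)) -> V z ->
 rD (fun w => \sum_(i <- s | Pr i) F i w) v z = \sum_(i <- s | Pr i) rD (F i) v z.
by move=> sF Vz; apply:isD_rD; apply:isD_sum => i _; apply:sm_isD. Qed.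
Lemma rD_cstV (c : C) v z : rD (fun _ : E => c) v z = 0.
apply:isD_rD; exact:isD_cst. Qed.
Lemma rD_congr f g v z : (forall w, V w -> f w = g w) -> smooth V f -> V z -> rD f v z = rD g v z.
move=> fg sf Vz; symmetry; apply:isD_rD; apply:isD_near (sm_isD v sf Vz).
apply:filterS (nr_op oV Vz) => w; exact:fg.
Qed.
Lemma rD_conjV f v z : smooth V f -> V z -> rD (fun w => (f w)^*) v z = (rD f v z)^*.
move=> sf Vz; apply:isD_rD; apply:isD_conj; exact:sm_isD. Qed.
Lemma dz_mul a f g z : smooth V f -> smooth V g -> V z ->
 (dz a (fun w => f w * g w) z = dz a f z * g z + f z * dz a g z) *
 (dzbar a (fun w => f w * g w) z = dzbar a f z * g z + f z * dzbar a g z).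
move=> sf sg Vz; rewrite !dzE !dzbarE !rD_mulV //; split; ring. Qed.
Lemma dz_sum a I (s : seq I) (Pr : pred I) (F : I -> E -> C) z : (forall i, smooth V (F i)) -> V z ->
 (dz a (fun w => \sum_(i <- s | Pr i) F i w) z = \sum_(i <- s | Pr i) dz a (F i) z) *
 (dzbar a (fun w => \sum_(i <- s | Pr i) F i w) z = \sum_(i <- s | Pr i) dzbar a (F i) z).
move=> sF Vz; rewrite dzE dzbarE !rD_sumV // mulr_sumr -sumrB -big_split !mulr_suml.
by split; apply:eq_bigr=> i; rewrite ?dzE ?dzbarE.
Qed.
Lemma dz_cst a (c : C) z : (dz a (fun _ : E => c) z = 0) * (dzbar a (fun _ : E => c) z = 0).
rewrite dzE dzbarE !rD_cstV; split; ring. Qed.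
Lemma dz_add a f g z : smooth V f -> smooth V g -> V z -> dz a (fun w => f w + g w) z = dz a f z + dz a g z.
move=> sf sg Vz; have E v : rD (fun w => f w + g w) v z = rD f v z + rD g v z.
 apply:isD_rD; apply:isD_add; exact:sm_isD.
rewrite !dzE !E; ring.
Qed.
Lemma dz_scale a (c : C) f z : smooth V f -> V z ->
 (dz a (fun w => c * f w) z = c * dz a f z) * (dzbar a (fun w => c * f w) z = c * dzbar a f z).
by move=> sf Vz; rewrite !(dz_mul _ (@sm_cst R n V c)) // !dz_cst mul0r !add0r. Qed.
Lemma dz_congr a f g z : (forall w, V w -> f w = g w) -> smooth V f -> V z ->
 (dz a f z = dz a g z) * (dzbar a f z = dzbar a g z).
by move=> fg sf Vz; rewrite !dzE !dzbarE !(rD_congr _ fg). Qed.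
Lemma dz_conj a f z : smooth V f -> V z ->
 (dz a (fun w => (f w)^*) z = (dzbar a f z)^*) * (dzbar a (fun w => (f w)^*) z = (dz a f z)^*).
move=> sf Vz; rewrite !dzE !dzbarE !rD_conjV // !cjM cjV cj_nat cjB cjD cjM cj_i; split; ring.
Qed.
Definition cdel x z : cf := csum (fun a => crz a (cdz a x z)).
Definition cdelbar x z : cf := csum (fun a => crb a (cdzb a x z)).
Lemma smc_lin (g : E -> C) x y : smooth V g -> smc V x -> smc V y -> smc V (fun z => clin (g z) (x z) (y z)).
move=> sg sx sy P; apply:sm_add => //; exact:sm_mul. Qed.
Lemma smc_crz a x : smc V x -> smc V (fun z => crz a (x z)).
move=> sx P; rewrite /crz; case:(a \in P.1); [apply:sm_mul; [exact:sm_cst|exact:sx]|exact:sm_cst]. Qed.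
Lemma smc_crb a x : smc V x -> smc V (fun z => crb a (x z)).
move=> sx P; rewrite /crb; case:(a \in P.2); [apply:sm_mul; [exact:sm_cst|exact:sx]|exact:sm_cst]. Qed.
Lemma smc_csum (I : finType) (F : I -> E -> cf) : (forall i, smc V (F i)) -> smc V (fun z => csum (fun i => F i z)).
move=> sF P; apply:sm_sum => i _; exact:sF. Qed.
Lemma smc_conj x : smc V x -> smc V (fun z => cconj (x z)).
move=> sx P; apply:sm_mul; [exact:sm_cst|exact:sm_conj]. Qed.
Lemma smc_wedge x y : smc V x -> smc V y -> smc V (fun z => cwedge (x z) (y z)).
move=> sx sy P; apply:sm_sum => Q _; apply:sm_mul; first exact:sm_cst.
exact:sm_mul.
Qed.
Lemma smc_cdz a x : smc V x -> smc V (cdz a x).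
move=> sx P; exact:sm_dz. Qed.
Lemma smc_cdzb a x : smc V x -> smc V (cdzb a x).
move=> sx P; exact:sm_dzb. Qed.
Lemma smc_cdel x : smc V x -> smc V (cdel x).
move=> sx; apply:smc_csum => a; apply:smc_crz; exact:smc_cdz. Qed.
Lemma smc_cdelbar x : smc V x -> smc V (cdelbar x).
move=> sx; apply:smc_csum => a; apply:smc_crb; exact:smc_cdzb. Qed.
Lemma cdz_lin a (g : E -> C) x y z : smooth V g -> smc V x -> smc V y -> V z ->
 cdz a (fun z => clin (g z) (x z) (y z)) z = clin (dz a g z) (x z) (clin (g z) (cdz a x z) (cdz a y z)).
move=> sg sx sy Vz; apply/funext=> P; rewrite /cdz /clin.
have sm := sm_mul sg (sx P).
rewrite dz_add // dz_mul //; ring.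
Qed.
Lemma cdz_cr a b x z : smc V x -> V z ->
 (cdz a (fun z => crz b (x z)) z = crz b (cdz a x z)) * (cdz a (fun z => crb b (x z)) z = crb b (cdz a x z)) *
 (cdzb a (fun z => crz b (x z)) z = crz b (cdzb a x z)).
move=> sx Vz; do ![split]; apply/funext=> P; rewrite /cdz /cdzb /crz /crb; case:ifP => _;
 by rewrite ?dz_cst ?dz_scale.
Qed.
Lemma cdz_csum a (I : finType) (F : I -> E -> cf) z : (forall i, smc V (F i)) -> V z ->
 (cdz a (fun z => csum (fun i => F i z)) z = csum (fun i => cdz a (F i) z)) *
 (cdzb a (fun z => csum (fun i => F i z)) z = csum (fun i => cdzb a (F i) z)).
by move=> sF Vz; split; apply/funext=> P; have [h1 h2] := dz_sum a (index_enum I) xpredT (fun i => sF i P) Vz. Qed.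
Lemma cdz_wedge a x y z : smc V x -> smc V y -> V z ->
 (cdz a (fun z => cwedge (x z) (y z)) z = clin 1 (cwedge (cdz a x z) (y z)) (cwedge (x z) (cdz a y z))) *
 (cdzb a (fun z => cwedge (x z) (y z)) z = clin 1 (cwedge (cdzb a x z) (y z)) (cwedge (x z) (cdzb a y z))).
move=> sx sy Vz; have sm Q Q' : smooth V (fun w => x w Q * y w Q') := sm_mul (sx Q) (sy Q').
split; apply/funext=> P; rewrite /cdz /cdzb /clin mul1r;
 (rewrite dz_sum // => [|Q]; last by apply:sm_mul; [exact:sm_cst|exact:sm]);
 by rewrite -big_split; apply:eq_bigr=> Q _ /=; rewrite dz_scale ?dz_mul //; ring.
Qed.
Lemma cdel_congr x y z : (forall w, V w -> x w = y w) -> smc V x -> V z ->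
 (cdel x z = cdel y z) * (cdelbar x z = cdelbar y z).
move=> xy sx Vz; have xP P w : V w -> x w P = y w P by move/xy=> ->.
by split; congr csum; apply/funext=> a; [congr crz|congr crb]; apply/funext=> P; have [] := dz_congr a (xP P) (sx P) Vz.
Qed.
Lemma cdel_zero x z : (forall w, V w -> x w = czero) -> V z -> (cdel x z = czero) * (cdelbar x z = czero).
move=> x0 Vz; have [<- <-] := cdel_congr (fun w Vw => esym (x0 w Vw)) (smc_cst V czero) Vz.
by split; apply/funext=> P; rewrite /cdel /cdelbar /csum big1 // => a; rewrite /crb /crz /cdzb /cdz dz_cst mulr0; case:ifP.
Qed.
Lemma cconj_csum (I : finType) (F : I -> cf) : cconj (csum F) = csum (fun i => cconj (F i)).
by apply/funext=> P; rewrite /cconj cj_sum mulr_sumr. Qed.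
Lemma cdel_conj x z : smc V x -> V z ->
 (cdel (fun z => cconj (x z)) z = cconj (cdelbar x z)) * (cdelbar (fun z => cconj (x z)) z = cconj (cdel x z)).
move=> sx Vz; have sc P : smooth V (fun w => (x w (P.2, P.1))^*) by apply:sm_conj.
rewrite !cconj_csum; split; congr csum; apply/funext=> a; rewrite ?cconj_crz ?cconj_crb; [congr crz|congr crb];
 by apply/funext=> P; rewrite /cdz /cdzb dz_scale ?dz_conj.
Qed.
Lemma csum_lin (I : finType) k (F G : I -> cf) : csum (fun i => clin k (F i) (G i)) = clin k (csum F) (csum G).
by apply/funext=> P; rewrite /clin mulr_sumr -big_split. Qed.
Lemma csum_antisym (F : 'I_n -> 'I_n -> cf) : (forall a b, F a b = clin (-1) (F b a) czero) ->
 csum (fun a => csum (fun b => F a b)) = czero.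
move=> H; apply/funext=> P; rewrite /csum /czero; set S := \sum_a _.
have : S = - S.
 rewrite [LHS]exchange_big /= -sumrN; apply:eq_bigr=> a _; rewrite -sumrN; apply:eq_bigr=> b _.
 by rewrite H /clin addr0 mulN1r.
by move/eqP; rewrite -addr_eq0 -mulr2n mulrn_eq0 => /eqP.
Qed.
Lemma cdel_lin (k : C) x y z : smc V x -> smc V y -> V z -> cdel (fun z => clin k (x z) (y z)) z = clin k (cdel x z) (cdel y z).
move=> sx sy Vz; rewrite /cdel -csum_lin; congr csum; apply/funext=> a.
rewrite (cdz_lin a (@sm_cst R n V k) sx sy Vz) dz_cst -crz_lin; congr crz.
by apply/funext=> P; rewrite /clin; ring.
Qed.
Lemma cdel_cdel x z : smc V x -> V z -> cdel (cdel x) z = czero.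
move=> sx Vz; rewrite /cdel.
transitivity (csum (fun a => csum (fun b => crz a (crz b (cdz a (cdz b x) z))))).
 congr csum; apply/funext=> a; rewrite cdz_csum // => [|b]; last by apply:smc_crz; exact:smc_cdz.
 rewrite (clin_csum (@crz_lin R n a)); congr csum; apply/funext=> b.
 rewrite cdz_cr //; exact:smc_cdz.
apply:csum_antisym => a b; rewrite crzC.
have -> : cdz a (cdz b x) z = cdz b (cdz a x) z by apply/funext=> P; exact:(dz_dzC oV (sx P)).
by [].
Qed.
Lemma cdel_cdelbar x z : smc V x -> V z -> cdel (cdelbar x) z = clin (-1) (cdelbar (cdel x) z) czero.
move=> sx Vz; rewrite /cdel /cdelbar.
transitivity (csum (fun a => csum (fun b => crz a (crb b (cdz a (cdzb b x) z))))).
 congr csum; apply/funext=> a; rewrite cdz_csum // => [|b]; last by apply:smc_crb; exact:smc_cdzb.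
 rewrite (clin_csum (@crz_lin R n a)); congr csum; apply/funext=> b.
 rewrite cdz_cr //; exact:smc_cdzb.
transitivity (clin (-1) (csum (fun b => csum (fun a => crb b (crz a (cdzb b (cdz a x) z))))) czero); last first.
 congr clin; congr csum; apply/funext=> b; rewrite cdz_csum // => [|a]; last by apply:smc_crz; exact:smc_cdz.
 rewrite (clin_csum (@crb_lin R n b)); congr csum; apply/funext=> a.
 rewrite cdz_cr //; exact:smc_cdz.
apply/funext=> P; rewrite /clin /csum addr0 exchange_big mulr_sumr; apply:eq_bigr=> b _.
rewrite mulr_sumr; apply:eq_bigr=> a _; rewrite crzbC /clin addr0; congr (_ * crb b (crz a _)).
apply/funext=> Q; exact:(dz_dzbarC oV (sx Q)).
Qed.
Lemma cdel_wedge x y z : smc V x -> smc V y -> V z ->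
 (cdel (fun z => cwedge (x z) (y z)) z = clin 1 (cwedge (cdel x z) (y z)) (cwedge (csgn (x z)) (cdel y z))) *
 (cdelbar (fun z => cwedge (x z) (y z)) z = clin 1 (cwedge (cdelbar x z) (y z)) (cwedge (csgn (x z)) (cdelbar y z))).
move=> sx sy Vz; have H := clin_csum (fun k c d => cw_linr k (csgn (x z)) c d).
rewrite !cw_sum !H -!csum_lin; split; congr csum; apply/funext=> a.
 by rewrite cdz_wedge // crz_lin cw_crz cw_sgn_crz.
by rewrite cdz_wedge // crb_lin cw_crb cw_sgn_crb.
Qed.
(** A Leibniz rule: the terms in which x is differentiated assemble, after anticommuting, to [T k]
    of [cdel x], which vanishes at z. The flag s treats dz_k and dzbar_k together. *)
Lemma cdel_comb (s : bool) (g : 'I_n -> E -> C) x z : let T := if s then @crz R n else @crb R n in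
 (forall k, smooth V (g k)) -> smc V x -> V z -> cdel x z = czero ->
 cdel (fun z => csum (fun k => clin (g k z) (T k (x z)) czero)) z =
 csum (fun a => csum (fun k => clin (dz a (g k) z) (crz a (T k (x z))) czero)).
move=> T sg sx Vz d0.
have TL k : forall t c d, T k (clin t c d) = clin t (T k c) (T k d).
 rewrite /T; case:s {T}; [exact:crz_lin|exact:crb_lin].
have sT k : smc V (fun z => T k (x z)) by rewrite /T; case:s {T TL}; [exact:smc_crz|exact:smc_crb].
have D a k : cdz a (fun z => T k (x z)) z = T k (cdz a x z) by rewrite /T; case:s {T TL sT}; rewrite cdz_cr.
have A a k c : crz a (T k c) = clin (-1) (T k (crz a c)) czero.
 rewrite /T; case:s {T TL sT D}; [exact:crzC|exact:crzbC].
have sz : smc V (fun=> czero : cf) := smc_cst V czero.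
have sF k : smc V (fun z => clin (g k z) (T k (x z)) czero) by exact:smc_lin.
apply/funext=> P; rewrite /cdel /csum.
transitivity (\sum_a \sum_k (dz a (g k) z * crz a (T k (x z)) P - g k z * T k (crz a (cdz a x z)) P)).
 apply:eq_bigr=> a _; rewrite (cdz_csum a sF Vz) (clin_csum (crz_lin a)); apply:eq_bigr=> k _.
 rewrite (cdz_lin a (sg k) (sT k) sz Vz) D !crz_lin !A (_ : cdz a (fun=> czero) z = czero) ?(clin0 (crz_lin a)).
  rewrite /clin; ring.
 by apply/funext=> Q; rewrite /cdz dz_cst.
under eq_bigr do rewrite sumrB; rewrite sumrB [X in _ - X]exchange_big [X in _ - X]big1 ?subr0 => [|k _].
 by apply:eq_bigr=> a _; apply:eq_bigr=> k; rewrite /clin addr0.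
rewrite -mulr_sumr -[\sum_a _]/(csum (fun a => T k (crz a (cdz a x z))) P) -(clin_csum (TL k)) -/(cdel x z).
by rewrite d0 (clin0 (TL k)) mulr0.
Qed.
End Wirtinger.

Section PullbackDerivative.
Variables (R : realType) (n m : nat).
Local Notation C := R[i].
Variables (V : set 'rV[C]_n) (W : set 'rV[C]_m) (phi : 'rV[C]_n -> 'rV[C]_m).
Hypotheses (oV : open V) (oW : open W) (VW : forall z, V z -> W (phi z)).
Hypothesis sphi : forall b, smooth V (fun z => phi z 0 b).
Hypothesis hphi : forall a b z, V z -> dzbar a (fun z => phi z 0 b) z = 0.
Definition Jac z : 'M[C]_(n, m) := \matrix_(a, b) dz a (fun z => phi z 0 b) z.
Lemma rD_dz f (v : 'I_n) z : rD f (ev R v) z = dz v f z + dzbar v f z /\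
 rD f (iev R v) z = 'i%C * (dz v f z - dzbar v f z).
rewrite dzE dzbarE; have := @sqri R; move: ('i%C : C) => j jj; split; first by field.
rewrite [RHS](_ : _ = - (j * j) * rD f (iev R v) z); last by field.
rewrite jj; ring.
Qed.
Lemma chain_rule f a z : smooth W f -> V z ->
 dz a (fun z => f (phi z)) z = \sum_b Jac z a b * dz b f (phi z) /\
 dzbar a (fun z => f (phi z)) z = \sum_b (Jac z a b)^* * dzbar b f (phi z).
move=> sf Vz.
have D v : rD (fun z => f (phi z)) v z = dform f (phi z) (\row_b rD (fun z => phi z 0 b) v z).
 apply:isD_rD; apply:(isD_comp oW sf (VW Vz)) => b; rewrite mxE; exact:sm_isD.
have E1 b : rD (fun z => phi z 0 b) (ev R a) z = Jac z a b.
 by rewrite (rD_dz _ a z).1 hphi // addr0 mxE.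
have E2 b : rD (fun z => phi z 0 b) (iev R a) z = 'i%C * Jac z a b.
 by rewrite (rD_dz _ a z).2 hphi // subr0 mxE.
have D1 : rD (fun z => f (phi z)) (ev R a) z = \sum_b (Jac z a b * dz b f (phi z) + (Jac z a b)^* * dzbar b f (phi z)).
 by rewrite D dformE; apply:eq_bigr=> b; rewrite mxE E1.
have D2 : rD (fun z => f (phi z)) (iev R a) z = 'i%C * \sum_b (Jac z a b * dz b f (phi z) - (Jac z a b)^* * dzbar b f (phi z)).
 rewrite D dformE mulr_sumr; apply:eq_bigr=> b _; rewrite mxE E2 cjM cj_i; ring.
rewrite dzE dzbarE D1 D2 mulrA sqri big_split sumrB /=.
by split; field.
Qed.
Lemma Jac_sm a b : smooth V (fun z => Jac z a b).
rewrite (_ : (fun z => _) = dz a (fun z => phi z 0 b)); first exact:sm_dz.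
by apply/funext=> z; rewrite mxE.
Qed.
Lemma Jac_hol a k b z : V z -> dzbar a (fun z => Jac z k b) z = 0.
move=> Vz; rewrite (_ : (fun z => _) = dz k (fun z => phi z 0 b)); last by apply/funext=> w; rewrite mxE.
rewrite -(dz_dzbarC oV (sphi b) Vz) -(dz_congr oV k (f := fun=> 0)) ?dz_cst //; last exact:sm_cst.
by move=> w Vw; rewrite hphi.
Qed.
Lemma Jac_sym a k b z : V z -> dz a (fun z => Jac z k b) z = dz k (fun z => Jac z a b) z.
move=> Vz; have E c : (fun z => Jac z c b) = dz c (fun z => phi z 0 b) by apply/funext=> w; rewrite mxE.
rewrite !E; exact:(dz_dzC oV (sphi b)).
Qed.
Lemma sm_minor (M : 'rV[C]_n -> 'M[C]_(n, m)) (I : {set 'I_n}) (K : {set 'I_m}) :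
 (forall a b, smooth V (fun z => M z a b)) -> smooth V (fun z => minor (M z) I K).
move=> sM; rewrite /minor; case:eqVneq => [e|_]; last exact:sm_cst.
rewrite /determinant; apply:sm_sum => s _; apply:sm_mul; first exact:sm_cst.
have H j k : smooth V (fun z => (\matrix_(a < #|I|, b < #|I|) M z (enum_val a) (enum_val (cast_ord e b))) j k).
 rewrite (_ : (fun z => _) = fun z => M z (enum_val j) (enum_val (cast_ord e k))); first exact:sM.
 by apply/funext=> z; rewrite mxE.
exact:sm_prod.
Qed.
Definition mm (P : {set 'I_n} * {set 'I_n}) (Q : {set 'I_m} * {set 'I_m}) z : C :=
 minor (Jac z) P.1 Q.1 * (minor (Jac z) P.2 Q.2)^*.
Lemma mm_sm P Q : smooth V (mm P Q).
apply:sm_mul; [|apply:sm_conj]; apply:sm_minor; exact:Jac_sm.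
Qed.
Lemma smc_pull (c : 'rV[C]_n -> coefs R m) : smc V c -> smc V (fun z => pull (Jac z) (c z)).
move=> sc P; apply:sm_sum => Q _; apply:sm_mul; [exact:sc|exact:mm_sm]. Qed.
(** By induction on the constant form c: for a factor dw_b the symmetric second derivatives of phi
    meet the antisymmetric dz_a dz_k, and for a conjugate factor the Jacobian entries are
    antiholomorphic. *)
Lemma cdel_pull0 c z : V z -> cdel (fun z => pull (Jac z) c) z = czero.
move=> Vz; have sp d : smc V (fun z => pull (Jac z) d) by apply:smc_pull; exact:smc_cst.
elim/(@coefs_ind R m): c => [k c d IHc IHd||b c IH|b c IH].
- have -> : (fun z => pull (Jac z) (clin k c d)) = fun z => clin k (pull (Jac z) c) (pull (Jac z) d).
  apply/funext=> w; exact:pull_clin.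
 rewrite (cdel_lin k (sp c) (sp d) Vz) IHc IHd; apply/funext=> P; rewrite /clin; ring.
- have -> : (fun z => pull (Jac z) (cone : coefs R m)) = fun=> cone by apply/funext=> w; exact:pull_cone.
 apply/funext=> P; rewrite /cdel /csum big1 // => a _; rewrite /crz; case:ifP => // _.
 by rewrite /cdz dz_cst mulr0.
- rewrite (_ : (fun z => _) = fun z => csum (fun k => clin (Jac z k b) (crz k (pull (Jac z) c)) czero)); last first.
  apply/funext=> w; exact:pull_crz.
 rewrite (cdel_comb true (g := fun k z => Jac z k b) _ (sp c) Vz IH) => [|k]; last exact:Jac_sm.
 apply:csum_antisym => a k; rewrite crzC Jac_sym //; apply/funext=> P; rewrite /clin; ring.
- rewrite (_ : (fun z => _) = fun z => csum (fun k => clin (Jac z k b)^* (crb k (pull (Jac z) c)) czero)); last first.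
  apply/funext=> w; exact:pull_crb.
 rewrite (cdel_comb false (g := fun k z => (Jac z k b)^*) _ (sp c) Vz IH) => [|k]; last first.
  apply:sm_conj; exact:Jac_sm.
 apply/funext=> P; rewrite /csum big1 // => a; rewrite big1 // => k _.
 rewrite (dz_conj a (@Jac_sm k b) Vz) Jac_hol // /clin; ring.
Qed.
(** The product rule lets the derivative fall on the minors or on the coefficients. The first part
    is that of a constant form, with coefficients frozen at z, and vanishes by [cdel_pull0]; the
    second is the chain rule. *)
Lemma cdel_pull c z : smc W c -> V z ->
 cdel (fun z => pull (Jac z) (c (phi z))) z = pull (Jac z) (cdel c (phi z)).
move=> sc Vz; have scp : smc V (fun z => c (phi z)).
 move=> P; apply:(sm_comp oV oW VW sphi (sc P)).
have D a : cdz a (fun z => pull (Jac z) (c (phi z))) z =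
  clin 1 (cdz a (fun w => pull (Jac w) (c (phi z))) z) (pull (Jac z) (cdz a (fun z => c (phi z)) z)).
 apply/funext=> P; rewrite /clin mul1r /cdz /pull.
 rewrite (dz_sum (V := V) a _ _ (F := fun Q w => c (phi w) Q * mm P Q w)) // => [|Q]; last first.
  apply:sm_mul; [exact:scp|exact:mm_sm].
 rewrite (dz_sum (V := V) a _ _ (F := fun Q w => c (phi z) Q * mm P Q w)) // => [|Q]; last first.
  apply:sm_mul; [exact:sm_cst|exact:mm_sm].
 rewrite -big_split; apply:eq_bigr=> Q _ /=.
 rewrite (dz_mul a (scp Q) (@mm_sm P Q) Vz) (dz_scale a _ (@mm_sm P Q) Vz) /mm; ring.
have D2 a : cdz a (fun z => c (phi z)) z = csum (fun b => clin (Jac z a b) (cdz b c (phi z)) czero).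
 apply/funext=> P; rewrite /cdz (chain_rule a (sc P) Vz).1; apply:eq_bigr=> b _.
 by rewrite /clin addr0.
transitivity (clin 1 (cdel (fun w => pull (Jac w) (c (phi z))) z)
  (csum (fun a => crz a (pull (Jac z) (cdz a (fun z => c (phi z)) z))))).
 rewrite -csum_lin; congr csum; apply/funext=> a; by rewrite D crz_lin.
rewrite cdel_pull0 //; apply/funext=> P; rewrite /clin mulr0 add0r.
rewrite (clin_csum (@pull_clin R n m (Jac z))).
transitivity (\sum_a \sum_b Jac z a b * crz a (pull (Jac z) (cdz b c (phi z))) P).
 apply:eq_bigr=> a _; rewrite D2 (clin_csum (@pull_clin R n m (Jac z))) (clin_csum (crz_lin a)).
 apply:eq_bigr=> b _; rewrite (clinZ (@pull_clin R n m (Jac z))) (clinZ (crz_lin a)).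
 by rewrite /clin addr0.
rewrite exchange_big; apply:eq_bigr=> b _; rewrite pull_crz; apply:eq_bigr=> a _.
by rewrite /clin addr0.
Qed.
End PullbackDerivative.
Lemma Jac_comp (R : realType) n m l (V : set 'rV[R[i]]_n) (W : set 'rV[R[i]]_m)
  (phi : 'rV[R[i]]_n -> 'rV[R[i]]_m) (psi : 'rV[R[i]]_m -> 'rV[R[i]]_l) g z :
 open V -> open W -> (forall z, V z -> W (phi z)) -> (forall b, smooth V (fun z => phi z 0 b)) ->
 (forall a b z, V z -> dzbar a (fun z => phi z 0 b) z = 0) -> (forall b, smooth W (fun z => psi z 0 b)) ->
 (forall z, V z -> psi (phi z) = g z) -> V z -> Jac g z = Jac phi z *m Jac psi (phi z).
move=> oV oW VW sphi hphi spsi pg Vz; apply/matrixP=> a b; rewrite !mxE.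
have sc : smooth V (fun z => psi (phi z) 0 b) by exact:(@sm_comp R m n V W (fun w => psi w 0 b) phi oV oW VW sphi (spsi b)).
rewrite -(dz_congr oV a (f := fun z => psi (phi z) 0 b)) // => [|w Vw]; last by rewrite pg.
by rewrite (@chain_rule R n m V W phi oW VW sphi hphi (fun w => psi w 0 b) a z (spsi b) Vz).1; apply:eq_bigr=> c; rewrite !mxE.
Qed.
Lemma Jac_id (R : realType) n (V : set 'rV[R[i]]_n) (g : 'rV[R[i]]_n -> 'rV[R[i]]_n) z :
 open V -> (forall w, V w -> g w = w) -> V z -> Jac g z = 1%:M.
move=> oV gE Vz; apply/matrixP=> a b; rewrite !mxE.
rewrite -(dz_congr oV a (f := fun w => w 0 b)) //; [|by move=> w Vw; rewrite gE|exact:sm_coord].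
rewrite dzE !(isD_rD (isD_coord b _ z)) !mxE /= mulrA sqri eq_sym.
by field.
Qed.

(** * Compact supports and the holomorphic change of variables *)

Section CompactSupport.
Variables (R : realType) (n : nat).
Local Notation C := R[i].
Local Notation E := 'rV[C]_n.
Implicit Types (V U : set E) (f g : E -> C) (K L : set E).
Lemma cpt_closedE K : compact K -> closed K.
by apply:compact_closed. Qed.
Lemma cpt_openC K : compact K -> open (~` K).
move=> cK; apply:closed_openC; exact:cpt_closedE. Qed.
Lemma nr_out K z : compact K -> ~ K z -> \forall y \near z, ~ K y.
move=> cK nK; exact:nr_op (cpt_openC cK) nK.
Qed.
Lemma cpt_rn_bdd K : compact K -> exists2 r : R, 0 <= r & forall z, K z -> rn z < r.
move=> cK; have [ys [_ H]] := cpt_net cK (ltr01 : (0 : R) < 1).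
exists (\sum_(y <- ys) rn y + 1); first by rewrite addr_ge0 // sumr_ge0 // => y _; exact:rn_ge0.
move=> z /H[y yin hy]; apply:le_lt_trans (_ : _ <= rn (z - y) + rn y) _.
 by have := rnD (z - y) y; rewrite subrK.
have : rn y <= \sum_(y <- ys) rn y.
 rewrite (big_rem y) //= lerDl sumr_ge0 // => x _; exact:rn_ge0.
lra.
Qed.
Definition csupp V f := (forall z, V z -> cts f z) /\
 exists K, [/\ compact K, K `<=` V & forall z, ~ K z -> f z = 0].
Lemma csupp_cts V f z : csupp V f -> cts f z.
move=> [fc [K [cK KV f0]]]; have [Kz|nK] := pselect (K z); first by apply:fc; exact:KV.
by apply:cts_near (cts_cst 0 z); apply:filterS (nr_out cK nK) => y /f0.
Qed.
Lemma csupp_Cc V f : csupp V f -> exists2 r : R, 0 <= r & Cc r f.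
move=> cf; have [_ [K [cK _ f0]]] := cf; have [r r0 Hr] := cpt_rn_bdd cK.
exists r => //; split=> [z|z hz]; first exact:csupp_cts cf.
by apply:f0 => /Hr; rewrite ltNge hz.
Qed.
(* Lebesgue number *)
Lemma cpt_margin K U : compact K -> open U -> K `<=` U ->
 exists2 d : R, 0 < d & forall z w, K z -> rn (w - z) <= d -> U w.
move=> /compact_near_coveringP cK oU KU.
have H := cK R (0 : R)^'+ (fun d z => forall w, rn (w - z) <= d -> U w).
have {H} : \forall d \near (0 : R)^'+, K `<=` (fun z => forall w, rn (w - z) <= d -> U w).
 apply:H => z Kz; have [d d0 Hd] := (openE_P U).1 oU z (KU z Kz).
 have d20 : 0 < d / 2 by lra.
 exists ([set y | rn (y - z) < d / 2], [set t | 0 < t < d / 2]) => /=.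
  by split; [apply/nbhsE_P; exists (d / 2)|exact:nr_right0].
 move=> [y t] /= [h1 /andP[t0 h2]] w hw; apply:Hd.
 have := rn_distD w y z; lra.
move=> H; have /filter_ex[d [h1 h2]] : \forall d \near (0 : R)^'+,
  (K `<=` (fun z => forall w, rn (w - z) <= d -> U w)) /\ 0 < d.
 by apply:filterS2 H (nbhs_right_gt (0 : R)).
exists d => // z w Kz; exact:h1.
Qed.
Lemma cpt_thicken K (d : R) : compact K -> compact [set w | exists2 z, K z & rn (w - z) <= d].
move=> cK; have cB : compact (Ball d : set E) by exact:cpt_Ball.
have cX : compact (K `*` (Ball d : set E)) by exact:compact_setX.
have ac : continuous (fun p : E * E => p.1 + p.2).
 move=> [x y]; apply:cvgD; [exact:cvg_fst|exact:cvg_snd].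
have -> : [set w | exists2 z, K z & rn (w - z) <= d] = (fun p : E * E => p.1 + p.2) @` (K `*` Ball d).
 apply/seteqP; split=> [w [z Kz h]|_ [[z b] /= [Kz Bb] <-]].
  by exists (z, w - z) => /=; [split|rewrite addrC subrK].
 by exists z => //=; rewrite addrC addKr.
apply:continuous_compact cX; exact:continuous_subspaceT.
Qed.
Lemma cpt_image m (K : set E) (phi : E -> 'rV[C]_m) V : compact K -> open V -> K `<=` V ->
 (forall z, V z -> phi @ z --> phi z) -> compact (phi @` K).
move=> cK oV KV pc; apply:continuous_compact => //.
apply:continuous_in_subspaceT => z; rewrite inE => /KV; exact:pc.
Qed.
Lemma vec_cvg m (phi : E -> 'rV[C]_m) z : (forall b, cts (fun z => phi z 0 b) z) -> phi @ z --> phi z.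
move=> H; apply/(@cvgE_P R m E (nbhs z) (nbhs_filter z)) => e e0; apply/nbhsE_P.
exact:vec_cts.
Qed.
Lemma sm_off V K f : open V -> compact K -> K `<=` V -> smooth V f -> (forall z, ~ K z -> f z = 0) -> smooth setT f.
move=> oV cK KV sf f0; apply:sm_local => z _; have [Kz|nK] := pselect (K z).
 exists V => //; split=> //; exact:KV.
have oW := cpt_openC cK; exists (~` K) => //.
apply:(@sm_congr R n _ (fun=> 0)) => // [y /f0|]; [exact:esym|exact:sm_cst].
Qed.
End CompactSupport.

Section StrictVector.
Variables (R : realType) (n m : nat).
Local Notation C := R[i].
Variables (V : set 'rV[C]_n) (phi : 'rV[C]_n -> 'rV[C]_m).
Hypothesis oV : open V.
Hypothesis sphi : forall b, smooth V (fun z => phi z 0 b).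
Hypothesis hphi : forall a b z, V z -> dzbar a (fun z => phi z 0 b) z = 0.
Lemma vec_strict z0 (e : R) : V z0 -> 0 < e -> exists2 d : R, 0 < d &
 forall x y, rn (x - z0) < d -> rn (y - z0) < d ->
  rn (phi x - phi y - (x - y) *m Jac phi z0) <= e * rn (x - y).
move=> Vz e0; have m0 : 0 < (m.+1%:R : R) by [].
have eb : 0 < e / m.+1%:R by rewrite divr_gt0.
pose P b (d : R) := forall x y, rn (x - z0) < d -> rn (y - z0) < d ->
 cn (phi x 0 b - phi y 0 b - dform (fun z => phi z 0 b) z0 (x - y)) <= e / m.+1%:R * rn (x - y).
have HN : \forall d \near (0 : R)^'+, forall b, P b d.
 apply:(@filter_forall _ 'I_m P _ (at_right_proper_filter 0)) => b.
 have [d d0 Hd] := sm_strict oV (sphi b) Vz eb.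
 apply:filterS (nr_right0 d0) => d' /andP[_ dd] x y h1 h2.
 apply:Hd; [exact:lt_trans dd|exact:lt_trans dd].
have [d [h1 h2]] := @filter_ex _ _ (at_right_proper_filter (0 : R)) _ (filterI HN (nbhs_right_gt (0 : R))).
exists d => // x y hx hy; rewrite rnE.
apply:le_trans (_ : \sum_(b < m) e / m.+1%:R * rn (x - y) <= _).
 apply:ler_sum => b _; apply:le_trans (h1 b x y hx hy).
 rewrite !mxE dformE le_eqVlt; apply/orP; left; apply/eqP; congr (cn (_ - _)).
 by apply:eq_bigr=> a; rewrite hphi // mulr0 addr0 [Jac _ _ _ _]mxE.
rewrite sumr_const card_ord -[X in X <= _]mulr_natr mulrAC ler_wpM2r ?rn_ge0 //.
by rewrite mulrAC ler_pdivrMr // ler_pM2l // ler_nat.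
Qed.
Lemma vec_lip z0 : V z0 -> exists d K : R, [/\ 0 < d, 0 < K &
 forall x y, rn (x - z0) < d -> rn (y - z0) < d -> rn (phi x - phi y) <= K * rn (x - y)].
move=> Vz; have [d d0 Hd] := vec_strict Vz ltr01; have [K K0 HK] := rn_mulmx (Jac phi z0).
exists d, (1 + K); split=> //; first by lra.
move=> x y hx hy; have := Hd x y hx hy; have := HK (x - y).
have := rnD (phi x - phi y - (x - y) *m Jac phi z0) ((x - y) *m Jac phi z0); rewrite subrK; lra.
Qed.
End StrictVector.
Lemma expVC_mulK (R : realType) (e : R) (k : nat) (a b c : R[i]) : e != 0 ->
 b = a -> (e ^+ k)%:C%C * c = b -> (e ^- k)%:C%C * a = c.
by move=> e0 <- <-; rewrite mulrA -rmorphM mulVf ?expf_neq0 // mul1r. Qed.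
Lemma scaleVK_mul (R : realType) n m (t : R) (w : 'rV[R[i]]_m) (u : 'rV[R[i]]_n) (N : 'M[R[i]]_(n, m)) : t != 0 ->
 t^-1%:C%C *: w - u *m N = t^-1%:C%C *: (w - (t%:C%C *: u) *m N).
by move=> t0; rewrite scalerBr scalemxAl scalerA -rmorphM mulVf // scale1r. Qed.
Lemma cn_near2 (R : realType) (a b c : R[i]) (e : R) : cn (a - b) < e / 2 -> cn (c - b) < e / 2 -> cn (a - c) < e.
move=> h1; rewrite cnC => h2; apply:le_lt_trans (cn_distD _ b _) _; lra. Qed.

Section ChangeOfVariables.
Variables (R : realType) (n : nat).
Local Notation C := R[i].
Local Notation E := 'rV[C]_n.
Variables (U V : set E) (phi psi : E -> E).
Hypotheses (oU : open U) (oV : open V).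
Hypotheses (UV : forall z, U z -> V (phi z)) (VU : forall z, V z -> U (psi z)).
Hypotheses (phiK : forall z, U z -> psi (phi z) = z) (psiK : forall z, V z -> phi (psi z) = z).
Hypothesis sphi : forall b, smooth U (fun z => phi z 0 b).
Hypothesis hphi : forall a b z, U z -> dzbar a (fun z => phi z 0 b) z = 0.
Hypothesis spsi : forall b, smooth V (fun z => psi z 0 b).
Hypothesis hpsi : forall a b z, V z -> dzbar a (fun z => psi z 0 b) z = 0.
Local Notation rd := (rad R n).
Lemma Jac_inv z : U z -> Jac phi z *m Jac psi (phi z) = 1%:M.
move=> Uz; rewrite -(Jac_comp oU oV UV sphi hphi spsi phiK Uz).
exact:(Jac_id oU (fun _ _ => erefl) Uz).
Qed.
Definition kk s (e : R) y : C := if `[< V y >] then pkerT e (psi y - s) else 0.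
Lemma kk_csupp s (e : R) : 0 < e -> (forall w, rn (w - s) <= e * rd -> U w) -> csupp V (kk s e).
move=> e0 H; split=> [y Vy|].
 have : cts (fun y => pkerT e (psi y - s)) y.
  apply:(@cts_comp R n n (pkerT e) (fun y => psi y - s)) => [b|].
   have := cts_lin 1 (sm_cont (spsi b) Vy) (cts_cst (- s 0 b) y).
   by apply:cts_near; apply:(@filterE _ (nbhs y) (nbhs_filter y)) => w; rewrite mul1r !mxE.
  exact:sm_cont (@pkerT_sm R n e) I.
 by apply:cts_near; apply:filterS (nr_op oV Vy) => w; rewrite /kk; case:asboolP.
exists (phi @` [set w | rn (w - s) <= e * rd]); split.
- apply:(cpt_image (V := U)) => //; first exact:cpt_rball.
 move=> z Uz; apply:vec_cvg => b; exact:sm_cont.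
- move=> _ [w hw <-]; apply:UV; exact:H.
move=> y ny; rewrite /kk; case:asboolP=> // Vy; apply:(@pkerT_Cc R n e e0).2.
rewrite leNgt mulrC; apply/negP=> h; apply:ny; exists (psi y); [exact:ltW|exact:psiK].
Qed.
Definition HH s (e : R) u : C := kk s e (phi s + e%:C%C *: u).
Lemma kk_HH s (e : R) : 0 < e -> (forall w, rn (w - s) <= e * rd -> U w) ->
 (e ^- (2 * n))%:C%C * icn (kk s e) = icn (HH s e).
move=> e0 H; have [r r0 Ck] := csupp_Cc (kk_csupp e0 H).
have ne : e != 0 by lra.
have rx : 0 <= r + rn (phi s) by rewrite addr_ge0 // rn_ge0.
have E1 := int_shift (phi s) r0 Ck; have E2 := int_scale ne rx (Cc_shift (phi s) Ck).
have E3 : HH s e = fun v => kk s e (e%:C%C *: v + phi s).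
 by apply/funext=> u; rewrite addrC.
rewrite E3; exact:(expVC_mulK ne E1).
Qed.
(** The rescaled kernel u -> p((psi(phi s' + e u) - s') / e) tends to p(u N), with N the Jacobian of
    psi at phi s, as s' tends to s and e to 0. The linear change of variables evaluates the integral
    of the limit. *)
Lemma HH_limit s : U s -> forall eta : R, 0 < eta ->
 \forall s' \near s & e \near (0 : R)^'+, cn (icn (HH s' e) - \det (Jac phi s) * (\det (Jac phi s))^*) < eta.
move=> Us; set M := Jac phi s; set N := Jac psi (phi s).
have MN : M *m N = 1%:M by exact:Jac_inv.
have [Mu Nu] := mulmx1_unit MN.
have [KM KM0 HM] := rn_mulmx M.
have [d1 [K1 [d10 K10 L1]]] := vec_lip oU sphi hphi Us.
have [d2 d20 Hd2] := (openE_P U).1 oU s Us.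
have rd1 := rad_gt0 R n.
(* A common support radius: the Lipschitz constant K1 of phi bounds the supports of the rescaled
   kernels, the norm KM of its Jacobian that of the limit. *)
pose r1 := (K1 + KM) * rd; have r10 : 0 <= r1 by rewrite mulr_ge0 ?addr_ge0 // ltW.
have bI := @int_ccfun R n r1 r10.
pose g u := pker (u *m N).
have Cg : Cc r1 g.
 split=> [u|u hu].
  by have [r' _ [gc _]] := Cc_mulmx Nu (ltW rd1) (@pker_Cc R n); exact:gc.
 apply:pker_rad; have : rn u <= KM * rn (u *m N).
  by rewrite -{1}[u]mulmx1 -(mulmx1C MN) mulmxA; exact:HM.
 move=> h; have : (K1 + KM) * rd <= KM * rn (u *m N) by exact:le_trans hu h.
 rewrite mulrDl => h2; have h3 : 0 <= K1 * rd by rewrite mulr_ge0 // ltW.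
 by rewrite -(ler_pM2l KM0); lra.
have gI : icn g = \det M * (\det M)^*.
 have := linear_change Nu (ltW rd1) (@pker_Cc R n); rewrite pker_int => H.
 have dMN : \det M * \det N = 1 by rewrite -det_mulmx MN det1.
 have E1 : \det M * (\det M)^* * (\det N * (\det N)^*) = 1.
  by rewrite mulrACA -cjM dMN cj1 mulr1.
 by rewrite -[RHS]mulr1 -H [RHS]mulrA E1 mul1r.
pose FF0 := (0 : R)^'+; pose Fl := filter_prod (nbhs s) FF0.
have FFl : Filter Fl by exact:filter_prod_filter.
pose d3 := Num.min d1 d2 / 2; have d30 : 0 < d3 by rewrite divr_gt0 // lt_min d10.
have d3a : d3 + d3 <= d1 by rewrite -splitr ge_min lexx.
have d3b : d3 + d3 <= d2 by rewrite -splitr ge_min lexx orbT.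
pose e3 := d3 / (rd + 1); have e30 : 0 < e3 by rewrite divr_gt0 //; lra.
have e3rd (e : R) : 0 < e -> e < e3 -> e * rd < d3.
 move=> e0; rewrite ltr_pdivlMr; last by lra.
 by rewrite mulrDr mulr1 => h; lra.
have goodU s' (e : R) : rn (s' - s) < d3 -> 0 < e -> e < e3 -> forall w, rn (w - s') <= e * rd -> U w.
 move=> hs e0 ee w hw; apply:Hd2; have := rn_distD w s' s; have := e3rd e e0 ee; lra.
have CH s' (e : R) : rn (s' - s) < d3 -> 0 < e -> e < e3 -> Cc r1 (HH s' e).
 move=> hs e0 ee; have GU := goodU s' e hs e0 ee.
 have ck := csupp_cts _ (kk_csupp e0 GU).
 split=> [u|u hu].
  apply:(@cts_comp R n n (kk s' e) (fun u => phi s' + e%:C%C *: u)) => [b|]; last exact:ck.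
  have := cts_lin e%:C%C (@cts_coord R n b u) (cts_cst (phi s' 0 b) u).
  by apply:cts_near; apply:(@filterE _ (nbhs u) (nbhs_filter u)) => w; rewrite !mxE addrC.
 rewrite /HH /kk; case:asboolP=> // Vy; set y := phi s' + _ in Vy *.
 apply:(@pkerT_Cc R n e e0).2; rewrite leNgt; apply/negP=> h.
 have ht : rn (psi y - s) < d1.
  by have := rn_distD (psi y) s' s; have := e3rd e e0 ee; rewrite mulrC in h; lra.
 have hs1 : rn (s' - s) < d1 by lra.
 have := L1 _ _ ht hs1; rewrite psiK //; have -> : y - phi s' = e%:C%C *: u by rewrite /y addrC addKr.
 rewrite rnZ gtr0_norm // => h1.
 have h2 : e * rn u < e * (K1 * rd).
  apply:le_lt_trans h1 _; rewrite mulrCA ltr_pM2l // mulrC; exact:h.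
 rewrite ltr_pM2l // in h2; have : K1 * rd <= r1 by rewrite /r1 mulrDl lerDl mulr_ge0 // ltW.
 lra.
have NN : \forall t \near Fl, rn (t.1 - s) < d3 /\ (0 < t.2 /\ t.2 < e3).
 exists ([set x | rn (x - s) < d3], [set x | 0 < x < e3]) => /=.
  by split; [apply/nbhsE_P; exists d3|exact:nr_right0].
 by move=> [x t] /= [h1 /andP[h2 h3]].
move=> eta eta0; rewrite -gI.
apply:(@bf_cvg R E (Ball r1) (Cc r1) (@icn R n) bI (E * R)%type Fl FFl (fun t => HH t.1 t.2) g Cg _ _ eta eta0).
 by apply:filterS NN => -[s' e] /= [h1 [h2 h3]]; exact:CH.
move=> u Bu e e0.
have e20 : 0 < e / 2 by rewrite divr_gt0.
have [dp dp0 Hdp] := sm_cont (@pker_sm R n setT) (I : setT (u *m N)) e20.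
have [KN KN0 HN] := rn_mulmx N.
(* Tolerance for linearising psi: the vectors u' have norm at most r1 + 1, so the error stays below
   dp / 2, half of the continuity radius of the kernel. *)
pose k := dp / (2 * (r1 + 2)); have k0 : 0 < k by rewrite divr_gt0 // mulr_gt0 //; lra.
have Vs : V (phi s) by exact:UV.
have [d4 d40 Hd4] := vec_strict oV spsi hpsi Vs k0.
have [d5 d50 Hd5] := (openE_P V).1 oV _ Vs.
pose d6 := Num.min d4 d5 / 2; have d60 : 0 < d6 by rewrite divr_gt0 // lt_min d40.
have d6a : d6 + d6 <= d4 by rewrite -splitr ge_min lexx.
have d6b : d6 + d6 <= d5 by rewrite -splitr ge_min lexx orbT.
have [d7 d70 Hd7] := vec_cts (fun b => sm_cont (sphi b) Us) d60.
pose d8 := Num.min 1 (dp / (2 * KN)); have d80 : 0 < d8 by rewrite lt_min ltr01 divr_gt0 // mulr_gt0.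
have d8a : d8 <= 1 by rewrite ge_min lexx.
have d8b : d8 * KN <= dp / 2.
 have : d8 <= dp / (2 * KN) by rewrite ge_min lexx orbT.
 by rewrite ler_pdivlMr ?mulr_gt0 // => h; rewrite ler_pdivlMr //; lra.
pose e9 := d6 / (r1 + 2); have e90 : 0 < e9 by rewrite divr_gt0 //; lra.
have NF : Fl [set t : E * R | [/\ rn (t.1 - s) < d7, rn (t.1 - s) < d2, 0 < t.2 & t.2 < e9]].
 exists ([set x | rn (x - s) < Num.min d7 d2], [set x | 0 < x < e9]) => /=.
  by split; [apply/nbhsE_P; exists (Num.min d7 d2); rewrite ?lt_min ?d70|exact:nr_right0].
 by move=> [x t] /= []; rewrite lt_min => /andP[h1 h1'] /andP[h2 h3].
exists ([set x | rn (x - u) < d8], [set t : E * R | [/\ rn (t.1 - s) < d7, rn (t.1 - s) < d2, 0 < t.2 & t.2 < e9]]) => /=.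
 by split=> //; apply/nbhsE_P; exists d8.
move=> [u' [s' t]] /= [hu [hs hs2 t0 te]].
have hu' : rn u' <= r1 + 1.
 by have := rn_distD u' u 0; rewrite !subr0; rewrite /Ball /= in Bu; lra.
have hp := Hd7 s' hs.
have htu : rn (t%:C%C *: u') < d6.
 rewrite rnZ gtr0_norm //; move: te; rewrite ltr_pdivlMr; last by lra.
 have := ler_wpM2l (ltW t0) hu'; lra.
have hy : rn (phi s' + t%:C%C *: u' - phi s) < d6 + d6.
 by rewrite addrAC; apply:le_lt_trans (rnD _ _) _; lra.
have Vy : V (phi s' + t%:C%C *: u') by apply:Hd5; lra.
have Us' : U s' by exact:Hd2.
rewrite /HH /kk; case:asboolP=> // _.
have S := Hd4 (phi s' + t%:C%C *: u') (phi s') ltac:(lra) ltac:(lra).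
rewrite [phi s' + _ - phi s']addrAC subrr add0r phiK // rnZ gtr0_norm // in S.
set w := psi _ - s' in S *.
have S2 : rn (t^-1%:C%C *: w - u' *m N) <= k * rn u'.
 have -> : t^-1%:C%C *: w - u' *m N = t^-1%:C%C *: (w - (t%:C%C *: u') *m N).
  by apply:scaleVK_mul; rewrite gt_eqF.
 by rewrite rnZ gtr0_norm ?invr_gt0 // mulrC ler_pdivrMr // -mulrA [rn u' * t]mulrC.
have h9 : k * rn u' <= dp / 2.
 apply:le_trans (ler_wpM2l (ltW k0) hu') _; rewrite /k -mulrA ler_pM2l // invfM -mulrA ler_piMr ?invr_ge0 //.
 by rewrite mulrC ler_pdivrMr; lra.
have h10 : rn (u' *m N - u *m N) < dp / 2.
 rewrite -mulmxBl; apply:le_lt_trans (HN _) _; apply:lt_le_trans d8b.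
 by rewrite mulrC ltr_pM2r.
have A1 : cn (pker (t^-1%:C%C *: w) - pker (u *m N)) < e / 2.
 by apply:Hdp; have := rn_distD (t^-1%:C%C *: w) (u' *m N) (u *m N); lra.
have A2 : cn (g u' - pker (u *m N)) < e / 2 by apply:Hdp; apply:lt_le_trans h10 _; rewrite ler_pdivrMr // ler_peMr ?ler1n // ltW.
rewrite /pkerT; exact:cn_near2 A1 A2.
Qed.
Definition pulled f s : C := if `[< U s >] then f (phi s) else 0.
Lemma pulled_csupp f : csupp V f -> csupp U (pulled f) /\
 exists K K', [/\ K `<=` V, forall z, ~ K z -> f z = 0, compact K', K' `<=` U & forall s, ~ K' s -> pulled f s = 0].
move=> [fc [K [cK KV f0]]].
have cK' : compact (psi @` K).
 apply:(cpt_image (V := V)) => //.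
 move=> z Vz; apply:vec_cvg => b; exact:sm_cont.
have K'U : psi @` K `<=` U by move=> _ [y Ky <-]; apply:VU; exact:KV.
have f0' s : ~ (psi @` K) s -> pulled f s = 0.
 rewrite /pulled; case:asboolP=> // Us ns; apply:f0 => Ks; apply:ns; exists (phi s) => //; exact:phiK.
split; last by exists K, (psi @` K).
split; last by exists (psi @` K).
move=> z Uz; have : cts (fun z => f (phi z)) z.
 apply:cts_comp; last by apply:fc; exact:UV.
 move=> b; exact:sm_cont.
by apply:cts_near; apply:filterS (nr_op oU Uz) => w; rewrite /pulled; case:asboolP.
Qed.
(** An approximate identity around s, transported to the target by psi, links the two sides.
    Integrated over s it reproduces f by mollification; integrated over y it produces the Jacobian
    factor by [HH_limit]. *)
Theorem change_of_variables f : csupp V f ->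
 icn f = icn (fun s => pulled f s * (\det (Jac phi s) * (\det (Jac phi s))^*)).
move=> cf; have [cg [K [K' [KV f0 cK' K'U g0]]]] := pulled_csupp cf.
set g := pulled f in cg g0 *.
have [rg rg0 Cg] := csupp_Cc cg.
have [d d0 Hd] := cpt_margin cK' oU K'U.
pose Kd := [set w : E | exists2 z, K' z & rn (w - z) <= d].
have cKd : compact Kd by exact:cpt_thicken.
have KdU : Kd `<=` U by move=> w [z Kz hz]; exact:Hd Kz hz.
have cL : compact (phi @` Kd).
 apply:(cpt_image (V := U)) => //.
 by move=> z Uz; apply:vec_cvg => b; exact:sm_cont Uz.
have LV : phi @` Kd `<=` V by move=> _ [w Kw <-]; apply:UV; exact:KdU.
have [rL rL0 HrL] := cpt_rn_bdd cL.
have [rK rK0 HrK] := cpt_rn_bdd cK'.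
have [rf rf0 Cf] := csupp_Cc cf.
pose r := rg + (rL + (rK + rf)); have r0 : 0 <= r by rewrite !addr_ge0.
have bI := @int_ccfun R n r r0.
have Cgr : Cc r g by apply:Cc_le Cg; rewrite lerDl !addr_ge0.
have Cfr : Cc r f by apply:Cc_le Cf; rewrite /r; lra.
have rd1 := rad_gt0 R n.
pose e0 := d / rd; have e00 : 0 < e0 by rewrite divr_gt0.
(* For e below e0 the kernels centred in the support of g stay in the image of its d-neighbourhood,
   so all integrals live on one compact subset of V. *)
have FL s y (e : R) : 0 < e -> e < e0 -> g s * kk s e y <> 0 -> (phi @` Kd) y.
 move=> ep ee nz; have K's : K' s by apply:contrapT => /g0 z; apply:nz; rewrite z mul0r.
 have Vy : V y by apply:contrapT => nV; apply:nz; rewrite /kk; case:asboolP=> //; rewrite mulr0.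
 exists (psi y); last exact:psiK.
 exists s => //; rewrite leNgt; apply/negP=> h; apply:nz; rewrite /kk; case:asboolP=> // _.
 rewrite (@pkerT_Cc R n e ep).2 ?mulr0 //.
 by rewrite mulrC; apply:le_trans (ltW h); rewrite -ler_pdivlMr // ltW.
have Fz s y (e : R) : 0 < e -> e < e0 -> ~ (phi @` Kd) y -> g s * kk s e y = 0.
 by move=> ep ee nL; apply:contrapT => nz; apply:nL; exact:FL nz.
have Fc (e : R) : 0 < e -> e < e0 -> forall s y, (fun p : E * E => g p.1 * kk p.1 e p.2) @ (s, y) --> g s * kk s e y.
 move=> ep ee s y; have [Vy|nV] := pselect (V y); last first.
  apply/(cvgC_P (nbhs_filter (s, y))) => eta eta0.
  have nL : ~ (phi @` Kd) y by move=> /LV.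
  exists (setT, [set y | ~ (phi @` Kd) y]) => /=.
   by split; [exact:(@filterT _ (nbhs s) (nbhs_filter s))|exact:nr_out].
  by move=> [s' y'] /= [_ ny']; rewrite !Fz // subrr cn0.
 have FF := nbhs_filter (s, y); have -> : kk s e y = pkerT e (psi y - s) by rewrite /kk asboolT.
 apply:(cvg_mulC FF); first exact:(@cvg_cts R n _ _ g fst s (Cg.1 s) cvg_fst).
 have pc := vec_cvg (fun b => sm_cont (spsi b) Vy).
 have H : (fun p : E * E => pkerT e (psi p.2 - p.1)) @ (s, y) --> pkerT e (psi y - s).
  apply:(@cvg_cts R n _ _ (pkerT e) (fun p : E * E => psi p.2 - p.1)).
   exact:sm_cont (@pkerT_sm R n e) I.
  by apply:cvgB; [exact:(cvg_comp _ _ cvg_snd pc)|exact:cvg_fst].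
 apply:cvg_trans H; apply:near_eq_cvg; exists (setT, V) => /=.
  by split; [exact:(@filterT _ (nbhs s) (nbhs_filter s))|exact:nr_op oV Vy].
 by move=> [s' y'] /= [_ Vy']; rewrite /kk asboolT.
have F1 (e : R) : forall s y, r <= rn s -> g s * kk s e y = 0.
 by move=> s y hs; rewrite (Cgr.2 s hs) mul0r.
have F2 (e : R) : 0 < e -> e < e0 -> forall s y, r <= rn y -> g s * kk s e y = 0.
 move=> ep ee s y hy; apply:Fz => // /HrL; rewrite ltNge => /negP; apply; apply:le_trans hy.
 by rewrite /r; lra.
have SW (e : R) (ep : 0 < e) (ee : e < e0) := @fub_joint R n E _ _ _ _ _ bI r0 (Fc e ep ee) (F2 e ep ee)
 (fun (h : E -> C) fc f0 => conj (fun s => (ctsP _ _).2 (fc s)) (fun s hs => f0 s (funext (fun y => F1 e s y hs)))).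
pose q (e : R) : C := (e ^- (2 * n))%:C%C.
(* both iterated integrals of g(s) q_e(psi y - s) are evaluated as e tends to 0 *)
pose T (e : R) := q e * icn (fun s => icn (fun y => g s * kk s e y)).
have aux (K1 t : R) : 0 <= K1 -> 0 < t -> K1 * (t / (K1 + 1) / 2) < t.
 move=> K10 t0; have k1 : 0 < K1 + 1 by lra.
 by rewrite mulrA ltr_pdivrMr // mulrA ltr_pdivrMr //; have := mulr_ge0 K10 (ltW t0); lra.
have lim1 eta : 0 < eta -> \forall e \near (0 : R)^'+, cn (T e - icn f) < eta.
 move=> eta0; have [KI KI0 HKI] := bf_bound bI.
 have eta1 : 0 < eta / (KI + 1) / 2 by rewrite !divr_gt0 //; lra.
 have [d' d'0 Hd'] := avg_unif rg0 Cg eta1.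
 have m0 : 0 < Num.min d' e0 by rewrite lt_min d'0.
 apply:filterS (nr_right0 m0) => e; rewrite lt_min => /andP[ep /andP[ed ee]].
 have [sw C2 _ _] := SW e ep ee; rewrite /T sw -(bf_Z bI (q e) C2).
 have C3 := bf_DZ bI (q e) C2; rewrite -(bf_B bI C3 Cfr).
 apply:le_lt_trans (HKI _ (eta / (KI + 1) / 2) (bf_DB bI C3 Cfr) _) _; last first.
  exact:aux.
 move=> y _; rewrite /kk; case:asboolP=> Vy; last first.
  rewrite (_ : (fun s => _) = fun=> 0); last by apply/funext=> s; rewrite mulr0.
  have fy : f y = 0 by apply:f0 => Ky; apply:Vy; exact:KV.
  by rewrite (bf_0 bI) mulr0 fy subrr cn0; exact:ltW.
 have := Hd' e (psi y) ep ed; rewrite (avg_mollify (psi y) rg0 ep Cg) {2}/g /pulled.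
 by case:asboolP=> [_|[]]; [rewrite psiK|exact:VU].
have lim2 eta : 0 < eta -> \forall e \near (0 : R)^'+, cn (T e - icn (fun s => g s * (\det (Jac phi s) * (\det (Jac phi s))^*))) < eta.
 move=> eta0; pose G s := g s * (\det (Jac phi s) * (\det (Jac phi s))^*).
 have Jc s : U s -> cts (fun s => \det (Jac phi s) * (\det (Jac phi s))^*) s.
  move=> Us; have sd : smooth U (fun s => \det (Jac phi s)).
   have -> : (fun s => \det (Jac phi s)) = (fun s => minor (Jac phi s) [set: 'I_n]%SET [set: 'I_n]%SET).
    by apply/funext=> w; rewrite minorT.
   by apply:sm_minor => a b; exact:(Jac_sm oU sphi).
  by apply:cts_mul; [|apply:cts_conj]; exact:sm_cont sd Us.
 have CG : Cc r G.
  split=> [s|s hs]; last by rewrite /G Cgr.2 ?mul0r.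
  have [K's|nK] := pselect (K' s).
   by apply:cts_mul; [exact:Cg.1|apply:Jc; exact:K'U].
  apply:cts_near (cts_cst 0 s); apply:filterS (nr_out cK' nK) => w nw.
  by rewrite /G g0 // mul0r.
 pose Fe (e : R) s := q e * icn (fun y => g s * kk s e y).
 have near0 : \forall e \near (0 : R)^'+, Cc r (Fe e) /\ T e = icn (Fe e).
  apply:filterS (nr_right0 e00) => e /andP[ep ee]; have [_ _ C1 _] := SW e ep ee.
  by split; [exact:bf_DZ bI _ _ C1|rewrite /T -(bf_Z bI (q e) C1)].
 have FFr : Filter (0 : R)^'+ by exact:at_right_proper_filter.
 have H := @bf_cvg R E (Ball r) (Cc r) (@icn R n) bI R (0 : R)^'+ FFr Fe G CG.
 have {}H := H (filterS (fun e (h : Cc r (Fe e) /\ T e = icn (Fe e)) => h.1) near0).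
 have {}H : \forall e \near (0 : R)^'+, cn (icn (Fe e) - icn G) < eta.
  apply:H => // s _ eta' eta'0.
  have [K's|nK] := pselect (K' s); last first.
   exists ([set y | ~ K' y], setT) => /=.
    by split; [exact:nr_out|exact:filterT].
   move=> [y t] /= [ny _]; rewrite /Fe /G (_ : (fun z => _) = fun=> 0); last first.
    by apply/funext=> z; rewrite g0 // mul0r.
   by rewrite (bf_0 bI) mulr0 g0 // mul0r subrr cn0.
  have Us := K'U s K's.
  pose Mg := cn (g s) + 1; have Mg0 : 0 < Mg by rewrite /Mg; have := cn_ge0 (g s); lra.
  have eta2 : 0 < eta' / Mg / 2 by rewrite !divr_gt0.
  have [d1 d10 H1] := Cg.1 s 1 ltr01.
  have [d2 d20 H2] := Jc s Us _ eta2.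
  have [[A B] /= [As B0] AB] := HH_limit Us eta2.
  pose dd := Num.min d1 (Num.min d2 (d / 2)); have dd0 : 0 < dd by rewrite !lt_min d10 d20 divr_gt0.
  exists ([set x | rn (x - s) < dd] `&` A, [set e | 0 < e < e0 / 2] `&` B) => /=.
   split; first by apply:filterI => //; apply/nbhsE_P; exists dd.
   by apply:filterI => //; apply:nr_right0; rewrite divr_gt0.
  move=> [x e] /= [[hx Ax] [/andP[ep ee] Be]].
  move: hx; rewrite !lt_min => /andP[/H1 h1 /andP[/H2 h2 h3]].
  have GU w : rn (w - x) <= e * rd -> U w.
   move=> hw; apply:(Hd s) => //; have := rn_distD w x s.
   have : e * rd <= d / 2 by rewrite -ler_pdivlMr // mulrAC ltW.
   lra.
  have := AB (x, e) (conj Ax Be); rewrite /= -(kk_HH ep GU) => h4.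
  have [rk rk0 Ckk] := csupp_Cc (kk_csupp ep GU).
  have -> : Fe e x = g x * (q e * icn (kk x e)).
   by rewrite /Fe (bf_Z (@int_ccfun R n rk rk0) (g x) Ckk); ring.
  rewrite /G -mulrBr; apply:le_lt_trans (cnM _ _) _.
  have gx : cn (g x) <= Mg by have := cn_distD (g x) (g s) 0; rewrite !subr0 /Mg; lra.
  set D := \det (Jac phi x) * _ in h2 *; set D0 := \det (Jac phi s) * _ in h2 h4.
  have h5 : cn (q e * icn (kk x e) - D) < eta' / Mg.
   exact:cn_near2 h4 h2.
  have h6 : cn (g x) * cn (q e * icn (kk x e) - D) <= Mg * cn (q e * icn (kk x e) - D).
   by rewrite ler_wpM2r // cn_ge0.
  by apply:le_lt_trans h6 _; rewrite mulrC -ltr_pdivlMr.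
 by apply:filterS2 near0 H => e [_ ->].
apply:subr0_eq; apply:cn_small => eta eta0; have eta2 : 0 < eta / 2 by rewrite divr_gt0.
have [e [h1 h2]] := @filter_ex _ _ (at_right_proper_filter (0 : R)) _ (filterI (lim1 _ eta2) (lim2 _ eta2)).
rewrite cnC in h1; apply:le_trans (cn_distD _ (T e) _) _; rewrite [leRHS]splitr; exact:lerD (ltW h1) (ltW h2).
Qed.
End ChangeOfVariables.

(** * Holomorphic maps, charts, and operations on forms *)

Section HolomorphicMaps.
Variables (R : realType).
Local Notation C := R[i].
Lemma norm_rn n (v : 'rV[C]_n) : `|v| <= (rn v)%:C%C.
have -> : `|v| = mx_norm v by [].
have [->|v0] := eqVneq (mx_norm v) 0; first by rewrite lecR rn_ge0.
have [[i j] ->] := mx_norm_neq0 v0; rewrite /= ord1.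
by apply:le_trans (normC_cn _) _; rewrite lecR rn_coord.
Qed.
Lemma coord_norm n (v : 'rV[C]_n) a : `|v 0 a| <= `|v|.
rewrite -nngE num_le.
exact:(le_bigmax _ (fun i : 'I_1 * 'I_n => `|v i.1 i.2|%:nng) (0, a)).
Qed.
Variables (n m : nat).
Implicit Types (phi : 'rV[C]_n -> 'rV[C]_m).
(** The differential is complex linear, hence determined by its values on the basis vectors; the
    rest compares the norm of row vectors with [rn]. *)
Lemma diff_cdiff phi z b : differentiable phi z ->
 cdiff (fun z => phi z 0 b) z (fun a => ('d phi z (delta_mx 0 a) : 'rV_m) 0 b).
move=> /diff_locally/eqaddoP H e e0.
have e2 : 0 < (e / 2)%:C%C :> C by rewrite ltcR divr_gt0.
have /nbhsE_P[d d0 Hd] := H _ e2; exists d => // w hw.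
have := Hd w; rewrite subr0 => /(_ hw); rewrite /= => h.
have -> : \sum_a w 0 a * ('d phi z (delta_mx 0 a) : 'rV_m) 0 b = ('d phi z w : 'rV_m) 0 b.
 rewrite {2}[w]row_sum_delta linear_sum summxE; apply:eq_bigr=> a _.
 by rewrite linearZ mxE.
have h2 := le_trans (coord_norm _ b) h.
rewrite -lecR; apply:le_trans (cn_normC _) _.
have h3 : `|phi (z + w) 0 b - phi z 0 b - ('d phi z w : 'rV_m) 0 b| <= (e / 2)%:C%C * (rn w)%:C%C.
 apply:le_trans (_ : (e / 2)%:C%C * `|w| <= _); last by rewrite ler_wpM2l ?norm_rn // ltW.
 by move: h2; rewrite !mxE /= opprD addrA [w + z]addrC.
apply:le_trans (ler_wpM2l _ h3) _; first by [].
have -> : (2 : C) = (2 : R)%:C%C by ring.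
by rewrite -!rmorphM mulrA mulrCA mulfV // mulr1.
Qed.
Variables (V : set 'rV[C]_n) (phi : 'rV[C]_n -> 'rV[C]_m).
Hypotheses (oV : open V) (dphi : forall z, V z -> differentiable phi z).
Lemma hol_sm b : smooth V (fun z => phi z 0 b).
by apply:cdiff_sm => // z /dphi/diff_cdiff; eexists. Qed.
Lemma hol_dzb a b z : V z -> dzbar a (fun z => phi z 0 b) z = 0.
by move=> /dphi/(diff_cdiff b) h; have [] := cdiff_dz a h. Qed.
Lemma hol_jacobian z : V z -> jacobian phi z = Jac phi z.
move=> /dphi h; apply/matrixP=> a b; rewrite !mxE.
by have [-> _] := cdiff_dz a (diff_cdiff b h).
Qed.
End HolomorphicMaps.

Section Charts.
Variables (R : realType) (n : nat) (X : ccManifold R n).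
Local Notation C := R[i].
Local Notation E := 'rV[C]_n.
Implicit Types (i j : chart_index X) (z : E).
Definition tr i j : E -> E := chart j \o chart_inv i.
Definition ovl i j : set E := [set z | chart_cod i z /\ chart_dom j (chart_inv i z)].
Lemma ovl_op i j : open (ovl i j).
rewrite openE => z [iz jz].
have h1 : nbhs z (chart_cod i) := nr_op (@chart_cod_open _ _ X i) iz.
have h2 : nbhs (chart_inv i z) (chart_dom j) by apply:open_nbhs_nbhs; split=> //; exact:chart_dom_open.
exact:filterI h1 (chart_inv_continuous iz h2).
Qed.
Lemma ovl_tr i j z : ovl i j z -> ovl j i (tr i j z).
move=> [iz jz]; split; first exact:chart_funS.
rewrite chartK //; exact:chart_inv_funS.
Qed.
Lemma ovl_trK i j z : ovl i j z -> tr j i (tr i j z) = z.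
by move=> [iz jz]; rewrite /tr /= chartK // chart_invK. Qed.
Lemma ovl_chart i j x : chart_dom i x -> chart_dom j x -> ovl i j (chart i x).
by split; [exact:chart_funS|rewrite chartK]. Qed.
Lemma tr_diff i j z : ovl i j z -> differentiable (tr i j) z.
case; exact:transition_holomorphic. Qed.
Definition tr_sm i j := hol_sm (@ovl_op i j) (@tr_diff i j).
Definition tr_hol i j := hol_dzb (@tr_diff i j).
Definition tr_jac i j := hol_jacobian (@tr_diff i j).
(* local expressions transform by the Jacobian matrices *)
Definition glues (w : preform X) := forall i j z, ovl i j z ->
 w i z = pull (Jac (tr i j) z) (w j (tr i j z)).
Lemma is_formP (T : nat -> nat -> bool) (w : preform X) : is_form T w <->
 [/\ forall i z, ~ chart_cod i z -> w i z = fun=> 0,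
   forall i, smc (chart_cod i) (w i), glues w
  & forall i z (P : {set 'I_n} * {set 'I_n}), ~~ T #|P.1| #|P.2| -> w i z P = 0].
split=> -[h1 h2 h3 h4]; split=> //.
- move=> i j z [iz jz]; rewrite -tr_jac //; exact:h3.
- by move=> i j z iz jz; rewrite (h3 i j) // tr_jac.
Qed.
End Charts.

Section FormOperations.
Import mathcomp.boot.finset.
Local Close Scope classical_set_scope.
Variables (R : realType) (n : nat) (X : ccManifold R n).
Local Notation C := R[i].
Implicit Types (w e : preform X) (T : nat -> nat -> bool).
(** The trivial type, for forms of which only smoothness and gluing matter. *)
Definition anyT : nat -> nat -> bool := fun _ _ => true.
Lemma form_smc T w i : is_form T w -> smc (chart_cod i) (w i).
by case/is_formP. Qed.
Lemma delE w i z : chart_cod i z -> del w i z = cdel (w i) z.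
move=> iz; apply/funext=> P; rewrite /del; case:asboolP=> // _.
rewrite big_mkcond; apply:eq_bigr=> a _; rewrite /crz inversions1.
by [].
Qed.
Lemma delbarE w i z : chart_cod i z -> delbar w i z = cdelbar (w i) z.
move=> iz; apply/funext=> P; rewrite /delbar; case:asboolP=> // _.
rewrite big_mkcond; apply:eq_bigr=> a _; rewrite /crb inversions1.
by [].
Qed.
Lemma form_conj T w : is_form T w -> is_form (fun a b => T b a) (conj_form w).
case/is_formP=> h1 h2 h3 h4; apply/is_formP; split.
- by move=> i z iz; apply/funext=> P; rewrite /conj_form h1 // cj0 mulr0.
- move=> i; exact:smc_conj.
- by move=> i j z ij; rewrite -[LHS]/(cconj (w i z)) (h3 i j z ij) pull_conj.
- by move=> i z P nT; rewrite /conj_form h4 // cj0 mulr0.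
Qed.
Lemma form_bidegC p q w : is_form (bideg p q) w -> is_form (bideg q p) (conj_form w).
by move/form_conj; apply:is_form_sub => a b; rewrite /bideg andbC. Qed.
Lemma conj_formK w : conj_form (conj_form w) = w.
apply/funext=> i; apply/funext=> z; exact:cconjK. Qed.
(** Facts about delbar are transported from del through this identity, so naturality under pullback
    has to be proved for del only. *)
Lemma db_conj T w : is_form T w -> delbar (conj_form w) = conj_form (del w).
move=> wT; apply/funext=> i; apply/funext=> z.
have [iz|niz] := pselect (chart_cod i z).
 by rewrite delbarE // -[RHS]/(cconj (del w i z)) delE // (cdel_conj (form_smc i wT)).
apply/funext=> P; rewrite /conj_form /delbar /del; case:asboolP=> // _.
ring.
Qed.
Lemma del_conj T w : is_form T w -> del (conj_form w) = conj_form (delbar w).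
by move=> /form_conj/db_conj; rewrite conj_formK => ->; rewrite conj_formK. Qed.
(** The gluing condition is the naturality [cdel_pull] for the transition maps on overlaps. *)
Lemma form_del T T' w : (forall a b, T a b -> T' a.+1 b) -> is_form T w -> is_form T' (del w).
move=> TT wT; have [h1 h2 h3 h4] := (is_formP T w).1 wT; apply/is_formP; split.
- by move=> i z; rewrite /del; case:asboolP.
- move=> i P; apply:(@sm_congr R n (chart_cod i) (fun z => cdel (w i) z P)).
 + exact:chart_cod_open.
 + by move=> z iz; rewrite delE.
 + exact:(smc_cdel (chart_cod_open (i:=i)) (h2 i)).
- move=> i j z ij; have [iz jz] := ij; have tz : chart_cod j (tr i j z) by have [] := ovl_tr ij.
 have oij := @ovl_op R n X i j.
 have s1 : smc (ovl i j) (w i) by move=> P; apply:sm_sub (h2 i P) => x [].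
 rewrite !delE // (cdel_congr oij (h3 i j) s1 ij).
 apply:(@cdel_pull R n n (ovl i j) (chart_cod j) (tr i j)) => //.
 + exact:chart_cod_open.
 + by move=> x /ovl_tr[].
 + exact:tr_sm.
 + exact:tr_hol.
- move=> i z P nT; rewrite /del; case:asboolP=> //; rewrite big1 // => a aP.
 rewrite (form_eq0 i wT) ?dz0 ?mulr0 //=; apply:contra nT => /TT.
 by rewrite (cardsD1 a) aP.
Qed.
Lemma form_db T T' w : (forall a b, T a b -> T' a b.+1) -> is_form T w -> is_form T' (delbar w).
move=> TT wT; rewrite -[delbar w]conj_formK -(del_conj wT).
apply:@form_conj; apply:form_del (form_conj wT) => a b; exact:TT.
Qed.
Lemma form_dext T T' w : (forall a b, T a b -> T' a.+1 b /\ T' a b.+1) -> is_form T w -> is_form T' (dext w).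
move=> TT wT; rewrite /dext -[del w]scale1r; apply:is_form_lin.
 by apply:form_del wT => a b /TT[].
by apply:form_db wT => a b /TT[].
Qed.
Lemma form_opp T w : is_form T w -> is_form T (- w).
move=> wT; rewrite -[- w]addr0 -scaleN1r; apply:is_form_lin => //; exact:is_form0. Qed.
Lemma form_add T w e : is_form T w -> is_form T e -> is_form T (w + e).
move=> wT eT; rewrite -[w]scale1r; exact:is_form_lin. Qed.
Lemma form_sub T w e : is_form T w -> is_form T e -> is_form T (w - e).
move=> wT eT; apply:form_add => //; exact:form_opp. Qed.
Lemma form_scale T a w : is_form T w -> is_form T (a *: w).
move=> wT; rewrite -[_ *: _]addr0; apply:is_form_lin => //; exact:is_form0. Qed.
Lemma form_sum T I (s : seq I) (F : I -> preform X) : (forall i, is_form T (F i)) -> is_form T (\sum_(i <- s) F i).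
move=> H; elim:s => [|i s IH]; first by rewrite big_nil; exact:is_form0.
rewrite big_cons; exact:form_add.
Qed.
Lemma delD T w e : is_form T w -> is_form T e -> del (w + e) = del w + del e.
by move=> wT eT; have := del_lin 1 wT eT; rewrite !scale1r. Qed.
Lemma delbarD T w e : is_form T w -> is_form T e -> delbar (w + e) = delbar w + delbar e.
by move=> wT eT; have := delbar_lin 1 wT eT; rewrite !scale1r. Qed.
Lemma dextD T w e : is_form T w -> is_form T e -> dext (w + e) = dext w + dext e.
by move=> wT eT; have := dext_lin 1 wT eT; rewrite !scale1r. Qed.
Lemma dextN T w : is_form T w -> dext (- w) = - dext w.
by move=> wT; have := dext_lin (-1) wT (is_form0 _ T); rewrite dext0 !addr0 !scaleN1r. Qed.
Lemma dextB T w e : is_form T w -> is_form T e -> dext (w - e) = dext w - dext e.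
by move=> wT eT; rewrite (dextD wT (form_opp eT)) (dextN eT). Qed.
Lemma dext_sum T I (s : seq I) (F : I -> preform X) : (forall i, is_form T (F i)) ->
 dext (\sum_(i <- s) F i) = \sum_(i <- s) dext (F i).
move=> H; elim:s => [|i s IH]; first by rewrite !big_nil dext0.
by rewrite !big_cons -IH (dextD (H i) (form_sum s H)).
Qed.
Lemma dext_conj T w : is_form T w -> dext (conj_form w) = conj_form (dext w).
move=> wT; rewrite /dext (del_conj wT) (db_conj wT) addrC.
by apply:preformP => i z P; rewrite -[LHS]mulrDr -cjD.
Qed.
Lemma del_del T w : is_form T w -> del (del w) = 0.
move=> wT; apply/funext=> i; apply/funext=> z.
have [iz|niz] := pselect (chart_cod i z); last by rewrite {1}/del; case:asboolP.
have oi := @chart_cod_open _ _ X i; have si := form_smc i wT.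
rewrite delE // -(cdel_congr oi (x := cdel (w i))) ?(cdel_cdel oi) //; last exact:smc_cdel.
by move=> x ix; rewrite delE.
Qed.
Lemma db_db T w : is_form T w -> delbar (delbar w) = 0.
move=> wT; rewrite -[w]conj_formK; have cT := form_conj wT.
have d1 := @form_del _ anyT _ (fun _ _ _ => isT) cT.
rewrite (db_conj cT) (db_conj d1) (del_del cT).
by apply:preformP => i z P; rewrite /conj_form cj0 mulr0.
Qed.
Lemma del_db T w : is_form T w -> del (delbar w) = - delbar (del w).
move=> wT; apply/funext=> i; apply/funext=> z.
have [iz|niz] := pselect (chart_cod i z); last first.
 apply/funext=> P; rewrite -[RHS]/(- delbar (del w) i z P) {1}/del; case:asboolP=> // _.
 by rewrite /delbar; case:asboolP=> //; rewrite oppr0.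
have oi := @chart_cod_open _ _ X i; have si := form_smc i wT.
rewrite delE // -(cdel_congr oi (x := cdelbar (w i))) //; last first.
- exact:smc_cdelbar.
- by move=> x ix; rewrite delbarE.
rewrite (cdel_cdelbar oi) //; apply/funext=> P; rewrite -[RHS]/(- delbar (del w) i z P) /clin addr0 mulN1r.
congr (- _); rewrite delbarE // (cdel_congr oi (y := del w i)) //; last exact:smc_cdel.
by move=> x ix; rewrite delE.
Qed.
Lemma dext_dext T w : is_form T w -> dext (dext w) = 0.
move=> wT; have d1 := @form_del _ anyT _ (fun _ _ _ => isT) wT.
have d2 := @form_db _ anyT _ (fun _ _ _ => isT) wT.
rewrite /dext (delD d1 d2) (delbarD d1 d2) (del_del wT) (db_db wT) (del_db wT).
ring.
Qed.
Lemma form_wedge T T1 T2 w e : (forall a b c d, T a b -> T1 c d -> T2 (a + c)%N (b + d)%N) ->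
 is_form T w -> is_form T1 e -> is_form T2 (wedge w e).
move=> TT /is_formP[h1 h2 h3 h4] /is_formP[g1 g2 g3 g4]; apply/is_formP; split.
- move=> i z niz; apply/funext=> P; rewrite /wedge big1 // => Q _.
 by rewrite h1 // mul0r mulr0.
- move=> i; exact:smc_wedge.
- by move=> i j z ij; rewrite -[LHS]/(cwedge (w i z) (e i z)) (h3 i j z ij) (g3 i j z ij) -pull_wedge.
- move=> i z P nT; rewrite /wedge big1 // => Q /andP[q1 q2].
 have := cardsID Q.1 P.1; have := cardsID Q.2 P.2; rewrite (setIidPr q1) (setIidPr q2) => e2 e1.
 case t : (T #|Q.1| #|Q.2|); last by rewrite h4 ?t // mul0r mulr0.
 rewrite g4 ?mulr0 //=; apply:contra nT => t1; rewrite -e1 -e2; exact:TT.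
Qed.
Lemma any_wedge T T' w e : is_form T w -> is_form T' e -> is_form anyT (wedge w e).
exact:form_wedge. Qed.
Lemma any_dext T w : is_form T w -> is_form anyT (dext w).
exact:form_dext. Qed.
Lemma w_linl a w w' e : wedge (a *: w + w') e = a *: wedge w e + wedge w' e.
apply/funext=> i; apply/funext=> z; exact:cw_linl. Qed.
Lemma w_linr a w e e' : wedge w (a *: e + e') = a *: wedge w e + wedge w e'.
apply/funext=> i; apply/funext=> z; exact:cw_linr. Qed.
Lemma wedgeBl w w' e : wedge (w - w') e = wedge w e - wedge w' e.
by rewrite addrC -scaleN1r w_linl scaleN1r addrC. Qed.
Lemma wedgeBr w e e' : wedge w (e - e') = wedge w e - wedge w e'.
by rewrite addrC -scaleN1r w_linr scaleN1r addrC. Qed.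
Lemma csgn_deg k w i z : is_form (deg k) w -> csgn (w i z) = clin ((-1) ^+ k) (w i z) (czero (R:=R) (n:=n)).
move=> [_ _ _ wT]; apply/funext=> P; rewrite /csgn /clin addr0.
case:(eqVneq (#|P.1| + #|P.2|)%N k) => [->//|ne]; by rewrite wT // !mulr0.
Qed.
Lemma leibniz k T w e : is_form (deg k) w -> is_form T e ->
 dext (wedge w e) = wedge (dext w) e + (-1) ^+ k *: wedge w (dext e).
move=> wk eT; apply/funext=> i; apply/funext=> z.
have [iz|niz] := pselect (chart_cod i z); last first.
 have f1 := any_wedge (any_dext wk) eT; have f2 := any_wedge wk (any_dext eT).
 have [-> // _ _ _] := any_dext (any_wedge wk eT); have [h _ _ _] := form_add f1 (form_scale ((-1) ^+ k) f2).
 by rewrite h.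
have oi := @chart_cod_open _ _ X i; have si := form_smc i wk; have ei := form_smc i eT.
apply/funext=> P; rewrite -[LHS]/(del (wedge w e) i z P + delbar (wedge w e) i z P).
rewrite delE // delbarE //.
rewrite !(cdel_wedge si ei iz) (csgn_deg i z wk).
have L0 y : cwedge (clin ((-1) ^+ k) (w i z) (czero (R:=R) (n:=n))) y P = (-1) ^+ k * cwedge (w i z) y P.
 rewrite cw_linl /clin (_ : cwedge (czero (R:=R) (n:=n)) y P = 0) ?addr0 //.
 by rewrite /cwedge big1 // => Q; rewrite mul0r mulr0.
rewrite /clin !mul1r !L0.
have dE x : dext x i z = clin 1 (cdel (x i) z) (cdelbar (x i) z).
 apply/funext=> Q; rewrite -[LHS]/(del x i z Q + delbar x i z Q) delE // delbarE //.
 by rewrite /clin mul1r.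
rewrite -[RHS]/(cwedge (dext w i z) (e i z) P + (-1) ^+ k * cwedge (w i z) (dext e i z) P).
rewrite !dE cw_linl cw_linr /clin; ring.
Qed.
Definition sm_fun (g : X -> C) := forall i, smooth (chart_cod i) (fun z => g (chart_inv i z)).
Definition fmul (g : X -> C) w : preform X := fun i z P => g (chart_inv i z) * w i z P.
Lemma form_fmul T g w : sm_fun g -> is_form T w -> is_form T (fmul g w).
move=> sg /is_formP[h1 h2 h3 h4]; apply/is_formP; split.
- by move=> i z niz; rewrite /fmul h1 // mulr0.
- move=> i P; apply:sm_mul; [exact:sg|exact:h2].
- move=> i j z ij; have [iz jz] := ij; rewrite /fmul (h3 i j z ij).
 rewrite chartK //.
 have pz : pull (Jac (tr i j) z) (czero (R:=R) (n:=n)) = czero (R:=R) (n:=n) by exact:pull0.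
 have := pull_clin (Jac (tr i j) z) (g (chart_inv i z)) (w j (tr i j z)) (czero (R:=R) (n:=n)).
 rewrite pz => e1; apply/funext=> P; have := congr1 (fun f => f P) e1.
 by rewrite /clin addr0 => <-; congr pull; apply/funext=> Q; rewrite addr0.
- by move=> i z P nT; rewrite /fmul h4 // mulr0.
Qed.
End FormOperations.

(** * Smooth partitions of unity and extension by zero *)

Section PartitionOfUnity.
Variables (R : realType) (n : nat) (X : ccManifold R n).
Local Notation C := R[i].
Local Notation E := 'rV[C]_n.
Implicit Types (i j k : chart_index X) (z : E) (K : set X) (L : set E).
Lemma cpt_closedX K : compact K -> closed K.
apply:compact_closed; exact:@point_of_hausdorff. Qed.
Lemma chart_cpt i K : compact K -> K `<=` chart_dom i -> compact (chart i @` K).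
move=> cK KD; apply:continuous_compact => //.
apply:continuous_in_subspaceT => x; rewrite inE => /KD; exact:chart_continuous.
Qed.
Lemma cinv_cpt i L : compact L -> L `<=` chart_cod i -> compact (chart_inv i @` L).
move=> cL LV; apply:continuous_compact => //.
apply:continuous_in_subspaceT => x; rewrite inE => /LV; exact:chart_inv_continuous.
Qed.
Lemma open_off i K : closed K -> open [set w | chart_cod i w /\ ~ K (chart_inv i w)].
move=> cK; rewrite openE => w [iw nKw]; have h1 : nbhs w (chart_cod i) := nr_op (@chart_cod_open _ _ X i) iw.
have h2 : nbhs (chart_inv i w) (~` K) by apply:open_nbhs_nbhs; split=> //; exact:closed_openC.
exact:filterI h1 (chart_inv_continuous iw h2).
Qed.
Lemma sm_patch i k K (f : E -> C) : closed K -> K `<=` chart_dom k ->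
 smooth (ovl i k) f -> (forall z, chart_cod i z -> ~ K (chart_inv i z) -> f z = 0) ->
 smooth (chart_cod i) f.
move=> cK KD sf f0; apply:sm_local => z iz.
have [Kz|nK] := pselect (K (chart_inv i z)).
 exists (ovl i k) => //; split; [exact:ovl_op|split=> //; exact:KD].
have oW := @open_off i _ cK; set W : set E := [set w | _ /\ _] in oW.
exists W => //; apply:(@sm_congr R n W (fun=> 0)) => //; last exact:sm_cst.
by move=> w [iw nw]; rewrite f0.
Qed.
Definition extf k (f : E -> C) (x : X) : C := if `[< chart_dom k x >] then f (chart k x) else 0.
Lemma extf_sm k (f : E -> C) L : compact L -> L `<=` chart_cod k ->
 smooth (chart_cod k) f -> (forall z, ~ L z -> f z = 0) -> sm_fun (extf k f).
move=> cL LV sf f0 i; have cK := cinv_cpt cL LV.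
apply:(sm_patch (k := k) (cpt_closedX cK)).
- move=> _ [z /LV zV <-]; exact:chart_inv_funS.
- apply:(@sm_congr R n (ovl i k) (fun z => f (tr i k z))); first exact:ovl_op.
  by move=> z [iz kz]; rewrite /extf; case:asboolP.
 apply:(@sm_comp R n n (ovl i k) (chart_cod k)) => //; [exact:ovl_op|exact:chart_cod_open| |].
  by move=> z /ovl_tr[].
 exact:tr_sm.
- move=> z iz nK; rewrite /extf; case:asboolP=> // kz; apply:f0 => Lz; apply:nK.
 by exists (chart k (chart_inv i z)) => //; rewrite chartK.
Qed.
Lemma cutoff (V : set E) c : open V -> V c -> exists (f : E -> C) L,
 [/\ forall V', smooth V' f, compact L, L `<=` V, forall w, ~ L w -> f w = 0 & (forall w, 0 <= f w) /\ 0 < f c].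
move=> oV Vc; have [d d0 Hd] := (openE_P V).1 oV c Vc.
pose r := d / 2 / rad R n; have r0 : 0 < r by rewrite !divr_gt0 // rad_gt0.
exists (fun w => bump 2 (r^-1%:C%C *: (w - c))), [set w : E | rn (w - c) <= d / 2]; split.
- move=> V'; apply:(@sm_sub R n setT) => //.
 rewrite (_ : (fun w => _) = fun w => bump 2 (- (r^-1%:C%C *: c) - (- r^-1)%:C%C *: w)).
  apply:sm_affine; exact:bump_sm.
 by apply/funext=> w; rewrite rmorphN scaleNr opprK scalerBr addrC.
- exact:cpt_rball.
- move=> w /= hw; apply:Hd; lra.
- move=> w nL; apply:bump_rad; rewrite rnZ gtr0_norm ?invr_gt0 // mulrC ler_pdivlMr //.
 rewrite mulrCA mulfV ?mulr1; last by rewrite gt_eqF // rad_gt0.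
 rewrite leNgt; apply/negP=> h; apply:nL; exact:ltW.
- split=> [w|]; [exact:bump_ge0|rewrite subrr scaler0; exact:bump0_gt0].
Qed.
Lemma local_bump (x : X) : exists p : chart_index X * (X -> R) * set X,
 [/\ open p.2 /\ p.2 x, forall y, p.2 y -> 0 < p.1.2 y, forall y, 0 <= p.1.2 y,
   sm_fun (fun y => (p.1.2 y)%:C%C) & closure [set y | p.1.2 y != 0] `<=` chart_dom p.1.1].
have [i ix] := chart_cover x; set c := chart i x; have ic : chart_cod i c by exact:chart_funS.
have [f [L [sf cL LV f0 [fp fp0]]]] := cutoff (@chart_cod_open _ _ X i) ic.
have fR w : f w = (complex.Re (f w))%:C%C by have := fp w; case:(f w) => p q /andP[/eqP -> _].
have fc : 0 < complex.Re (f c) by have := fp0; rewrite fR ltcR.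
have fge0 w : 0 <= complex.Re (f w) by have := fp w; rewrite fR lecR.
have [e e0 He] := sm_cont (sf setT) (I : setT c) fc.
pose b y : R := complex.Re (extf i f y).
have bE y : (b y)%:C%C = extf i f y by rewrite /b /extf; case:asboolP.
pose W := [set y | chart_dom i y /\ rn (chart i y - c) < e].
exists (i, b, W) => /=; split.
- split; last by split=> //; rewrite subrr rn0.
 rewrite openE => y [iy hy]; have h1 : nbhs y (chart_dom i) by apply:open_nbhs_nbhs; split=> //; exact:chart_dom_open.
 have h2 : nbhs (chart i y) [set w | rn (w - c) < e] := nr_op (@open_rball R n c e) hy.
 exact:filterI h1 (chart_continuous iy h2).
- move=> y [iy /He]; rewrite /b /extf; case:asboolP=> // _.
 rewrite cnE raddfB /= => h; have := normr_ge0 (complex.Im (f (chart i y) - f c)).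
 have := ler_norm (- (complex.Re (f (chart i y)) - complex.Re (f c))); rewrite normrN; lra.
- by move=> y; rewrite /b /extf; case:asboolP.
- rewrite (_ : (fun y => _) = extf i f); first exact:extf_sm f0.
 by apply/funext=> y.
- have cK := cinv_cpt cL LV; have clK := cpt_closedX cK.
 apply:(@subset_trans _ (chart_inv i @` L)); last by move=> _ [w /LV wV <-]; exact:chart_inv_funS.
 have -> : chart_inv i @` L = closure (chart_inv i @` L) by rewrite -(closure_id _).1.
 apply:closureS => y /= by0.
 have : extf i f y != 0 by rewrite -bE fmorph_eq0.
 rewrite /extf; case:asboolP=> [iy fy|]; last by rewrite eqxx.
 exists (chart i y); last exact:chartK.
 by apply:contrapT => /f0 h; rewrite h eqxx in fy.
Qed.
Lemma exists_pou : exists u : partition_of_unity X, True.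
have [F HF] := choice local_bump.
(* Compactness is used in its filter form. Along the filter of large finite lists every point is
   eventually covered together with a neighbourhood, hence a single list covers X. *)
pose Fl : set_system (seq X) := [set A | exists s0 : seq X, forall s : seq X, {subset s0 <= s} -> A s].
have FF : Filter Fl.
 split; first by exists [::].
  move=> A B [s0 h0] [s1 h1]; exists (s0 ++ s1) => s h; split.
   by apply:h0 => x xs; apply:h; rewrite mem_cat xs.
  by apply:h1 => x xs; apply:h; rewrite mem_cat xs orbT.
 by move=> A B AB [s0 h0]; exists s0 => s /h0/AB.
have cX := (compact_near_coveringP _).1 (@point_of_compact R n X).
have [s /(_ s (fun _ => id)) HD] : \forall s \near Fl, [set: X] `<=` [set y | exists2 x, x \in s & (F x).2 y].
 apply:(cX (seq X) Fl (fun s y => exists2 x, x \in s & (F x).2 y)) => x _.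
 exists ((F x).2, [set s : seq X | x \in s]) => /=.
  split; first by apply:open_nbhs_nbhs; have [[]] := HF x.
  by exists [:: x] => s; apply; rewrite mem_head.
 by move=> [y s] [h1 h2]; exists x.
pose m := size s; pose nt (k : 'I_m) : X := tnth (in_tuple s) k.
pose b (k : 'I_m) : X -> R := (F (nt k)).1.2.
have b0 (k : 'I_m) (y : X) : 0 <= b k y by have [_ _ h _ _] := HF (nt k); exact:h.
pose S y : R := \sum_k b k y.
have S0 (y : X) : 0 < S y.
 have [x xs hx] := HD y I.
 have [k ek] : exists k : 'I_m, nt k = x by have /tnthP[k ->] : x \in in_tuple s by []; exists k.
 rewrite /S (bigD1 k) //=; apply:ltr_pwDl; last by apply:sumr_ge0.
 by have [_ h _ _ _] := HF (nt k); apply:h; rewrite ek.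
have sb (k : 'I_m) : sm_fun (fun y : X => (b k y)%:C%C) by have [_ _ _ h _] := HF (nt k).
have sS i : smooth (chart_cod i) (fun z => (S (chart_inv i z))%:C%C).
 rewrite (_ : (fun z => _) = fun z => \sum_k (b k (chart_inv i z))%:C%C).
  apply:sm_sum => k _; exact:sb.
 by apply/funext=> z; rewrite rmorph_sum.
have p1 (k : 'I_m) (x : X) : 0 <= b k x / S x by rewrite divr_ge0 // ltW.
have p2 (k : 'I_m) i : smooth (chart_cod i) (fun z => (b k (chart_inv i z) / S (chart_inv i z))%:C%C).
 rewrite (_ : (fun z => _) = fun z => (b k (chart_inv i z))%:C%C * ((S (chart_inv i z))%:C%C)^-1).
  apply:sm_mul; first exact:sb.
  by apply:sm_inv; [move=> z _; rewrite fmorph_eq0 gt_eqF|exact:sS].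
 by apply/funext=> z; rewrite rmorphM fmorphV.
have p3 (k : 'I_m) : closure [set x : X | b k x / S x != 0] `<=` chart_dom (F (nt k)).1.1.
 have [_ _ _ _ h] := HF (nt k); apply:subset_trans h; apply:closureS => x /=.
 by apply:contra => /eqP e; rewrite /b e mul0r.
have p4 (x : X) : \sum_k b k x / S x = 1 by rewrite -mulr_suml; apply:mulfV; apply:lt0r_neq0; exact:S0.
by exists (PartitionOfUnity p1 p2 p3 p4).
Qed.
End PartitionOfUnity.

Section Extension.
Variables (R : realType) (n : nat) (X : ccManifold R n).
Local Notation C := R[i].
Local Notation E := 'rV[C]_n.
Implicit Types (i j k : chart_index X) (z : E) (L : set E) (f : E -> coefs R n).
Lemma Jac_tr i j k z : ovl i j z -> chart_dom k (chart_inv i z) ->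
 Jac (tr i k) z = Jac (tr i j) z *m Jac (tr j k) (tr i j z).
move=> ij kz; pose V := ovl i j `&` ovl i k; have oV : open V by apply:openI; exact:ovl_op.
apply:(Jac_comp (l := n) oV (@ovl_op _ _ X j k) (phi := tr i j) (psi := tr j k)).
- by move=> w [[iw jw] [_ kw]]; split; [exact:chart_funS|rewrite /tr /= chartK].
- by move=> b; apply:sm_sub (@tr_sm R n X i j b) => x [].
- by move=> a b w [h _]; exact:tr_hol.
- exact:tr_sm.
- by move=> w [[iw jw] _]; rewrite /tr /= chartK.
- by split=> //; split=> //; have [] := ij.
Qed.
Definition ext k f : preform X := fun i z =>
 if `[< ovl i k z >] then pull (Jac (tr i k) z) (f (tr i k z)) else fun=> 0.
Definition supp_in k f := exists L, [/\ compact L, L `<=` chart_cod k & forall z, ~ L z -> f z = fun=> 0].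
Lemma ext_diag k f : supp_in k f -> ext k f k = f.
move=> [L [_ LV f0]]; apply/funext=> z; rewrite /ext; case:asboolP=> [[kz _]|nz]; last first.
 rewrite f0 // => Lz; apply:nz; split; [exact:LV|exact:chart_inv_funS (LV _ Lz)].
have J1 : Jac (tr k k) z = 1%:M.
 by apply:(Jac_id (@chart_cod_open _ _ X k)) => // w kw; rewrite /tr /= chart_invK.
by rewrite J1 pull1 /tr /= chart_invK.
Qed.
Lemma ext_form T k f : supp_in k f -> smc (chart_cod k) f ->
 (forall z (P : {set 'I_n} * {set 'I_n}), ~~ T #|P.1| #|P.2| -> f z P = 0) -> is_form T (ext k f).
move=> [L [cL LV f0]] sf fT; apply/is_formP; split.
- by move=> i z; rewrite /ext; case:asboolP=> // -[].
- move=> i P; have cK := cinv_cpt cL LV.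
 apply:(sm_patch (k := k) (cpt_closedX cK)).
 + move=> _ [z /LV zV <-]; exact:chart_inv_funS.
 + apply:(@sm_congr R n (ovl i k) (fun z => pull (Jac (tr i k) z) (f (tr i k z)) P)).
  * exact:ovl_op.
  * by move=> z; rewrite /ext; case:asboolP.
  apply:(@smc_pull R n n (ovl i k) (tr i k) (@ovl_op _ _ X i k) (@tr_sm _ _ X i k) (fun z => f (tr i k z))) => Q.
  apply:(@sm_comp R n n (ovl i k) (chart_cod k) (fun w => f w Q) (tr i k)) => //; [exact:ovl_op|exact:chart_cod_open| |].
   by move=> z /ovl_tr[].
  exact:tr_sm.
 + move=> z iz nK; rewrite /ext; case:asboolP=> // -[_ kz]; rewrite f0 ?pull0 // => Lz; apply:nK.
  by exists (tr i k z) => //; rewrite chartK.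
- move=> i j z ij; have [iz jz] := ij; rewrite /ext; case:asboolP=> [[_ kz]|nk]; last first.
  case:asboolP=> [[_ kz]|_]; last by rewrite pull0.
  by case:nk; move: kz; rewrite chartK.
 case:asboolP=> [[h1 h2]|nk]; last first.
  by case:nk; split; [exact:chart_funS|rewrite chartK].
 by rewrite (Jac_tr ij kz) pull_comp /tr /= chartK.
- move=> i z P nT; rewrite /ext; case:asboolP=> // _; case:P nT => A B nT; apply:pull_deg => A' B' eA eB.
 by apply:fT; rewrite eA eB.
Qed.
End Extension.

(** * Integration on X and Stokes' theorem *)

Section CompactlySupported.
Variables (R : realType) (n : nat).
Local Notation C := R[i].
Local Notation E := 'rV[C]_n.
Implicit Types (V : set E) (f g : E -> C).
Lemma csupp_lin V c f g : csupp V f -> csupp V g ->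
 csupp V (fun z => c * f z + g z) /\ icn (fun z => c * f z + g z) = c * icn f + icn g.
move=> cf cg; split.
 have [fc [K [cK KV f0]]] := cf; have [gc [L [cL LV g0]]] := cg; split.
  move=> z Vz; apply:cts_lin; [exact:fc|exact:gc].
 exists (K `|` L); split; first exact:compactU.
  move=> z []; [exact:KV|exact:LV].
 by move=> z nz; rewrite f0 ?g0 ?mulr0 ?addr0 // => h; apply:nz; [right|left].
have [r r0 Cf] := csupp_Cc cf; have [s s0 Cg] := csupp_Cc cg.
have rs : 0 <= r + s by lra.
by apply:(bf_lin (@int_ccfun R n (r + s) rs)); [apply:Cc_le Cf; rewrite lerDl|apply:Cc_le Cg; rewrite lerDr].
Qed.
Lemma csupp0 V : csupp V (fun=> 0).
split=> [z _|]; [exact:cts_cst|exists set0; split=> //; exact:compact0]. Qed.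
Lemma integral0 : icn (fun _ : E => (0 : C)) = 0.
exact:(bf_0 (@int_ccfun R n 0 (lexx 0))). Qed.
Lemma csupp_sum V I (s : seq I) (F : I -> E -> C) : (forall i, csupp V (F i)) ->
 csupp V (fun z => \sum_(i <- s) F i z) /\
 icn (fun z => \sum_(i <- s) F i z) = \sum_(i <- s) icn (F i).
move=> H; elim:s => [|i s [IH1 IH2]].
 rewrite big_nil (_ : (fun z => _) = fun=> 0); last by apply/funext=> z; rewrite big_nil.
 split; [exact:csupp0|exact:integral0].
have [h1 h2] := csupp_lin 1 (H i) IH1.
rewrite (_ : (fun z => _) = fun z => 1 * F i z + \sum_(j <- s) F j z); last first.
 by apply/funext=> z; rewrite big_cons mul1r.
by rewrite h2 big_cons IH2 mul1r.
Qed.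
Lemma csupp_scale V c f : csupp V f -> csupp V (fun z => c * f z) /\ icn (fun z => c * f z) = c * icn f.
move=> cf; have [h1 h2] := csupp_lin c cf (csupp0 V); rewrite integral0 addr0 in h2.
by rewrite (_ : (fun z => _) = fun z => c * f z + 0) //; apply/funext=> z; rewrite addr0.
Qed.
Lemma csupp_rD f v : smooth setT f -> csupp setT f -> csupp setT (rD f v) /\ icn (rD f v) = 0.
move=> sf cf; have cD : csupp setT (rD f v).
 have [_ [K [cK _ f0]]] := cf; split=> [z _|]; first exact:sm_cont (sm_rD v openT sf) I.
 exists K; split=> // z nK; apply:isD_rD; apply:isD_near (isD_cst 0 v z).
 by apply:filterS (nr_out cK nK) => y /f0.
split=> //; have [r r0 Cf] := csupp_Cc cf; have [s s0 Cg] := csupp_Cc cD.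
have rs : 0 <= r + s by lra.
apply:(@int_isD R n f (rD f v) v _ rs); [by apply:Cc_le Cf; rewrite lerDl|by apply:Cc_le Cg; rewrite lerDr|].
move=> z; exact:sm_isD.
Qed.
Lemma csupp_dz a f : smooth setT f -> csupp setT f ->
 (csupp setT (dz a f) /\ icn (dz a f) = 0) /\ (csupp setT (dzbar a f) /\ icn (dzbar a f) = 0).
move=> sf cf; have [a1 a2] := csupp_rD (ev R a) sf cf; have [b1 b2] := csupp_rD (iev R a) sf cf.
have H c (f' : E -> C) : f' = (fun z => 2^-1 * (c * rD f (iev R a) z + rD f (ev R a) z)) -> csupp setT f' /\ icn f' = 0.
 move=> ->; have [l1 l2] := csupp_lin c b1 a1; have [m1 m2] := csupp_scale (2^-1) l1.
 by rewrite m2 l2 a2 b2 mulr0 addr0 mulr0.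
split; [apply:(H (- 'i%C))|apply:(H 'i%C)]; apply/funext=> z; rewrite ?dzE ?dzbarE; ring.
Qed.
Lemma int_cdel (x : E -> coefs R n) P : smc setT x -> (forall Q, csupp setT (fun z => x z Q)) ->
 [/\ csupp setT (fun z => cdel x z P), csupp setT (fun z => cdelbar x z P),
   icn (fun z => cdel x z P) = 0 & icn (fun z => cdelbar x z P) = 0].
move=> sx cx.
have H1 (a : 'I_n) : csupp setT (fun z => crz a (cdz a x z) P) /\ icn (fun z => crz a (cdz a x z) P) = 0.
 rewrite /crz; have [aP|aP] := boolP (a \in P.1); last by split; [exact:csupp0|exact:integral0].
 have [[h1 h2] _] := csupp_dz a (sx ((P.1 :\ a)%SET, P.2)) (cx _).
 by have [g1 g2] := csupp_scale ((-1) ^+ inv1 a (P.1 :\ a)%SET) h1; rewrite h2 mulr0 in g2.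
have H2 (a : 'I_n) : csupp setT (fun z => crb a (cdzb a x z) P) /\ icn (fun z => crb a (cdzb a x z) P) = 0.
 rewrite /crb; have [aP|aP] := boolP (a \in P.2); last by split; [exact:csupp0|exact:integral0].
 have [_ [h1 h2]] := csupp_dz a (sx (P.1, (P.2 :\ a)%SET)) (cx _).
 by have [g1 g2] := csupp_scale ((-1) ^+ (#|P.1| + inv1 a (P.2 :\ a)%SET)) h1; rewrite h2 mulr0 in g2.
have [a1 a2] := csupp_sum (index_enum 'I_n) (fun a => (H1 a).1).
have [b1 b2] := csupp_sum (index_enum 'I_n) (fun a => (H2 a).1).
split=> //.
 by rewrite a2 big1 // => a; have [] := H1 a.
by rewrite b2 big1 // => a; have [] := H2 a.
Qed.
End CompactlySupported.

Section Integration.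
Variables (R : realType) (n : nat) (X : ccManifold R n) (u : partition_of_unity X).
Local Notation C := R[i].
Local Notation E := 'rV[C]_n.
Local Notation TT := ([set: 'I_n], [set: 'I_n])%SET.
Implicit Types (w e : preform X) (k : 'I_(pou_size u)).
Definition rho k (x : X) : C := (pou_fun k x)%:C%C.
Definition pc k := pou_chart k.
Definition psupp k : set X := closure [set x | pou_fun k x != 0].
Definition topd k w (z : E) : C := rho k (chart_inv (pc k) z) * w (pc k) z TT.
Definition orient : C := (-1) ^+ 'C(n, 2) * (- (2 * 'i%C)) ^+ n.
Definition Itg w := orient * \sum_k icn (topd k w).
Lemma rho_sm k : sm_fun (rho k).
exact:pou_smooth. Qed.
Lemma rho_out k x : ~ psupp k x -> rho k x = 0.
move=> nx; rewrite /rho; case:(eqVneq (pou_fun k x) 0) => [->//|h].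
case:nx; exact:subset_closure.
Qed.
Lemma psupp_dom k : psupp k `<=` chart_dom (pc k).
exact:pou_support. Qed.
Lemma psupp_cpt k : compact (psupp k).
apply:(@subclosed_compact X _ setT) => //; [exact:closed_closure|exact:@point_of_compact]. Qed.
Lemma rho_sum x : \sum_k rho k x = 1.
by rewrite -rmorph_sum pou_sum. Qed.
Lemma orient_neq0 : orient != 0.
rewrite mulf_neq0 // expf_neq0 // oppr_eq0 mulf_neq0 //.
by rewrite eq_complex oner_eq0 andbF.
Qed.
Lemma topd_csupp T k w : is_form T w -> csupp (chart_cod (pc k)) (topd k w).
move=> wT; have [w0 _ _ _] := wT; split.
 move=> z kz; apply:cts_mul; first exact:sm_cont (@rho_sm k (pc k)) kz.
 exact:sm_cont (form_smc (pc k) wT TT) kz.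
exists (chart (pc k) @` psupp k); split.
- apply:chart_cpt; [exact:psupp_cpt|exact:psupp_dom].
- move=> _ [x /psupp_dom xk <-]; exact:chart_funS.
move=> z nz; rewrite /topd; have [kz|nk] := pselect (chart_cod (pc k) z); last by rewrite w0 // mulr0.
rewrite rho_out ?mul0r // => h; apply:nz; exists (chart_inv (pc k) z) => //; exact:chart_invK.
Qed.
Lemma Itg_lin T (a : C) w e : is_form T w -> is_form T e -> Itg (a *: w + e) = a * Itg w + Itg e.
move=> wT eT; rewrite mulrCA -mulrDr; congr (_ * _); rewrite mulr_sumr -big_split; apply:eq_bigr=> k _ /=.
have [_ <-] := csupp_lin a (topd_csupp k wT) (topd_csupp k eT); congr icn; apply/funext=> z.
rewrite /topd preform_linE; ring.
Qed.
Lemma ItgD T w e : is_form T w -> is_form T e -> Itg (w + e) = Itg w + Itg e.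
by move=> wT eT; have := Itg_lin 1 wT eT; rewrite scale1r mul1r. Qed.
Lemma ItgB T w e : is_form T w -> is_form T e -> Itg (w - e) = Itg w - Itg e.
by move=> wT eT; have := Itg_lin (-1) eT wT; rewrite scaleN1r mulN1r addrC => ->; rewrite addrC. Qed.
Lemma Itg0 : Itg 0 = 0.
rewrite /Itg big1 ?mulr0 // => k; rewrite (_ : topd k 0 = fun=> 0) ?integral0 //; exact:mulr0.
Qed.
Lemma ItgZ T a w : is_form T w -> Itg (a *: w) = a * Itg w.
by move=> wT; have := Itg_lin a wT (is_form0 X T); rewrite Itg0 !addr0. Qed.
Lemma Itg_sum T I (s : seq I) (F : I -> preform X) : (forall i, is_form T (F i)) ->
 Itg (\sum_(i <- s) F i) = \sum_(i <- s) Itg (F i).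
move=> H; elim:s => [|i s IH]; first by rewrite !big_nil Itg0.
by rewrite !big_cons -IH (ItgD (H i) (form_sum s H)).
Qed.
Lemma Itg_top w : (forall i z, w i z TT = 0) -> Itg w = 0.
move=> w0; rewrite /Itg big1 ?mulr0 // => k _.
by rewrite (_ : topd k w = fun=> 0) ?integral0 //; apply/funext=> z; rewrite /topd w0 mulr0.
Qed.
Definition carried j (L : set E) w := [/\ compact L, L `<=` chart_cod j &
 forall i z, chart_cod i z -> ~ (chart_inv j @` L) (chart_inv i z) -> w i z = fun=> 0].
Lemma carried_csupp T j L w P : is_form T w -> carried j L w -> csupp (chart_cod j) (fun z => w j z P).
move=> wT [cL LV w0]; have [wout _ _ _] := wT; split=> [z jz|]; first exact:sm_cont (form_smc j wT P) jz.
exists L; split=> // z nz; have [jz|nj] := pselect (chart_cod j z); last by rewrite wout.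
rewrite w0 // => -[z' Lz' e]; apply:nz.
rewrite -(chart_invK jz) -e chart_invK //; exact:LV.
Qed.
(** Each summand of the partition is moved to chart j by the change of variables, whose factor is
    the transformation law of top forms; there the weights add up to 1. *)
Lemma Itg_chart T j L w : is_form T w -> carried j L w -> Itg w = orient * icn (fun z => w j z TT).
move=> wT carr; have [cL LV w0] := carr; have [wout _ _ _] := wT; have [_ _ wg _] := (is_formP T w).1 wT.
have cw := carried_csupp TT wT carr; congr (_ * _).
have Cf k : csupp (chart_cod j) (fun s => rho k (chart_inv j s) * w j s TT).
 have [wc [K [cK KV wK]]] := cw; split=> [z jz|].
  apply:cts_mul; [exact:sm_cont (@rho_sm k j) jz|exact:wc].
 by exists K; split=> // z nz; rewrite wK ?mulr0.
transitivity (\sum_k icn (fun s => rho k (chart_inv j s) * w j s TT)); last first.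
 have [_ <-] := csupp_sum (index_enum 'I_(pou_size u)) Cf; congr icn; apply/funext=> s.
 by rewrite -mulr_suml rho_sum mul1r.
apply:eq_bigr=> k _; set K' := pc k.
have cV : csupp (ovl K' j) (topd k w).
 split=> [z _|]; first exact:csupp_cts (topd_csupp k wT).
 have cK := cinv_cpt cL LV.
 have cI : compact (psupp k `&` chart_inv j @` L).
  apply:(subclosed_compact _ cK); last by [].
  apply:closedI; [exact:closed_closure|exact:cpt_closedX].
 exists (chart K' @` (psupp k `&` chart_inv j @` L)); split.
 - by apply:chart_cpt => // x [/psupp_dom].
 - move=> _ [x [/psupp_dom xk [z Lz zx]] <-]; apply:ovl_chart => //.
  rewrite -zx; apply:chart_inv_funS; exact:LV.
 - move=> z nz; rewrite /topd; have [kz|nk] := pselect (chart_cod K' z); last by rewrite wout ?mulr0.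
  have [h1|h1] := pselect (psupp k (chart_inv K' z)); last by rewrite rho_out ?mul0r.
  rewrite w0 ?mulr0 // => h2; apply:nz; exists (chart_inv K' z) => //; exact:chart_invK.
rewrite (@change_of_variables R n (ovl j K') (ovl K' j) (tr j K') (tr K' j) (@ovl_op _ _ X _ _) (@ovl_op _ _ X _ _)
 (@ovl_tr _ _ X _ _) (@ovl_tr _ _ X _ _) (@ovl_trK _ _ X _ _) (@ovl_trK _ _ X _ _)
 (@tr_sm _ _ X _ _) (@tr_hol _ _ X _ _) (@tr_sm _ _ X _ _) (@tr_hol _ _ X _ _) _ cV).
congr icn; apply/funext=> s; rewrite /pulled; case:asboolP=> [js|njs].
 have [jz kz] := js; rewrite (wg j K' s js) pull_top /topd chartK //; ring.
rewrite mul0r; have [jz|nj] := pselect (chart_cod j s); last by rewrite wout // mulr0.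
by rewrite rho_out ?mul0r // => /psupp_dom h; apply:njs.
Qed.
Lemma del_local T (K : set X) w : closed K -> is_form T w ->
 (forall i z, chart_cod i z -> ~ K (chart_inv i z) -> w i z = fun=> 0) ->
 forall i z, chart_cod i z -> ~ K (chart_inv i z) -> del w i z = (fun=> 0) /\ delbar w i z = (fun=> 0).
move=> cK wT w0 i z iz nK.
have oW := @open_off _ _ _ i _ cK; rewrite delE // delbarE //.
by have [-> ->] := @cdel_zero R n _ oW (w i) z (fun y Wy => w0 i y Wy.1 Wy.2) (conj iz nK).
Qed.
Definition Lk k : set E := chart (pc k) @` psupp k.
Lemma Lk_cpt k : compact (Lk k).
apply:chart_cpt; [exact:psupp_cpt|exact:psupp_dom]. Qed.
Lemma Lk_cod k : Lk k `<=` chart_cod (pc k).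
move=> _ [x /psupp_dom xk <-]; exact:chart_funS. Qed.
Lemma Lk_inv k : chart_inv (pc k) @` Lk k = psupp k.
apply/seteqP; split=> [_ [_ [x xk <-] <-]|x xk]; first by rewrite chartK //; exact:psupp_dom.
by exists (chart (pc k) x); [exists x|rewrite chartK //; exact:psupp_dom].
Qed.
(** The pieces rho_k w have compact support in one chart each, where every coefficient of their d is
    a combination of partial derivatives of compactly supported functions. *)
Theorem stokes T w : is_form T w -> Itg (dext w) = 0.
move=> wT; have ft k := form_fmul (rho_sm k) wT.
have -> : w = \sum_k fmul (rho k) w.
 apply:preformP => i z P.
 have ev (s : seq 'I_(pou_size u)) : (\sum_(k <- s) fmul (rho k) w) i z P = \sum_(k <- s) rho k (chart_inv i z) * w i z P.
  elim:s => [|k s IH]; first by rewrite !big_nil.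
  by rewrite !big_cons -IH.
 by rewrite ev -mulr_suml rho_sum mul1r.
have dT k := any_dext (ft k).
rewrite (dext_sum _ ft) (Itg_sum _ dT) big1 // => k _.
set g := fmul (rho k) w; set j := pc k; have gT : is_form T g by exact:ft.
have clK : closed (psupp k) by exact:closed_closure.
have cL := @Lk_cpt k; have LV := @Lk_cod k; have LK := @Lk_inv k.
have g0 i z : chart_cod i z -> ~ psupp k (chart_inv i z) -> g i z = fun=> 0.
 by move=> iz nz; apply/funext=> P; rewrite /g /fmul rho_out ?mul0r.
have carg : carried j (Lk k) g by split=> // i z; rewrite LK; exact:g0.
have card : carried j (Lk k) (dext g).
 split=> // i z iz; rewrite LK => nz; have [e1 e2] := del_local clK gT g0 iz nz.
 by apply/funext=> P; rewrite -[LHS]/(del g i z P + delbar g i z P) e1 e2 addr0.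
rewrite (Itg_chart (dT k) card).
have cs P := carried_csupp P gT carg.
have off y : ~ (Lk k) y -> g j y = czero.
 move=> ny; have [jy|njy] := pselect (chart_cod j y); last by have [-> ] := gT.
 have [_ _ h] := carg; rewrite h // LK => hy; apply:ny; exists (chart_inv j y) => //; exact:chart_invK.
have sgT : smc setT (g j).
 by move=> P; apply:(sm_off (@chart_cod_open _ _ X j) cL LV (form_smc j gT P)) => y /off ->.
have csT P : csupp setT (fun z => g j z P).
 have [_ [K [cK KV K0]]] := cs P; split=> [z _|]; first exact:csupp_cts (cs P).
 by exists K; split.
have [h1 h2 h3 h4] := int_cdel TT sgT csT.
have [l1 l2] := csupp_lin 1 h1 h2.
rewrite (_ : (fun z => dext g j z TT) = fun z => 1 * cdel (g j) z TT + cdelbar (g j) z TT).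
 by rewrite l2 h3 h4 !mulr0 addr0 mulr0.
apply/funext=> z; rewrite -[LHS]/(del g j z TT + delbar g j z TT) mul1r.
have [jz|nj] := pselect (chart_cod j z); first by rewrite delE // delbarE.
rewrite /del /delbar; case:asboolP=> // _; rewrite addr0.
have nL : ~ (Lk k) z by move=> /LV.
by have [-> ->] := cdel_zero (cpt_openC cL) off nL; rewrite addr0.
Qed.
End Integration.

(** * Positivity and the intersection pairings *)

Section Positivity.
Variables (R : realType) (n : nat) (X : ccManifold R n) (u : partition_of_unity X).
Local Notation C := R[i].
Local Notation TT := ([set: 'I_n], [set: 'I_n])%SET.
Local Notation s0 := (@finset.set0 'I_n).
Implicit Types (w e : preform X) (T : nat -> nat -> bool).
Lemma Itg_exactl k T b e : is_form (deg k) b -> is_form T e -> dext e = 0 -> Itg u (wedge (dext b) e) = 0.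
move=> bk eT de; have := leibniz bk eT; rewrite de.
have -> : wedge b 0 = 0 :> preform X.
 apply:preformP => i z P; rewrite /wedge big1 // => Q _.
 ring.
rewrite scaler0 addr0 => <-; apply:(@stokes R n X u anyT).
exact:(any_wedge bk eT).
Qed.
Lemma Itg_exactr k T e b : is_form (deg k) e -> is_form T b -> dext e = 0 -> Itg u (wedge e (dext b)) = 0.
move=> ek bT de; have := leibniz ek bT; rewrite de.
have -> : wedge 0 b = 0 :> preform X.
 apply:preformP => i z P; rewrite /wedge big1 // => Q _.
 ring.
rewrite add0r => E.
have f1 := any_wedge ek (any_dext bT).
have := stokes u (any_wedge ek bT).
rewrite E (ItgZ u _ f1) => /eqP; rewrite mulf_eq0 signr_eq0 => /eqP //.
Qed.
Lemma w_type0 T T' w e i z : is_form T w -> is_form T' e ->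
 (forall a b c d, T a b -> T' c d -> ~~ ((a + c == n) && (b + d == n))%N) -> wedge w e i z TT = 0.
move=> wT eT H; have [_ _ _ h] := @form_wedge R n X _ _ (fun a b => ~~ ((a == n) && (b == n))) _ _ H wT eT.
by apply:h; rewrite finset.cardsT card_ord eqxx.
Qed.
Lemma inversionsr0 (I : {set 'I_n}) : inversions I s0 = 0%N.
by apply:eq_card0 => -[x y]; rewrite !inE andbF.
Qed.
Lemma bideg_n0 (P : {set 'I_n} * {set 'I_n}) : bideg n 0 #|P.1| #|P.2| -> P = ([set: 'I_n], s0)%SET.
case:P => I J /andP[/= /eqP i1 /eqP /cards0_eq ->]; congr pair; apply/eqP.
by rewrite finset.eqEcard finset.subsetT finset.cardsT card_ord i1 leqnn.
Qed.
Lemma bideg_0n (P : {set 'I_n} * {set 'I_n}) : bideg 0 n #|P.1| #|P.2| -> P = (s0, [set: 'I_n])%SET.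
case:P => I J /andP[/= /eqP /cards0_eq -> /eqP j1]; congr pair; apply/eqP.
by rewrite finset.eqEcard finset.subsetT finset.cardsT card_ord j1 leqnn.
Qed.
Lemma w_hol w e i z : is_form (bideg n 0) w ->
 wedge w e i z TT = w i z ([set: 'I_n], s0)%SET * e i z (s0, [set: 'I_n])%SET.
move=> [_ _ _ wT]; rewrite /wedge (bigD1 ([set: 'I_n], s0)%SET) /=; last by rewrite subxx finset.sub0set.
rewrite big1 ?addr0 => [|Q /andP[_ ne]]; last first.
 by rewrite wT ?mul0r ?mulr0 //; apply/negP=> /bideg_n0 h; rewrite h eqxx in ne.
by rewrite finset.setDT finset.setD0 inversionsr0 inversions0 cards0 mul1r.
Qed.
(** Covers (n, 0)- and (0, n)-forms at once: P0 is the only index that occurs, and sg the sign in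
    front of its squared modulus. Each rho_k times this square is continuous, nonnegative and of
    integral zero, hence zero, and at every point some rho_k is positive. *)
Lemma form_pos (P0 : {set 'I_n} * {set 'I_n}) (sg : C) T T2 w W : is_form T w ->
 (forall P : {set 'I_n} * {set 'I_n}, T #|P.1| #|P.2| -> P = P0) ->
 (forall i z, W i z TT = sg * (w i z P0 * (w i z P0)^*)) -> sg != 0 -> is_form T2 W -> Itg u W = 0 -> w = 0.
move=> wT HT HW sn0 WT I0; have [w0 _ wg wt] := (is_formP T w).1 wT.
pose f (k : 'I_(pou_size u)) z := rho k (chart_inv (pc k) z) * (w (pc k) z P0 * (w (pc k) z P0)^*).
have cf (k : 'I_(pou_size u)) : csupp (chart_cod (pc k)) (topd k W) by exact:topd_csupp WT.
have tE k : topd k W = fun z => sg * f k z by apply/funext=> z; rewrite /topd HW /f; ring.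
have fE k : f k = fun z => sg^-1 * topd k W z.
 by apply/funext=> z; rewrite tE mulrA mulVf // mul1r.
have csf k : csupp (chart_cod (pc k)) (f k) by rewrite fE; have [] := csupp_scale sg^-1 (cf k).
have fge k z : 0 <= f k z.
 rewrite mulr_ge0 ?mul_conjC_ge0 // lecR; exact:pou_ge0.
have Ik k : 0 <= icn (f k).
 have [r r0 Cf] := csupp_Cc (csf k); exact:int_ge0 Cf (fge k).
have S0 : \sum_k icn (f k) = 0.
 move: I0; rewrite /Itg (eq_bigr (fun k => sg * icn (f k))).
  rewrite -mulr_sumr => /eqP; rewrite mulf_eq0 (negbTE (orient_neq0 R n)) /=.
  by rewrite mulf_eq0 (negbTE sn0) => /eqP.
 by move=> k; rewrite tE; have [_ <-] := csupp_scale sg (csf k).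
have /eqP := S0; rewrite psumr_eq0 => [/allP H|k _]; last exact:Ik.
have fz k z : f k z = 0.
 have [r r0 Cf] := csupp_Cc (csf k); apply:(int_eq0 r0 Cf (fge k)).
 by apply/eqP; have := H k (mem_index_enum k).
apply/funext=> i; apply/funext=> z; have [iz|/w0 ->//] := pselect (chart_cod i z).
set x := chart_inv i z.
have [k rk] : exists k : 'I_(pou_size u), rho k x != 0.
 apply:contrapT => h; have := rho_sum u x; rewrite big1 => [/eqP|k _]; first by rewrite eq_sym oner_eq0.
 by apply/eqP; rewrite -[_ == _]negbK; apply/negP=> e; apply:h; exists k.
have xk : chart_dom (pc k) x.
 by apply:psupp_dom; apply:contrapT => /rho_out e; rewrite e eqxx in rk.
have ik : ovl i (pc k) z by [].
rewrite (wg i (pc k) z ik); have -> : w (pc k) (tr i (pc k) z) = fun=> 0; last by rewrite pull0.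
apply/funext=> P; case t : (T #|P.1| #|P.2|); last by rewrite wt ?t.
have /eqP := fz k (tr i (pc k) z); rewrite /f /tr chartK // mulf_eq0 (negbTE rk) /=.
by rewrite mul_conjC_eq0 (HT P t) => /eqP.
Qed.
Lemma hol_pos w : is_form (bideg n 0) w -> Itg u (wedge w (conj_form w)) = 0 -> w = 0.
move=> wT; apply:(form_pos (P0 := ([set: 'I_n], s0)%SET) (sg := 1) wT bideg_n0).
- by move=> i z; rewrite w_hol // /conj_form cards0 !mul1r.
- exact:oner_neq0.
- exact:(any_wedge wT (form_conj wT)).
Qed.
Lemma antihol_pos w : is_form (bideg 0 n) w -> Itg u (wedge w (conj_form w)) = 0 -> w = 0.
move=> wT; apply:(form_pos (P0 := (s0, [set: 'I_n])%SET) (sg := (-1) ^+ (n * n)) wT bideg_0n).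
- move=> i z; transitivity (cconj (wedge (conj_form w) w i z) TT).
  by rewrite cconj_wedge cconjK.
 rewrite /cconj (w_hol _ _ _ (form_bidegC wT)) /conj_form cards0 muln0 mul1r cjM cjK finset.cardsT card_ord //.
- by rewrite signr_eq0.
- exact:(any_wedge wT (form_conj wT)).
Qed.
End Positivity.

Section Pairing.
Variables (R : realType) (n : nat) (X : ccManifold R n) (u : partition_of_unity X).
Hypothesis n_gt0 : (0 < n)%N.
Local Notation C := R[i].
Local Notation Zn := (Defs.subspace (ker_forms (d_op X) (deg n))).
Implicit Types (w e : Zn) (a b : HdR X n) (T : nat -> nat -> bool).
Lemma closedP (D : form_operator X) T (w : Defs.subspace (ker_forms D T)) : is_form T (subspace_val w) /\ D (subspace_val w) = 0.
by have /asboolP := subspaceP w. Qed.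
Lemma exactP k T (v : preform X) : v \in im_d_forms k T ->
 is_form T v /\ exists2 e, is_form (pred_deg k) e & v = dext e.
by move=> /asboolP. Qed.
Lemma pred_degE (v : preform X) : is_form (pred_deg n) v -> is_form (deg n.-1) v.
by apply:is_form_sub => c d /eqP <-; rewrite /deg. Qed.
Lemma pred_deg_dext (v : preform X) : is_form (pred_deg n) v -> is_form (deg n) (dext v).
by move=> vT; apply:form_dext vT => k l /eqP <-; rewrite /deg addnS. Qed.
(** The representatives are changed one at a time; the integrals then differ by that of an exact
    form wedged with a closed one, which vanishes by the Leibniz rule and Stokes. *)
Lemma pair_wd w w' e e' : dR_class w = dR_class w' -> dR_class e = dR_class e' ->
 Itg u (wedge (subspace_val w) (subspace_val e)) = Itg u (wedge (subspace_val w') (subspace_val e')).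
move=> /clsP/exactP[_ [b b1 eb]] /clsP/exactP[_ [c c1 ec]].
have [wT dw] := closedP w; have [eT de] := closedP e; have [w'T dw'] := closedP w'; have [e'T de'] := closedP e'.
have F (x y : Zn) : is_form anyT (wedge (subspace_val x) (subspace_val y)).
 have [xT _] := closedP x; have [yT _] := closedP y; exact:(any_wedge xT yT).
have E1 : Itg u (wedge (subspace_val w) (subspace_val e)) = Itg u (wedge (subspace_val w') (subspace_val e)).
 apply/eqP; rewrite -subr_eq0 -(ItgB u (F _ _) (F _ _)) -wedgeBl eb.
 by rewrite (Itg_exactl u (pred_degE b1) eT de).
rewrite E1; apply/eqP; rewrite -subr_eq0 -(ItgB u (F _ _) (F _ _)) -wedgeBr ec.
by rewrite (Itg_exactr u w'T c1 dw').
Qed.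
Lemma conj_formB (v v' : preform X) : conj_form (v - v') = conj_form v - conj_form v'.
apply:preformP => i z P.
by rewrite -[LHS]/(_ * (v i z _ - v' i z _)^*) cjB mulrBr.
Qed.
Lemma conj_form0 : conj_form 0 = 0 :> preform X.
by apply:preformP => i z P; rewrite /conj_form cj0 mulr0. Qed.
Lemma degC T (v : preform X) : (forall c d, T c d = T d c) -> is_form T v -> is_form T (conj_form v).
by move=> TC /form_conj; apply:is_form_sub => c d; rewrite TC. Qed.
Lemma conj_cl w : is_form (deg n) (conj_form (subspace_val w)) /\ dext (conj_form (subspace_val w)) = 0.
have [wT dw] := closedP w; split; first by apply:degC => // c d; rewrite /deg addnC.
by rewrite (dext_conj wT) [dext _]dw conj_form0.
Qed.
Lemma conj_mem w : conj_form (subspace_val w) \in ker_forms (d_op X) (deg n).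
apply/asboolP; exact:conj_cl. Qed.
Lemma pairh_wd w w' e e' : dR_class w = dR_class w' -> dR_class e = dR_class e' ->
 Itg u (wedge (subspace_val w) (conj_form (subspace_val e))) = Itg u (wedge (subspace_val w') (conj_form (subspace_val e'))).
move=> h /clsP/exactP[eT [c c1 ec]]; apply:(@pair_wd w w' (Subspace (conj_mem e)) (Subspace (conj_mem e')) h).
apply/clsP/asboolP; rewrite -conj_formB ec; split; first by rewrite -ec; apply:degC eT => a b; rewrite /deg addnC.
exists (conj_form c); last by rewrite (dext_conj c1).
by apply:degC c1 => a b; rewrite /pred_deg addnC.
Qed.
Lemma cls_surj (Z B : submodClosed (preform X)) (c : subquot Z B) : exists w : Defs.subspace Z, cls B w = c.
eexists; exact:cls_repr. Qed.
Definition rep a : Zn := projT1 (cid (cls_surj a)).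
Lemma rep_cls a : dR_class (rep a) = a.
exact:projT2 (cid (cls_surj a)). Qed.
Definition Qf a b : C := Itg u (wedge (subspace_val (rep a)) (subspace_val (rep b))).
Definition hf a b : C := Itg u (wedge (subspace_val (rep a)) (conj_form (subspace_val (rep b)))).
Lemma Qf_cls w e : Qf (dR_class w) (dR_class e) = Itg u (wedge (subspace_val w) (subspace_val e)).
by apply:pair_wd; rewrite rep_cls. Qed.
Lemma hf_cls w e : hf (dR_class w) (dR_class e) = Itg u (wedge (subspace_val w) (conj_form (subspace_val e))).
by apply:pairh_wd; rewrite rep_cls. Qed.
Lemma Qf_form : is_intersection_form Qf.
exists u; exact:Qf_cls. Qed.
Lemma hf_form : is_hermitian_intersection_form hf.
exists u; exact:hf_cls. Qed.
Definition of_type T a := exists2 w, dR_class w = a & is_form T (subspace_val w).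
Lemma hol_type a : range (@hol_to_dR R n X) a -> of_type (bideg n 0) a.
by move=> [w _ <-]; exists (subspace_incl (@Hhol_closed R n X) w) => //; have [] := closedP w. Qed.
Lemma antihol_type a : range (@antihol_to_dR R n X) a -> of_type (bideg 0 n) a.
by move=> [w _ <-]; exists (subspace_incl (@Hantihol_closed R n X) w) => //; have [] := closedP w. Qed.
Lemma mid_type a : range (@mid_to_dR R n X) a -> of_type (mid n) a.
move=> [c _ <-]; have [w <-] := cls_surj c; exists (subspace_incl (@Hmid_closed R n X) w).
 symmetry; exact:subquot_inclE.
by have [] := closedP w.
Qed.
Definition apart T T' := forall a b c d : nat, T a b -> T' c d -> ~~ ((a + c == n) && (b + d == n))%N.
Lemma Qf_orth T T' (A B : set (HdR X n)) : (forall a, A a -> of_type T a) -> (forall b, B b -> of_type T' b) ->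
 apart T T' -> orthogonal_spaces Qf A B.
move=> HA HB ap a b /HA[w <- wT] /HB[e <- eT]; rewrite !Qf_cls; split; apply:Itg_top => i z.
 exact:w_type0 ap.
apply:w_type0 eT wT _ => c d c' d' h h'; rewrite addnC [(d + _)%N]addnC; exact:ap.
Qed.
Lemma hf_orth T T' (A B : set (HdR X n)) : (forall a, A a -> of_type T a) -> (forall b, B b -> of_type T' b) ->
 apart T (fun a b : nat => T' b a) -> orthogonal_spaces hf A B.
move=> HA HB ap a b /HA[w <- wT] /HB[e <- eT]; rewrite !hf_cls; split; apply:Itg_top => i z.
 exact:w_type0 (form_conj eT) ap.
apply:w_type0 eT (form_conj wT) _ => c d c' d' h h'; rewrite andbC addnC [(c + _)%N]addnC; exact:ap.
Qed.
Lemma apart_mid_hol : apart (mid n) (bideg n 0).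
by move=> a b c d /and3P[_ a1 b1] /andP[/eqP -> /eqP ->]; rewrite -[X in _ == X]add0n eqn_add2r; case:a a1. Qed.
Lemma apart_mid_antihol : apart (mid n) (bideg 0 n).
by move=> a b c d /and3P[_ a1 b1] /andP[/eqP -> /eqP ->]; rewrite andbC -[X in _ == X]add0n eqn_add2r; case:b b1. Qed.
Lemma apart_hol_mid : apart (bideg n 0) (fun a b : nat => mid n b a).
by move=> a b c d /andP[/eqP -> /eqP ->] /and3P[_ a1 b1]; rewrite -[X in _ == X]addn0 eqn_add2l; case:c b1. Qed.
(** An (n, 0)-form wedged with the conjugate of a (0, n)-form has bidegree (2n, 0), which differs
    from (n, n) because n > 0. *)
Lemma apart_hol_antihol : apart (bideg n 0) (fun a b : nat => bideg 0 n b a).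
move=> a b c d /andP[/eqP -> /eqP ->] /andP[/eqP -> /eqP ->]; rewrite -[X in _ == X]addn0 eqn_add2l.
by case:n n_gt0.
Qed.
End Pairing.

(** * The smoothing parametrix, first in C^n and then on X *)

Section Parametrix.
Variables (R : realType) (n : nat) (T : R).
Hypothesis T0 : 0 < T.
Local Notation C := R[i].
Local Notation E := 'rV[C]_n.
Local Notation rd := (rad R n).
Definition jcts (g : R * E -> C) := (forall t u, g @ (t, u) --> g (t, u)) /\ forall t u, rd <= rn u -> g (t, u) = 0.
Definition segint (g : R * E -> C) : C := Lam 0 T (fun t => icn (fun u => g (t, u))).
Lemma jcts_slice g t : jcts g -> Cc rd (fun u => g (t, u)).
move=> [gc g0]; split=> [u|u hu]; last exact:g0.
apply/ctsP; apply:(@joint_r R R E (fun t u => g (t, u))); rewrite (_ : (fun p => _) = g); [exact:gc|by apply/funext=> -[]].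
Qed.
Lemma jcts_cont g : jcts g -> continuous (fun t => icn (fun u => g (t, u))).
move=> [gc g0]; have gc' t u : (fun p : R * E => g (p.1, p.2)) @ (t, u) --> g (t, u).
 by rewrite (_ : (fun p => _) = g); [exact:gc|apply/funext=> -[]].
by have [_ _ _] := @fub_joint R n R _ _ _ (fun t u => g (t, u)) rd (@bfun_seg R T (ltW T0)) (ltW (rad_gt0 R n)) gc' g0 (fun (h : R -> C) hc _ => hc).
Qed.
Lemma bfun_segint : bfun ((`[0, T] : set R) `*` (Ball rd : set E)) jcts segint.
have bI := @int_ccfun R n rd (ltW (rad_gt0 R n)).
split.
- apply:compact_setX; [exact:segment_compact|exact:cpt_Ball].
- split=> // t u; exact:@cvg_cst.
- move=> c f g [fc f0] [gc g0]; split=> [t u|t u hu]; last by rewrite f0 // g0 // mulr0 addr0.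
 exact:(@cvg_lin C _ (nbhs (t, u)) (nbhs_filter _) c _ _ _ _ (fc t u) (gc t u)).
- move=> c f g jf jg; rewrite /segint -(Lam_lin c 0 T (jcts_cont jf) (jcts_cont jg)).
 by congr Lam; apply/funext=> t; rewrite -(bf_lin bI c (jcts_slice t jf) (jcts_slice t jg)).
have [K K0 HK] := bf_bound bI; exists (2 * K * T); first by rewrite !mulr_ge0 // ltW.
move=> f M jf fM; have -> : 2 * K * T * M = 2 * (K * M) * (T - 0) by lra.
apply:Lam_bound (ltW T0) (jcts_cont jf) _ => t ht; apply:HK (jcts_slice t jf) _ => u Bu.
by apply:fM.
Qed.
(** Here B_j(x) is twice the integral over 0 <= t <= T and u of p(u) u_j q(x - t u); moving dz_j out
    of the integral turns [homotopy] into the claim. B_j only sees q within distance T rd of x,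
    which keeps supports inside a chart. *)
Theorem parametrix (q : E -> C) : smooth setT q -> exists B : 'I_n -> E -> C,
 [/\ forall j, smooth setT (B j), forall x, q x - avg q x T = \sum_j dz j (B j) x &
   forall j x, (forall w, rn (x - w) <= T * rd -> q w = 0) -> B j x = 0].
move=> sq; have rd0 := rad_gt0 R n.
pose w (j : 'I_n) (s : R * E) : C := pker s.2 * s.2 0 j; pose al (s : R * E) : E := - (s.1%:C%C *: s.2).
have wcts j u : cts (fun u : E => pker u * u 0 j) u.
 apply:cts_mul; [exact:(@pker_Cc R n).1|exact:cts_coord].
have wc j s : ((`[0, T] : set R) `*` (Ball rd : set E)) s -> w j @ s --> w j s.
 move=> _; case:s => t u; exact:(@cvg_snd_cts R n R (fun u => pker u * u 0 j) t u (wcts j u)).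
have alc s : ((`[0, T] : set R) `*` (Ball rd : set E)) s -> al @ s --> al s.
 move=> _; case:s => t u; have FF := nbhs_filter (t, u); apply:cvgN.
 apply:cvgZ; [apply:cvg_real; exact:cvg_fst|exact:cvg_snd].
have QV j (f : E -> C) x : smooth setT f -> (setT : set E) x -> jcts (fun s => w j s * f (x + al s)).
 move=> sf _; split=> [t u|t u hu]; last by rewrite /w pker_rad // !mul0r.
 apply:(@cvg_mulC R _ (nbhs (t, u)) (nbhs_filter _)).
  exact:(@cvg_snd_cts R n R (fun u => pker u * u 0 j) t u (wcts j u)).
 exact:@joint_affine.
pose B j x := 2 * @gop R n (R * E)%type segint (w j) al q x.
have sg j : smooth setT (@gop R n (R * E)%type segint (w j) al q).
 apply:(@gop_sm R n _ _ jcts segint bfun_segint (fun f => smooth setT f) (w j) al setT openT (wc j) alc) => //.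
  exact:rD_sm.
 exact:QV.
exists B; split.
- move=> j; apply:sm_mul; [exact:sm_cst|exact:sg].
- move=> x; rewrite (homotopy x (ltW T0) sq); apply:eq_bigr=> j _.
 have -> : dz j (B j) x = 2 * dz j (@gop R n (R * E)%type segint (w j) al q) x.
  rewrite !dzE /B; have E v : rD (fun x => 2 * gop segint (w j) al q x) v x = 2 * rD (gop segint (w j) al q) v x.
   apply:isD_rD; apply:isD_scale; exact:sm_isD.
  rewrite !E; ring.
 rewrite (@gop_dz R n _ _ jcts segint bfun_segint (fun f => smooth setT f) (w j) al setT openT (wc j) alc) //.
 + exact:rD_sm.
 + exact:QV.
- move=> j x q0; rewrite /B /gop /segint (_ : Lam _ _ _ = 0) ?mulr0 // -(Lam0 0 T); apply:Lam_eq => t /andP[t0 tT].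
 rewrite (_ : (fun u => _) = fun=> 0); first exact:(bf_0 (@int_ccfun R n rd (ltW rd0))).
 apply/funext=> u; rewrite /w /al /=; have [h|h] := leP rd (rn u); first by rewrite pker_rad // !mul0r.
 rewrite q0 ?mulr0 // opprD opprK addrA subrr add0r rnZ ger0_norm //.
 nra.
Qed.
End Parametrix.

Section TopForms.
Import mathcomp.boot.finset.
Local Close Scope classical_set_scope.
Variables (R : realType) (n : nat).
Hypothesis n_gt0 : (0 < n)%N.
Local Notation C := R[i].
Local Notation E := 'rV[C]_n.
Local Notation P0 := ([set: 'I_n], set0 : {set 'I_n}).
Local Notation Q0 := (set0 : {set 'I_n}, [set: 'I_n]).
Implicit Types (V : classical_sets.set E) (g b : E -> C) (j : 'I_n).
Definition top0 g (z : E) : coefs R n := fun P => if P == P0 then g z else 0.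
Definition bot0 g (z : E) : coefs R n := fun P => if P == Q0 then g z else 0.
(** The product of b with all dz_i for i different from j, with the sign that makes its del equal to
    (dz_j b) dz_1 /\ ... /\ dz_n. *)
Definition sub1 j b (z : E) : coefs R n := fun P =>
 if P == ([set: 'I_n] :\ j, set0) then (-1) ^+ inv1 j ([set: 'I_n] :\ j) * b z else 0.
Lemma smc_top0 V g : smooth V g -> smc V (top0 g).
move=> sg P; rewrite /top0; case:(P == P0) => //; exact:sm_cst. Qed.
Lemma smc_bot0 V g : smooth V g -> smc V (bot0 g).
move=> sg P; rewrite /bot0; case:(P == Q0) => //; exact:sm_cst. Qed.
Lemma smc_sub1 V j b : smooth V b -> smc V (sub1 j b).
move=> sb P; rewrite /sub1; case:(P == _); last exact:sm_cst.
apply:sm_mul => //; exact:sm_cst.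
Qed.
Lemma top0_lin c g b z : top0 (fun x => c * g x + b x) z = clin c (top0 g z) (top0 b z).
by apply/funext=> P; rewrite /top0 /clin; case:ifP => //; rewrite mulr0 addr0. Qed.
Lemma top0_type g z (P : {set 'I_n} * {set 'I_n}) : ~~ bideg n 0 #|P.1| #|P.2| -> top0 g z P = 0.
by rewrite /top0; case:eqP => // ->; rewrite /bideg cardsT card_ord cards0 eqxx. Qed.
Lemma bot0_type g z (P : {set 'I_n} * {set 'I_n}) : ~~ bideg 0 n #|P.1| #|P.2| -> bot0 g z P = 0.
by rewrite /bot0; case:eqP => // ->; rewrite /bideg cardsT card_ord cards0 !eqxx. Qed.
Lemma sub1_type j b z (P : {set 'I_n} * {set 'I_n}) : ~~ bideg n.-1 0 #|P.1| #|P.2| -> sub1 j b z P = 0.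
rewrite /sub1; case:eqP => // -> /=; rewrite /bideg cards0 andbT.
have := cardsD1 j [set: 'I_n]; rewrite cardsT card_ord inE add1n => e.
by have -> : #|[set: 'I_n] :\ j| = n.-1; [apply/eqP; rewrite -eqSS -e prednK|rewrite eqxx].
Qed.
Lemma cdel_sub1 V j b z : open V -> smooth V b -> V z -> cdel (sub1 j b) z = top0 (dz j b) z.
move=> oV sb Vz; apply/funext=> P; rewrite /cdel /csum /top0.
have H a : crz a (cdz a (sub1 j b) z) P = if (P == P0) && (a == j) then dz j b z else 0.
 rewrite /crz; case:ifP => aP; last first.
  by case:eqP => // e; rewrite e inE in aP.
 rewrite /cdz /sub1 xpair_eqE; case:P aP => I J /= aP.
 have [->|J0] /= := eqVneq J; last by rewrite andbF dz_cst mulr0 xpair_eqE (negbTE J0) andbF.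
 rewrite andbT xpair_eqE eqxx andbT.
 have [e|ne] := eqVneq.
  have -> : a = j.
   apply/eqP; have := setD11 a I; rewrite e !inE andbT => /negbT; by rewrite negbK.
  have -> : I = [set: 'I_n].
   rewrite -(setD1K aP) e; apply/setP=> x; rewrite !inE andbT; have := setD11 a I; rewrite e !inE andbT.
   move=> /negbT; rewrite negbK => /eqP ->; exact:orbN.
  by rewrite !eqxx (dz_scale j _ sb Vz) mulrA -expr2 sqrr_sign mul1r.
 rewrite dz_cst mulr0; case:eqP => //= eI; case:eqP => // ea.
 by rewrite eI ea eqxx in ne.
under eq_bigr do rewrite H.
case:eqP => /= _; last by rewrite big1.
by rewrite (bigD1 j) //= eqxx big1 ?addr0 // => a /negbTE ->.
Qed.
Lemma pull_top0 (M : 'M[C]_n) g z : pull M (top0 g z) P0 = \det M * g z.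
rewrite /pull (bigD1 P0) //= big1 ?addr0 => [|Q /negbTE nQ]; last by rewrite /top0 nQ mul0r.
by rewrite /top0 eqxx minorT minor0 cj1 mulr1 mulrC.
Qed.
End TopForms.

Section Extensions.
Variables (R : realType) (n : nat) (X : ccManifold R n).
Local Notation C := R[i].
Local Notation E := 'rV[C]_n.
Implicit Types (k : chart_index X) (f g : E -> coefs R n) (w e : preform X) (L : set E).
Lemma ext_lin k c f g : ext k (fun z => clin c (f z) (g z)) = c *: ext k f + ext k g.
apply:preformP => i z P; rewrite preform_linE /ext.
by case:asboolP=> _; [rewrite pull_clin|rewrite mulr0 addr0].
Qed.
Lemma ext_carried k f L : compact L -> L `<=` chart_cod k -> (forall z, ~ L z -> f z = fun=> 0) -> carried k L (ext k f).
move=> cL LV f0; split=> // i z iz nK; rewrite /ext; case:asboolP=> // -[_ kz]; rewrite f0 ?pull0 // => Lz; apply:nK.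
by exists (tr i k z) => //; rewrite chartK.
Qed.
Lemma carried_eq T T' k L w e : is_form T w -> is_form T' e -> carried k L w -> carried k L e -> w k = e k -> w = e.
move=> /is_formP[w0 _ wg _] /is_formP[e0 _ eg _] [_ LV wL] [_ _ eL] we.
apply/funext=> i; apply/funext=> z; have [iz|ni] := pselect (chart_cod i z); last by rewrite w0 // e0.
have [[y Ly h]|nK] := pselect ((chart_inv k @` L) (chart_inv i z)); last by rewrite wL // eL.
have ik : ovl i k z by split=> //; rewrite -h; apply:chart_inv_funS; exact:LV.
by rewrite (wg i k z ik) (eg i k z ik) we.
Qed.
Lemma cdel_off L f z : compact L -> (forall z, ~ L z -> f z = fun=> 0) -> ~ L z -> cdel f z = fun=> 0.
move=> cL f0 nz; exact:(cdel_zero (cpt_openC cL) f0 nz).1.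
Qed.
(** Both sides are forms supported on the image of L, so a comparison in chart k alone decides. *)
Lemma del_ext k f L : compact L -> L `<=` chart_cod k -> (forall z, ~ L z -> f z = fun=> 0) -> smc (chart_cod k) f ->
 del (ext k f) = ext k (cdel f).
move=> cL LV f0 sf.
have F1 : is_form (@anyT) (ext k f) by apply:ext_form => //; exists L.
have F2 : is_form (@anyT) (ext k (cdel f)).
 apply:ext_form => //; first by exists L; split=> // z; exact:cdel_off.
 exact:(smc_cdel (@chart_cod_open _ _ X k)).
have F3 := @form_del R n X _ anyT _ (fun _ _ _ => isT) F1.
have K1 := ext_carried cL LV f0.
have K2 := ext_carried cL LV (fun z => cdel_off cL f0 (z := z)).
have clK : closed (chart_inv k @` L) by apply:cpt_closedX; exact:cinv_cpt.
apply:(carried_eq F3 F2 (k := k) (L := L)) => //.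
 split=> // i z iz nz; have [_ _ h] := K1; by have [] := del_local clK F1 h iz.
rewrite ext_diag; last by exists L; split=> // z; exact:cdel_off.
apply/funext=> z; have [kz|nk] := pselect (chart_cod k z).
 by rewrite delE // ext_diag //; exists L.
rewrite (cdel_off cL f0); last by move=> /LV.
by rewrite /del; case:asboolP.
Qed.
End Extensions.

Section GlobalParametrix.
Variables (R : realType) (n : nat) (X : ccManifold R n) (u : partition_of_unity X).
Hypothesis n_gt0 : (0 < n)%N.
Local Notation C := R[i].
Local Notation E := 'rV[C]_n.
Local Notation P0 := ([set: 'I_n]%SET, @finset.set0 'I_n).
Local Notation I_ := 'I_(pou_size u).
Local Notation rd := (rad R n).
Implicit Types (k : I_) (a v : preform X) (f g : I_ -> E -> C).
Lemma rho_Lk k z : chart_cod (pc k) z -> ~ Lk k z -> rho k (chart_inv (pc k) z) = 0.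
move=> kz nz; apply:rho_out => h; apply:nz; exists (chart_inv (pc k) z) => //; exact:chart_invK.
Qed.
(** The coefficient of dz_1 /\ ... /\ dz_n of rho_k a in the chart of k. It is supported in the
    compact set [Lk k], and these functions together recover an (n, 0)-form by [form_decomp]. *)
Definition Rk k a (z : E) : C := rho k (chart_inv (pc k) z) * a (pc k) z P0.
Lemma Rk_out T k a z : is_form T a -> ~ Lk k z -> Rk k a z = 0.
move=> [a0 _ _ _] nz; rewrite /Rk; have [kz|nk] := pselect (chart_cod (pc k) z); last by rewrite a0 // mulr0.
by rewrite rho_Lk // mul0r.
Qed.
Lemma Rk_sm T k a : is_form T a -> smooth setT (Rk k a).
move=> aT; apply:(sm_off (@chart_cod_open _ _ X (pc k)) (@Lk_cpt _ _ X u k) (@Lk_cod _ _ X u k)).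
 apply:sm_mul; [exact:@rho_sm|exact:(form_smc (pc k) aT)].
move=> z; exact:Rk_out aT.
Qed.
Lemma top0_off (L : set E) (h : E -> C) : (forall z, ~ L z -> h z = 0) -> forall z, ~ L z -> top0 h z = fun=> 0.
by move=> h0 z /h0 e; apply/funext=> P; rewrite /top0; case:ifP. Qed.
Lemma form_decomp a : is_form (bideg n 0) a -> a = \sum_k ext (pc k) (top0 (Rk k a)).
move=> aT; have [a0 _ _ at0] := aT.
have E1 k : fmul (rho k) a = ext (pc k) (top0 (Rk k a)).
 have F1 := form_fmul (@rho_sm R n X u k) aT.
 have R0 z : ~ Lk k z -> Rk k a z = 0 by exact:Rk_out aT.
 have F2 : is_form (bideg n 0) (ext (pc k) (top0 (Rk k a))).
  apply:ext_form.
  - exists (Lk k); split; [exact:Lk_cpt|exact:Lk_cod|exact:top0_off].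
  - by apply:smc_top0; apply:sm_sub (Rk_sm k aT).
  - exact:top0_type.
 have K2 := ext_carried (@Lk_cpt _ _ X u k) (@Lk_cod _ _ X u k) (top0_off R0).
 apply:(carried_eq F1 F2 (k := pc k) (L := Lk k)) => //.
  split; [exact:Lk_cpt|exact:Lk_cod|] => i z iz; rewrite Lk_inv => nz.
  by apply/funext=> P; rewrite /fmul rho_out // mul0r.
 rewrite ext_diag; last by exists (Lk k); split; [exact:Lk_cpt|exact:Lk_cod|exact:top0_off].
 apply/funext=> z; apply/funext=> P; rewrite /fmul /top0; case:eqP => [->//|nP].
 rewrite at0 ?mulr0 //; apply/negP=> h; apply:nP; exact:bideg_n0.
rewrite -(eq_bigr _ (fun k _ => E1 k)).
apply:preformP => i z P.
have ev (s : seq I_) : (\sum_(k <- s) fmul (rho k) a) i z P = \sum_(k <- s) rho k (chart_inv i z) * a i z P.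
 by elim:s => [|k s IH]; [rewrite !big_nil|rewrite !big_cons -IH].
by rewrite ev -mulr_suml rho_sum mul1r.
Qed.
Lemma margin : exists2 d : R, 0 < d & forall k z w, Lk k z -> rn (w - z) <= d -> chart_cod (pc k) w.
have H k : \forall d \near (0 : R)^'+, forall z w, Lk k z -> rn (w - z) <= d -> chart_cod (pc k) w.
 have [d d0 Hd] := cpt_margin (@Lk_cpt _ _ X u k) (@chart_cod_open _ _ X (pc k)) (@Lk_cod _ _ X u k).
 apply:filterS (nr_right0 d0) => e /andP[_ ed] z w Lz h; apply:Hd Lz _; apply:le_trans h _; exact:ltW.
have [d [h1 h2]] := @filter_ex _ _ (at_right_proper_filter (0 : R)) _ (filterI
 (@filter_forall _ I_ (fun k (d : R) => forall z w, Lk k z -> rn (w - z) <= d -> chart_cod (pc k) w) _ (at_right_proper_filter (0 : R)) H)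
 (nbhs_right_gt (0 : R))).
exists d => // k z w.
Qed.
Variable d : R.
Hypothesis d0 : 0 < d.
Hypothesis dk : forall k z w, Lk k z -> rn (w - z) <= d -> chart_cod (pc k) w.
(** At this scale averaging enlarges supports by d / 2 only. The other half of the margin d lets the
    density of the functional be defined on a neighbourhood [Vk] of [Lk k]. *)
Definition T0 := d / 2 / rd.
Lemma T0_gt0 : 0 < T0. by rewrite !divr_gt0 // rad_gt0. Qed.
Lemma T0rd : T0 * rd = d / 2. by rewrite divfK // gt_eqF // rad_gt0. Qed.
Definition L1 k : set E := [set w | exists2 z, Lk k z & rn (w - z) <= d].
Lemma L1_cpt k : compact (L1 k). apply:cpt_thicken; exact:Lk_cpt. Qed.
Lemma L1_cod k : L1 k `<=` chart_cod (pc k). move=> w [z]; exact:dk. Qed.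
Lemma L1_near k x : (exists2 w, Lk k w & rn (x - w) <= T0 * rd) -> L1 k x.
by move=> [w Lw h]; exists w => //; apply:le_trans h _; rewrite T0rd ler_pdivrMr // ler_peMr ?ler1n // ltW. Qed.
(** The space on which the smoothing operator and the Neumann series act. Continuity rather than
    smoothness makes it closed under uniform limits. *)
Definition Dk f := forall k, (forall z, cts (f k) z) /\ forall z, ~ Lk k z -> f k z = 0.
Lemma Dk_csupp f k : Dk f -> csupp (chart_cod (pc k)) (f k).
by move=> /(_ k)[fc f0]; split=> [z _|]; [exact:fc|exists (Lk k); split; [exact:Lk_cpt|exact:Lk_cod|]]. Qed.
Lemma Dk_Rk T a : is_form T a -> Dk (fun k => Rk k a).
move=> aT k; split=> z; [exact:sm_cont (Rk_sm k aT) I|exact:Rk_out aT]. Qed.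
Lemma Dk_lin c f g : Dk f -> Dk g -> Dk (fun k z => c * f k z + g k z).
move=> Df Dg k; have [fc f0] := Df k; have [gc g0] := Dg k; split=> z; first exact:cts_lin.
by move=> nz; rewrite f0 // g0 // mulr0 addr0.
Qed.
Definition avk f k x := avg (f k) x T0.
Lemma avk_sm f k : Dk f -> smooth setT (avk f k).
move=> Df; have [r r0 Cf] := csupp_Cc (Dk_csupp k Df).
exact:(avg_sm openT r0 T0_gt0).
Qed.
Lemma avg_out (q : E -> C) (T : R) x : 0 <= T -> (forall w, rn (x - w) <= T * rd -> q w = 0) -> avg q x T = 0.
move=> T1 q0; rewrite /avg (_ : (fun w => _) = fun=> 0); first exact:integral0.
apply/funext=> w; have [h|h] := leP rd (rn w); first by rewrite pker_rad // mul0r.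
rewrite q0 ?mulr0 // opprD opprK addrA subrr add0r rnZ ger0_norm // ler_wpM2l //; exact:ltW.
Qed.
Lemma avk_out f k x : Dk f -> ~ L1 k x -> avk f k x = 0.
move=> Df nx; apply:avg_out => [|w hw]; first exact:ltW T0_gt0.
by have [_ f0] := Df k; apply:f0 => Lw; apply:nx; apply:L1_near; exists w.
Qed.
Lemma avk_lin c f g k x : Dk f -> Dk g -> avk (fun k z => c * f k z + g k z) k x = c * avk f k x + avk g k x.
move=> Df Dg; have bI := @int_ccfun R n rd (ltW (rad_gt0 R n)).
have H h : Dk h -> Cc rd (fun w => pker w * h k (x - T0%:C%C *: w)).
 move=> Dh; apply:Cc_mull; first exact:pker_Cc.
 by move=> z; apply:affine_cts; have [] := Dh k.
rewrite -(bf_lin bI c (H f Df) (H g Dg)); congr icn; apply/funext=> w; ring.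
Qed.
(* chart-supported (n, 0)-forms *)
Definition extk k (g : E -> C) : preform X := ext (pc k) (top0 g).
Definition good k (g : E -> C) := smooth setT g /\ forall z, ~ L1 k z -> g z = 0.
Lemma extk_form k (g : E -> C) : good k g -> is_form (bideg n 0) (extk k g).
move=> [sg g0]; apply:ext_form.
- exists (L1 k); split; [exact:L1_cpt|exact:L1_cod|exact:top0_off].
- by apply:smc_top0; apply:sm_sub sg.
- exact:top0_type.
Qed.
Lemma extk_lin k c (g h : E -> C) : extk k (fun z => c * g z + h z) = c *: extk k g + extk k h.
rewrite -ext_lin; congr ext; apply/funext=> z; exact:top0_lin. Qed.
Lemma good_avk f k : Dk f -> good k (avk f k).
split=> [|z]; [exact:avk_sm|exact:avk_out]. Qed.
Definition Jop f : preform X := \sum_k extk k (avk f k).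
Lemma Jop_form f : Dk f -> is_form (bideg n 0) (Jop f).
move=> Df; apply:form_sum => k; apply:extk_form; exact:good_avk. Qed.
Lemma Jop_lin c f g : Dk f -> Dk g -> Jop (fun k z => c * f k z + g k z) = c *: Jop f + Jop g.
move=> Df Dg; rewrite scaler_sumr -big_split; apply:eq_bigr=> k _ /=.
rewrite -extk_lin; congr extk; apply/funext=> x; exact:avk_lin.
Qed.
(** The local identity of [parametrix] is applied to each [Rk k a] and extended by zero: a sum of
    dz_j B_j times dz_1 /\ ... /\ dz_n is del of the forms [sub1 j (B j)]. *)
Lemma ptx_form a : is_form (bideg n 0) a ->
 exists2 b, is_form (bideg n.-1 0) b & a - Jop (fun k => Rk k a) = del b.
move=> aT; have DR := Dk_Rk aT.
have HB k := parametrix T0_gt0 (Rk_sm k aT).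
have [B {}HB] := choice HB.
have B0 k j z : ~ L1 k z -> B k j z = 0.
 move=> nz; have [_ _ h] := HB k; apply:h => w hw; apply:(Rk_out aT) => Lw; apply:nz.
 by apply:L1_near; exists w.
have s0 k j z : ~ L1 k z -> sub1 j (B k j) z = fun=> 0.
 by move=> /(B0 k j) e; apply/funext=> P; rewrite /sub1 e mulr0; case:ifP.
have sB k j : smooth setT (B k j) by have [h _ _] := HB k.
have ss k j : smc (chart_cod (pc k)) (sub1 j (B k j)).
 by apply:smc_sub1; apply:sm_sub (sB k j).
have Fb k j : is_form (bideg n.-1 0) (ext (pc k) (sub1 j (B k j))).
 apply:ext_form => //; last by exact:sub1_type.
 exists (L1 k); split; [exact:L1_cpt|exact:L1_cod|exact:s0].
have db k j : del (ext (pc k) (sub1 j (B k j))) = extk k (dz j (B k j)).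
 rewrite (del_ext (@L1_cpt k) (@L1_cod k) (s0 k j) (ss k j)); congr ext; apply/funext=> z.
 exact:(cdel_sub1 (V := setT) j openT (sB k j)).
have del_sum (I0 : Type) (s : seq I0) (F : I0 -> preform X) : (forall i, is_form (bideg n.-1 0) (F i)) ->
  del (\sum_(i <- s) F i) = \sum_(i <- s) del (F i).
 move=> H; elim:s => [|i s IH]; first by rewrite !big_nil del0.
 by rewrite !big_cons (delD (H i) (form_sum s H)) IH.
exists (\sum_k \sum_j ext (pc k) (sub1 j (B k j))).
 by apply:form_sum => k; apply:form_sum.
rewrite {1}(form_decomp aT) -sumrB del_sum; last by move=> k; exact:form_sum.
apply:eq_bigr=> k _; rewrite del_sum //; under eq_bigr do rewrite db.
have es (s : seq 'I_n) : \sum_(j <- s) extk k (dz j (B k j)) = extk k (fun x => \sum_(j <- s) dz j (B k j) x).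
 elim:s => [|j s IH].
  rewrite big_nil; apply:preformP => i z P; rewrite /extk /ext.
  case:asboolP=> //; rewrite (_ : top0 _ _ = fun=> 0) ?pull0 //; apply/funext=> Q; rewrite /top0 big_nil.
  by case:ifP.
 rewrite big_cons IH -[extk k (dz j (B k j))]scale1r -extk_lin; congr extk; apply/funext=> x.
 by rewrite big_cons mul1r.
rewrite es -addrC -scaleN1r -extk_lin; congr extk; apply/funext=> x.
by have [_ <- _] := HB k; rewrite mulN1r addrC.
Qed.
End GlobalParametrix.

(** * Finite codimension by a Neumann series *)

Section Neumann.
Variable R : realType.
Local Notation C := R[i].
Lemma pow_small (K e : R) : 0 < e -> exists m : nat, K / 2 ^+ m < e.
move=> e0; have k0 : 0 <= `|K| / e by rewrite divr_ge0 // ltW.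
exists (Num.bound (`|K| / e)); rewrite ltr_pdivrMr //.
apply:le_lt_trans (ler_norm K) _; rewrite mulrC -ltr_pdivrMr //.
apply:lt_trans (archi_boundP k0) _; rewrite -natrX ltr_nat; exact:ltn_expl.
Qed.
(** Nested intervals: u_m - 2 M / 2^m increases, u_m + 2 M / 2^m decreases, and the supremum of the
    former lies between them for every m. *)
Lemma geom_lim_real (u : nat -> R) (M : R) : (forall m, `|u m.+1 - u m| <= M / 2 ^+ m) ->
 exists l, forall m, `|l - u m| <= 2 * M / 2 ^+ m.
move=> H; pose A m := M / 2 ^+ m.
have AS m : A m = 2 * A m.+1 by rewrite /A exprS; field.
pose v m := u m - 2 * A m; pose w m := u m + 2 * A m.
have A0 m : 0 <= A m by apply:le_trans (H m).
have vS m : v m <= v m.+1 by have := H m; rewrite -/(A m) ler_norml /v => /andP[h1 h2]; have := AS m; lra.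
have wS m : w m.+1 <= w m by have := H m; rewrite -/(A m) ler_norml /w => /andP[h1 h2]; have := AS m; lra.
have vm (m k : nat) : v m <= v (m + k)%N by elim:k => [|k IH]; rewrite ?addn0 // addnS; exact:le_trans (vS _).
have wm (m k : nat) : w (m + k)%N <= w m by elim:k => [|k IH]; rewrite ?addn0 // addnS; exact:le_trans.
have vw m k : v m <= w k.
 apply:le_trans (vm m k) _; apply:le_trans (_ : w (m + k)%N <= _); last by rewrite addnC.
 rewrite /v /w; have := A0 (m + k)%N; lra.
have hs : has_sup (range v).
 by split; [exists (v 0%N)|exists (w 0%N) => _ [m _ <-]].
exists (sup (range v)) => m; have h1 : v m <= sup (range v) by apply:sup_upper_bound.
have h2 : sup (range v) <= w m by apply:ge_sup; [exists (v 0%N)|move=> _ [k _ <-]].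
have -> : 2 * M / 2 ^+ m = 2 * A m by rewrite mulrA.
rewrite ler_norml /v /w in h1 h2 *; lra.
Qed.
Lemma geom_lim (u : nat -> C) (M : R) : (forall m, cn (u m.+1 - u m) <= M / 2 ^+ m) ->
 exists l, forall m, cn (l - u m) <= 4 * M / 2 ^+ m.
move=> H; have [m|a Ha] := @geom_lim_real (fun m => complex.Re (u m)) M.
 by apply:le_trans (H m); rewrite cnE raddfB lerDl.
have [m|b Hb] := @geom_lim_real (fun m => complex.Im (u m)) M.
 by rewrite -raddfB; apply:le_trans (H m); rewrite cnE lerDr.
exists (a +i* b)%C => m; rewrite cnE !raddfB /=.
have := Ha m; have := Hb m; set q := 2 ^+ m; have -> : 4 * M / q = 2 * M / q + 2 * M / q by lra.
lra.
Qed.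
Variables (S1 S2 : Type) (D : (S1 -> S2 -> C) -> Prop) (G : (S1 -> S2 -> C) -> S1 -> S2 -> C).
Implicit Types f g c : S1 -> S2 -> C.
Hypothesis D0 : D (fun _ _ => 0).
Hypothesis Dlin : forall (a : C) f g, D f -> D g -> D (fun s x => a * f s x + g s x).
Hypothesis Dlim : forall c, (forall e : R, 0 < e -> exists2 f, D f & forall s x, cn (c s x - f s x) <= e) -> D c.
Hypothesis GD : forall f, D f -> D (G f).
Hypothesis Glin : forall (a : C) f g s x, D f -> D g -> G (fun s x => a * f s x + g s x) s x = a * G f s x + G g s x.
Hypothesis Gbd : forall f (M : R), D f -> (forall s x, cn (f s x) <= M) -> forall s x, cn (G f s x) <= M / 2.
(** Since G halves suprema, the iterates of c -> f + G c converge geometrically, and D is closed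
    under uniform limits. The first argument of the functions will be the index of the chart. *)
Lemma neumann f (M : R) : D f -> (forall s x, cn (f s x) <= M) ->
 exists c, [/\ D c, forall s x, c s x = f s x + G c s x & forall s x, cn (c s x) <= 4 * M].
move=> Df fM; pose it := fix it m := if m is m'.+1 then fun s x => 1 * f s x + G (it m') s x else fun _ _ => 0.
have Dit m : D (it m) by elim:m => [|m IH] //=; apply:Dlin => //; exact:GD.
have G0 s x : G (fun _ _ => 0) s x = 0.
 have E0 : (fun (_ : S1) (_ : S2) => -1 * (0 : C) + 0) = fun _ _ => 0.
  by rewrite mulr0 addr0.
 have := Glin (-1) s x D0 D0; rewrite E0 => ->; ring.
have Dd g c : D g -> D c -> D (fun s x => g s x - c s x).
 move=> Dg Dc; rewrite (_ : (fun s x => _) = fun s x => -1 * c s x + g s x); first exact:Dlin.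
 apply/funext=> s; apply/funext=> x; ring.
have Gd g c s x : D g -> D c -> G (fun s x => g s x - c s x) s x = G g s x - G c s x.
 move=> Dg Dc; rewrite (_ : (fun s x => _) = fun s x => -1 * c s x + g s x).
  rewrite Glin //; ring.
 apply/funext=> s'; apply/funext=> x'; ring.
have dlt m : forall s x, cn (it m.+1 s x - it m s x) <= M / 2 ^+ m.
 elim:m => [|m IH] s x; first by rewrite /= G0 subr0 addr0 mul1r divr1.
 have -> : it m.+2 s x - it m.+1 s x = G (fun s x => it m.+1 s x - it m s x) s x.
  rewrite (Gd _ _ s x (Dit m.+1) (Dit m)) /=; ring.
 have -> : M / 2 ^+ m.+1 = M / 2 ^+ m / 2 by rewrite exprSr invfM mulrA.
 apply:Gbd => //; exact:Dd.
have HL s : exists l : S2 -> C, forall x m, cn (l x - it m s x) <= 4 * M / 2 ^+ m.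
 have h x := @geom_lim (fun m => it m s x) M (fun m => dlt m s x).
 by have [l Hl] := choice h; exists l.
have [c Hc] := choice HL.
have Dc : D c.
 apply:Dlim => e e0; have [m hm] := pow_small (4 * M) e0.
 exists (it m) => // s x; apply:le_trans (Hc s x m) _; exact:ltW.
exists c; split=> // s x; last by have := Hc s x 0%N; rewrite subr0 divr1.
apply:subr0_eq; apply:cn_small => e e0; have [m hm] := pow_small (4 * M) e0.
have h1 := Hc s x m.+1; have h2 : cn (G c s x - G (it m) s x) <= 4 * M / 2 ^+ m / 2.
 by rewrite -Gd //; apply:Gbd; [exact:Dd|move=> s' x'].
have -> : c s x - (f s x + G c s x) = (c s x - it m.+1 s x) - (G c s x - G (it m) s x) by rewrite /=; ring.
apply:le_trans (cnB _ _) _; have e1 : 4 * M / 2 ^+ m.+1 = 4 * M / 2 ^+ m / 2 by rewrite exprSr invfM mulrA.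
lra.
Qed.
End Neumann.
Lemma weighted_sum (K : comPzRingType) m (P g : 'I_m -> K) (f a : K) : \sum_i P i = 1 ->
 f * a - \sum_i g i * (f * P i) = f * \sum_i P i * (a - g i).
move=> P1; under [in RHS]eq_bigr=> i _ do rewrite mulrBr.
rewrite sumrB -mulr_suml P1 mul1r mulrBr mulr_sumr; congr (_ - _); apply:eq_bigr=> i _; ring.
Qed.

Section FiniteRank.
Variables (R : realType) (n : nat).
Local Notation C := R[i].
Local Notation E := 'rV[C]_n.
Local Notation rd := (rad R n).
Implicit Types (f g : E -> C) (L : set E).
Lemma cts_bdd L f : compact L -> (forall z, L z -> cts f z) -> exists2 K : R, 0 <= K & forall z, L z -> cn (f z) <= K.
move=> /compact_near_coveringP cL fc.
have H : \forall K \near +oo%R, L `<=` (fun z => cn (f z) <= K).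
 apply:(cL R (+oo%R) (fun K z => cn (f z) <= K)) => z Lz; have [d d0 Hd] := fc z Lz 1 ltr01.
 exists ([set y | rn (y - z) < d], [set K | cn (f z) + 1 <= K]) => /=.
  by split; [apply/nbhsE_P; exists d|apply:nbhs_pinfty_ge; exact:num_real].
 move=> [y K] /= [/Hd h hK]; have := cn_distD (f y) (f z) 0; rewrite !subr0; lra.
have /filter_ex[K [h1 h2]] : \forall K \near +oo%R, L `<=` (fun z => cn (f z) <= K) /\ 0 <= K.
 by apply:filterI H _; apply:nbhs_pinfty_ge.
by exists K.
Qed.
Definition zero_off L f := (forall z, cts f z) /\ forall z, ~ L z -> f z = 0.
(* mollification is uniformly close to finite rank operators *)
Lemma finrank L (T eps : R) : compact L -> 0 < T -> 0 < eps ->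
 exists (ys : seq E) (t : nat -> (E -> C) -> C) (K : R),
 [/\ forall i, (i < size ys)%N -> L (nth 0 ys i), 0 <= K,
   forall i c f g, zero_off L f -> zero_off L g -> t i (fun z => c * f z + g z) = c * t i f + t i g,
   forall i f (M : R), zero_off L f -> (forall z, cn (f z) <= M) -> cn (t i f) <= K * M &
   forall f (M : R) x, zero_off L f -> (forall z, cn (f z) <= M) ->
    cn (avg f x T - \sum_(i < size ys) t i f * pkerT T (x - nth 0 ys i)) <= eps * M].
move=> cL T0 eps0; have [r r0 Hr] := cpt_rn_bdd cL.
have CL f : zero_off L f -> Cc r f.
 by move=> [fc f0]; split=> // z hz; apply:f0 => /Hr; rewrite ltNge hz.
have bI := @int_ccfun R n r r0; have [K K0 HK] := bf_bound bI.
pose q : C := (T ^- (2 * n))%:C%C.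
have q0 : 0 <= cn q by exact:cn_ge0.
(* The oscillation allowed for the kernel: it is multiplied by the scaling factor q and by the bound
   K of the integral, and the added ones avoid dividing by zero. *)
pose om := eps / ((cn q + 1) * (K + 1)); have om0 : 0 < om by rewrite divr_gt0 // mulr_gt0; lra.
have [d d0 Hd] : exists2 d : R, 0 < d & forall y y' : E, rn (y - y') < d -> cn (pkerT T y - pkerT T y') <= om.
 have rdT : 0 <= rd * T by rewrite mulr_ge0 // ltW // rad_gt0.
 have [P1 P2] := @pkerT_Cc R n T T0.
 have [d d0 Hd] := @unif_cts R n R `[0, 0]%classic (fun _ y => pkerT T y) (rd * T) (@segment_compact R 0 0) rdT
  (fun s y _ => cvg_snd_cts s (P1 y)) (fun s y h => P2 y h) om om0.
 by exists d => // y y'; apply:(Hd 0); rewrite /= in_itv /= lexx.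
have [s [s1 s2 s3 s4]] := part_fine cL d0.
pose y i := (nth (0, fun=> 0) s i).1; pose psi i z : C := ((nth (0, fun=> 0) s i).2 z)%:C%C.
have psiE i z : (i < size s)%N -> 0 <= (nth (0, fun=> 0) s i).2 z <= 1.
 move=> hi; have P k : (k < size s)%N -> 0 <= (nth (0, fun=> 0) s k).2 z by move=> /s2[_ h _].
 rewrite P //=; apply:le_trans (s3 z); rewrite (bigD1 (Ordinal hi)) //= lerDl sumr_ge0 // => k _; exact:P.
have Cf i f : zero_off L f -> (i < size s)%N -> Cc r (fun z => f z * psi i z).
 move=> /CL h /s2[hc _ _]; exact:Cc_mull.
exists [seq p.1 | p <- s], (fun i f => if (i < size s)%N then q * icn (fun z => f z * psi i z) else 0), (cn q * K).
rewrite size_map; have ny i : (i < size s)%N -> nth 0 [seq p.1 | p <- s] i = y i.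
 by move=> hi; rewrite (nth_map (0, fun=> 0)).
split.
- move=> i hi; rewrite ny //; exact:s1.
- nra.
- move=> i c f g Lf Lg; case:ifP => hi; last by ring.
 rewrite mulrCA -mulrDr -(bf_lin bI c (Cf i f Lf hi) (Cf i g Lg hi)); congr (_ * _); congr icn.
 apply/funext=> z; ring.
- move=> i f M Lf fM; have M0 : 0 <= M by apply:le_trans (fM 0); exact:cn_ge0.
 case:ifP => hi; last by rewrite cn0 !mulr_ge0.
 apply:le_trans (cnM _ _) _; rewrite -mulrA ler_wpM2l //; apply:HK (Cf i f Lf hi) _ => z _.
 rewrite mulrC cnZ; have /andP[h1 h2] := psiE i z hi; rewrite ger0_norm //.
 by apply:le_trans (fM z); rewrite ler_piMl // cn_ge0.
move=> f M x Lf fM; have M0 : 0 <= M by apply:le_trans (fM 0); exact:cn_ge0.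
have Cm : Cc r (fun w => f w * pkerT T (x + - w)).
 apply:Cc_mull (CL f Lf) _ => z; exact:sm_cont (sm_reflect x (@pkerT_sm R n T)) I.
have Cs : Cc r (fun w => \sum_(i < size s) pkerT T (x - y i) * (f w * psi i w)).
 apply:(bf_Dsum bI) => i _; apply:(bf_DZ bI); exact:Cf.
have -> : avg f x T - \sum_(i < size s) (if (i < size s)%N then q * icn (fun z => f z * psi i z) else 0) * pkerT T (x - nth 0 [seq p.1 | p <- s] i)
  = q * icn (fun w => f w * pkerT T (x + - w) - \sum_(i < size s) pkerT T (x - y i) * (f w * psi i w)).
 rewrite (bf_B bI Cm Cs) (avg_mollify x r0 T0 (CL f Lf)) mulrBr; congr (_ - _).
 rewrite (bf_sum bI); last by move=> i _; apply:(bf_DZ bI); exact:Cf.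
 rewrite mulr_sumr; apply:eq_bigr=> i _; rewrite ltn_ord ny // (bf_Z bI _ (Cf i f Lf (ltn_ord i))); ring.
apply:le_trans (cnM _ _) _.
have B1 : cn (icn (fun w => f w * pkerT T (x + - w) - \sum_(i < size s) pkerT T (x - y i) * (f w * psi i w))) <= K * (M * om).
 apply:HK (bf_DB bI Cm Cs) _ => w _; have [Lw|nL] := pselect (L w); last first.
  rewrite Lf.2 // mul0r big1 => [|i _]; last by ring.
  by rewrite subr0 cn0 mulr_ge0 // ltW.
 have -> : f w * pkerT T (x + - w) - \sum_(i < size s) pkerT T (x - y i) * (f w * psi i w) =
   f w * \sum_(i < size s) psi i w * (pkerT T (x - w) - pkerT T (x - y i)).
  have S1 : \sum_(i < size s) psi i w = 1 by rewrite -rmorph_sum s4.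
  exact:weighted_sum.
 apply:le_trans (cnM _ _) _; apply:ler_pM; [exact:cn_ge0|exact:cn_ge0|exact:fM|].
 apply:le_trans (cn_sum _ _ _) _; apply:le_trans (_ : \sum_(i < size s) (nth (0, fun=> 0) s i).2 w * om <= _).
  apply:ler_sum => i _; rewrite cnZ; have /andP[h1 h2] := psiE i w (ltn_ord i); rewrite ger0_norm //.
  have [h|h] := leP d (rn (w - y i)).
   by have [_ _ h3] := s2 i (ltn_ord i); rewrite (h3 w h) !mul0r.
  rewrite ler_wpM2l //; apply:Hd.
  by rewrite opprB addrC subrKA rnC.
 by rewrite -mulr_suml s4 // mul1r.
apply:le_trans (ler_wpM2l q0 B1) _.
have -> : cn q * (K * (M * om)) = (cn q * K * om) * M by lra.
rewrite ler_wpM2r // mulrA ler_pdivrMr; last by nra.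
nra.
Qed.
End FiniteRank.

Section FinitelyGenerated.
Variables (R : realType) (n : nat) (X : ccManifold R n) (u : partition_of_unity X).
Hypothesis n_gt0 : (0 < n)%N.
Local Notation C := R[i].
Local Notation E := 'rV[C]_n.
Local Notation P0 := ([set: 'I_n]%SET, @finset.set0 'I_n).
Local Notation I_ := 'I_(pou_size u).
Local Notation rd := (rad R n).
Implicit Types (k l : I_) (a v : preform X) (f g c : I_ -> E -> C).
Variable d : R.
Hypothesis d0 : 0 < d.
Hypothesis dk : forall k z w, Lk k z -> rn (w - z) <= d -> chart_cod (pc k) w.
Local Notation T := (T0 n d).
Lemma rho_le1 k x : cn (rho k x) <= 1.
rewrite cn_real ger0_norm ?pou_ge0 //.
rewrite -(pou_sum u x) (bigD1 k) //= lerDl sumr_ge0 // => i _; exact:pou_ge0.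
Qed.
Lemma Rk_lin (b : C) l a v z : Rk l (b *: a + v) z = b * Rk l a z + Rk l v z.
rewrite /Rk preform_linE; ring. Qed.
Lemma Rk_sum l (I0 : Type) (s : seq I0) (F : I0 -> preform X) z : Rk l (\sum_(i <- s) F i) z = \sum_(i <- s) Rk l (F i) z.
elim:s => [|i s IH]; first by rewrite !big_nil; exact:mulr0.
by rewrite !big_cons -IH; have := Rk_lin 1 l (F i) (\sum_(j <- s) F j) z; rewrite scale1r mul1r.
Qed.
(** Passing from chart k to chart l multiplies the coefficient by the Jacobian determinant of the
    transition map, which is bounded on the compact part of the overlap where rho_l and g can both
    be nonzero. *)
Lemma Rk_extk : exists2 K : R, 0 <= K & forall l k (g : E -> C) (M : R), (forall z, ~ L1 d k z -> g z = 0) ->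
 (forall z, cn (g z) <= M) -> forall z, cn (Rk l (extk k g) z) <= K * M.
pose S (p : I_ * I_) : set E := chart (pc p.1) @` (psupp p.1 `&` chart_inv (pc p.2) @` L1 d p.2).
have HS p : exists K : R, 0 <= K /\ forall z, S p z -> cn (\det (Jac (tr (pc p.1) (pc p.2)) z)) <= K.
 have cI : compact (chart_inv (pc p.2) @` L1 d p.2) by apply:cinv_cpt; [exact:L1_cpt|exact:L1_cod].
 have cS : compact (S p).
  apply:chart_cpt; last by move=> x [/psupp_dom].
  apply:(subclosed_compact _ cI); last by [].
  apply:closedI; [exact:closed_closure|exact:cpt_closedX].
 have SO z : S p z -> ovl (pc p.1) (pc p.2) z.
  move=> [x [/psupp_dom xk [y Ly yx]] <-]; apply:ovl_chart => //.
  rewrite -yx; apply:chart_inv_funS; exact:L1_cod Ly.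
 have [|K K0 HK] := @cts_bdd R n (S p) (fun z => \det (Jac (tr (pc p.1) (pc p.2)) z)) cS; last by exists K.
 move=> z /SO oz; have sd : smooth (ovl (pc p.1) (pc p.2)) (fun z => \det (Jac (tr (pc p.1) (pc p.2)) z)).
  have -> : (fun z => \det (Jac (tr (pc p.1) (pc p.2)) z)) = (fun z => minor (Jac (tr (pc p.1) (pc p.2)) z) [set: 'I_n]%SET [set: 'I_n]%SET).
   by apply/funext=> w; rewrite minorT.
  apply:sm_minor; apply:(Jac_sm (@ovl_op _ _ X _ _)); exact:tr_sm.
 exact:sm_cont.
have [K HK] := choice HS; exists (\sum_p K p); first by apply:sumr_ge0 => p; have [] := HK p.
move=> l k g M g0 gM z; have M0 : 0 <= M by apply:le_trans (gM 0); exact:cn_ge0.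
have K0 : 0 <= \sum_p K p by apply:sumr_ge0 => p; have [] := HK p.
have z0 : 0 <= (\sum_p K p) * M by nra.
rewrite /Rk /extk /ext; case:asboolP=> [ik|_]; last by rewrite mulr0 cn0.
rewrite pull_top0; have [sl|nl] := pselect (psupp l (chart_inv (pc l) z)); last by rewrite rho_out // mul0r cn0.
have [Lz|nz] := pselect (L1 d k (tr (pc l) (pc k) z)); last by rewrite g0 // !mulr0 cn0.
have [lz kz] := ik; have Sz : S (l, k) z.
 exists (chart_inv (pc l) z); last exact:chart_invK.
 by split=> //; exists (tr (pc l) (pc k) z) => //; rewrite chartK.
apply:le_trans (cnM _ _) _; apply:le_trans (_ : 1 * (K (l, k) * M) <= _).
 apply:ler_pM; [exact:cn_ge0|exact:cn_ge0|exact:rho_le1|].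
 apply:le_trans (cnM _ _) _; apply:ler_pM; [exact:cn_ge0|exact:cn_ge0| |exact:gM].
 have [_ h] := HK (l, k); exact:h.
rewrite mul1r ler_wpM2r // (bigD1 (l, k)) //= lerDl sumr_ge0 // => p; by have [] := HK p.
Qed.
Lemma Dk_zero_off f k : Dk f -> zero_off (Lk k) (f k).
by move=> /(_ k)[]. Qed.
Lemma Dk_lim c : (forall e : R, 0 < e -> exists2 f, Dk f & forall s x, cn (c s x - f s x) <= e) -> Dk c.
move=> H k; split=> z.
 move=> e e0; have e3 : 0 < e / 3 by lra.
 have [f Df fc] := H _ e3; have [h _] := Df k; have [dd dd0 Hd] := h z _ e3; exists dd => // w /Hd h1.
 have := cn_distD (c k w) (f k w) (c k z); have := cn_distD (f k w) (f k z) (c k z).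
 have := fc k w; have := fc k z; rewrite cnC; lra.
move=> nz; apply:cn_small => e e0.
by have [f Df fc] := H _ e0; have [_ h] := Df k; have := fc k z; rewrite h // subr0.
Qed.
(** A finite rank operator [JN] is taken so close to [Jop] that G f = Rk (Jop f - JN f) halves
    suprema. With c = Rk a + G c from the Neumann series, the parametrix applied to a and to Jop c -
    JN c gives a = del b1 + del b2 + JN c. *)
Theorem fin_gen : exists (N : I_ -> nat) (es : I_ -> nat -> preform X) (K : R),
 [/\ 0 <= K, forall k i, (i < N k)%N -> is_form (bideg n 0) (es k i) &
 forall a (M : R), is_form (bideg n 0) a -> (forall k z, cn (Rk k a z) <= M) ->
  exists t : I_ -> nat -> C, (forall k i, cn (t k i) <= K * M) /\
  exists2 b, is_form (bideg n.-1 0) b & a = del b + \sum_k \sum_(i < N k) t k i *: es k i].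
have [K K0 HK] := Rk_extk; have TT0 := T0_gt0 n d0.
pose m : R := #|{: I_}|%:R; have m0 : 0 <= m by [].
(* The remainder is a sum over m charts, each summand costing the transition bound K; this choice
   makes m K eps at most 1 / 2. *)
pose eps := (2 * (m * K + 1))^-1.
have mK : 0 <= m * K by nra.
have eps0 : 0 < eps by rewrite invr_gt0; lra.
have H k := finrank (@Lk_cpt _ _ X u k) TT0 eps0.
have [ys {}H] := choice H; have [t {}H] := choice H; have [KK {}H] := choice H.
pose pk k f x := \sum_(i < size (ys k)) t k i (f k) * pkerT T (x - nth 0 (ys k) i).
pose ee k i := extk k (fun x => pkerT T (x - nth 0 (ys k) i)).
have gp k (i : nat) : (i < size (ys k))%N -> good d k (fun x => pkerT T (x - nth 0 (ys k) i)).
 move=> hi; have [h _ _ _ _] := H k; have Ly := h i hi; split.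
  have := @sm_comp R n n setT setT (pkerT T) (fun x => x - nth 0 (ys k) i) openT openT (fun _ _ => Logic.I).
  apply; last exact:pkerT_sm.
  move=> b; rewrite (_ : (fun z => _) = fun z : E => z 0 b + (- (nth 0 (ys k) i) 0 b)).
   apply:sm_add; [exact:sm_coord|exact:sm_cst].
  by apply/funext=> z; rewrite !mxE.
 move=> z nz; have [_] := @pkerT_Cc R n T TT0; apply; rewrite leNgt; apply/negP=> h2; apply:nz.
 apply:(L1_near d0); exists (nth 0 (ys k) i) => //; rewrite mulrC; exact:ltW.
have gpk k f : good d k (pk k f).
 split.
  by apply:sm_sum => i _; apply:sm_mul; [exact:sm_cst|have [] := gp k i].
 by move=> z nz; rewrite /pk big1 // => i; have [_ h] := gp k i (ltn_ord i); rewrite h // mulr0.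
pose JN f : preform X := \sum_k extk k (pk k f).
have fJN f : is_form (bideg n 0) (JN f) by apply:form_sum => k; exact:(extk_form dk (gpk k f)).
have JNE f : JN f = \sum_k \sum_(i < size (ys k)) t k i (f k) *: ee k i.
 apply:eq_bigr=> k _; rewrite /pk /ee.
 have S (s : seq 'I_(size (ys k))) : extk k (fun x => \sum_(i <- s) t k i (f k) * pkerT T (x - nth 0 (ys k) i)) =
   \sum_(i <- s) t k i (f k) *: extk k (fun x => pkerT T (x - nth 0 (ys k) i)).
  elim:s => [|i s IH]; last first.
   by rewrite big_cons -IH -extk_lin; congr extk; apply/funext=> x; rewrite big_cons.
  rewrite big_nil; have := extk_lin k (-1) (fun _ : E => 0 : C) (fun _ => 0); rewrite scaleN1r addNr => <-.
  by congr extk; apply/funext=> x; rewrite big_nil mulr0 addr0.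
 exact:S.
have pkl b f g k x : Dk f -> Dk g -> pk k (fun k z => b * f k z + g k z) x = b * pk k f x + pk k g x.
 move=> Df Dg; rewrite mulr_sumr -big_split; apply:eq_bigr=> i _ /=.
 have [_ _ h _ _] := H k; rewrite (h i b _ _ (Dk_zero_off k Df) (Dk_zero_off k Dg)); ring.
have JNl b f g : Dk f -> Dk g -> JN (fun k z => b * f k z + g k z) = b *: JN f + JN g.
 move=> Df Dg; rewrite scaler_sumr -big_split; apply:eq_bigr=> k _ /=.
 rewrite -extk_lin; congr extk; apply/funext=> x; exact:pkl.
pose G f l z := Rk l (Jop d f - JN f) z.
have fJ f : Dk f -> is_form (bideg n 0) (Jop d f - JN f).
 move=> Df; apply:form_sub => //; exact:Jop_form.
have DG f : Dk f -> Dk (G f) by move=> Df; have h := @Dk_Rk R n X u _ _ (fJ f Df).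
have D00 : @Dk R n X u (fun _ _ => 0) by split=> //; exact:cts_cst.
have Gl b f g s x : Dk f -> Dk g -> G (fun k z => b * f k z + g k z) s x = b * G f s x + G g s x.
 move=> Df Dg; rewrite /G (Jop_lin d b Df Dg) JNl // -Rk_lin; congr (Rk s _ x).
 ring.
have Gb f (M : R) : Dk f -> (forall s x, cn (f s x) <= M) -> forall s x, cn (G f s x) <= M / 2.
 move=> Df fM s x; have M0 : 0 <= M by apply:le_trans (fM s 0); exact:cn_ge0.
 have -> : G f s x = \sum_k Rk s (extk k (fun y => -1 * pk k f y + avk d f k y)) x.
  rewrite -Rk_sum /G -sumrB; congr (Rk s _ x); apply:eq_bigr=> k _.
  by rewrite extk_lin scaleN1r addrC.
 apply:le_trans (cn_sum _ _ _) _; apply:le_trans (_ : \sum_(k : I_) K * (eps * M) <= _).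
  apply:ler_sum => k _; apply:HK => [z nz|z].
   by have [_ h] := gpk k f; rewrite h // (avk_out d0 Df nz) mulr0 addr0.
  rewrite mulN1r addrC; have [_ _ _ _ h] := H k; exact:h.
 rewrite sumr_const -[_ *+ _]mulr_natl -/m.
 have -> : m * (K * (eps * M)) = (m * K) * eps * M by lra.
 rewrite [M / 2]mulrC ler_wpM2r // ler_pdivrMr; last by lra.
 lra.
exists (fun k => size (ys k)), ee, (4 * \sum_k KK k); split.
- by rewrite mulr_ge0 // sumr_ge0 // => k; have [] := H k.
- move=> k i hi; exact:(extk_form dk (gp k i hi)).
move=> a M aT aM; have Df := @Dk_Rk R n X u _ _ aT.
have [c [Dc cE cM]] := neumann D00 (@Dk_lin R n X u) Dk_lim DG Gl Gb Df aM.
exists (fun k i => if (i < size (ys k))%N then t k i (c k) else 0); split.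
 move=> k i; have M0 : 0 <= M by apply:le_trans (aM k 0); exact:cn_ge0.
 have S0 : KK k <= \sum_k KK k.
  by rewrite (bigD1 k) //= lerDl sumr_ge0 // => j; have [] := H j.
 have [_ k0 _ h _] := H k; case:ifP => hi; last first.
  by rewrite cn0 mulr_ge0 // mulr_ge0 // (le_trans k0).
 apply:le_trans (h i (c k) (4 * M) (Dk_zero_off k Dc) (cM k)) _.
 nra.
have [b1 b1T e1] := ptx_form n_gt0 d0 dk aT.
have [b2 b2T e2] := ptx_form n_gt0 d0 dk (fJ c Dc).
exists (b1 + b2); first exact:form_add.
rewrite (delD b1T b2T) -e1 -e2.
have -> : \sum_k \sum_(i < size (ys k)) (if (i < size (ys k))%N then t k i (c k) else 0) *: ee k i = JN c.
 by rewrite JNE; apply:eq_bigr=> k _; apply:eq_bigr=> i; rewrite ltn_ord.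
have cE' : c = fun k z => 1 * Rk k a z + G c k z by apply/funext=> k; apply/funext=> z; rewrite mul1r.
have E : Jop d c = Jop d (fun k => Rk k a) + Jop d (G c).
 by rewrite {1}cE' (Jop_lin d 1 Df (DG c Dc)) scale1r.
have Z (V : zmodType) (x A B J F : V) : F = A + B -> x = x - A + (F - J - B) + J.
 by move=> ->; rewrite [A + B - J - B]addrAC addrK subrKA subrK.
exact:Z.
Qed.
End FinitelyGenerated.

(** * A bounded functional vanishing on split forms, and its smooth density *)

Section Hyperplane.
Variables (K : fieldType) (V : lmodType K).
Implicit Types (W H : V -> Prop) (x y : V) (s : seq V).
Definition lin_cl W := W 0 /\ forall (t : K) x y, W x -> W y -> W (t *: x + y).
Lemma lin_closedB W x y : lin_cl W -> W x -> W y -> W (x - y).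
move=> [_ WL] Wx Wy; rewrite addrC -scaleN1r; exact:WL. Qed.
Lemma lin_closedZ W t x : lin_cl W -> W x -> W (t *: x).
move=> [W0 WL] Wx; rewrite -[_ *: _]addr0; exact:WL. Qed.
Lemma lin_closedD W x y : lin_cl W -> W x -> W y -> W (x + y).
move=> [_ WL] Wx Wy; rewrite -[x]scale1r; exact:WL. Qed.
Lemma lin_closed_sum W I (s : seq I) (F : I -> V) : lin_cl W -> (forall i, W (F i)) -> W (\sum_(i <- s) F i).
move=> WL WF; elim:s => [|i s IH]; first by rewrite big_nil; have [] := WL.
rewrite big_cons; exact:lin_closedD.
Qed.
(** The vectors of s are added to W one after the other, except those already congruent to a
    multiple of x, so that x stays outside. When W and s span everything, H is a hyperplane
    complementary to x. *)
Lemma hyperplane W x s : lin_cl W -> ~ W x -> exists H,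
 [/\ lin_cl H, forall y, W y -> H y, ~ H x & forall y, y \in s -> exists t, H (y - t *: x)].
move=> WL Wx; elim:s => [|e s [H [HL WH Hx Hs]]]; first by exists W.
have [[t Ht]|ne] := pselect (exists t, H (e - t *: x)).
 by exists H; split=> // y; rewrite inE => /orP[/eqP ->|/Hs //]; exists t.
pose H' y := exists r, H (y - r *: e).
have HH' y : H y -> H' y by exists 0; rewrite scale0r subr0.
exists H'; split.
- split; first by apply:HH'; have [] := HL.
 move=> t y z [r Hr] [r' Hr']; exists (t * r + r').
 have [_ h] := HL; have := h t _ _ Hr Hr'; rewrite scalerBr scalerDl scalerA addrACA opprD //.
- by move=> y /WH /HH'.
- move=> [r Hr]; have [r0|rn0] := eqVneq r 0.
  by apply:Hx; rewrite -[x]subr0 -(scale0r e) -r0.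
 apply:ne; exists r^-1; have := lin_closedZ (- r^-1) HL Hr.
 by rewrite scalerBr scalerA mulNr mulVf // !scaleNr scale1r opprK addrC.
- move=> y; rewrite inE => /orP[/eqP ->|/Hs[t Ht]].
  by exists 0; exists 1; rewrite scale0r scale1r subr0 subrr; have [] := HL.
 exists t; exact:HH'.
Qed.
End Hyperplane.

Section Functional.
Variables (R : realType) (n : nat) (X : ccManifold R n) (u : partition_of_unity X).
Hypothesis n_gt0 : (0 < n)%N.
Local Notation C := R[i].
Local Notation E := 'rV[C]_n.
Local Notation I_ := 'I_(pou_size u).
Implicit Types (k : I_) (a v : preform X).
Definition split_form v := exists e b, [/\ is_form (bideg n 0) e, delbar e = 0, is_form (bideg n.-1 0) b & v = e + del b].
Lemma split_lin : lin_cl split_form.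
split; first by exists 0, 0; split; [exact:is_form0|exact:delbar0|exact:is_form0|rewrite del0 addr0].
move=> t _ _ [e [b [e1 e2 b1 ->]]] [e' [b' [e1' e2' b1' ->]]]; exists (t *: e + e'), (t *: b + b'); split.
- exact:is_form_lin.
- by rewrite (delbar_lin t e1 e1') e2 e2' scaler0 addr0.
- exact:is_form_lin.
- by rewrite (del_lin t b1 b1') scalerDr addrACA.
Qed.
(** lam v is the unique t with v - t a0 in the hyperplane. For the bound, [fin_gen] writes v as a
    del-exact form, which lam kills, plus finitely many fixed forms whose coefficients are
    controlled by the suprema of v. *)
Lemma functional a0 : is_form (bideg n 0) a0 -> ~ split_form a0 ->
 exists (lam : preform X -> C) (K : R),
 [/\ 0 <= K, forall (t : C) a v, is_form (bideg n 0) a -> is_form (bideg n 0) v -> lam (t *: a + v) = t * lam a + lam v,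
   forall v, split_form v -> lam v = 0, lam a0 = 1 &
   forall v (M : R), is_form (bideg n 0) v -> (forall k z, cn (Rk k v z) <= M) -> cn (lam v) <= K * M].
move=> a0T nW; have [d d0 dk] := margin u.
have [N [es [K [K0 esT Hes]]]] := fin_gen n_gt0 d0 dk.
pose s : seq (preform X) := flatten [seq [seq es k (nat_of_ord i) | i <- enum 'I_(N k)] | k <- enum {: I_}].
have ess k (i : 'I_(N k)) : es k i \in s.
 by apply/flatten_mapP; exists k; rewrite ?mem_enum //; apply/mapP; exists i; rewrite ?mem_enum.
have [H [HL WH Ha0 Hs]] := hyperplane s split_lin nW.
have ex v : is_form (bideg n 0) v -> exists t, H (v - t *: a0).
 move=> vT; have [t' [_ [b bT ->]]] : exists t : I_ -> nat -> C, True /\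
   exists2 b, is_form (bideg n.-1 0) b & v = del b + \sum_k \sum_(i < N k) t k i *: es k i.
  have HM k : exists M : R, forall z, cn (Rk k v z) <= M.
   have [M _ HM] := @cts_bdd R n (Lk k) (Rk k v) (@Lk_cpt _ _ X u k) (fun z _ => sm_cont (Rk_sm k vT) (I : setT z)).
   exists (Num.max M 0) => z; rewrite le_max; have [Lz|nz] := pselect (Lk k z); first by rewrite HM.
   by rewrite (Rk_out vT nz) cn0 lexx orbT.
  have [M {}HM] := choice HM.
  have [|t [_ ht]] := Hes v (\sum_k `|M k|) vT; last by exists t.
  move=> k z; apply:le_trans (HM k z) _; apply:le_trans (ler_norm _) _.
  by rewrite (bigD1 k) //= lerDl sumr_ge0.
 have [r Hr] : exists r : I_ -> nat -> C, forall k (i : 'I_(N k)), H (es k i - r k i *: a0).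
  have h (p : I_ * nat) : exists r : C, (p.2 < N p.1)%N -> H (es p.1 p.2 - r *: a0).
   have [hi|hi] := ltnP; last by exists 0.
   by have [r Hr] := Hs _ (@ess p.1 (Ordinal hi)); exists r.
  have [r Hr] := choice h; exists (fun k i => r (k, i)) => k i; exact:(Hr (k, nat_of_ord i) (ltn_ord i)).
 exists (\sum_k \sum_(i < N k) t' k i * r k i).
 rewrite -addrA; apply:lin_closedD => //.
  by apply:WH; exists 0, b; split=> //; [exact:is_form0|exact:delbar0|rewrite add0r].
 rewrite scaler_suml -sumrB; apply:lin_closed_sum => // k; rewrite scaler_suml -sumrB.
 by apply:lin_closed_sum => // i; rewrite -scalerA -scalerBr; apply:lin_closedZ.
have uq v t t' : H (v - t *: a0) -> H (v - t' *: a0) -> t = t'.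
 move=> h1 h2; apply/eqP; rewrite -subr_eq0; apply/negPn/negP => ne; apply:Ha0.
 have := lin_closedZ (t - t')^-1 HL (lin_closedB HL h2 h1).
 have -> : v - t' *: a0 - (v - t *: a0) = (t - t') *: a0 by rewrite opprB addrC subrKA scalerBl.
 by rewrite scalerA mulVf // scale1r.
pose lam v := if pselect (exists t, H (v - t *: a0)) is left e then projT1 (cid e) else 0.
have lamP v : is_form (bideg n 0) v -> H (v - lam v *: a0).
 move=> vT; rewrite /lam; case:pselect => [e|/(_ (ex v vT))//]; exact:projT2 (cid e).
have lamE v t : is_form (bideg n 0) v -> H (v - t *: a0) -> lam v = t by move=> vT; exact:uq (lamP v vT).
have laml t a v : is_form (bideg n 0) a -> is_form (bideg n 0) v -> lam (t *: a + v) = t * lam a + lam v.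
 move=> aT vT; apply:lamE; first exact:is_form_lin.
 have [_ h] := HL; have := h t _ _ (lamP a aT) (lamP v vT).
 by rewrite scalerBr scalerDl scalerA opprD addrACA.
have lamW v : is_form (bideg n 0) v -> split_form v -> lam v = 0.
 move=> vT Wv; apply:lamE => //; rewrite scale0r subr0; exact:WH.
have WT v : split_form v -> is_form (bideg n 0) v.
 move=> [e [b [e1 _ b1 ->]]]; apply:form_add => //; apply:form_del b1 => c d'.
 by move=> /andP[/eqP -> /eqP ->]; rewrite /bideg prednK // eqxx.
exists lam, (K * \sum_k \sum_(i < N k) cn (lam (es k i))); split=> //.
- apply:mulr_ge0 => //; apply:sumr_ge0 => k _; apply:sumr_ge0 => i _; exact:cn_ge0.
- move=> v Wv; apply:lamW => //; exact:WT.
- by apply:lamE => //; rewrite scale1r subrr; have [] := HL.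
move=> v M vT vM; have [t [tM [b bT e]]] := Hes v M vT vM.
have lam0 : lam 0 = 0 by apply:lamE; [exact:is_form0|rewrite scale0r subr0; have [] := HL].
have ls (I0 : Type) (r : seq I0) (F : I0 -> preform X) : (forall i, is_form (bideg n 0) (F i)) ->
  lam (\sum_(i <- r) F i) = \sum_(i <- r) lam (F i).
 move=> FT; elim:r => [|i r IH]; first by rewrite !big_nil.
 by rewrite !big_cons -[F i]scale1r (laml 1 _ _ (FT i) (form_sum r FT)) mul1r IH scale1r.
have F1 k (i : 'I_(N k)) : is_form (bideg n 0) (t k i *: es k i) by apply:form_scale; exact:esT.
have F2 k : is_form (bideg n 0) (\sum_(i < N k) t k i *: es k i) by exact:form_sum.
have W1 : split_form (del b) by exists 0, b; split=> //; [exact:is_form0|exact:delbar0|rewrite add0r].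
have -> : lam v = \sum_k \sum_(i < N k) t k i * lam (es k i).
 rewrite e -[del b]scale1r (laml 1 _ _ (WT _ W1) (form_sum _ F2)) (lamW _ (WT _ W1) W1) mulr0 add0r ls //.
 apply:eq_bigr=> k _; rewrite ls //; apply:eq_bigr=> i _.
 by rewrite -[_ *: _]addr0 (laml _ _ _ (esT k i (ltn_ord i)) (is_form0 _ _)) lam0 addr0.
apply:le_trans (cn_sum _ _ _) _; rewrite mulr_sumr mulr_suml; apply:ler_sum => k _.
apply:le_trans (cn_sum _ _ _) _; rewrite mulr_sumr mulr_suml; apply:ler_sum => i _.
apply:le_trans (cnM _ _) _; rewrite mulrAC; apply:ler_pM => //; exact:cn_ge0.
Qed.
Variables (d : R) (lam : preform X -> C) (K : R).
Hypothesis d0 : 0 < d.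
Hypothesis dk : forall k z w, Lk k z -> rn (w - z) <= d -> chart_cod (pc k) w.
Hypothesis K0 : 0 <= K.
Hypothesis laml : forall (t : C) a v, is_form (bideg n 0) a -> is_form (bideg n 0) v -> lam (t *: a + v) = t * lam a + lam v.
Hypothesis lamb : forall v (M : R), is_form (bideg n 0) v -> (forall k z, cn (Rk k v z) <= M) -> cn (lam v) <= K * M.
Hypothesis lamd : forall b, is_form (bideg n.-1 0) b -> lam (del b) = 0.
Local Notation T := (T0 n d).
Local Notation rd := (rad R n).
Let TT0 : 0 < T := T0_gt0 n d0.
Definition Jl k (g : E -> C) : C := lam (extk k g).
(** The point 0 keeps the compact set nonempty, so that a bound M valid on it is nonnegative. *)
Definition A1_ k : set E := L1 d k `|` [set 0].
Lemma good_lin k c (f g : E -> C) : good d k f -> good d k g -> good d k (fun z => c * f z + g z).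
move=> [sf f0] [sg g0]; split=> [|z nz]; last by rewrite f0 // g0 // mulr0 addr0.
exact:sm_linT.
Qed.
Lemma good0 k : good d k (fun=> 0).
split=> //; exact:sm_cst. Qed.
Lemma Jl_bfun k : bfun (A1_ k) (good d k) (Jl k).
split.
- apply:compactU; [exact:L1_cpt|exact:compact_set1].
- exact:good0.
- exact:good_lin.
- move=> c f g gf gg; rewrite /Jl extk_lin laml //; [exact:(extk_form dk)|exact:(extk_form dk)].
have [K1 K10 HK1] := Rk_extk dk; exists (K * K1); first exact:mulr_ge0.
move=> f M gf fM; have M0 : 0 <= M by apply:le_trans (fM 0 (or_intror erefl)); exact:cn_ge0.
rewrite -mulrA; apply:lamb => [|l z]; first exact:(extk_form dk).
have [sf f0] := gf; apply:HK1 => // w; have [Lw|nw] := pselect (L1 d k w); first by apply:fM; left.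
by rewrite f0 // cn0.
Qed.
Definition Vk k : set E := [set y | exists2 z, Lk k z & rn (y - z) < d / 2].
Lemma Vk_op k : open (Vk k).
apply/openE_P=> y [z Lz h]; exists (d / 2 - rn (y - z)); first by lra.
exists z => //; have := rn_distD w y z; lra.
Qed.
Lemma Lk_Vk k : Lk k `<=` Vk k.
by move=> z; exists z => //; rewrite subrr rn0 divr_gt0. Qed.
Definition Qk (q : E -> C) := smooth setT q /\ forall v : E, T * rd < rn v -> q v = 0.
Definition q0 (v : E) : C := pkerT T (- v).
(** The density of lam in the chart of k: lam applied to the kernel centred at y, regarded as an (n,
    0)-form. As a [gop] it is smooth where the kernels stay in the chart. *)
Definition hk k (y : E) : C := @gop R n E (Jl k) (fun=> 1) (fun s => - s) q0 y.
Lemma Qk_good k q y : Qk q -> Vk k y -> good d k (fun s => 1 * q (y + - s)).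
move=> [sq qz] [z Lz hy]; split=> [|s ns].
 apply:sm_mul; [exact:sm_cst|exact:sm_reflect].
rewrite qz ?mulr0 // ltNge; apply/negP=> h; apply:ns; exists z => //.
have := rn_distD s y z; rewrite (rnC s y); move: h; rewrite T0rd; lra.
Qed.
Lemma Qk_q0 : Qk q0.
split.
 have -> : q0 = fun v : E => pkerT T (0 - v) by apply/funext=> v; rewrite sub0r.
 exact:sm_reflect (@pkerT_sm R n T).
move=> v hv; have [_] := @pkerT_Cc R n T TT0; apply; rewrite rnN mulrC; exact:ltW.
Qed.
Lemma hk_sm k : smooth (Vk k) (hk k).
apply:(@gop_sm R n E (A1_ k) (good d k) (Jl k) (Jl_bfun k) Qk (fun=> 1) (fun s => - s) (Vk k) (@Vk_op k)).
- move=> s _; exact:(@cvg_cst C (1 : C) _ (nbhs s) (nbhs_filter s)).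
- move=> w _; apply/(@cvgE_P R n E (nbhs w) (nbhs_filter w)) => e e0; apply/nbhsE_P; exists e => // y hy.
 by rewrite -opprD rnN.
- by move=> q [].
- move=> q v [sq qz]; split=> [|w hw]; first exact:rD_sm.
 apply:isD_rD; apply:isD_near (isD_cst 0 v w).
 have d1 : 0 < rn w - T * rd by lra.
 apply/nbhsE_P; exists (rn w - T * rd) => // y hy; rewrite qz //.
 have := rn_distD w y 0; rewrite !subr0 rnC; lra.
- exact:Qk_good.
- exact:Qk_q0.
Qed.
Lemma Jl0 k : Jl k (fun=> 0) = 0.
exact:bf_0 (Jl_bfun k). Qed.
(** By the parametrix lam v = lam (Jop v) up to a del-exact form, which lam kills. Each average is
    an integral of kernels centred at y, and exchanging lam with this integral by [bf_swap] leaves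
    the density [hk]. *)
Lemma lam_rep v : is_form (bideg n 0) v ->
 lam v = (T ^- (2 * n))%:C%C * \sum_k icn (fun y => Rk k v y * hk k y).
move=> vT; have Df := @Dk_Rk R n X u _ _ vT; set q : C := (T ^- (2 * n))%:C%C.
have qn0 : q != 0 by rewrite fmorph_eq0 invr_eq0 expf_neq0 // gt_eqF.
have [b bT e] := ptx_form n_gt0 d0 dk vT.
have JT := Jop_form d0 dk Df.
have -> : lam v = lam (Jop d (fun k => Rk k v)).
 have dT : is_form (bideg n 0) (del b).
  by apply:form_del bT => c d' /andP[/eqP -> /eqP ->]; rewrite /bideg prednK // eqxx.
 have {1}-> : v = 1 *: del b + Jop d (fun k => Rk k v) by rewrite scale1r -e subrK.
 by rewrite laml // lamd // mulr0 add0r.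
have ls (s : seq I_) (F : I_ -> preform X) : (forall i, is_form (bideg n 0) (F i)) ->
  lam (\sum_(i <- s) F i) = \sum_(i <- s) lam (F i).
 have lam0 : lam 0 = 0.
  have := laml (-1) (is_form0 X (bideg n 0)) (is_form0 X (bideg n 0)); rewrite scaler0 addr0 => ->; ring.
 move=> FT; elim:s => [|i s IH]; first by rewrite !big_nil.
 by rewrite !big_cons -[F i]scale1r (laml 1 (FT i) (form_sum s FT)) mul1r IH scale1r.
rewrite ls; last by move=> k; apply:(extk_form dk); exact:good_avk.
rewrite mulr_sumr; apply:eq_bigr=> k _; rewrite -/(Jl k _).
have [r r0 Cf] := csupp_Cc (Dk_csupp k Df); have [fc f0] := Df k.
pose F s y := Rk k v y * pkerT T (s + - y).
have aE s : icn (F s) = q^-1 * avk d (fun k => Rk k v) k s.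
 by rewrite /avk (avg_mollify s r0 TT0 Cf) mulrA mulVf // mul1r.
have D1 y : good d k (F^~ y).
 have [Ly|nL] := pselect (Lk k y); last first.
  by rewrite (_ : F^~ y = fun=> 0); [exact:good0|apply/funext=> s; rewrite /F f0 // mul0r].
 have [h1 h2] := good_lin (Rk k v y) (Qk_good Qk_q0 (Lk_Vk Ly)) (good0 k).
 have E1 : F^~ y = fun s => Rk k v y * (1 * q0 (y + - s)) + 0.
  by apply/funext=> s; rewrite /q0 mul1r addr0 opprB.
 by rewrite E1.
have JF y : Jl k (F^~ y) = Rk k v y * hk k y.
 have [Ly|nL] := pselect (Lk k y); last first.
  by rewrite f0 // mul0r (_ : F^~ y = fun=> 0) ?Jl0 //; apply/funext=> s; rewrite /F f0 // mul0r.
 rewrite -(bf_Z (Jl_bfun k) (Rk k v y) (Qk_good Qk_q0 (Lk_Vk Ly))); congr Jl; apply/funext=> s.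
 by rewrite /q0 mul1r opprB.
have C1 s : Cc r (F s).
 apply:Cc_mull Cf _ => z; exact:sm_cont (sm_reflect s (@pkerT_sm R n T)) I.
have D2 : good d k (fun s => icn (F s)).
 have [h1 h2] := good_lin q^-1 (good_avk d0 k Df) (good0 k).
 by split=> [|z nz]; [move: h1; congr smooth; apply/funext=> s; rewrite addr0|rewrite aE; have := h2 z nz; rewrite addr0].
have C2 : Cc r (fun y => Jl k (F^~ y)).
 split=> [y|y hy]; last by rewrite JF Cf.2 // mul0r.
 have [Ly|nL] := pselect (Lk k y).
  have E2 : (fun y => Jl k (F^~ y)) = fun y => Rk k v y * hk k y by apply/funext=> y'.
  rewrite E2; apply:cts_mul; [exact:fc|exact:sm_cont (hk_sm k) (Lk_Vk Ly)].
 apply:cts_near (cts_cst 0 y); apply:filterS (nr_out (@Lk_cpt _ _ X u k) nL) => w nw.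
 by rewrite JF f0 // mul0r.
have J3 s y : A1_ k s -> (fun p : E * E => F p.1 p.2) @ (s, y) --> F s y.
 move=> _; apply:(@cvg_mulC R _ (nbhs (s, y)) (nbhs_filter _)).
  exact:@cvg_snd_cts.
 apply/cvgC_P=> e0 e00.
 have [dd dd0 Hd] := sm_cont (@pkerT_sm R n T) (I : setT (s - y)) e00.
 have d2 : 0 < dd / 2 by lra.
 exists ([set x | rn (x - s) < dd / 2], [set x | rn (x - y) < dd / 2]) => /=.
  by split; apply/nbhsE_P; exists (dd / 2).
 move=> [s' y'] /= [h1 h2]; apply:Hd; rewrite opprD addrACA -opprD; apply:le_lt_trans (rnB _ _) _; lra.
have SW := @bf_swap R n E (A1_ k) (good d k) (Jl k) (@icn R n) F r (Jl_bfun k) (@int_ccfun R n) r0 D1 C1 D2 C2 J3.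
have -> : Jl k (avk d (fun k => Rk k v) k) = q * Jl k (fun s => icn (F s)).
 rewrite -(bf_Z (Jl_bfun k) q D2); congr Jl; apply/funext=> s.
 by rewrite aE mulrA mulfV // mul1r.
by rewrite SW; congr (_ * _); congr icn; apply/funext=> y.
Qed.
End Functional.

(** * Weak equations, and the splitting of (n, 0)-forms *)

Section Weak.
Variables (R : realType) (n : nat).
Local Notation C := R[i].
Local Notation E := 'rV[C]_n.
Lemma dz_off (j : 'I_n) (K : set E) (f : E -> C) z : compact K -> (forall w, ~ K w -> f w = 0) -> ~ K z -> dz j f z = 0.
move=> cK f0 nz; have oW := cpt_openC cK.
by rewrite -(@dz_congr R n _ oW j (fun=> 0) f z) ?dz_cst // => [w nw|]; [rewrite f0|exact:sm_cst].
Qed.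
(** Testing with a cutoff times conj(dz_j t) and integrating by parts shows that the integral of the
    cutoff times |dz_j t|^2 vanishes. Since t is already smooth, the weak equation holds
    pointwise. *)
Lemma weak (j : 'I_n) (V : set E) (t : E -> C) : open V -> smooth V t ->
 (forall (g : E -> C) (K : set E), smooth setT g -> compact K -> K `<=` V -> (forall z : E, ~ K z -> g z = 0) -> icn (fun z => dz j g z * t z) = 0) ->
 forall z, V z -> dz j t z = 0.
move=> oV st H c Vc; have [f [K [sf cK KV f0 [fp fc]]]] := cutoff oV Vc.
pose h := dz j t; have sh : smooth V h := sm_dz j oV st.
pose g (z : E) : C := f z * (h z)^*.
have g0 z : ~ K z -> g z = 0 by move=> nz; rewrite /g f0 ?mul0r.
have sgV : smooth V g by apply:sm_mul; [exact:sf|exact:sm_conj].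
have sg := sm_off oV cK KV sgV g0.
have sgt : smooth setT (fun z => g z * t z).
 by apply:(sm_off oV cK KV) => [|z nz]; [exact:sm_mul|rewrite g0 ?mul0r].
have cs (q : E -> C) : smooth V q -> (forall z, ~ K z -> q z = 0) -> csupp setT q.
 move=> sq q0; split=> [z _|]; last by exists K.
 exact:sm_cont (sm_off oV cK KV sq q0) I.
have c1 : csupp setT (fun z => g z * t z) by apply:cs => [|z nz]; [exact:sm_mul|rewrite g0 ?mul0r].
have c2 : csupp setT (fun z => g z * h z) by apply:cs => [|z nz]; [exact:sm_mul|rewrite g0 ?mul0r].
have c3 : csupp setT (fun z => dz j g z * t z).
 apply:cs => [|z nz]; last by rewrite (@dz_off j K g z cK g0 nz) mul0r.
 by apply:sm_mul => //; apply:sm_sub (sm_dz j openT sg).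
have [[_ e1] _] := csupp_dz j sgt c1; have [_ e2] := csupp_lin 1 c3 c2.
have e3 : icn (fun z => g z * h z) = 0.
 rewrite (H g K) // mulr0 add0r in e2; rewrite -e2 -e1; congr icn; apply/funext=> z.
 rewrite mul1r; have [Vz|nV] := pselect (V z); first by rewrite (@dz_mul R n V).
 have nz : ~ K z by move=> /KV.
 by rewrite (@dz_off j K g z cK g0 nz) g0 // !mul0r add0r (@dz_off j K _ z cK _ nz) // => w nw; rewrite g0 ?mul0r.
have [r r0 Cf] := csupp_Cc c2.
have gp z : 0 <= g z * h z by rewrite -mulrA mulr_ge0 // mulrC mul_conjC_ge0.
have /eqP := int_eq0 r0 Cf gp e3 c.
by rewrite -mulrA mulf_eq0 gt_eqF //= mulrC mul_conjC_eq0 => /eqP.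
Qed.
End Weak.

Section Split.
Variables (R : realType) (n : nat) (X : ccManifold R n) (u : partition_of_unity X).
Hypothesis n_gt0 : (0 < n)%N.
Local Notation C := R[i].
Local Notation E := 'rV[C]_n.
Local Notation I_ := 'I_(pou_size u).
Local Notation TT := ([set: 'I_n], [set: 'I_n])%SET.
Local Notation s0 := (@finset.set0 'I_n).
Lemma wedge0r w : wedge w 0 = 0 :> preform X.
by have := wedgeBr w 0 0; rewrite !subrr. Qed.
Lemma w_sumr v (s : seq I_) (F : I_ -> preform X) : wedge v (\sum_(k <- s) F k) = \sum_(k <- s) wedge v (F k).
elim:s => [|k s IH]; first by rewrite !big_nil wedge0r.
by rewrite !big_cons -[F k]scale1r w_linr IH !scale1r.
Qed.
Theorem form_split (a : preform X) : is_form (bideg n 0) a -> split_form a.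
move=> aT; apply:contrapT => nW.
have [lam [K [K0 laml lamW lam1 lamb]]] := functional u n_gt0 aT nW.
have lamd b : is_form (bideg n.-1 0) b -> lam (del b) = 0.
 by move=> bT; apply:lamW; exists 0, b; split=> //; [exact:is_form0|exact:delbar0|rewrite add0r].
have [d d0 dk] := margin u.
have rep v vT := @lam_rep R n X u n_gt0 d lam K d0 dk K0 laml lamb lamd v vT.
set q : C := _%:C%C in rep.
(* The factor rho_k is moved from v, where [Rk] put it, to the density, so that the density has
   compact support and extends by zero to X. *)
pose tk (k : I_) (z : E) : C := if `[< chart_cod (pc k) z >] then rho k (chart_inv (pc k) z) * hk d lam k z else 0.
have tk0 (k : I_) z : ~ Lk k z -> tk k z = 0.
 by move=> nz; rewrite /tk; case:asboolP=> // kz; rewrite rho_Lk ?mul0r.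
have tks (k : I_) : smooth setT (tk k).
 pose V := Vk d k `&` chart_cod (pc k).
 have oV : open V by apply:openI; [exact:Vk_op|exact:chart_cod_open].
 apply:(sm_off oV (@Lk_cpt _ _ X u k)) (@tk0 k) => [z Lz|].
  split; [exact:Lk_Vk|exact:Lk_cod].
 apply:(@sm_congr R n V (fun z => rho k (chart_inv (pc k) z) * hk d lam k z)) => // [z [_ kz]|].
  by rewrite /tk; case:asboolP.
 apply:sm_mul; first by apply:(sm_sub _ (@rho_sm R n X u k (pc k))) => z [].
 have Vs : V `<=` Vk d k by move=> z [].
 apply:(sm_sub Vs); exact:(hk_sm d0 dk K0).
have b0 (k : I_) z : ~ Lk k z -> bot0 (tk k) z = fun=> 0.
 by move=> nz; apply/funext=> P; rewrite /bot0 tk0 //; case:ifP.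
have s1 (k : I_) : supp_in (pc k) (bot0 (tk k)).
 exists (Lk k); split; [exact:Lk_cpt|exact:Lk_cod|exact:b0].
pose F k := ext (pc k) (bot0 (tk k)).
have FT k : is_form (bideg 0 n) (F k).
 apply:ext_form => [//||z P]; last exact:bot0_type.
 by apply:smc_bot0; apply:sm_sub (tks k).
(* The factor supplies the constant of [lam_rep] and cancels the orientation constant of [Itg], so
   that lam v is the integral of v /\ [th]. *)
pose th := (q / orient R n) *: \sum_k F k.
have thT : is_form (bideg 0 n) th by apply:form_scale; exact:form_sum.
have lamE v : is_form (bideg n 0) v -> lam v = Itg u (wedge v th).
 move=> vT; rewrite rep // /th -[_ *: _]addr0 w_linr.
 rewrite wedge0r addr0 (@ItgZ R n X u (@anyT)); last exact:any_wedge vT (form_sum _ FT).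
 rewrite w_sumr (@Itg_sum R n X u (@anyT)); last by move=> k; exact:any_wedge vT (FT k).
 rewrite mulr_sumr mulr_sumr; apply:eq_bigr=> k _.
 have cF := ext_carried (@Lk_cpt _ _ X u k) (@Lk_cod _ _ X u k) (@b0 k).
 rewrite (@Itg_chart R n X u (@anyT) (pc k) (Lk k)); [|exact:any_wedge vT (FT k)|]; last first.
  have [h1 h2 h3] := cF; split=> // i z iz nz; apply/funext=> P.
  by rewrite /wedge big1 // => Q; rewrite /F h3 // !mulr0.
 rewrite mulrA divfK ?orient_neq0 //; congr (_ * icn _); apply/funext=> z.
 rewrite w_hol // /F ext_diag // /bot0 eqxx /Rk /tk.
 case:asboolP=> [_|nk]; first by ring.
 have [v0 _ _ _] := vT; rewrite v0 //; ring.
(* For a test function g in chart i the form (dz_j g) dz_1 /\ ... /\ dz_n is del of [sub1 j g], so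
   lam kills it; this is the weak equation for the coefficient of [th]. *)
have dth i j z : chart_cod i z -> dz j (fun z => th i z (s0, [set: 'I_n])%SET) z = 0.
 apply:(weak (@chart_cod_open _ _ X i) (form_smc i thT _)) => g L sg cL LV g0 {z}.
 have h0 (h : E -> C) : (forall z, ~ L z -> h z = 0) -> forall z, ~ L z -> sub1 j h z = fun=> 0.
  by move=> hz z nz; apply/funext=> P; rewrite /sub1 hz // mulr0; case:ifP.
 have sg' : smooth (chart_cod i) g by exact:sm_sub sg.
 have bT : is_form (bideg n.-1 0) (ext i (sub1 j g)).
  apply:ext_form; last exact:sub1_type.
   exists L; split=> //; exact:h0.
  exact:smc_sub1.
 have dE : cdel (sub1 j g) = top0 (dz j g).
  apply/funext=> z; exact:(cdel_sub1 _ openT).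
 have d0' := fun z => @dz_off R n j L g z cL g0.
 have t1 : supp_in i (top0 (dz j g)) by exists L; split=> //; exact:top0_off.
 have tT : is_form (bideg n 0) (ext i (top0 (dz j g))).
  apply:ext_form => [//||z P]; last exact:top0_type.
  by apply:smc_top0; apply:sm_sub (sm_dz j openT sg).
 have /eqP := lamE _ tT; rewrite -{1}dE -(del_ext cL LV (h0 _ g0) (smc_sub1 j sg')) lamd //.
 have cT := ext_carried cL LV (top0_off d0').
 rewrite (@Itg_chart R n X u (@anyT) i L); [|exact:any_wedge tT thT|]; last first.
  have [h1 h2 h3] := cT; split=> // k z iz nz; apply/funext=> P.
  by rewrite /wedge big1 // => Q; rewrite h3 // mul0r mulr0.
 rewrite eq_sym mulf_eq0 (negbTE (orient_neq0 R n)) => /eqP <-; congr icn; apply/funext=> z.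
 by rewrite w_hol // ext_diag // /top0 eqxx.
have dth0 : del th = 0.
 apply:preformP => i z P; rewrite /del; case:asboolP=> // iz; rewrite big1 // => j _.
 have [e|ne] := eqVneq ((P.1 :\ j)%SET, P.2) (s0, [set: 'I_n]%SET); first by rewrite e dth // mulr0.
 rewrite (form_eq0 i thT) ?dz_cst ?mulr0 //; apply/negP=> /bideg_0n h; by rewrite h eqxx in ne.
have eT := form_bidegC thT.
have th0 : conj_form th = 0.
 apply:(hol_pos (u := u)) => //; rewrite conj_formK -lamE //; apply:lamW.
 exists (conj_form th), 0; split=> //; [|exact:is_form0|by rewrite del0 addr0].
 by rewrite (db_conj thT) dth0 conj_form0.
have := lamE a aT; rewrite lam1 -(conj_formK th) th0 conj_form0 wedge0r Itg0 => /eqP.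
by rewrite oner_eq0.
Qed.
End Split.

(** * The three-term decomposition of the cohomology *)

Section Components.
Variables (R : realType) (n : nat) (X : ccManifold R n).
Local Notation C := R[i].
Implicit Types (T : nat -> nat -> bool) (w a : preform X).
Lemma form_out T w i z (P : {set 'I_n} * {set 'I_n}) : is_form T w -> ~~ T #|P.1| #|P.2| -> w i z P = 0.
move=> [_ _ _]; apply. Qed.
Lemma form_refine T T' w : is_form T w ->
 (forall i z (P : {set 'I_n} * {set 'I_n}), T #|P.1| #|P.2| -> ~~ T' #|P.1| #|P.2| -> w i z P = 0) -> is_form T' w.
move=> [h1 h2 h3 h4] H; split=> // i z P nT'; case t : (T #|P.1| #|P.2|); first exact:H.
by apply:h4; rewrite t.
Qed.
Definition cut T a : preform X := fun i z P => if T #|P.1| #|P.2| then a i z P else 0.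
Lemma pull_cut (M : 'M[C]_n) T (c : coefs R n) :
 pull M (fun P => if T #|P.1| #|P.2| then c P else 0) = fun P => if T #|P.1| #|P.2| then pull M c P else 0.
apply/funext=> P; rewrite /pull (_ : (if _ then _ else _) = \sum_(Q : {set 'I_n} * {set 'I_n})
 if T #|P.1| #|P.2| then c Q * (minor M P.1 Q.1 * (minor M P.2 Q.2)^*) else 0); last by case:ifP => //; rewrite big1.
apply:eq_bigr=> Q _; have [e1|n1] := eqVneq #|P.1| #|Q.1|; last first.
 by rewrite (minor_card _ n1) mul0r !mulr0 if_same.
have [e2|n2] := eqVneq #|P.2| #|Q.2|; last by rewrite (minor_card _ n2) cj0 !mulr0 if_same.
by rewrite -e1 -e2; case:ifP; rewrite ?mul0r.
Qed.
Lemma form_cut T T' a : is_form T' a -> is_form T (cut T a).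
move=> [h1 h2 h3 h4]; split.
- by move=> i z nz; apply/funext=> P; rewrite /cut h1 // if_same.
- move=> i P; rewrite (_ : (fun z => _) = fun z => if T #|P.1| #|P.2| then a i z P else 0) //.
 case:(T _ _); [exact:h2|exact:sm_cst].
- by move=> i j z iz jz; rewrite pull_cut -h3.
- by move=> i z P /negbTE nT; rewrite /cut nT.
Qed.
Lemma del_pure p q w : is_form (bideg p q) w -> dext w = 0 -> del w = 0.
move=> wT dw; have dT : is_form (bideg p.+1 q) (del w) by apply:form_del wT => b.
have dT' : is_form (bideg p q.+1) (delbar w) by apply:form_db wT => b.
apply:preformP => i z P; case t : (bideg p.+1 q #|P.1| #|P.2|); last by rewrite (form_out i z dT) ?t.
have : dext w i z P = 0 by rewrite dw.
rewrite -[dext w i z P]/(del w i z P + delbar w i z P) (form_out i z dT') ?addr0 //.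
by move/andP: t => [/eqP -> _]; rewrite negb_and neq_ltn ltnSn orbT.
Qed.
Variable u : partition_of_unity X.
Hypothesis n_gt0 : (0 < n)%N.
Lemma closed_split a : is_form (deg n) a -> dext a = 0 -> exists e m t b,
 [/\ is_form (bideg n 0) e /\ delbar e = 0, is_form (mid n) m /\ dext m = 0,
   is_form (bideg 0 n) t /\ del t = 0, is_form (pred_deg n) b & a = e + m + t + dext b].
move=> aT da; have [e [b [eT de bT E1]]] := form_split u n_gt0 (form_cut (bideg n 0) aT).
have [eT' de'] : is_form (deg n) e /\ dext e = 0.
 by have /asboolP : e \in ker_forms (d_op X) (deg n) by apply:Hhol_closed; apply/asboolP.
have bT' : is_form (pred_deg n) b.
 by apply:is_form_sub bT => c d /andP[/eqP -> /eqP ->]; rewrite /pred_deg addn0 prednK.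
have pd := @pred_deg_dext R n X.
have nn0 : n != 0 by rewrite -lt0n.
pose a1 := a - e - dext b.
have a1T : is_form (deg n) a1 by apply:form_sub (pd _ bT'); exact:form_sub.
have da1 : dext a1 = 0.
 by rewrite (dextB (form_sub aT eT') (pd _ bT')) (dextB aT eT') de' (dext_dext bT') !subr0.
(* Of d b only del b has type (n, 0), delbar b being of type (n - 1, 1); so subtracting d b removes
   exactly the del-exact part of the (n, 0)-component. *)
have a10 i z (P : {set 'I_n} * {set 'I_n}) : bideg n 0 #|P.1| #|P.2| -> a1 i z P = 0.
 move=> h; have e1 : cut (bideg n 0) a i z P = e i z P + del b i z P by rewrite E1.
 have dT : is_form (bideg n.-1 1) (delbar b) by apply:form_db bT => d.
 rewrite -[LHS]/(a i z P - e i z P - (del b i z P + delbar b i z P)) (form_out i z dT); last first.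
  by move/andP: h => [_ /eqP ->]; rewrite /bideg andbF.
 move: e1; rewrite /cut h => ->; ring.
(* For n = 1 the second correction would disturb the first, since del g then has type (1, 0) = (n,
   0). But there a1 is already purely of type (0, 1), and being closed it is antiholomorphic. *)
have [n1|n1] := eqVneq n 1%N.
 have tT : is_form (bideg 0 n) a1.
  apply:(form_refine a1T) => i z P h nh; apply:a10; move: #|P.1| #|P.2| h nh => k l; rewrite /deg /bideg n1.
  by case:k => [|[|k]]; case:l => [|[|l]].
 exists e, 0, a1, b; split=> //; first by split; [exact:is_form0|exact:dext0].
  split=> //; exact:del_pure tT da1.
 rewrite /a1; ring.
have cT := form_bidegC (form_cut (bideg 0 n) a1T).
have [e' [b' [eT1 de1 bT1 E2]]] := form_split u n_gt0 cT.
pose t := conj_form e'; pose g := conj_form b'.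
have E3 : cut (bideg 0 n) a1 = t + delbar g.
 have D (v w : preform X) : conj_form (v + w) = conj_form v + conj_form w.
  by have := conj_formB (v + w) w; rewrite addrK => ->; rewrite subrK.
 by rewrite -[LHS]conj_formK E2 (db_conj bT1).
have tT : is_form (bideg 0 n) t := form_bidegC eT1.
have dt : del t = 0 by rewrite (del_conj eT1) de1 conj_form0.
have [tT' dt'] : is_form (deg n) t /\ dext t = 0.
 by have /asboolP : t \in ker_forms (d_op X) (deg n) by apply:Hantihol_closed; apply/asboolP.
have gT0 : is_form (bideg 0 n.-1) g := form_bidegC bT1.
have gT : is_form (pred_deg n) g.
 by apply:is_form_sub gT0 => c d /andP[/eqP -> /eqP ->]; rewrite /pred_deg prednK.
have g1 : is_form (bideg 1 n.-1) (del g) by apply:form_del gT0 => d.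
have g2 : is_form (bideg 0 n) (delbar g) by apply:form_db gT0 => d; rewrite -{2}(prednK n_gt0).
pose m := a1 - t - dext g.
have mT : is_form (deg n) m by apply:form_sub (pd _ gT); exact:form_sub.
have mE i z P : m i z P = a1 i z P - t i z P - (del g i z P + delbar g i z P) by [].
exists e, m, t, (b + g); split; [by []| |by []|exact:form_add|].
- split; last by rewrite (dextB (form_sub a1T tT') (pd _ gT)) (dextB a1T tT') dt' (dext_dext gT) !subr0.
 apply:(form_refine mT) => i z P h nh; rewrite mE.
 have [h1|h1] := boolP (bideg n 0 #|P.1| #|P.2|).
  have /andP[/eqP p1 /eqP p2] := h1.
  rewrite (a10 _ _ _ h1) (form_out i z tT) ?(form_out i z g1) ?(form_out i z g2) ?p1 /bideg ?(negbTE nn0) ?(negbTE n1) //.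
  ring.
 have h2 : bideg 0 n #|P.1| #|P.2|.
  move: h nh h1; rewrite /deg /mid /bideg; case: #|P.1| => [|k]; first by [].
  by case: #|P.2| => [|l]; [rewrite addn0 => ->|move=> ->].
 have e1 : cut (bideg 0 n) a1 i z P = t i z P + delbar g i z P by rewrite E3.
 have /andP[/eqP p1 /eqP p2] := h2.
 rewrite (form_out i z g1) ?p1 //; move: e1; rewrite /cut h2 => ->; ring.
- rewrite (dextD bT' gT) /m /a1; ring.
Qed.
End Components.

Section Decomposition.
Variables (R : realType) (n : nat) (X : ccManifold R n) (u : partition_of_unity X).
Hypothesis n_gt0 : (0 < n)%N.
Local Notation Zn := (Defs.subspace (ker_forms (d_op X) (deg n))).
(** The hermitian pairing depends on classes only, so the first w may be replaced by e; for reasons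
    of type e /\ conj w has no top component. With positivity this makes such a w vanish as a
    form. *)
Lemma type_apart T T' (w e : Zn) : is_form T (subspace_val w) -> is_form T' (subspace_val e) ->
 apart n T' (fun a b : nat => T b a) -> dR_class w = dR_class e ->
 Itg u (wedge (subspace_val w) (conj_form (subspace_val w))) = 0.
move=> wT eT ap h; rewrite -hf_cls {1}h hf_cls.
apply:Itg_top => i z; exact:w_type0 (form_conj wT) ap.
Qed.
Lemma sum_to_dR_onto c : exists t, @sum_to_dR R n X t = c.
have [w <-] := cls_surj c; have [wT dw] := closedP w.
have [e [m [t [b [he hm ht bT E]]]]] := closed_split u n_gt0 wT dw.
pose e1 : Hhol X := Subspace (asboolT he : e \in ker_forms (delbar_op X) (bideg n 0)).
pose m1 := Subspace (asboolT hm : m \in ker_forms (d_op X) (mid n)).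
pose t1 : Hantihol X := Subspace (asboolT ht : t \in ker_forms (del_op X) (bideg 0 n)).
exists (e1, cls _ m1, t1); rewrite /sum_to_dR /= subquot_inclE -!clsD; apply/clsP=> /=.
rewrite -opprB rpredN E addrC addKr; apply/asboolP; split; last by exists b.
exact:pred_deg_dext.
Qed.
Lemma sum_to_dR_inj : injective (@sum_to_dR R n X).
move=> [[e c] x] [[e' c'] x'] /eqP; rewrite /sum_to_dR /= -subr_eq0 !opprD addrACA [X in X + _]addrACA -!linearB.
set ep := e - e'; set ch := x - x'; have [mu Emu] := cls_surj (c - c'); rewrite -Emu /= subquot_inclE => /eqP h.
have [eT _] := closedP ep; have [cT _] := closedP ch; have [mT _] := closedP mu.
pose I1 : Zn := subspace_incl (@Hhol_closed R n X) ep; pose I2 : Zn := subspace_incl (@Hmid_closed R n X) mu.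
pose I3 : Zn := subspace_incl (@Hantihol_closed R n X) ch.
have {}h : dR_class I1 + dR_class I2 + dR_class I3 = 0 by [].
have D (v w : Zn) : dR_class (v + w) = dR_class v + dR_class w by exact:clsD.
have N (w : Zn) : dR_class (- w) = - dR_class w by exact:linearN.
have FF T T' (w v : preform X) : is_form T w -> is_form T' v -> is_form (fun a b => T a b || T' a b) (- (w + v)).
 move=> wT vT; apply:form_opp; apply:form_add; [apply:is_form_sub wT|apply:is_form_sub vT] => a b ->//; exact:orbT.
(* By [h] the class of the (n, 0)-part is also represented by minus the sum of the other two parts,
   whose types never pair with it. *)
have e0 : subspace_val ep = 0.
 apply:(hol_pos (u := u)) => //; apply:(@type_apart _ _ I1 (- (I2 + I3)) eT (FF _ _ _ _ mT cT)) => [a b c0 d|].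
  move=> H /andP[/eqP -> /eqP ->]; rewrite addn0 -[X in _ && (_ == X)]add0n eqn_add2r; apply/negP=> /andP[/eqP ea /eqP eb].
  by case/orP: H => [/and3P[_ _]|/andP[/eqP h0 _]]; [rewrite eb|by move: n_gt0; rewrite -ea h0].
 by apply/eqP; rewrite N D -subr_eq0 opprK addrA h.
have x0 : subspace_val ch = 0.
 apply:(antihol_pos (u := u)) => //; apply:(@type_apart _ _ I3 (- (I1 + I2)) cT (FF _ _ _ _ eT mT)) => [a b c0 d|].
  move=> H /andP[/eqP -> /eqP ->]; rewrite addn0 -[X in (_ == X) && _]add0n eqn_add2r; apply/negP=> /andP[/eqP ea /eqP eb].
  by case/orP: H => [/andP[/eqP h0 /eqP h1]|/and3P[_]]; [by move: n_gt0; rewrite -eb h1|rewrite ea].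
 by apply/eqP; rewrite N D -subr_eq0 opprK addrC h.
have ep0 : ep = 0 by exact:val_inj.
have ch0 : ch = 0 by exact:val_inj.
(* The denominator of [Hmid] admits primitives of every type, so a mixed form that is exact in [HdR]
   is already zero in [Hmid]. *)
have m0 : cls (im_d_forms n (mid n)) mu = 0.
 transitivity (cls (im_d_forms n (mid n)) (0 : Defs.subspace (ker_forms (d_op X) (mid n)))); last exact:linear0.
 apply/clsP; rewrite subr0.
 have : dR_class I2 = dR_class 0.
  have Z : dR_class (0 : Zn) = 0 by exact:linear0.
  have i1 : I1 = 0 by exact:val_inj.
  have i3 : I3 = 0 by exact:val_inj.
  by move: h; rewrite i1 i3 Z add0r addr0.
 by move=> /clsP; rewrite subr0 => /exactP[_ H]; apply/asboolP.
by congr (_, _, _); apply/eqP; rewrite -subr_eq0 -/ep -/ch ?ep0 ?ch0 -?Emu ?m0.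
Qed.
Lemma sum_to_dR_bij : bijective (@sum_to_dR R n X).
have [g gK] := choice sum_to_dR_onto.
by exists g => // t; apply:sum_to_dR_inj.
Qed.
End Decomposition.

(** * Functoriality under holomorphic maps *)

Section Pullback.
Variables (R : realType) (n : nat) (X Y : ccManifold R n) (f : X -> Y).
Hypothesis fh : holomorphic f.
Local Notation C := R[i].
Local Notation E := 'rV[C]_n.
Implicit Types (i : chart_index X) (j : chart_index Y) (z : E) (T : nat -> nat -> bool) (w e : preform Y).
Definition lrep i j : E -> E := local_rep f i j.
Definition ldom i j : set E := [set z | chart_cod i z /\ chart_dom j (f (chart_inv i z))].
Lemma ldom_op i j : open (ldom i j).
rewrite openE => z [iz jz]; have [fc _] := fh.
have h1 : nbhs z (chart_cod i) := nr_op (@chart_cod_open _ _ X i) iz.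
have h2 : nbhs (f (chart_inv i z)) (chart_dom j) by apply:open_nbhs_nbhs; split=> //; exact:chart_dom_open.
exact:filterI h1 (chart_inv_continuous iz (fc _ _ h2)).
Qed.
Lemma ldom_cod i j z : ldom i j z -> chart_cod j (lrep i j z).
move=> [_ jz]; exact:chart_funS. Qed.
Lemma lrep_diff i j z : ldom i j z -> differentiable (lrep i j) z.
move=> [iz jz]; have [_] := fh; exact. Qed.
Definition lrep_sm i j := hol_sm (@ldom_op i j) (@lrep_diff i j).
Definition lrep_hol i j := hol_dzb (@lrep_diff i j).
Definition pchart i z : chart_index Y := projT1 (cid (chart_cover (f (chart_inv i z)))).
Lemma pchartP i z : chart_dom (pchart i z) (f (chart_inv i z)).
exact:projT2 (cid (chart_cover (f (chart_inv i z)))). Qed.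
(** At each point a chart of Y around the image is chosen; [pbE] shows that every other chart gives
    the same value, since w glues and Jacobians multiply. *)
Definition pb w : preform X := fun i z =>
 if `[< chart_cod i z >] then pull (Jac (lrep i (pchart i z)) z) (w (pchart i z) (lrep i (pchart i z) z)) else fun=> 0.
Lemma pbE T w i j z : is_form T w -> ldom i j z -> pb w i z = pull (Jac (lrep i j) z) (w j (lrep i j z)).
move=> wT [iz jz]; rewrite /pb (asboolT iz); have := pchartP i z; move: (pchart i z) => k kz.
have [_ _ wg _] := (is_formP T w).1 wT.
have kj : ovl k j (lrep i k z) by split; [exact:chart_funS|rewrite chartK].
rewrite (wg k j _ kj) -pull_comp; have -> : tr k j (lrep i k z) = lrep i j z by rewrite /tr /= chartK.
congr pull; symmetry; pose V := ldom i k `&` ldom i j.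
have oV : open V by apply:openI; exact:ldom_op.
apply:(Jac_comp (l := n) oV (@ovl_op _ _ Y k j) (phi := lrep i k) (psi := tr k j)) => //.
- by move=> y [[iy ky] [_ jy]]; split; [exact:chart_funS|rewrite chartK].
- by move=> b; apply:sm_sub (@lrep_sm i k b) => y [].
- move=> a b y [h _]; exact:lrep_hol.
- exact:tr_sm.
- by move=> y [[iy ky] _]; rewrite /tr /= chartK.
Qed.
Lemma pb_smc T w i j : is_form T w -> smc (ldom i j) (fun z => pull (Jac (lrep i j) z) (w j (lrep i j z))).
move=> wT; apply:(@smc_pull R n n (ldom i j) (lrep i j) (@ldom_op i j) (@lrep_sm i j)) => Q.
apply:(@sm_comp R n n (ldom i j) (chart_cod j) (fun y => w j y Q) (lrep i j)); [exact:ldom_op|exact:chart_cod_open|exact:ldom_cod|exact:lrep_sm|exact:(form_smc j wT)].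
Qed.
Lemma pb_form T w : is_form T w -> is_form T (pb w).
move=> wT; apply/is_formP; split.
- by move=> i z; rewrite /pb; case:asboolP.
- move=> i P; apply:sm_local => z iz; have [j jz] := chart_cover (f (chart_inv i z)).
 exists (ldom i j); first by split; [exact:ldom_op|].
 apply:(sm_congr (@ldom_op i j)) (pb_smc i j wT P) => y yd; by rewrite (pbE wT yd).
- move=> i k z ik; have [iz kz] := ik; have [j jz] := chart_cover (f (chart_inv i z)).
 have ij : ldom i j z by [].
 have kj : ldom k j (tr i k z) by split; [exact:chart_funS|rewrite chartK].
 rewrite (pbE wT ij) (pbE wT kj) -pull_comp.
 have -> : lrep k j (tr i k z) = lrep i j z by rewrite /lrep /local_rep /= chartK.
 congr pull; pose V := ovl i k `&` ldom i j.
 have oV : open V by apply:openI; [exact:ovl_op|exact:ldom_op].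
 apply:(Jac_comp (l := n) oV (@ldom_op k j) (phi := tr i k) (psi := lrep k j)) => //.
 + by move=> y [[iy ky] [_ jy]]; split; [exact:chart_funS|rewrite chartK].
 + by move=> b; apply:sm_sub (@tr_sm _ _ X i k b) => y [].
 + move=> a b y [h _]; exact:tr_hol.
 + exact:lrep_sm.
 + by move=> y [[iy ky] _]; rewrite /lrep /local_rep /= chartK.
- move=> i z [A B] nT; rewrite /pb; case:asboolP=> // _; apply:pull_deg => K L eK eL.
 by apply:(form_out _ _ wT); rewrite eK eL.
Qed.
Lemma pb_lin a w e : pb (a *: w + e) = a *: pb w + pb e.
apply:preformP => i z P; rewrite preform_linE /pb; case:asboolP=> _; last by ring.
move: pchart => j; by rewrite pull_clin.
Qed.
Lemma pb_del T w : is_form T w -> del (pb w) = pb (del w).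
move=> wT; apply/funext=> i; apply/funext=> z; have dT := @form_del R n Y _ anyT _ (fun _ _ _ => isT) wT.
have [iz|nz] := pselect (chart_cod i z); last by rewrite /del /pb; case:asboolP.
have [j jz] := chart_cover (f (chart_inv i z)); have ij : ldom i j z by [].
rewrite delE // (pbE dT ij) delE; last exact:ldom_cod.
rewrite -(cdel_congr (@ldom_op i j) _ (pb_smc i j wT) ij) => [|y yd]; last by rewrite (pbE wT yd).
apply:(@cdel_pull R n n (ldom i j) (chart_cod j) (lrep i j)) => //; [exact:ldom_op|exact:chart_cod_open|exact:ldom_cod|exact:lrep_sm|by exact:lrep_hol|exact:form_smc wT].
Qed.
Lemma pb_db T w : is_form T w -> delbar (pb w) = pb (delbar w).
move=> wT; have H e : pb (conj_form e) = conj_form (pb e).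
 apply/funext=> i; apply/funext=> z; rewrite /pb; case:asboolP=> zi.
  by rewrite -pull_conj -[RHS]/(cconj (if _ then _ else _)) asboolT.
 by apply/funext=> P; rewrite /conj_form; case:asboolP=> //; rewrite cj0 mulr0.
rewrite -[w in LHS]conj_formK H (db_conj (pb_form (form_conj wT))) (pb_del (form_conj wT)) -H.
by rewrite (del_conj wT) conj_formK.
Qed.
Lemma pb_dext T w : is_form T w -> dext (pb w) = pb (dext w).
move=> wT; rewrite /dext (pb_del wT) (pb_db wT) -[pb (del w)]scale1r -pb_lin scale1r //.
Qed.
Lemma pb_ker (D : form_operator X) (D' : form_operator Y) T :
 (forall w, is_form T w -> D (pb w) = pb (D' w)) ->
 forall w : Defs.subspace (ker_forms D' T), pb (subspace_val w) \in ker_forms D T.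
move=> H w; have [wT dw] := closedP w; apply/asboolP; split; first exact:pb_form.
by rewrite H // dw; have := pb_lin (-1) 0 0; rewrite scaler0 addr0 => ->; rewrite scaleN1r addNr.
Qed.
Local Notation Zd Y := (Defs.subspace (ker_forms (d_op Y) (deg n))).
Definition pbZ (w : Zd Y) : Zd X := Subspace (pb_ker (D := d_op X) (D' := d_op Y) (@pb_dext _) w).
Definition pb_dR (c : HdR Y n) : HdR X n := dR_class (pbZ (rep c)).
Lemma pb_dRE (w : Zd Y) : pb_dR (dR_class w) = dR_class (pbZ w).
apply/clsP=> /=; have -> : pb (subspace_val (rep (dR_class w))) - pb (subspace_val w) = pb (subspace_val (rep (dR_class w)) - subspace_val w).
 by rewrite [in RHS]addrC -scaleN1r pb_lin scaleN1r addrC.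
have /clsP/exactP[rT [b bT ->]] := rep_cls (dR_class w); apply/asboolP; split.
 exact:pb_form (pred_deg_dext bT).
by exists (pb b); [exact:pb_form|rewrite (pb_dext bT)].
Qed.
Lemma pb_dR_linear : linear pb_dR.
move=> a c c'; rewrite -(rep_cls c) -(rep_cls c'); move: (rep c) (rep c') => w e.
have D (Z : ccManifold R n) (x y : Zd Z) : dR_class (a *: x + y) = a *: dR_class x + dR_class y by exact:cls_linear.
rewrite -D !pb_dRE -D; congr dR_class; apply:val_inj; exact:pb_lin.
Qed.
Lemma functorial : exists F : {linear HdR Y n -> HdR X n},
 [/\ is_dR_pullback f F,
   F @` range (@hol_to_dR R n Y) `<=` range (@hol_to_dR R n X),
   F @` range (@mid_to_dR R n Y) `<=` range (@mid_to_dR R n X) &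
   F @` range (@antihol_to_dR R n Y) `<=` range (@antihol_to_dR R n X)].
pose F : {linear HdR Y n -> HdR X n} := HB.pack pb_dR (GRing.isLinear.Build _ _ _ _ pb_dR pb_dR_linear).
exists F; split.
- move=> w; exists (pbZ w); last exact:pb_dRE.
 move=> i j z iz jz; have ij : ldom i j z by []; have [wT _] := closedP w.
 by rewrite (hol_jacobian (@lrep_diff i j) ij) -(pbE wT).
- move=> _ [_ [w _ <-] <-]; exists (Subspace (pb_ker (D := delbar_op X) (D' := delbar_op Y) (@pb_db _) w)) => //.
 rewrite /= pb_dRE; congr dR_class; exact:val_inj.
- move=> _ [_ [c _ <-] <-]; have [w <-] := cls_surj c.
 exists (cls _ (Subspace (pb_ker (D := d_op X) (D' := d_op Y) (@pb_dext _) w))) => //.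
 rewrite /= !subquot_inclE pb_dRE; congr dR_class; exact:val_inj.
- move=> _ [_ [w _ <-] <-]; exists (Subspace (pb_ker (D := del_op X) (D' := del_op Y) (@pb_del _) w)) => //.
 rewrite /= pb_dRE; congr dR_class; exact:val_inj.
Qed.
End Pullback.
Theorem theorem22 (R : realType) (n : nat) (n_gt0 : (0 < n)%N)
  (X : ccManifold R n) :
 [/\ bijective (@sum_to_dR R n X),
   forall (Y : ccManifold R n) (f : X -> Y), holomorphic f ->
    exists F : {linear HdR Y n -> HdR X n},
     [/\ is_dR_pullback f F,
       F @` range (@hol_to_dR R n Y) `<=` range (@hol_to_dR R n X),
       F @` range (@mid_to_dR R n Y) `<=` range (@mid_to_dR R n X) &
       F @` range (@antihol_to_dR R n Y)
        `<=` range (@antihol_to_dR R n X)],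
   exists Q : HdR X n -> HdR X n -> R[i],
    [/\ is_intersection_form Q,
      orthogonal_spaces Q
       (range (@mid_to_dR R n X)) (range (@hol_to_dR R n X)) &
      orthogonal_spaces Q
       (range (@mid_to_dR R n X)) (range (@antihol_to_dR R n X))] &
   exists h : HdR X n -> HdR X n -> R[i],
    [/\ is_hermitian_intersection_form h,
      orthogonal_spaces h
       (range (@hol_to_dR R n X)) (range (@mid_to_dR R n X)),
      orthogonal_spaces h
       (range (@hol_to_dR R n X)) (range (@antihol_to_dR R n X)) &
      orthogonal_spaces h
       (range (@mid_to_dR R n X)) (range (@antihol_to_dR R n X))]].
have [u _] := exists_pou X; split.
- exact:sum_to_dR_bij.
- exact:functorial.
- exists (Qf u); split; first exact:Qf_form.
  exact:(@Qf_orth R n X u _ _ _ _ (@mid_type _ _ X) (@hol_type _ _ X) (@apart_mid_hol n)).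
 exact:(@Qf_orth R n X u _ _ _ _ (@mid_type _ _ X) (@antihol_type _ _ X) (@apart_mid_antihol n)).
- exists (hf u); split; first exact:hf_form.
 + exact:(@hf_orth R n X u _ _ _ _ (@hol_type _ _ X) (@mid_type _ _ X) (@apart_hol_mid n)).
 + exact:(@hf_orth R n X u _ _ _ _ (@hol_type _ _ X) (@antihol_type _ _ X) (apart_hol_antihol n_gt0)).
 (* The conjugate of a (0, n)-form has type (n, 0), so this is the pairing of mixed with (n,
    0)-type. *)
 + apply:(@hf_orth R n X u _ _ _ _ (@mid_type _ _ X) (@antihol_type _ _ X)) => a b c d h.
  by move=> /andP[/eqP -> /eqP ->]; apply:(apart_mid_hol h); rewrite /bideg eqxx.
Qed.
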